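(* Consider the holomorphic family of operators $R^h(\lambda):C_c^\infty(\mathrm{AdS}_3)\to\mathcal D'(\mathrm{AdS}_3)$ defined for $\lambda\in\mathbb C$ by the integral kernel $R^h(\lambda;x,y)=F^h_\lambda(-q(x,y))$ (with respect to $\mathrm{dv}_g$), where $$F^h_\lambda(\zeta):=\begin{cases}\dfrac{i}{4\pi\sqrt{\zeta^2-1}}(\zeta+\sqrt{\zeta^2-1})^{-(\lambda+1)},&\zeta>1,\\[2mm]\dfrac{1}{4\pi\sqrt{1-\zeta^2}}(\zeta+i\sqrt{1-\zeta^2})^{-(\lambda+1)},&\zeta\in(-1,1),\\[2mm]0,&\zeta<-1.\end{cases}$$ Then for each $f\in C_c^\infty(\mathrm{AdS}_3)$, $$(\Box_g+\lambda(\lambda+2))R^h(\lambda)f=f$$ in $\mathcal D'(\Omega_f)$, where $\Omega_f:=\{x\in\mathrm{AdS}_3\,|\,\forall y\in\mathrm{supp}(f),\ -q(x,y)>-1\}$.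
   Context: $q(x,y)=-x_1y_1-x_2y_2+x_3y_3+x_4y_4$ on $\mathbb R^4$, $q(x)=q(x,x)$; $\mathrm{AdS}_3=\{x\in\mathbb R^4:q(x)=-1\}$ with the Lorentzian metric $g$ induced by $q$ on $T_x\mathrm{AdS}_3=\{v:q(x,v)=0\}$ and volume measure $\mathrm{dv}_g$. $\Box_g=d^*d=-\mathrm{div}\,\mathrm{grad}$. For $\zeta=\cos\theta$, $\theta\in(0,\pi)$, $(\zeta+i\sqrt{1-\zeta^2})^{-(\lambda+1)}=e^{-i\theta(\lambda+1)}$. *)

(* Defs.v *)
From HB Require Import structures.
From mathcomp Require Import all_boot all_order all_algebra.
From mathcomp Require Import all_classical all_reals all_analysis.
From mathcomp Require Import complex.

Set Implicit Arguments.
Unset Strict Implicit.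
Unset Printing Implicit Defensive.

Import Order.TTheory GRing.Theory Num.Theory.
Import numFieldNormedType.Exports.

Local Open Scope classical_set_scope.
Local Open Scope ring_scope.
Local Open Scope complex_scope.

Section AntiDeSitter.
Variable R : realType.

Local Notation C := R[i].

Definition cexp (z : C) : C :=
  (expR (complex.Re z))%:C * (cos (complex.Im z) +i* sin (complex.Im z)).

Definition cintegrable d (T : measurableType d)
    (mu : {measure set T -> \bar R}) (D : set T) (h : T -> C) : Prop :=
  mu.-integrable D (EFin \o (fun x => complex.Re (h x))) /\
  mu.-integrable D (EFin \o (fun x => complex.Im (h x))).

Definition cintegral d (T : measurableType d)
    (mu : {measure set T -> \bar R}) (D : set T) (h : T -> C) : C :=
  Rintegral mu D (fun x => complex.Re (h x)) +i*
  Rintegral mu D (fun x => complex.Im (h x)).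

Definition q (x y : 'rV[R]_4) : R :=
  - (x 0 (inord 0) * y 0 (inord 0)) - x 0 (inord 1) * y 0 (inord 1)
  + x 0 (inord 2) * y 0 (inord 2) + x 0 (inord 3) * y 0 (inord 3).

Definition AdS3 : set 'rV[R]_4 := [set x | q x x = -1].

(* The map (t, a, b) |-> (sqrt(1+a^2+b^2) cos t, sqrt(1+a^2+b^2) sin t, a, b)
   is a local diffeomorphism of R^3 onto AdS_3 (its universal covering, with
   deck transformations t |-> t + 2 pi k), so that its local inverses form an
   atlas of AdS_3, and it is a bijection from [fundamental] onto AdS_3.
   Functions on AdS_3 are represented by functions on R^4 of which only the
   values on AdS_3 are ever used. *)
Definition Phi (p : R * R * R) : 'rV[R]_4 :=
  let t := p.1.1 in let a := p.1.2 in let b := p.2 in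
  let r := Num.sqrt (1 + a ^+ 2 + b ^+ 2) in
  \row_i nth 0 [:: r * cos t; r * sin t; a; b] i.

Definition fundamental : set (R * R * R) := [set p | 0 <= p.1.1 < 2 * pi].

Definition chart (x : 'rV[R]_4) : R * R * R := xget (0, 0, 0) [set p | Phi p = x].

Definition pbasis (i : 'I_3) : R * R * R :=
  ((nat_of_ord i == 0)%:R, (nat_of_ord i == 1)%:R, (nat_of_ord i == 2)%:R).

Definition pdiff (i : 'I_3) (u : R * R * R -> C) (p : R * R * R) : C :=
  ('D_(pbasis i) (fun p' => complex.Re (u p')) p) +i*
  ('D_(pbasis i) (fun p' => complex.Im (u p')) p).

Definition pdiffs (s : seq 'I_3) (u : R * R * R -> C) : R * R * R -> C :=
  foldr pdiff u s.

Definition smooth_param (u : R * R * R -> C) : Prop :=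
  forall s : seq 'I_3,
    [/\ continuous (fun p => complex.Re (pdiffs s u p)),
        continuous (fun p => complex.Im (pdiffs s u p)) &
        forall (i : 'I_3) (p : R * R * R),
          derivable (fun p' => complex.Re (pdiffs s u p')) p (pbasis i) /\
          derivable (fun p' => complex.Im (pdiffs s u p')) p (pbasis i)].

Definition metric (p : R * R * R) : 'M[R]_3 :=
  \matrix_(i, j) q ('D_(pbasis i) Phi p) ('D_(pbasis j) Phi p).

Definition vol_density (p : R * R * R) : R := Num.sqrt `|\det (metric p)|.

(* [measurableTypeR R] is R with its Borel sigma-algebra. *)
Local Notation mR := (measurableTypeR R).
Local Notation mR3 := (mR * mR * mR)%type.

(* Canonical inference only finds a sigma-finite structure on a product of
   finite measures, hence the explicit instances below. *)
Lemma product_sigma_finite d1 d2 (T1 : measurableType d1)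
    (T2 : measurableType d2) (m1 : {sigma_finite_measure set T1 -> \bar R})
    (m2 : {sigma_finite_measure set T2 -> \bar R}) :
  sigma_finite setT (m1 \x m2)%E.
Proof.
have /sigma_finiteP[F [TF ndF Foo]] := sigma_finiteT m1.
have /sigma_finiteP[G [TG ndG Goo]] := sigma_finiteT m2.
exists (fun n => F n `*` G n).
  rewrite -setXTT TF TG predeqE => -[x y]; split.
    move=> [/= [n _ Fnx] [k _ Gky]]; exists (maxn n k) => //; split.
    - by move: x Fnx; exact/subsetPset/ndF/leq_maxl.
    - by move: y Gky; exact/subsetPset/ndG/leq_maxr.
  by move=> [n _ []/= ? ?]; split; exists n.
move=> k; have [? ?] := Foo k; have [? ?] := Goo k.
split; first exact: measurableX.
by rewrite product_measure1E// lte_mul_pinfty// ge0_fin_numE.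
Qed.

Definition leb2 : set (mR * mR) -> \bar R :=
  (@lebesgue_measure R \x @lebesgue_measure R)%E.
HB.instance Definition _ := Measure.on leb2.
HB.instance Definition _ := Measure_isSigmaFinite.Build _ _ _ leb2
  (product_sigma_finite (@lebesgue_measure R) (@lebesgue_measure R)).

Definition leb3 : set mR3 -> \bar R := (leb2 \x @lebesgue_measure R)%E.
HB.instance Definition _ := Measure.on leb3.
HB.instance Definition _ := Measure_isSigmaFinite.Build _ _ _ leb3
  (product_sigma_finite leb2 (@lebesgue_measure R)).

Definition leb33 : set (mR3 * mR3) -> \bar R := (leb3 \x leb3)%E.
HB.instance Definition _ := Measure.on leb33.

(* dv_g = |det g|^{1/2} dt da db, integrated over one fundamental domain of
   the covering. *)
Definition ads_int (h : 'rV[R]_4 -> C) : C :=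
  cintegral leb3 fundamental (fun p => (vol_density p)%:C * h (Phi p)).

Definition ads_integrand2 (H : 'rV[R]_4 -> 'rV[R]_4 -> C)
    (p : (R * R * R) * (R * R * R)) : C :=
  (vol_density p.1 * vol_density p.2)%:C * H (Phi p.1) (Phi p.2).

Definition ads_integrable2 (H : 'rV[R]_4 -> 'rV[R]_4 -> C) : Prop :=
  cintegrable leb33 (fundamental `*` fundamental) (ads_integrand2 H).

Definition ads_int2 (H : 'rV[R]_4 -> 'rV[R]_4 -> C) : C :=
  cintegral leb33 (fundamental `*` fundamental) (ads_integrand2 H).

(* (grad u)^i = g^{ij} d_j u  and  div X = |g|^{-1/2} d_i (|g|^{1/2} X^i) *)
Definition grad_coord (u : R * R * R -> C) (i : 'I_3) (p : R * R * R) : C :=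
  \sum_(j < 3) (invmx (metric p) i j)%:C * pdiff j u p.

Definition div_coord (X : 'I_3 -> R * R * R -> C) (p : R * R * R) : C :=
  (vol_density p)^-1%:C *
  \sum_(i < 3) pdiff i (fun p' => (vol_density p')%:C * X i p') p.

(* The value does not depend on the preimage of x chosen by [chart], since
   u \o Phi is 2 pi-periodic in t and the metric does not depend on t. *)
Definition Box (u : 'rV[R]_4 -> C) (x : 'rV[R]_4) : C :=
  - div_coord (grad_coord (u \o Phi)) (chart x).

(* AdS_3 is closed in R^4, so this is the support relative to AdS_3. *)
Definition supp (f : 'rV[R]_4 -> C) : set 'rV[R]_4 :=
  closure [set x | AdS3 x /\ f x <> 0].

Definition test_function (f : 'rV[R]_4 -> C) : Prop :=
  smooth_param (f \o Phi) /\ compact (supp f).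

(* D'(AdS_3): linear forms on C_c^oo(AdS_3) satisfying, on each compact set K,
   a bound by finitely many derivatives. *)
Definition is_distribution (T : ('rV[R]_4 -> C) -> C) : Prop :=
  (forall (a : C) (phi psi : 'rV[R]_4 -> C),
     test_function phi -> test_function psi ->
     T (fun x => a * phi x + psi x) = a * T phi + T psi) /\
  (forall K : set 'rV[R]_4, K `<=` AdS3 -> compact K ->
     exists (N : nat) (c : R), forall (phi : 'rV[R]_4 -> C) (M : R),
       test_function phi -> supp phi `<=` K ->
       (forall (s : seq 'I_3) (p : R * R * R),
          (size s <= N)%N -> `|pdiffs s (phi \o Phi) p| <= M%:C) ->
       `|T phi| <= (c * M)%:C).

Definition eq_distr_on (Omega : set 'rV[R]_4)
    (S T : ('rV[R]_4 -> C) -> C) : Prop :=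
  forall phi : 'rV[R]_4 -> C,
    test_function phi -> supp phi `<=` Omega -> S phi = T phi.

Definition distr_of_fun (f : 'rV[R]_4 -> C) : ('rV[R]_4 -> C) -> C :=
  fun phi => ads_int (fun x => f x * phi x).

(* Box_g = d^*d is symmetric for the bilinear pairing \int u phi dv_g, hence
   acts on distributions by transposition without change of sign. *)
Definition Box_distr (T : ('rV[R]_4 -> C) -> C) : ('rV[R]_4 -> C) -> C :=
  fun phi => T (Box phi).

(* Principal powers: (zeta + sqrt(zeta^2-1))^w = exp(w ln(...)) for zeta > 1,
   and zeta + i sqrt(1-zeta^2) = e^{i theta} with theta = acos zeta on (-1,1).
   The values at zeta = 1 and zeta = -1, which are irrelevant for the kernel
   (q(x,y) = +-1 has measure zero), are 0. *)
Definition Fh (lambda : C) (zeta : R) : C :=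
  if 1 < zeta then
    'i / (4 * pi * Num.sqrt (zeta ^+ 2 - 1))%:C *
    cexp (- (lambda + 1) * (ln (zeta + Num.sqrt (zeta ^+ 2 - 1)))%:C)
  else if (-1 < zeta) && (zeta < 1) then
    (4 * pi * Num.sqrt (1 - zeta ^+ 2))^-1%:C *
    cexp (- 'i * (acos zeta)%:C * (lambda + 1))
  else 0.

Definition Rh_kernel (lambda : C) (x y : 'rV[R]_4) : C := Fh lambda (- q x y).

Definition Rh_integrand (lambda : C) (f phi : 'rV[R]_4 -> C)
    (x y : 'rV[R]_4) : C :=
  Rh_kernel lambda x y * f y * phi x.

(* The distribution R^h(lambda) f, paired with phi. *)
Definition Rh (lambda : C) (f : 'rV[R]_4 -> C) : ('rV[R]_4 -> C) -> C :=
  fun phi => ads_int2 (Rh_integrand lambda f phi).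

Definition Omega (f : 'rV[R]_4 -> C) : set 'rV[R]_4 :=
  [set x | AdS3 x /\ forall y, supp f y -> -1 < - q x y].

Definition entire (h : C -> C) : Prop :=
  forall z : C, derivable (h : C^o -> C^o) z 1.

End AntiDeSitter.

(* Main.v *)
(** In the chart [Phi] the volume density is 1, and for a fixed point y the
    function zeta = - q(x, y) takes, after an isometry moving y to the base
    point and a passage to polar coordinates, the role of a coordinate: AdS3
    becomes the region z^2 + s^2 > 1 of the space of (z, s, theta), with
    Lebesgue measure.

    The real and imaginary parts V of F^h satisfy (z^2 - 1) V'' + 3 z V' = c V
    off z = 1 and blow up there like |z - 1|^(-1/2), so that Green's formula
    only applies to the function chi V obtained by cutting V off to 0 for z
    within eta^4 of 1.  What remains of the integral of V Box phi + W phi (W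
    being the right-hand side of the equation) is, up to O(eta), the integral
    of k(zeta) phi, where k lives on |z - 1| < eta^4 and has size eta^(-6).
    Two moments of k matter: its integral is O(eta), while its integral against
    sqrt(1 - z^2) tends to - g, with g the limit of (1 - z^2)^(3/2) V' as z
    tends to 1 from below.  The integral of phi over the level zeta = z equals,
    up to O(eta^3), a constant minus 4 pi sqrt(1 - z^2) phi(y): the second term
    accounts for the slice s^2 < 1 - z^2, which is missing for z < 1.  Hence
    the limit is 4 pi g phi(y); g is 1/(4 pi) for the real part of F^h and 0
    for its imaginary part.

    All integrals converge because |F^h| is at most a multiple of
    |z^2 - 1|^(-1/2) on bounded sets, and the dependence on lambda is through
    an exponential, whose second order Taylor remainder gives holomorphy. *)

Require Import Defs.
From mathcomp Require Import all_boot all_order all_algebra.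
From mathcomp Require Import all_classical all_reals all_analysis.
From mathcomp Require Import measurable_realfun complex.
From mathcomp Require Import ring lra.
Set Implicit Arguments.
Unset Strict Implicit.
Unset Printing Implicit Defensive.
Import Order.TTheory GRing.Theory Num.Theory.
Import numFieldNormedType.Exports.
Local Open Scope classical_set_scope.
Local Open Scope ring_scope.

(** Polar coordinates in one plane or in the other give the charts (t, a, b) and (z, s, theta).

    Why eta^4: with width d the leftover k has size d^(-3/2) on a slab of volume O(d), so phi must
    be known there with mean error o(d^(1/2)). Comparing the level z with the level 1 costs
    O(d^(3/4)) for |s| above d^(1/4) and O(d^(1/2)) below, hence O(d^(3/4)) on average, by Lipschitz
    continuity of phi in the ambient coordinates.

    The moments come from two primitives: (z^2 - 1) V'' + 3 z V' + V is the derivative of z V + (z^2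
    - 1) V', which has no jump at 1, and - sqrt(1 - z^2) ((z^2 - 1) V'' + 3 z V') is that of (1 -
    z^2)^(3/2) V'.

    The second singularity, at z = -1, is kept away by Omega_f: supp phi is compact, so zeta >= -1 +
    delta on it, with delta depending on y, and V is modified below that level. *)

Lemma ge0_integral_mrestr d (T : measurableType d) (R : realType)
    (m : {measure set T -> \bar R}) (U : set T) (mU : measurable U)
    (f : T -> \bar R) : measurable_fun setT f -> (forall x, (0 <= f x)%E) ->
  (\int[mrestr m mU]_x f x = \int[m]_(x in U) f x)%E.
Proof.
move=> mf f0; pose m' : {measure set T -> \bar R} := mrestr m mU.
rewrite -/m' (@ge0_negligible_integral _ _ _ m' setT (~` U))//.
- rewrite setDE setCK setTI; apply: eq_measure_integral => A mA AU.
  by rewrite /m'/= /mrestr; congr (m _); apply/setIidPl.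
- exact: measurableC.
- by rewrite /m'/= /mrestr setICl measure0.
Qed.

(** * Change of variables on AdS3 *)

Section Substitution.
Variable R : realType.
Local Notation mR := (measurableTypeR R).
Local Notation mu := (@lebesgue_measure R).
Local Open Scope ereal_scope.

Lemma mu_itv0c (c : R) : (0 <= c)%R -> mu `]0%R, c] = c%:E.
Proof.
move=> c0; rewrite lebesgue_measure_itv/= lte_fin; case: ltP => [_|c0'].
  by rewrite oppr0 adde0.
by congr (_%:E); apply/le_anti; rewrite c0 c0'.
Qed.

(** The hypothesis on intervals says that [h] transports w dx on [D] to Lebesgue measure, tested on
    half-open intervals only. To invoke uniqueness of Lebesgue measure, w dx has to appear as a
    measure: it is realised as planar measure on the region under the graph of [w], pushed forward
    by (x, s) |-> h x. *)
Lemma ge0_substitution (D : set mR) (h w : mR -> mR) (G : mR -> \bar R) :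
  measurable D -> measurable_fun setT h -> measurable_fun setT w ->
  (forall x, (0 <= w x)%R) ->
  (forall a b : R, (a <= b)%R ->
     \int[mu]_(x in D `&` h @^-1` `]a, b]) (w x)%:E = (b - a)%:E) ->
  measurable_fun setT G -> (forall x, 0 <= G x) ->
  \int[mu]_(x in D) (G (h x) * (w x)%:E) = \int[mu]_x G x.
Proof.
move=> mD mh mw w0 hw mG G0.
pose U : set (mR * mR) := (fst @^-1` D) `&` [set p | (0 < p.2 <= w p.1)%R].
have mU : measurable U.
  apply: measurableI; first by rewrite -[X in measurable X]setTI; exact: measurable_fst.
  rewrite [X in measurable X](_ : _ = [set p | (0 < p.2)%R] `&` [set p | (p.2 <= w p.1)%R]); last first.
    by apply/seteqP; split => p /=; [move=> /andP[]|move=> [-> ->]].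
  apply: measurableI.
    rewrite -[X in measurable X]setTI.
    exact: (measurable_fun_ltr (measurable_cst _) measurable_snd measurableT (Y := [set true])).
  rewrite -[X in measurable X]setTI.
  have m1 : measurable_fun setT (w \o fst : mR * mR -> mR) by exact: measurableT_comp.
  exact: (measurable_fun_ler measurable_snd m1 measurableT (Y := [set true])).
have secU x : xsection U x = if `[< D x >] then `]0%R, w x]%classic else set0.
  rewrite /xsection /U; apply/seteqP; split => s /=; rewrite inE/=.
    by move=> [Dx /= sw]; rewrite asboolT//= in_itv/=.
  by case: asboolP => //= Dx; rewrite in_itv.
have muU x : mu (xsection U x) = (\1_D x * w x)%:E.
  rewrite secU indicE; case: asboolP => [Dx|nDx].
    by rewrite mem_set// mul1r mu_itv0c.
  by rewrite memNset// mul0r measure0.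
pose H : mR * mR -> mR := h \o fst.
have mH : measurable_fun setT H by exact: measurableT_comp.
pose nu := pushforward (mrestr (mu \x mu) mU) H.
have nuE A : measurable A -> mu A = nu A.
  move=> mA.
  apply: (@lebesgue_measure_unique _ nu) => // _ [[a b] /= _ <-].
  have [ba|ab] := ltP b a.
    rewrite (_ : `]a, b]%classic = set0) ?measure0//.
    by apply/seteqP; split => x //=; rewrite in_itv/= => /andP[ax xb]; lra.
  rewrite /nu /pushforward /mrestr /product_measure1 /=.
  have := hw _ _ ab; rewrite lebesgue_measure_itv/= lte_fin.
  have -> : (if (a < b)%R then b%:E - a%:E else 0) = (b - a)%:E.
    case: ltP => [_|ba]; first by rewrite EFinB.
    by congr (_%:E); lra.
  move=> <-; rewrite integral_mkcond; apply: eq_integral => x _ /=.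
  have -> : xsection (H @^-1` `]a, b] `&` U) x
     = if h x \in `]a, b] then xsection U x else set0.
    apply/seteqP; split => s; rewrite /xsection/=.
      by rewrite inE /H => -[/= hx Us]; case: ifPn => [_|/negP //]; exact/mem_set.
    by case: ifPn => //= hx; rewrite !inE.
  rewrite patchE; case: ifPn => [/set_mem[Dx hx]|].
    by rewrite ifT// muU indicE mem_set// mul1r.
  rewrite notin_setE => nDh; case: ifPn => [hx|_]; last by rewrite measure0.
  rewrite muU indicE memNset ?mul0r// => Dx; apply: nDh; split => //.
transitivity (\int[nu]_x G x); last first.
  by apply: eq_measure_integral => A mA _; apply/esym; exact: nuE.
rewrite ge0_integral_pushforward// preimage_setT.
have mGH : measurable_fun setT (G \o H) by exact: measurableT_comp.
rewrite ge0_integral_mrestr//; last by move=> x; exact: G0.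
rewrite integral_mkcond fubini_tonelli1; last 2 first.
- exact/(measurable_restrictT _ mU)/measurable_funTS.
- by move=> x; apply: erestrict_ge0 => ? _; exact: G0.
rewrite [LHS]integral_mkcond; apply: eq_integral => x _.
rewrite /fubini_F.
transitivity (\int[mu]_(y in xsection U x) G (h x)).
  rewrite integral_cst; last exact: measurable_xsection.
  transitivity (G (h x) * (\1_D x * w x)%:E); last by congr (_ * _); exact/esym/muU.
  rewrite indicE patchE; case: ifPn => _; first by rewrite mul1r.
  by rewrite mul0r mule0.
rewrite [LHS]integral_mkcond; apply: eq_integral => y _.
by rewrite !patchE /xsection mem_setE.
Qed.

End Substitution.

(** * One-variable calculus *)

Section Calculus1.
Variable R : realType.
Local Notation mR := (measurableTypeR R).
Local Notation mu := (@lebesgue_measure R).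

Lemma is_derive_continuous (F : R -> R) (x l : R) :
  is_derive x 1 F l -> {for x, continuous F}.
Proof.
move=> dF; apply: differentiable_continuous; apply/derivable1_diffP.
exact: ex_derive.
Qed.

Lemma FTC2 (f F : R -> R) (a b : R) : a <= b ->
  (forall x, a <= x <= b -> is_derive x 1 F (f x)) ->
  (forall x, a <= x <= b -> {for x, continuous f}) ->
  (\int[mu]_(x in `[a, b]) (f x)%:E = (F b - F a)%:E)%E.
Proof.
move=> ab dF cf; move: ab; rewrite le_eqVlt => /predU1P[<-|ab].
  by rewrite set_itv1 integral_set1 subrr.
rewrite (continuous_FTC2 ab (F := F)).
- by rewrite EFinB.
- apply: continuous_in_subspaceT => x /set_mem/=; rewrite in_itv/=; exact: cf.
- have cF x : a <= x <= b -> {for x, continuous F}.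
    by move=> /dF; exact: is_derive_continuous.
  split => [x /[!in_itv]/= /andP[ax xb]||].
  + have : is_derive x 1 F (f x) by apply: dF; rewrite (ltW ax) (ltW xb).
    by move=> ?; exact: ex_derive.
  + apply: cvg_at_right_filter; apply: cF; by rewrite lexx (ltW ab).
  + apply: cvg_at_left_filter; apply: cF; by rewrite lexx (ltW ab).
- move=> x; rewrite in_itv/= => /andP[ax xb].
  have : is_derive x 1 F (f x) by apply: dF; rewrite (ltW ax) (ltW xb).
  by move=> ?; rewrite derive1E derive_val.
Qed.

Lemma cvg_is_derive (V W : normedModType R) (f : V -> W) (a v : V) (l : W) :
  h^-1 *: (f (h *: v + a) - f a) @[h --> (0 : R)^'] --> l -> is_derive a v f l.
Proof.
move=> fl; apply: DeriveDef; last exact: cvg_lim fl.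
by apply/cvg_ex; exists l.
Qed.

Lemma is_derive_cvg (V W : normedModType R) (f : V -> W) (a v : V) (l : W) :
  is_derive a v f l -> h^-1 *: (f (h *: v + a) - f a) @[h --> (0 : R)^'] --> l.
Proof. by case=> df <-. Qed.

(** The odd C^1 extension of the square on the half-line. It serves twice: as an increasing
    bijection of R that allows the substitution u = x^2, and as the building block of truncated
    powers, whose differentiability at the knots it contains. *)
Lemma is_derive_mulnorm (x : R) : is_derive x 1 (fun y : R => y * `|y|) (2 * `|x|).
Proof.
have d1 (c : R) : is_derive x 1 (fun y : R => c * y ^+ 2) (c * (2 * x)).
  by apply: is_derive_eq; rewrite /GRing.scale/=; ring.
have [x0|x0|->] := ltgtP x 0.
- apply: (near_eq_is_derive (f := fun y : R => -1 * y ^+ 2)).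
    near=> y; rewrite ltr0_norm; first by ring.
    by near: y; exact: lt_nbhsl.
  by rewrite ltr0_norm// (_ : 2 * - x = -1 * (2 * x))//; ring.
- apply: (near_eq_is_derive (f := fun y : R => 1 * y ^+ 2)).
    near=> y; rewrite gtr0_norm; first by ring.
    by near: y; exact: lt_nbhsr.
  by rewrite gtr0_norm// (_ : 2 * x = 1 * (2 * x))//; ring.
- rewrite normr0 mulr0; apply: cvg_is_derive.
  have : (`|h| : R) @[h --> (0 : R)^'] --> (0 : R).
    rewrite -[X in _ --> X](@normr0 _ R); apply: cvg_within_filter.
    exact: (@norm_continuous _ R^o).
  apply: cvg_trans; apply: near_eq_cvg; near=> h.
  have h0 : h != 0 by near: h; exact: nbhs_dnbhs_neq.
  rewrite /GRing.scale/= !addr0 mul0r subr0 mulr1 mulrA mulVf ?mul1r//.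
Unshelve. all: by end_near. Qed.

Lemma inv_measurable : measurable_fun [set: mR] (fun x : mR => x^-1 : mR).
Proof.
rewrite -(setUv [set 0 : mR]); apply/measurable_funU => //.
  exact: measurableC.
split; first exact: measurable_fun_set1.
apply: open_continuous_measurable_fun.
  by apply: closed_openC; exact: closed_eq.
move=> x; rewrite inE/= => /eqP x0; exact: inv_continuous.
Qed.

Lemma sqrt_measurable : measurable_fun [set: mR] (Num.sqrt : mR -> mR).
Proof. by apply: continuous_measurable_fun; exact: sqrt_continuous. Qed.

End Calculus1.

Section Substitutions.
Variable R : realType.
Local Notation mR := (measurableTypeR R).
Local Notation mu := (@lebesgue_measure R).
Local Open Scope ereal_scope.

Lemma ge0_substitution_affine (a b : R) (G : mR -> \bar R) : (a != 0)%R ->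
  measurable_fun setT G -> (forall x, 0 <= G x) ->
  \int[mu]_x (G (a * x + b)%R * `|a|%:E) = \int[mu]_x G x.
Proof.
move=> a0 mG G0; apply: (@ge0_substitution _ setT (fun x => a * x + b)%R (cst `|a|%R)) => //.
  by apply: measurable_funD => //; exact: measurable_funM.
move=> c d cd; rewrite setTI.
have /orP[a0'|a0'] : ((a < 0) || (0 < a))%R by rewrite -neq_lt.
  have -> : (fun x => a * x + b)%R @^-1` `]c, d] = `[(d - b) / a, (c - b) / a[%classic%R.
    apply/seteqP; split => x /=; rewrite !in_itv/= => /andP[].
      rewrite ler_ndivrMr// ltr_ndivlMr// => ? ?; apply/andP; split; lra.
    rewrite ler_ndivrMr// ltr_ndivlMr// => ? ?; apply/andP; split; lra.
  have le1 : ((d - b) / a <= (c - b) / a)%R by rewrite ler_nM2r ?invr_lt0//; lra.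
  rewrite [LHS](_ : _ = \int[mu]_(x in `[(d - b) / a, (c - b) / a[%classic%R) cst `|a|%:E x)//.
  rewrite integral_cst// [X in _ * X]lebesgue_measure_itv/= lte_fin.
  have -> : (if ((d - b) / a < (c - b) / a)%R then ((c - b) / a)%:E - ((d - b) / a)%:E else 0)
     = (((c - b) / a)%:E - ((d - b) / a)%:E).
    case: ltP => // h; rewrite -EFinB; congr (_%:E); apply/le_anti; lra.
  by rewrite -EFinB -EFinM ltr0_norm//; congr (_%:E); field.
have -> : (fun x => a * x + b)%R @^-1` `]c, d] = `](c - b) / a, (d - b) / a]%classic%R.
  apply/seteqP; split => x /=; rewrite !in_itv/= => /andP[].
    rewrite ler_pdivlMr// ltr_pdivrMr// => ? ?; apply/andP; split; lra.
  rewrite ler_pdivlMr// ltr_pdivrMr// => ? ?; apply/andP; split; lra.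
have le1 : ((c - b) / a <= (d - b) / a)%R by rewrite ler_pM2r ?invr_gt0//; lra.
rewrite [LHS](_ : _ = \int[mu]_(x in `](c - b) / a, (d - b) / a]%classic%R) cst `|a|%:E x)//.
rewrite integral_cst// [X in _ * X]lebesgue_measure_itv/= lte_fin.
have -> : (if ((c - b) / a < (d - b) / a)%R then ((d - b) / a)%:E - ((c - b) / a)%:E else 0)
   = (((d - b) / a)%:E - ((c - b) / a)%:E).
  case: ltP => // h; rewrite -EFinB; congr (_%:E); apply/le_anti; lra.
by rewrite -EFinB -EFinM gtr0_norm//; congr (_%:E); field.
Qed.

Lemma integral_itv_cc_oc (f : R -> \bar R) (a b : R) :
  measurable_fun `]a, b[ f ->
  \int[mu]_(x in `]a, b]) f x = \int[mu]_(x in `[a, b]) f x.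
Proof. by move=> mf; rewrite (@integral_itv_bndoo _ _ _ _ false false)// (@integral_itv_bndoo _ _ _ _ true false)//. Qed.

(** The square is extended to the increasing bijection x |x| of R, with the signed root as inverse,
    so that preimages of intervals are intervals and the general substitution applies on the whole
    line. *)
Lemma ge0_substitution_square (G : mR -> \bar R) :
  measurable_fun setT G -> (forall x, 0 <= G x) ->
  \int[mu]_(x in `]0%R, +oo[) (G (x ^+ 2)%R * (2 * x)%:E) =
  \int[mu]_(x in `]0%R, +oo[) G x.
Proof.
move=> mG G0; pose I := `]0%R, +oo[%classic : set mR.
pose h (x : R) : R := (x * `|x|)%R.
rewrite [RHS]integral_mkcond.
rewrite -(@ge0_substitution _ setT h (fun x => 2 * `|x|)%R (G \_ I))//.
- rewrite [LHS]integral_mkcond; apply: eq_integral => x _.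
  rewrite !patchE !mem_setE !in_itv/= !andbT /h; have [x0|x0] := ltP 0%R x.
    by rewrite gtr0_norm ?mulr_gt0// -expr2.
  rewrite ltNge mulr_le0_ge0//= mul0e//.
- by apply: measurable_funM => //; exact: measurableT_comp.
- by apply: measurable_funM => //; exact: measurableT_comp.
- move=> a b ab; rewrite setTI.
  pose g (u : R) := (if (0 <= u)%R then Num.sqrt u else - Num.sqrt (- u))%R.
  have gK u : h (g u) = u.
    rewrite /h /g; case: ifPn => u0.
      by rewrite ger0_norm ?sqrtr_ge0// -expr2 sqr_sqrtr.
    rewrite normrN ger0_norm ?sqrtr_ge0// mulNr -expr2 sqr_sqrtr ?opprK//.
    by rewrite oppr_ge0 ltW// ltNge.
  have hmono : {mono h : x y / (x <= y)%R}.
    apply: le_mono => x y xy; rewrite /h.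
    case: (ger0P x); case: (ger0P y) => *; nra.
  have -> : h @^-1` `]a, b] = `]g a, g b]%classic.
    have hx x : (a < h x <= b)%R = (g a < x <= g b)%R.
      by rewrite -(leW_mono hmono (g a)) -(hmono x) !gK.
    by apply/seteqP; split => x /=; rewrite !in_itv/= hx.
  have gab : (g a <= g b)%R by rewrite -hmono !gK.
  rewrite integral_itv_cc_oc; last first.
    apply/measurable_EFinP; apply: measurable_funTS.
    by apply: measurable_funM => //; exact: measurableT_comp.
  rewrite (FTC2 gab (fun x _ => is_derive_mulnorm x)) -?/(h _) ?gK// => x _.
  apply: continuousM; first exact: cst_continuous.
  exact: (@norm_continuous _ R^o).
- have mI : measurable I by exact: measurable_itv.
  exact/(measurable_restrictT _ mI)/measurable_funTS.
- by move=> x; apply: erestrict_ge0.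
Qed.

Lemma tan_measurable : measurable_fun [set: mR] (tan : mR -> mR).
Proof.
rewrite (_ : tan = (fun x => sin x * (cos x)^-1)%R)//.
apply: measurable_funM.
  by apply: continuous_measurable_fun; exact: continuous_sin.
apply: (measurableT_comp (@inv_measurable R)).
by apply: continuous_measurable_fun; exact: continuous_cos.
Qed.

(** Used with the slope of a line through the origin as the old variable and its angle as the new
    one. *)
Lemma ge0_substitution_tan (G : mR -> \bar R) :
  measurable_fun setT G -> (forall x, 0 <= G x) ->
  \int[mu]_(x in `](- (pi / 2))%R, (pi / 2)%R[) (G (tan x) * (1 + tan x ^+ 2)%:E) =
  \int[mu]_x G x.
Proof.
move=> mG G0; pose D := `](- (pi / 2))%R, (pi / 2)%R[%classic : set mR.
have mw : measurable_fun setT (fun x : mR => 1 + tan x ^+ 2 : mR)%R.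
  apply: measurable_funD => //; apply: measurable_funX; exact: tan_measurable.
apply: (@ge0_substitution _ D (@tan R) (fun x => 1 + tan x ^+ 2)%R G) => //.
- exact: measurable_itv.
- exact: tan_measurable.
- by move=> x; rewrite addr_ge0// sqr_ge0.
move=> a b ab.
have hx x : D x -> (a < tan x <= b)%R = (atan a < x <= atan b)%R.
  move=> Dx; have Da (u : R) : atan u \in `](- (pi / 2))%R, (pi / 2)%R[.
    by rewrite in_itv/= atan_gtNpi2 atan_ltpi2.
  have -> : (atan a < x)%R = (a < tan x)%R by rewrite -(ltr_tan (Da a) Dx) atanK.
  by rewrite !leNgt -(ltr_tan (Da b) Dx) atanK.
have -> : D `&` tan @^-1` `]a, b] = `]atan a, atan b]%classic.
  apply/seteqP; split => x /=.
    by move=> [Dx]; rewrite !in_itv/= hx.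
  rewrite !in_itv/= => axb; have Dx : D x.
    rewrite /D/= in_itv/=; have := atan_gtNpi2 a; have := atan_ltpi2 b.
    by move: axb => /andP[? ?] ? ?; apply/andP; split; lra.
  by split => //; rewrite hx.
have cosx x : (atan a <= x <= atan b)%R -> (cos x != 0)%R.
  move=> /andP[? ?]; rewrite gt_eqF// cos_gt0_pihalf//.
  by have := atan_gtNpi2 a; have := atan_ltpi2 b => ? ?; apply/andP; split; lra.
have lab : (atan a <= atan b)%R by exact: le_atan.
rewrite integral_itv_cc_oc; last exact/measurable_EFinP/measurable_funTS.
have dtan x : (atan a <= x <= atan b)%R -> is_derive x 1%R tan (1 + tan x ^+ 2)%R.
  by move=> /cosx c0; rewrite -cos2_tan2//; exact: is_derive_tan.
rewrite (FTC2 lab dtan) ?atanK// => x /cosx c0.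
apply: continuousD; first exact: cst_continuous.
apply: (@continuous_comp _ _ _ tan (fun y => y ^+ 2)%R); first exact: continuous_tan.
exact: exprn_continuous.
Qed.

End Substitutions.

(** * Polar coordinates in the plane *)

Section Polar.
Variable R : realType.
Local Notation mR := (measurableTypeR R).
Local Notation mu := (@lebesgue_measure R).
Local Open Scope ereal_scope.

Lemma ge0_integral_cond0 (D : set mR) (F : mR -> \bar R) : measurable D ->
  \int[mu]_x (F x * (\1_D x)%:E) = \int[mu]_(x in D) F x.
Proof.
move=> mD; rewrite [RHS]integral_mkcond; apply: eq_integral => x _.
by rewrite patchE indicE; case: ifPn => _; rewrite ?mule1 ?mule0.
Qed.

Lemma integral_neq0 (F : mR -> \bar R) : measurable_fun setT F ->
  (forall x, 0 <= F x) ->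
  \int[mu]_x F x = \int[mu]_(x in [set~ 0%R]) F x.
Proof.
move=> mF F0; rewrite (@ge0_negligible_integral _ _ _ mu setT [set 0%R])//.
  by rewrite setTD.
exact: lebesgue_measure_set1.
Qed.

(** A composition of one-dimensional substitutions: y = x m on each vertical line, m = tan t after
    Fubini, and x = z cos t for fixed t. The factors |x|, 1 + (tan t)^2 and cos t multiply to |z|.
    The radius z is signed and the angle runs over a half circle. *)
Lemma ge0_polar_half (G : mR * mR -> \bar R) :
  measurable_fun setT G -> (forall x, 0 <= G x) ->
  \int[mu]_x \int[mu]_y G (x, y) =
  \int[mu]_(t in `](- (pi / 2))%R, (pi / 2)%R[)
     \int[mu]_z (G (z * cos t, z * sin t)%R * `|z|%:E).
Proof.
move=> mG G0.
have mG1 x : measurable_fun setT (fun y => G (x, y)) by exact: measurableT_comp.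
have mK : measurable_fun setT (fun p : mR * mR => G (p.1, p.1 * p.2)%R * `|p.1|%:E).
  apply: emeasurable_funM; last first.
    by apply/measurable_EFinP; apply: measurableT_comp => //; exact: measurable_fst.
  apply: measurableT_comp => //; apply: measurable_fun_pair => //.
  by apply: measurable_funM.
have mKt : measurable_fun setT (fun m : mR => \int[mu]_x (G (x, x * m)%R * `|x|%:E)).
  apply: (measurable_fun_fubini_tonelli_G (m1 := mu) (fun p : mR * mR => G (p.1, p.1 * p.2)%R * `|p.1|%:E)) => //.
  by move=> p; rewrite mule_ge0.
transitivity (\int[mu]_x \int[mu]_m (G (x, x * m)%R * `|x|%:E)).
  (* The line x = 0 is removed, since the substitution y = x m degenerates there. *)
  rewrite integral_neq0; last 2 first.
  - exact: (measurable_fun_fubini_tonelli_F (m2 := mu) G).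
  - by move=> x; apply: integral_ge0.
  rewrite [RHS]integral_neq0; last 2 first.
  - apply: (measurable_fun_fubini_tonelli_F (m2 := mu) (fun p : mR * mR => G (p.1, p.1 * p.2)%R * `|p.1|%:E)) => //.
    by move=> p; rewrite mule_ge0.
  - by move=> x; apply: integral_ge0 => y _; rewrite mule_ge0.
  apply: eq_integral => x; rewrite inE/= => /eqP x0.
  rewrite -(ge0_substitution_affine 0 x0 (mG1 x))//.
  by under eq_integral do rewrite addr0.
transitivity (\int[mu]_m \int[mu]_x (G (x, x * m)%R * `|x|%:E)).
  apply: (fubini_tonelli (m1 := mu) (m2 := mu) (fun p : mR * mR => G (p.1, p.1 * p.2)%R * `|p.1|%:E)) => //.
  by move=> p; rewrite mule_ge0.
rewrite -(ge0_substitution_tan mKt); last first.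
  by move=> m; apply: integral_ge0 => y _; rewrite mule_ge0.
apply: eq_integral => t; rewrite inE/= in_itv/= => /cos_gt0_pihalf c0.
have c0' : (cos t != 0)%R by rewrite gt_eqF.
rewrite -(@ge0_substitution_affine _ (cos t) 0 (fun x => G (x, x * tan t)%R * `|x|%:E))//; last 2 first.
- apply: (measurableT_comp mK (g := fun x => (x, tan t))).
  exact: measurable_fun_pair.
- by move=> x; rewrite mule_ge0.
rewrite -ge0_integralZr//=; last 3 first.
- apply: emeasurable_funM => //.
  apply: (measurableT_comp mK (g := fun z : mR => (cos t * z + 0, tan t)%R)).
  by apply: measurable_fun_pair => //; apply: measurable_funD => //; exact: measurable_funM.
- by move=> x _; rewrite !mule_ge0.
- by rewrite lee_fin addr_ge0// sqr_ge0.
apply: eq_integral => z _; rewrite addr0.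
rewrite -cos2_tan2// /tan -!muleA; congr (G (_, _) * _).
- by ring.
- by field.
- rewrite -!EFinM; congr (_%:E); rewrite normrM gtr0_norm//; field.
  exact: c0'.
Qed.

Lemma ge0_integral_shift (F : mR -> \bar R) (a b c : R) :
  measurable_fun setT F -> (forall x, 0 <= F x) ->
  \int[mu]_(x in `[a, b[) F (x + c)%R = \int[mu]_(x in `[(a + c)%R, (b + c)%R[) F x.
Proof.
move=> mF F0; rewrite [RHS]integral_mkcond.
have mI : measurable (`[(a + c)%R, (b + c)%R[%classic : set mR) by exact: measurable_itv.
rewrite -(@ge0_substitution_affine _ 1 c) ?oner_eq0//; last 2 first.
- exact/(measurable_restrictT _ mI)/measurable_funTS.
- by move=> x; apply: erestrict_ge0.
rewrite [LHS]integral_mkcond; apply: eq_integral => x _.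
by rewrite !patchE !mem_setE !in_itv/= normr1 mule1 mul1r lerD2r ltrD2r.
Qed.

(** The quarter [3 pi / 2, 2 pi[ is moved by a period to [- pi / 2, 0[; what results is a half
    circle and its image under the half turn. *)
Lemma ge0_integral_circle (F : mR -> \bar R) :
  measurable_fun setT F -> (forall x, 0 <= F x) ->
  (forall x, F (x + pi *+ 2)%R = F x) ->
  \int[mu]_(t in `[0%R, (2 * pi)%R[) F t =
  \int[mu]_(t in `](- (pi / 2))%R, (pi / 2)%R[) (F t + F (t + pi)%R).
Proof.
move=> mF F0 pF; have pi0 := @pi_gt0 R.
have mFp (c : R) : measurable_fun setT (fun t : mR => F (t + c)%R).
  by apply: measurableT_comp => //; exact: measurable_funD.
rewrite -(@integral_itv_bndoo _ _ _ _ true true); last first.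
  by apply: measurable_funTS; apply: emeasurable_funD => //; exact: mFp.
rewrite ge0_integralD//; last 2 first.
- exact: measurable_funTS.
- by apply: measurable_funTS; exact: mFp.
rewrite ge0_integral_shift//.
have split3 (a b c : R) : (a <= b)%R -> (b <= c)%R ->
  \int[mu]_(t in `[a, c[) F t = \int[mu]_(t in `[a, b[) F t + \int[mu]_(t in `[b, c[) F t.
  move=> ab bc; rewrite (@itv_bndbnd_setU _ _ _ (BLeft b))//.
  rewrite ge0_integral_setU//; first exact: measurable_funTS.
  apply/disj_setPS => x /= []; rewrite !in_itv/= => /andP[_ xb] /andP[bx _].
  by move: xb; rewrite ltNge bx.
rewrite (split3 _ (pi / 2)%R); [|lra|lra].
rewrite (split3 (pi / 2)%R (3 * pi / 2)%R); [|lra|lra].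
rewrite (split3 (- (pi / 2))%R 0%R); [|lra|lra].
rewrite (_ : - (pi / 2) + pi = pi / 2)%R; last by lra.
rewrite (_ : pi / 2 + pi = 3 * pi / 2)%R; last by lra.
have -> : \int[mu]_(t in `[(3 * pi / 2)%R, (2 * pi)%R[) F t = \int[mu]_(t in `[(- (pi / 2))%R, 0%R[) F t.
  transitivity (\int[mu]_(x in `[(- (pi / 2))%R, 0%R[) F (x + (pi *+ 2))%R).
    rewrite ge0_integral_shift// add0r (_ : - (pi / 2) + pi *+ 2 = 3 * pi / 2)%R; last by rewrite (mulr2n pi); lra.
    by rewrite (mulr_natl (@pi R) 2).
  by apply: eq_integral => x _; rewrite pF.
by rewrite addeA addeC addeA.
Qed.

(** Negative radii of the half-circle form are the points at angle t + pi. The variable is the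
    squared radius u: the Jacobian becomes the constant 1/2, and levels of a quadratic form become
    affine conditions on u. *)
Lemma ge0_polar (G : mR * mR -> \bar R) :
  measurable_fun setT G -> (forall x, 0 <= G x) ->
  \int[mu]_x \int[mu]_y G (x, y) =
  2^-1%:E * \int[mu]_(t in `[0%R, (2 * pi)%R[)
     \int[mu]_(u in `]0%R, +oo[) G (Num.sqrt u * cos t, Num.sqrt u * sin t)%R.
Proof.
move=> mG G0.
have mGt : measurable_fun setT (fun p : mR * mR => G (Num.sqrt p.2 * cos p.1, Num.sqrt p.2 * sin p.1)%R).
  have m2 : measurable_fun setT (fun p : mR * mR => Num.sqrt p.2).
    exact: (measurableT_comp (@sqrt_measurable R)).
  have mc : measurable_fun [set: mR] (@cos R).
    by apply: continuous_measurable_fun; exact: continuous_cos.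
  have ms : measurable_fun [set: mR] (@sin R).
    by apply: continuous_measurable_fun; exact: continuous_sin.
  apply: measurableT_comp => //; apply: measurable_fun_pair; apply: measurable_funM => //.
    exact: (measurableT_comp mc).
  exact: (measurableT_comp ms).
have mI : measurable (`]0%R, +oo[%classic : set mR) by exact: measurable_itv.
pose F (t : mR) := \int[mu]_(u in `]0%R, +oo[) G (Num.sqrt u * cos t, Num.sqrt u * sin t)%R.
have mF : measurable_fun setT F.
  rewrite (_ : F = fun t => \int[mu]_u (G (Num.sqrt u * cos t, Num.sqrt u * sin t)%R * (\1_(`]0%R, +oo[%classic) u)%:E)); last first.
    by apply/funext => t; rewrite ge0_integral_cond0.
  apply: (measurable_fun_fubini_tonelli_F (m2 := mu) (fun p : mR * mR => G (Num.sqrt p.2 * cos p.1, Num.sqrt p.2 * sin p.1)%R * (\1_(`]0%R, +oo[%classic) p.2)%:E)).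
    apply: emeasurable_funM => //; apply/measurable_EFinP.
    by apply: measurableT_comp => //; exact: measurable_indic.
  by move=> p; rewrite mule_ge0// lee_fin.
have F0 t : 0 <= F t by apply: integral_ge0.
rewrite ge0_polar_half// (ge0_integral_circle mF F0); last first.
  by move=> t; rewrite /F cosD2pi sinD2pi.
rewrite -ge0_integralZl//; last 2 first.
- apply: measurable_funTS; apply: emeasurable_funD => //.
  by apply: (measurableT_comp mF); exact: measurable_funD.
- by move=> t _; rewrite adde_ge0.
apply: eq_integral => t _.
have FE s : 2^-1%:E * F s = \int[mu]_(z in `]0%R, +oo[) (G (z * cos s, z * sin s)%R * z%:E).
  rewrite /F -ge0_substitution_square//; last first.
    by apply: (measurableT_comp mGt (g := fun u : mR => (s, u))); exact: measurable_fun_pair.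
  rewrite -ge0_integralZl//; last 2 first.
  - apply: measurable_funTS; apply: emeasurable_funM.
      apply: (measurableT_comp mGt (g := fun x : mR => (s, x ^+ 2)%R)).
      by apply: measurable_fun_pair => //; exact: measurable_funX.
    by apply/measurable_EFinP; exact: measurable_funM.
  - by move=> x; rewrite /= in_itv/= andbT => x0; rewrite mule_ge0// lee_fin; lra.
  apply: eq_integral => z; rewrite inE/= in_itv/= andbT => z0.
  by rewrite sqrtr_sqr gtr0_norm// muleCA -EFinM; congr (_ * _%:E); field.
rewrite muleDr// ?ge0_adde_def ?inE// !FE.
pose K (z : R) : \bar R := G (z * cos t, z * sin t)%R * `|z|%:E.
have mK : measurable_fun [set: mR] K.
  apply: emeasurable_funM; last by apply/measurable_EFinP; exact: normr_measurable.
  by apply: measurableT_comp => //; apply: measurable_fun_pair; exact: measurable_funM.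
have K0 z : 0 <= K z by rewrite mule_ge0.
rewrite [LHS](_ : _ = \int[mu]_z K z)//.
rewrite (_ : setT = `]-oo, 0%R] `|` `]0%R, +oo[); last by rewrite -setCitvr setvU.
rewrite ge0_integral_setU//=; last 2 first.
- exact: measurable_funTS.
- apply/disj_setPS => x /= []; rewrite !in_itv/= andbT => x0.
  by rewrite ltNge x0.
rewrite addeC; congr (_ + _).
  apply: eq_integral => z; rewrite inE/= in_itv/= andbT => z0.
  by rewrite /K gtr0_norm.
have cos_sinE z : (z * cos (t + pi), z * sin (t + pi))%R = (- z * cos t, - z * sin t)%R.
  by rewrite cosDpi sinDpi !mulrN !mulNr.
transitivity (\int[mu]_(z in `[0%R, +oo[) K (- z)%R); last first.
  rewrite -integral_itv_obnd_cbnd; last first.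
    by apply: measurable_funTS; exact: measurableT_comp.
  apply: eq_integral => z; rewrite inE/= in_itv/= andbT => z0.
  by rewrite cos_sinE /K normrN gtr0_norm.
rewrite ge0_integration_by_substitution0//; last exact: measurableT_comp.
by apply: eq_integral => z _; rewrite opprK.
Qed.

End Polar.

Lemma cos_measurable (R : realType) : measurable_fun [set: measurableTypeR R] (@cos R).
Proof. by apply: continuous_measurable_fun; exact: continuous_cos. Qed.

Lemma sin_measurable (R : realType) : measurable_fun [set: measurableTypeR R] (@sin R).
Proof. by apply: continuous_measurable_fun; exact: continuous_sin. Qed.

Ltac mfun := lazymatch goal with
  | |- measurable_fun _ (fun=> ?c) => exact: measurable_cst
  | |- measurable_fun _ (fun x => x) => exact: measurable_id
  | |- measurable_fun _ (fun x => (@?a x, @?b x)) =>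
      apply: measurable_fun_pair; [mfun|mfun]
  | |- measurable_fun _ (fun x => fst x) => exact: measurable_fst
  | |- measurable_fun _ (fun x => snd x) => exact: measurable_snd
  | |- measurable_fun _ (fun x => fst (@?a x)) =>
      apply: (@measurableT_comp _ _ _ _ _ _ fst _ a); [exact: measurable_fst|mfun]
  | |- measurable_fun _ (fun x => snd (@?a x)) =>
      apply: (@measurableT_comp _ _ _ _ _ _ snd _ a); [exact: measurable_snd|mfun]
  | |- measurable_fun _ (fun x => (@?a x + @?b x)%R) =>
      apply: (@measurable_funD _ _ _ _ a b); [mfun|mfun]
  | |- measurable_fun _ (fun x => (@?a x * @?b x)%R) =>
      apply: (@measurable_funM _ _ _ _ a b); [mfun|mfun]
  | |- measurable_fun _ (fun x => (- @?a x)%R) =>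
      apply: (measurableT_comp (@oppr_measurable _ setT) (g := a)); mfun
  | |- measurable_fun _ (fun x => (@?a x ^+ ?n)%R) =>
      apply: (@measurable_funX _ _ _ _ a n); mfun
  | |- measurable_fun _ (fun x => (@?a x)^-1%R) =>
      apply: (measurableT_comp (@inv_measurable _) (g := a)); mfun
  | |- measurable_fun _ (fun x => Num.sqrt (@?a x)) =>
      apply: (measurableT_comp (@sqrt_measurable _) (g := a)); mfun
  | |- measurable_fun _ (fun x => cos (@?a x)) =>
      apply: (measurableT_comp (@cos_measurable _) (g := a)); mfun
  | |- measurable_fun _ (fun x => sin (@?a x)) =>
      apply: (measurableT_comp (@sin_measurable _) (g := a)); mfun
  | |- _ => try done
  end.

(** * Disintegration of Lebesgue measure on a solid cone in R^4 *)

Section Cone.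
Variable R : realType.
Local Notation mR := (measurableTypeR R).
Local Notation mu := (@lebesgue_measure R).
Local Notation l2 := (@leb2 R).
Local Notation R4 := ((mR * mR) * (mR * mR))%type.

Local Open Scope ereal_scope.

Lemma leb2E1 (G : mR * mR -> \bar R) : measurable_fun setT G -> (forall p, 0 <= G p) ->
  \int[l2]_p G p = \int[mu]_x \int[mu]_y G (x, y).
Proof. by move=> mG G0; exact: fubini_tonelli1. Qed.

Lemma leb2E2 (G : mR * mR -> \bar R) : measurable_fun setT G -> (forall p, 0 <= G p) ->
  \int[l2]_p G p = \int[mu]_y \int[mu]_x G (x, y).
Proof. by move=> mG G0; exact: fubini_tonelli2. Qed.

Lemma ge0_integral_affineV (a b : R) (G : mR -> \bar R) : (a != 0)%R ->
  measurable_fun setT G -> (forall x, 0 <= G x) ->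
  \int[mu]_x G (a * x + b)%R = `|a|^-1%:E * \int[mu]_x G x.
Proof.
move=> a0 mG G0; rewrite -(ge0_substitution_affine b a0 mG G0).
have mGa : measurable_fun [set: mR] (fun x : mR => G (a * x + b)%R).
  by apply: measurableT_comp => //; mfun.
rewrite ge0_integralZr// muleCA -EFinM mulVf ?normr_eq0// mule1//.
Qed.

(** For a <> 0 the map is (x, y) |-> (a x + b y, y) followed by (X, y) |-> (X, (c X + y) / a), by
    the determinant condition; each factor is affine in one variable and the Jacobians |a| and 1 /
    |a| cancel. For a = 0 the two coordinates are treated one after the other, with b c = -1. *)
Lemma ge0_integral_linear2 (a b c d : R) (G : mR * mR -> \bar R) :
  (a * d - b * c = 1)%R -> measurable_fun setT G -> (forall p, 0 <= G p) ->
  \int[l2]_p G (a * p.1 + b * p.2, c * p.1 + d * p.2)%R = \int[l2]_p G p.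
Proof.
move=> det mG G0.
have mGl : measurable_fun setT (fun p : mR * mR => G (a * p.1 + b * p.2, c * p.1 + d * p.2)%R).
  by apply: measurableT_comp => //; mfun.
have mG1 x : measurable_fun setT (fun y : mR => G (x, y)) by apply: measurableT_comp => //; mfun.
rewrite leb2E2//=; have [a0|a0] := eqVneq a 0%R; last first.
  pose H (p : mR * mR) := G (p.1, (c / a) * p.1 + p.2 / a)%R.
  have mH : measurable_fun setT H by apply: measurableT_comp => //; mfun.
  have H0 p : 0 <= H p by exact: G0.
  transitivity (\int[mu]_y (`|a|^-1%:E * \int[mu]_x H (x, y))).
    apply: eq_integral => y _.
    rewrite -(@ge0_integral_affineV a (b * y) (fun x => H (x, y)))//; last first.
      by apply: measurableT_comp => //; mfun.
    apply: eq_integral => x _; congr (G (_, _)) => /=.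
    have -> : (d = (1 + b * c) / a)%R by rewrite -det; field.
    by field.
  have mHx : measurable_fun setT (fun y => \int[mu]_x H (x, y)).
    exact: (measurable_fun_fubini_tonelli_G (m1 := mu) H).
  rewrite ge0_integralZl//; last by move=> y _; exact: integral_ge0.
  rewrite -leb2E2// leb2E1// [in RHS]leb2E1//.
  rewrite -ge0_integralZl//; last 2 first.
  - exact: (measurable_fun_fubini_tonelli_F (m2 := mu) H).
  - by move=> y _; exact: integral_ge0.
  apply: eq_integral => x _; rewrite /H/=.
  have a0' : (a^-1 != 0)%R by rewrite invr_eq0.
  under eq_integral => y _ do rewrite [X in (_, X)]addrC [X in (_, X + _)%R]mulrC.
  rewrite (@ge0_integral_affineV a^-1 (c / a * x) (fun y => G (x, y)))//.
  by rewrite muleA -EFinM normfV invrK mulVf ?normr_eq0// mul1e.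
have bc : (b * c = -1)%R by move: det; rewrite a0; lra.
have c0 : (c != 0)%R by apply/eqP => c0; move: bc; rewrite c0; lra.
have b0 : (b != 0)%R by apply/eqP => b0; move: bc; rewrite b0; lra.
transitivity (\int[mu]_y (`|c|^-1%:E * \int[mu]_x G (b * y, x)%R)).
  apply: eq_integral => y _.
  rewrite -(@ge0_integral_affineV c (d * y) (fun x => G (b * y, x)%R))//.
  by apply: eq_integral => x _; rewrite a0 mul0r add0r.
have mGx : measurable_fun setT (fun y => \int[mu]_x G (y, x)).
  exact: (measurable_fun_fubini_tonelli_F (m2 := mu) G).
rewrite ge0_integralZl//; last 2 first.
- by apply: (measurableT_comp mGx); mfun.
- by move=> y _; exact: integral_ge0.
under eq_integral => y _ do rewrite -[(b * y)%R]addr0.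
rewrite (@ge0_integral_affineV b 0 (fun y => \int[mu]_x G (y, x)))//; last first.
  by move=> y; exact: integral_ge0.
by rewrite muleA -EFinM -invfM -normrM mulrC bc normrN1 invr1 mul1e -leb2E1.
Qed.

Lemma ge0_integral_scale2 (a : R) (G : mR * mR -> \bar R) : (0 < a)%R ->
  measurable_fun setT G -> (forall p, 0 <= G p) ->
  \int[l2]_p G (p.1 / a, p.2 / a)%R = (a ^+ 2)%:E * \int[l2]_p G p.
Proof.
move=> a0 mG G0.
have mGl : measurable_fun setT (fun p : mR * mR => G (p.1 / a, p.2 / a)%R).
  by apply: measurableT_comp => //; mfun.
have mG1 x : measurable_fun setT (fun y : mR => G (x, y)) by apply: measurableT_comp => //; mfun.
have a0' : (a^-1 != 0)%R by rewrite invr_eq0 gt_eqF.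
rewrite leb2E1// [in RHS]leb2E1//=.
have mGx : measurable_fun setT (fun x => \int[mu]_y G (x, y)).
  exact: (measurable_fun_fubini_tonelli_F (m2 := mu) G).
have Gx0 x : 0 <= \int[mu]_y G (x, y) by exact: integral_ge0.
have E (H : mR -> \bar R) : measurable_fun setT H -> (forall x, 0 <= H x) ->
    \int[mu]_x H (x / a)%R = a%:E * \int[mu]_x H x.
  move=> mH H0; under eq_integral => x _ do rewrite -[(x / a)%R]addr0 [(x / a)%R]mulrC.
  by rewrite ge0_integral_affineV// normfV invrK gtr0_norm.
transitivity (\int[mu]_x (a%:E * \int[mu]_y G (x / a, y)%R)).
  by apply: eq_integral => x _; exact: (E (fun y => G (x / a, y)%R)).
rewrite ge0_integralZl; last 4 first.
- exact: measurableT.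
- by apply: (measurableT_comp mGx); mfun.
- by move=> x _; exact: Gx0.
- by rewrite lee_fin ltW.
by rewrite (E _ mGx Gx0) muleA -EFinM expr2.
Qed.

Definition nsq (p : mR * mR) : mR := (p.1 ^+ 2 + p.2 ^+ 2)%R.

(** The 2 cancels the Jacobian 1/2 of polar coordinates, 1 / v cancels the factor v by which a plane
    scales, and [1, 2] has length 1: the weighted integral over the cone becomes an integral over
    the level v = 1. *)
Definition cone_weight (v : mR) : mR := (if (1 <= v :> R) && (v <= 2 :> R) then 2 / v else 0)%R.

(** The extension of [K] from the level v = 1 that is homogeneous of degree 0, weighted and
    restricted to 1 <= v <= 2. The sign e, 1 or -1, tells which of the two planes stands first; the
    first one will carry the polar coordinates. *)
Definition cone_fun (e : R) (K : R4 -> \bar R) (r : R4) : \bar R :=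
  let v := (e * (nsq r.1 - nsq r.2))%R in
  let s := Num.sqrt v in
  K ((r.1.1 / s, r.1.2 / s), (r.2.1 / s, r.2.2 / s))%R * (cone_weight v)%:E.

(** The level v = 1, parametrised by the second plane and by the polar angle in the first. For e =
    -1 the last factor discards the unit disc, over whose interior the level has no points. *)
Definition cone_section (e : R) (K : R4 -> \bar R) (p : (mR * mR) * mR) : \bar R :=
  let s := Num.sqrt (e + nsq p.1) in
  K ((s * cos p.2, s * sin p.2), p.1)%R * ((0 < e + nsq p.1 :> R)%R%:R)%:E.

Lemma cone_weight_ge0 v : (0 <= cone_weight v)%R.
Proof.
rewrite /cone_weight; case: ifPn => // /andP[v1 _].
by rewrite divr_ge0// (le_trans _ v1).
Qed.

Lemma cone_weight_measurable : measurable_fun setT cone_weight.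
Proof.
rewrite /cone_weight; apply: measurable_fun_ifT => //; last by mfun; exact: inv_measurable.
by apply: measurable_and; exact: measurable_fun_ler.
Qed.

Lemma cone_fun_measurable e K : measurable_fun setT K -> measurable_fun setT (cone_fun e K).
Proof.
move=> mK; rewrite /cone_fun; apply: emeasurable_funM.
  apply: measurableT_comp => //; mfun; rewrite /nsq; mfun.
apply/measurable_EFinP; apply: (measurableT_comp cone_weight_measurable).
by rewrite /nsq; mfun.
Qed.

Lemma cone_section_measurable e K : measurable_fun setT K ->
  measurable_fun setT (cone_section e K).
Proof.
move=> mK; rewrite /cone_section; apply: emeasurable_funM.
  by apply: measurableT_comp => //; rewrite /nsq; mfun.
apply/measurable_EFinP; rewrite [X in measurable_fun _ X](_ : _ =
  fun p => if (0 < e + nsq p.1 :> R)%R then 1%R : mR else 0%R : mR); last first.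
  by apply/funext => p; case: ltP.
apply: measurable_fun_ifT => //; apply: measurable_fun_ltr => //.
by rewrite /nsq; mfun.
Qed.

Lemma cone_section_ge0 e K p : (forall r, 0 <= K r) -> 0 <= cone_section e K p.
Proof. by move=> K0; rewrite mule_ge0// lee_fin ler0n. Qed.

Lemma cone_fun_ge0 e K p : (forall r, 0 <= K r) -> 0 <= cone_fun e K p.
Proof. by move=> K0; rewrite mule_ge0// lee_fin cone_weight_ge0. Qed.

(** In polar coordinates of the first plane the squared radius is u = e v + |q|^2, so u is exchanged
    for v with Jacobian 1. Fubini puts v outside, and for fixed v the second plane is rescaled by
    sqrt v; the weight is made so that only the length of [1, 2] remains. *)
Lemma integral_cone e K : (e ^+ 2 = 1)%R -> measurable_fun setT K -> (forall r, 0 <= K r) ->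
  \int[l2]_q \int[l2]_p cone_fun e K (p, q) =
  \int[mu]_(t in `[0%R, (2 * pi)%R[) \int[l2]_q cone_section e K (q, t).
Proof.
move=> e1 mK K0.
have e0 : (e != 0)%R by apply/eqP => e0; move: e1; rewrite e0 expr0n/=; lra.
have ne : (`|e| = 1)%R.
  have : (`|e| ^+ 2 = 1)%R by rewrite -normrX e1 normr1.
  by move=> /eqP; rewrite sqrf_eq1 => /orP[/eqP//|/eqP h]; have := normr_ge0 e; rewrite h; lra.
have mC := cone_fun_measurable e mK.
have mS := cone_section_measurable e mK.
have C0 p : 0 <= cone_fun e K p by exact: cone_fun_ge0.
have S0 p : 0 <= cone_section e K p by exact: cone_section_ge0.
pose T := `[0%R, (2 * pi)%R[%classic : set mR.
have mT : measurable T by exact: measurable_itv.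
pose X (r : ((mR * mR) * mR) * mR) : \bar R :=
  cone_section e K ((r.1.1.1 / Num.sqrt r.2, r.1.1.2 / Num.sqrt r.2), r.1.2)%R
  * (cone_weight r.2)%:E.
have mX : measurable_fun setT X.
  apply: emeasurable_funM; first by apply: measurableT_comp => //; mfun.
  by apply/measurable_EFinP; apply: (measurableT_comp cone_weight_measurable); mfun.
have X0 r : 0 <= X r by rewrite mule_ge0// lee_fin cone_weight_ge0.
have step1 q : \int[l2]_p cone_fun e K (p, q) =
    2^-1%:E * \int[mu]_(t in T) \int[mu]_v X (q, t, v).
  rewrite leb2E1//; last by apply: measurableT_comp => //; mfun.
  rewrite (@ge0_polar _ (fun p => cone_fun e K (p, q))); last 2 first.
  - by apply: measurableT_comp => //; mfun.
  - by move=> p; exact: C0.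
  apply: (congr1 (mule _)); apply: eq_integral => t _.
  pose H (u : mR) : \bar R := cone_fun e K ((Num.sqrt u * cos t, Num.sqrt u * sin t), q)%R
     * (\1_(`]0%R, +oo[%classic) u)%:E.
  have mH : measurable_fun setT H.
    apply: emeasurable_funM; first by apply: measurableT_comp => //; mfun.
    by apply/measurable_EFinP; exact: measurable_indic.
  transitivity (\int[mu]_u H u).
    by rewrite ge0_integral_cond0//; exact: measurable_itv.
  have H0 u : 0 <= H u by rewrite mule_ge0// lee_fin.
  rewrite -[LHS]mul1e -{1}[1%R]invr1 -{1}ne -(ge0_integral_affineV (nsq q) e0 mH H0).
  apply: eq_integral => v _.
  rewrite /H /X /cone_fun /cone_section /=.
  set u := (e * v + nsq q)%R.
  have uE : (0 < u)%R -> (e * (nsq (Num.sqrt u * cos t, Num.sqrt u * sin t) - nsq q) = v)%R.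
    move=> u0; rewrite /nsq/= !exprMn sqr_sqrtr ?(ltW u0)// -mulrDr cos2Dsin2 mulr1.
    by rewrite /u /nsq addrK mulrA -expr2 e1 mul1r.
  have [/andP[v1 v2]|nv] := boolP ((1 <= v :> R) && (v <= 2 :> R))%R; last first.
    rewrite {2}/cone_weight (negbTE nv) mule0 indicE.
    have [u0|u0] := ltP 0%R u; last by rewrite memNset ?mule0//= in_itv/= andbT ltNge u0.
    by rewrite uE// /cone_weight (negbTE nv) !mule0 mul0e.
  have v0 : (0 < v)%R by rewrite (lt_le_trans _ v1).
  have s0 : (Num.sqrt v != 0)%R by rewrite gt_eqF// sqrtr_gt0.
  have sE : (e + nsq (q.1 / Num.sqrt v, q.2 / Num.sqrt v) = u / v)%R.
    by rewrite /nsq/= !exprMn !exprVn sqr_sqrtr ?(ltW v0)// /u /nsq; field; rewrite gt_eqF.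
  rewrite sE pmulr_lgt0 ?invr_gt0// indicE.
  have [u0|u0] := ltP 0%R u; last by rewrite memNset ?mule0 ?mul0e//= in_itv/= andbT ltNge u0.
  rewrite mem_set/= ?in_itv/= ?andbT// !mule1 uE// sqrtrM ?(ltW u0)// sqrtrV ?(ltW v0)//.
  by congr (K ((_, _), _) * _); ring.
pose Xv (r : (mR * mR) * mR) := \int[mu]_v X (r, v).
have mXv : measurable_fun setT Xv.
  exact: (measurable_fun_fubini_tonelli_F (m2 := mu) X).
have Xv0 r : 0 <= Xv r by exact: integral_ge0.
pose XT (r : (mR * mR) * mR) := Xv r * (\1_T r.2)%:E.
have mXT : measurable_fun setT XT.
  apply: emeasurable_funM => //; apply/measurable_EFinP.
  have m1T : measurable_fun setT (\1_T : mR -> mR) by exact: measurable_indic.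
  exact: (measurableT_comp m1T measurable_snd).
have XT0 r : 0 <= XT r by rewrite mule_ge0// lee_fin.
have mXv1 t : measurable_fun setT (fun q => Xv (q, t)).
  by apply: measurableT_comp => //; mfun.
have mXq : measurable_fun setT (fun t => \int[l2]_q Xv (q, t)).
  exact: (measurable_fun_fubini_tonelli_G (m1 := l2) Xv).
have Xq0 t : 0 <= \int[l2]_q Xv (q, t) by exact: integral_ge0.
transitivity (2^-1%:E * \int[l2]_q \int[mu]_t XT (q, t)).
  rewrite -ge0_integralZl//; last 2 first.
  - exact: (measurable_fun_fubini_tonelli_F (m2 := mu) XT).
  - by move=> q _; exact: integral_ge0.
  apply: eq_integral => q _; rewrite step1; congr (_ * _).
  by rewrite -ge0_integral_cond0.
have -> : \int[l2]_q \int[mu]_t XT (q, t) = \int[mu]_t \int[l2]_q XT (q, t).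
  exact: (fubini_tonelli (m1 := l2) (m2 := mu) XT).
have -> : \int[mu]_t \int[l2]_q XT (q, t) = \int[mu]_(t in T) \int[l2]_q Xv (q, t).
  rewrite -[RHS]ge0_integral_cond0//; apply: eq_integral => t _.
  by rewrite /XT/= ge0_integralZr// lee_fin.
rewrite -ge0_integralZl//=; last exact: measurable_funTS.
apply: eq_integral => t _.
have mXt : measurable_fun setT (fun r : (mR * mR) * mR => X (r.1, t, r.2)).
  by apply: measurableT_comp => //; mfun.
have -> : \int[l2]_q Xv (q, t) = \int[mu]_v \int[l2]_q X (q, t, v).
  exact: (fubini_tonelli (m1 := l2) (m2 := mu) (fun r => X (r.1, t, r.2))).
have mSt : measurable_fun setT (fun q => cone_section e K (q, t)).
  by apply: measurableT_comp => //; mfun.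
have St0 : 0 <= \int[l2]_q cone_section e K (q, t) by exact: integral_ge0.
have -> : \int[mu]_v \int[l2]_q X (q, t, v) =
    \int[mu]_v ((2 * \1_(`[1%R, 2%R]%classic) v)%:E * \int[l2]_q cone_section e K (q, t)).
  apply: eq_integral => v _; rewrite /X/=.
  rewrite ge0_integralZr//; last 2 first.
  - by apply: (measurableT_comp mS (g := fun q : mR * mR => ((q.1 / Num.sqrt v, q.2 / Num.sqrt v), t)%R)); mfun.
  - by rewrite lee_fin cone_weight_ge0.
  rewrite indicE mem_setE in_itv/= /cone_weight; case: ifPn => [/andP[v1 v2]|nv]; last first.
    by rewrite mulr0 mule0 mul0e.
  have v0 : (0 < v)%R by rewrite (lt_le_trans _ v1).
  have s0 : (0 < Num.sqrt v)%R by rewrite sqrtr_gt0.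
  rewrite (ge0_integral_scale2 s0 mSt)// sqr_sqrtr ?(ltW v0)// muleAC -EFinM mulr1.
  by rewrite mulrC divfK// gt_eqF.
rewrite ge0_integralZr//; last first.
  by apply/measurable_EFinP; apply: measurable_funM => //; exact: measurable_indic.
have -> : \int[mu]_v (2 * \1_(`[1%R, 2%R]%classic) v)%:E = 2%:E.
  under eq_integral do rewrite EFinM.
  rewrite ge0_integralZl//; last by apply/measurable_EFinP; exact: measurable_indic.
  rewrite integral_indic// setIT [X in _ * X]lebesgue_measure_itv/= lte_fin ifT; last by lra.
  by rewrite -EFinB -EFinM; congr (_%:E); lra.
by rewrite muleA -EFinM mulVf// mul1e.
Qed.

End Cone.

(** * The two parametrisations of the hyperboloid and its isometries *)

Section ChangeOfVariables.
Variable R : realType.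
Local Notation mR := (measurableTypeR R).
Local Notation mu := (@lebesgue_measure R).
Local Notation l2 := (@leb2 R).
Local Notation l3 := (@leb3 R).
Local Notation R4 := ((mR * mR) * (mR * mR))%type.
Local Notation R3 := (mR * mR * mR)%type.
Local Open Scope ereal_scope.

Definition rot (c s : R) (p : mR * mR) : mR * mR := (c * p.1 - s * p.2, s * p.1 + c * p.2)%R.

(** Hyperbolic rotation of the first coordinates of the two planes, when c^2 - s^2 = 1. *)
Definition boost (c s : R) (r : R4) : R4 :=
  ((c * r.1.1 + s * r.2.1, r.1.2), (s * r.1.1 + c * r.2.1, r.2.2))%R.

Lemma boost_measurable c s : measurable_fun setT (boost c s).
Proof. by rewrite /boost; mfun. Qed.

Lemma ge0_integral_rot c s (G : mR * mR -> \bar R) : (c ^+ 2 + s ^+ 2 = 1)%R ->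
  measurable_fun setT G -> (forall p, 0 <= G p) ->
  \int[l2]_p G (rot c s p) = \int[l2]_p G p.
Proof.
move=> cs mG G0; rewrite -(@ge0_integral_linear2 _ c (- s) s c G)//; last first.
  by rewrite -cs; ring.
by apply: eq_integral => p _; rewrite /rot mulNr.
Qed.

Lemma leb4C (G : R4 -> \bar R) : measurable_fun setT G -> (forall r, 0 <= G r) ->
  \int[l2]_p \int[l2]_q G (p, q) = \int[l2]_q \int[l2]_p G (p, q).
Proof. by move=> mG G0; exact: (fubini_tonelli (m1 := l2) (m2 := l2) G). Qed.

(** Regroups the four coordinates so that a boost becomes a linear map of determinant 1 in one of
    the two plane integrals. *)
Lemma leb4_mix (G : R4 -> \bar R) : measurable_fun setT G -> (forall r, 0 <= G r) ->
  \int[l2]_p \int[l2]_q G (p, q) =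
  \int[l2]_s \int[l2]_r G ((s.1, r.1), (s.2, r.2)).
Proof.
move=> mG G0.
have mG' : measurable_fun setT (fun z : R4 => G ((z.1.1, z.2.1), (z.1.2, z.2.2))).
  by apply: (measurableT_comp mG (g := fun z : R4 => ((z.1.1, z.2.1), (z.1.2, z.2.2)))); mfun.
pose H (z : R3) := \int[mu]_w G ((z.1.1, z.1.2), (z.2, w)).
have mH : measurable_fun setT H.
  apply: (measurable_fun_fubini_tonelli_F (m2 := mu)
    (fun z : R3 * mR => G ((z.1.1.1, z.1.1.2), (z.1.2, z.2)))) => //.
  by apply: (measurableT_comp mG (g := fun z : R3 * mR => ((z.1.1.1, z.1.1.2), (z.1.2, z.2)))); mfun.
have H0 z : 0 <= H z by exact: integral_ge0.
rewrite leb2E1; last 2 first.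
- exact: (measurable_fun_fubini_tonelli_F (m2 := l2) G).
- by move=> p; exact: integral_ge0.
rewrite [RHS]leb2E1; last 2 first.
- exact: (measurable_fun_fubini_tonelli_F (m2 := l2) (fun z : R4 => G ((z.1.1, z.2.1), (z.1.2, z.2.2)))).
- by move=> p; exact: integral_ge0.
apply: eq_integral => x1 _.
transitivity (\int[mu]_x2 \int[mu]_x3 H (x1, x2, x3)).
  apply: eq_integral => x2 _; apply: leb2E1 => //.
  by apply: (measurableT_comp mG (g := fun q : mR * mR => ((x1, x2), q))); mfun.
transitivity (\int[mu]_x3 \int[mu]_x2 H (x1, x2, x3)).
  apply: (fubini_tonelli (m1 := mu) (m2 := mu) (fun z : mR * mR => H (x1, z.1, z.2))) => //.
  by apply: (measurableT_comp mH (g := fun z : mR * mR => (x1, z.1, z.2))); mfun.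
apply: eq_integral => x3 _; apply/esym.
apply: (leb2E1 (G := fun r : mR * mR => G ((x1, r.1), (x3, r.2)))) => //.
by apply: (measurableT_comp mG (g := fun r : mR * mR => ((x1, r.1), (x3, r.2)))); mfun.
Qed.

Lemma ge0_integral_boost c s (G : R4 -> \bar R) : (c ^+ 2 - s ^+ 2 = 1)%R ->
  measurable_fun setT G -> (forall r, 0 <= G r) ->
  \int[l2]_p \int[l2]_q G (boost c s (p, q)) = \int[l2]_p \int[l2]_q G (p, q).
Proof.
move=> cs mG G0.
have mGb : measurable_fun setT (G \o boost c s).
  exact: (measurableT_comp mG (boost_measurable c s)).
rewrite [RHS](leb4_mix mG G0); transitivity (\int[l2]_z \int[l2]_r G (boost c s ((z.1, r.1), (z.2, r.2)))).
  by apply: (leb4_mix (G := G \o boost c s)) => // r; exact: G0.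
pose H (z : mR * mR) := \int[l2]_r G ((z.1, r.1), (z.2, r.2)).
have mH : measurable_fun setT H.
  apply: (measurable_fun_fubini_tonelli_F (m2 := l2) (fun z : R4 => G ((z.1.1, z.2.1), (z.1.2, z.2.2)))) => //.
  by apply: (measurableT_comp mG (g := fun z : R4 => ((z.1.1, z.2.1), (z.1.2, z.2.2)))); mfun.
have H0 z : 0 <= H z by exact: integral_ge0.
by rewrite -(@ge0_integral_linear2 _ c s s c H).
Qed.

(** A boost followed by a rotation in each plane. Such maps preserve the quadratic form, and they
    already carry the base point ((1, 0), (0, 0)) to every point of the hyperboloid. *)
Definition isom (c1 s1 c2 s2 c s : R) (r : R4) : R4 :=
  let r' := boost c s r in (rot c1 s1 r'.1, rot c2 s2 r'.2).

Lemma isom_measurable c1 s1 c2 s2 c s : measurable_fun setT (isom c1 s1 c2 s2 c s).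
Proof. by rewrite /isom /rot /boost/=; mfun. Qed.

(** [Phi] with the four coordinates grouped into the negative and the positive plane. *)
Definition ads4 (p : R3) : R4 :=
  ((Num.sqrt (1 + nsq (p.1.2, p.2)) * cos p.1.1, Num.sqrt (1 + nsq (p.1.2, p.2)) * sin p.1.1),
   (p.1.2, p.2))%R.

(** The parametrisation by p = (theta, z, s), where z is the coordinate along the base point and
    therefore equals zeta for pairs whose second point is the base point. *)
Definition cyl4 (p : R3) : R4 :=
  ((p.1.2, p.2), (Num.sqrt (-1 + nsq (p.1.2, p.2)) * cos p.1.1,
    Num.sqrt (-1 + nsq (p.1.2, p.2)) * sin p.1.1))%R.

Definition cyl_dom : set R3 := @fundamental R `&` [set p | (0 < -1 + nsq (p.1.2, p.2) :> R)%R].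

Lemma ads4_measurable : measurable_fun setT ads4.
Proof. by rewrite /ads4 /nsq/=; mfun. Qed.

Lemma cyl4_measurable : measurable_fun setT cyl4.
Proof. by rewrite /cyl4 /nsq/=; mfun. Qed.

Lemma fundamentalE : @fundamental R = [set p | p.1.1 \in `[0%R, (2 * pi)%R[%R].
Proof. by apply/seteqP; split => p; rewrite /= in_itv. Qed.

Lemma fundamental_measurable : measurable (@fundamental R : set R3).
Proof.
rewrite fundamentalE [X in measurable X](_ : _ =
   setT `&` (fst \o fst : R3 -> mR) @^-1` (`[0%R, (2 * pi)%R[%classic)); last by rewrite setTI.
have m : measurable_fun setT (fst \o fst : R3 -> mR) by rewrite /comp; mfun.
by apply: m => //; exact: measurable_itv.
Qed.

Lemma cyl_dom_measurable : measurable (cyl_dom : set R3).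
Proof.
apply: measurableI; first exact: fundamental_measurable.
rewrite -[X in measurable X]setTI.
have m : measurable_fun setT (fun p : R3 => -1 + nsq (p.1.2, p.2) : mR)%R by rewrite /nsq/=; mfun.
exact: (measurable_fun_ltr (measurable_cst _) m measurableT (Y := [set true])).
Qed.

Lemma leb3_cond (G : R3 -> \bar R) : measurable_fun setT G -> (forall r, 0 <= G r) ->
  \int[l3]_(p in @fundamental R) G p =
  \int[mu]_(t in `[0%R, (2 * pi)%R[) \int[l2]_q G (t, q.1, q.2).
Proof.
move=> mG G0; pose T := `[0%R, (2 * pi)%R[%classic : set mR.
have mT : measurable T by exact: measurable_itv.
pose H (p : R3) := G p * (\1_T p.1.1)%:E.
have m1T : measurable_fun setT (\1_T : mR -> mR) by exact: measurable_indic.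
have mH : measurable_fun setT H.
  apply: emeasurable_funM => //; apply/measurable_EFinP.
  by apply: (measurableT_comp m1T (g := fun p : R3 => p.1.1)); mfun.
have H0 p : 0 <= H p by rewrite mule_ge0// lee_fin.
transitivity (\int[l3]_p H p).
  rewrite integral_mkcond; apply: eq_integral => p _.
  rewrite patchE /H indicE fundamentalE; case: ifPn.
    by rewrite inE => pT; rewrite mem_set// mule1.
  by rewrite notin_setE => pT; rewrite memNset// mule0.
transitivity (\int[l2]_z \int[mu]_b H (z, b)).
  exact: (fubini_tonelli1 (m1 := l2) (m2 := mu) H).
rewrite leb2E1; last 2 first.
- exact: (measurable_fun_fubini_tonelli_F (m2 := mu) H).
- by move=> p; exact: integral_ge0.
rewrite -[RHS]ge0_integral_cond0//; apply: eq_integral => t _.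
have mGt : measurable_fun setT (fun q : mR * mR => G (t, q.1, q.2)).
  by apply: (measurableT_comp mG (g := fun q : mR * mR => (t, q.1, q.2))); mfun.
rewrite leb2E1//= -ge0_integralZr//=; last 2 first.
- exact: (measurable_fun_fubini_tonelli_F (m2 := mu) (fun q : mR * mR => G (t, q.1, q.2))).
- by move=> a _; exact: integral_ge0.
apply: eq_integral => a _; rewrite -ge0_integralZr//=.
by apply: (measurableT_comp mG (g := fun b : mR => (t, a, b))); mfun.
Qed.

(** Both sides are the same integral over the solid cone 1 <= v <= 2: the left one with polar
    coordinates in the negative plane; the right one, after the linear isometry, with polar
    coordinates in the positive plane. *)
Lemma ge0_change_of_variables c1 s1 c2 s2 c s (K : R4 -> \bar R) :
  (c1 ^+ 2 + s1 ^+ 2 = 1)%R -> (c2 ^+ 2 + s2 ^+ 2 = 1)%R -> (c ^+ 2 - s ^+ 2 = 1)%R ->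
  measurable_fun setT K -> (forall r, 0 <= K r) ->
  \int[l3]_(p in @fundamental R) K (ads4 p) =
  \int[l3]_(p in cyl_dom) K (isom c1 s1 c2 s2 c s (cyl4 p)).
Proof.
move=> h1 h2 h3 mK K0.
pose M := K \o isom c1 s1 c2 s2 c s.
have mM : measurable_fun setT M by exact: (measurableT_comp mK (isom_measurable _ _ _ _ _ _)).
have M0 r : 0 <= M r by exact: K0.
pose M' (r : R4) := M (r.2, r.1).
have mM' : measurable_fun setT M'.
  by apply: (measurableT_comp mM (g := fun r : R4 => (r.2, r.1))); mfun.
have M'0 r : 0 <= M' r by exact: M0.
have N11 : ((-1 : R) ^+ 2 = 1)%R by rewrite sqrrN expr1n.
have N1 : ((1 : R) ^+ 2 = 1)%R by rewrite expr1n.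
have nsq0 q : (0 <= nsq q :> R)%R by rewrite /nsq addr_ge0// sqr_ge0.
pose C := cone_fun 1 K; have mC : measurable_fun setT C by exact: cone_fun_measurable.
have C0 r : 0 <= C r by exact: cone_fun_ge0.
pose C1 (r : R4) := C (rot c1 s1 r.1, rot c2 s2 r.2).
have mC1 : measurable_fun setT C1.
  by apply: (measurableT_comp mC (g := fun r : R4 => (rot c1 s1 r.1, rot c2 s2 r.2))); rewrite /rot; mfun.
have C10 r : 0 <= C1 r by exact: C0.
transitivity (\int[l2]_p \int[l2]_q C (p, q)).
  rewrite (leb3_cond (G := K \o ads4)); [|exact: (measurableT_comp mK ads4_measurable)|by move=> r; exact: K0].
  rewrite (leb4C mC C0) /C (integral_cone N1 mK K0); apply: eq_integral => t _; apply: eq_integral => q _.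
  rewrite /cone_section /ads4/= -surjective_pairing.
  by rewrite (_ : 0 < 1 + nsq q :> R)%R ?mule1// ltr_wpDr.
transitivity (\int[l2]_p \int[l2]_q C1 (p, q)).
  transitivity (\int[l2]_p \int[l2]_q C (p, rot c2 s2 q)).
    apply: eq_integral => p _; apply/esym; apply: (ge0_integral_rot (G := fun q => C (p, q))) => //.
    by apply: (measurableT_comp mC (g := fun q : mR * mR => (p, q))); mfun.
  apply/esym; apply: (ge0_integral_rot (G := fun p => \int[l2]_q C (p, rot c2 s2 q))) => //.
    apply: (measurable_fun_fubini_tonelli_F (m2 := l2) (fun r : R4 => C (r.1, rot c2 s2 r.2))) => //.
    by apply: (measurableT_comp mC (g := fun r : R4 => (r.1, rot c2 s2 r.2))); rewrite /rot; mfun.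
  by move=> p; exact: integral_ge0.
rewrite -(ge0_integral_boost h3 mC1 C10).
have -> : \int[l2]_p \int[l2]_q C1 (boost c s (p, q)) =
    \int[l2]_p \int[l2]_q cone_fun (-1) M' (q, p).
  apply: eq_integral => p _; apply: eq_integral => q _.
  rewrite /C1 /C /cone_fun /M' /M /isom /=.
  (* The form v is invariant under the isometry; exchanging the roles of the planes accounts for the
     sign -1. *)
  have -> : (1 * (nsq (rot c1 s1 (c * p.1 + s * q.1, p.2)) - nsq (rot c2 s2 (s * p.1 + c * q.1, q.2)))
     = -1 * (nsq q - nsq p))%R.
    rewrite /nsq /rot/= mul1r mulN1r opprB.
    transitivity ((c1 ^+ 2 + s1 ^+ 2) * ((c * p.1 + s * q.1) ^+ 2 + p.2 ^+ 2)
       - (c2 ^+ 2 + s2 ^+ 2) * ((s * p.1 + c * q.1) ^+ 2 + q.2 ^+ 2))%R; first by ring.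
    rewrite h1 h2; transitivity ((c ^+ 2 - s ^+ 2) * (p.1 ^+ 2 - q.1 ^+ 2) + p.2 ^+ 2 - q.2 ^+ 2)%R; first by ring.
    by rewrite h3; ring.
  by congr (K _ * _); rewrite /rot /boost/=; congr ((_, _), (_, _)); ring.
rewrite (integral_cone N11 mM' M'0).
pose E (p : R3) := M (cyl4 p) * ((0 < -1 + nsq (p.1.2, p.2) :> R)%R%:R)%:E.
have mE : measurable_fun setT E.
  apply: emeasurable_funM; first exact: (measurableT_comp mM cyl4_measurable).
  apply/measurable_EFinP; rewrite [X in measurable_fun _ X](_ : _ =
    fun p : R3 => if (0 < -1 + nsq (p.1.2, p.2) :> R)%R then 1%R : mR else 0%R : mR); last first.
    by apply/funext => p; case: ltP.
  apply: measurable_fun_ifT => //; apply: measurable_fun_ltr => //.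
  by rewrite /nsq; mfun.
have E0 p : 0 <= E p by rewrite mule_ge0// lee_fin ler0n.
transitivity (\int[l3]_(p in @fundamental R) E p).
  by rewrite (leb3_cond mE E0); apply: eq_integral => t _; apply: eq_integral => -[q1 q2] _.
rewrite integral_mkcond [RHS]integral_mkcond; apply: eq_integral => p _.
rewrite !patchE /cyl_dom in_setI /E; case: ifPn => //= _.
case: ifPn => [/set_mem/= ->|]; first by rewrite mule1.
by rewrite notin_setE/= => /negP/negbTE ->; rewrite mule0.
Qed.

Lemma change_of_variables c1 s1 c2 s2 c s (K : R4 -> \bar R) :
  (c1 ^+ 2 + s1 ^+ 2 = 1)%R -> (c2 ^+ 2 + s2 ^+ 2 = 1)%R -> (c ^+ 2 - s ^+ 2 = 1)%R ->
  measurable_fun setT K ->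
  \int[l3]_(p in @fundamental R) K (ads4 p) =
  \int[l3]_(p in cyl_dom) K (isom c1 s1 c2 s2 c s (cyl4 p)).
Proof.
move=> h1 h2 h3 mK; rewrite integralE [RHS]integralE; congr (_ - _).
  have P (f : R3 -> R4) D : \int[l3]_(p in D) (fun x => K (f x))^\+ p = \int[l3]_(p in D) K^\+ (f p).
    by apply: eq_integral => p _; rewrite (funepos_comp K f).
  rewrite !P; apply: (ge0_change_of_variables h1 h2 h3) => //; exact: measurable_funepos.
have N (f : R3 -> R4) D : \int[l3]_(p in D) (fun x => K (f x))^\- p = \int[l3]_(p in D) K^\- (f p).
  by apply: eq_integral => p _; rewrite (funeneg_comp K f).
rewrite !N; apply: (ge0_change_of_variables h1 h2 h3) => //; exact: measurable_funeneg.
Qed.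

End ChangeOfVariables.

(** * Green's formula in the chart *)

Section DirectionalDerivatives.
Variable R : realType.
Implicit Types (V W : normedModType R).

Lemma is_derive_lineP V W (u : V -> W) (p v : V) (du : W) (s : R) :
  is_derive p v u du <-> is_derive s 1 (fun s' : R => u ((s' - s) *: v + p)) du.
Proof.
have E h : h^-1 *: (u ((h *: (1 : R) + s - s) *: v + p) - u ((s - s) *: v + p)) =
    h^-1 *: (u (h *: v + p) - u p).
  by rewrite addrK subrr scale0r add0r [h *: 1]mulr1.
split => /is_derive_cvg du'; apply: cvg_is_derive; apply: cvg_trans du';
  by apply: near_eq_cvg; near=> h; rewrite E.
Unshelve. all: by end_near. Qed.

(** Along the line through p in the direction v everything is a function of one real variable, so
    the chain rule holds for mere directional derivatives. *)
Lemma is_derive_chain V (h : R -> R) (u : V -> R) (p v : V) (a b : R) :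
  is_derive (u p) 1 h a -> is_derive p v u b -> is_derive p v (h \o u) (a * b).
Proof.
move=> dh /(is_derive_lineP _ _ _ _ 0) du; apply/(is_derive_lineP _ _ _ _ 0).
apply: (@is_derive1_comp _ h (fun s' : R => u ((s' - 0) *: v + p))).
by rewrite subrr scale0r add0r.
Qed.

Local Notation R3 := (R * R * R)%type.
Local Notation pb := (@pbasis R).

Definition co (i : 'I_3) (p : R3) : R :=
  if i == 0 :> nat then p.1.1 else if i == 1%N :> nat then p.1.2 else p.2.

Lemma is_derive_co i j p : is_derive p (pb j) (co i) (i == j)%:R.
Proof.
apply: cvg_is_derive.
have : (cst (i == j)%:R) @ (0 : R)^' --> ((i == j)%:R : R) by exact: cvg_cst.
apply: cvg_trans; apply: near_eq_cvg; near=> h.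
have h0 : h != 0 by near: h; exact: nbhs_dnbhs_neq.
move: i j => [[|[|[|i]]] iP] [[|[|[|j]]] jP] //=; rewrite /co /pbasis /GRing.scale/=;
 by rewrite addrK ?mulr0n ?mulr1n ?scaler0 ?[_ *: 1]mulr1 ?mulr0 ?mulVf.
Unshelve. all: by end_near. Qed.

End DirectionalDerivatives.

(** * Measurability and integrability of continuous functions in the chart *)

Section ContinuousMeasurable.
Variable R : realType.
Local Notation mR := (measurableTypeR R).
Local Notation R3 := (R * R * R)%type.
Local Notation mR3 := (mR * mR * mR)%type.
Local Notation l3 := (@leb3 R).

(** The measurable structure is the product one, so the open set is written as a countable union of
    boxes with rational corners. *)
Lemma open_measurable3 (U : set R3) : open U -> measurable (U : set mR3).
Proof.
move=> oU.
pose B (q : (rat * rat) * (rat * rat) * (rat * rat)) : set mR3 :=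
  (`](ratr q.1.1.1 : R), ratr q.1.1.2[ `*` `](ratr q.1.2.1 : R), ratr q.1.2.2[) `*` `](ratr q.2.1 : R), ratr q.2.2[.
have -> : (U : set mR3) = \bigcup_q (if `[< B q `<=` U >] then B q else set0).
  apply/seteqP; split => [p Up|p [q _]]; last by case: asboolP => // BU /BU.
  have [e/= e0 eU] : exists2 e : R, 0 < e & ball p e `<=` U.
    by apply/nbhs_ballP; exact: open_nbhs_nbhs.
  pose I (q : rat * rat) := `](ratr q.1 : R), (ratr q.2 : R)[.
  have rat_near (x : R) : exists q, x \in I q /\ (forall y, y \in I q -> ball x e y).
    have [q1 /[!in_itv]/= /andP[q1l q1r]] := @rat_in_itvoo R (x - e) x ltac:(lra).
    have [q2 /[!in_itv]/= /andP[q2l q2r]] := @rat_in_itvoo R x (x + e) ltac:(lra).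
    exists (q1, q2); rewrite /I in_itv/= q1r q2l; split => // y; rewrite in_itv/= => /andP[y1 y2].
    by rewrite /ball/= ltr_distlC; apply/andP; split; lra.
  have [q1 [i1 b1]] := rat_near p.1.1.
  have [q2 [i2 b2]] := rat_near p.1.2.
  have [q3 [i3 b3]] := rat_near p.2.
  exists (q1, q2, q3) => //; rewrite asboolT//= => r [[r1 r2] r3].
  by apply: eU; split; [split|]; [exact: b1|exact: b2|exact: b3].
apply: countable_bigcupT_measurable => // q; case: ifPn => // _.
by apply: measurableX; [apply: measurableX|]; exact: measurable_itv.
Qed.

Lemma continuous_measurable3 (f : R3 -> R) : continuous f ->
  measurable_fun setT (f : mR3 -> mR).
Proof.
move=> /continuousP cf; apply: (measurability _ (RGenOpens.measurableE R)).
move=> _ [_ [a [b ->] <-]]; rewrite setTI; apply: open_measurable3.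
exact/cf/interval_open.
Qed.

Definition box (B : R) : set R3 := [set p | [/\ 0 <= p.1.1 <= 2 * pi, `|p.1.2| <= B & `|p.2| <= B]].

Lemma boxE B : box B = (`[0, 2 * pi] `*` `[- B, B]) `*` `[- B, B].
Proof.
apply/seteqP; split => p; rewrite /box/= !in_itv/= !ler_norml.
  by move=> [].
by move=> [[]].
Qed.

Lemma compact_box B : compact (box B).
Proof. by rewrite boxE; do ! apply: compact_setX; exact: segment_compact. Qed.

Lemma continuous_box_bounded (f : R3 -> R) B : continuous f ->
  exists2 M, 0 <= M & forall p, box B p -> `|f p| <= M.
Proof.
move=> cf; have : compact (f @` box B).
  by apply: continuous_compact; [exact: continuous_subspaceT|exact: compact_box].
move=> /compact_bounded [M [_ hM]]; exists (`|M| + 1); first by rewrite addr_ge0.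
by move=> p bp; apply: hM; [rewrite ltr_pwDr// ler_norm|exists p].
Qed.

Lemma box_measurable B : measurable (box B : set mR3).
Proof. by rewrite boxE; apply: measurableX; [apply: measurableX|]; exact: measurable_itv. Qed.

Lemma box_finite B : (l3 (box B) < +oo)%E.
Proof.
rewrite boxE /leb3 product_measure1E//=; last by apply: measurableX; exact: measurable_itv.
rewrite /leb2 product_measure1E//= !lebesgue_measure_itv/=.
by rewrite !lte_fin; do ! case: ifP => _; rewrite -?EFinB -?EFinM ?mule0 ?mul0e ?ltry.
Qed.

(** Bounded support in the directions a and b only; in the direction t the functions of interest are
    periodic. *)
Definition bsupp (f : R3 -> R) (B : R) := forall p, f p != 0 -> `|p.1.2| <= B /\ `|p.2| <= B.

Lemma integrable_bsupp (f : R3 -> R) (B M : R) : measurable_fun setT (f : mR3 -> mR) ->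
  bsupp f B -> (forall p, box B p -> `|f p| <= M) ->
  l3.-integrable (@fundamental R) (EFin \o f).
Proof.
move=> mf sf Mf.
have mfund := @fundamental_measurable R.
pose g (p : mR3) : \bar R := (M * \1_(box B) p)%:E.
have ig : l3.-integrable (@fundamental R) g.
  rewrite (_ : g = fun p => (M%:E * (\1_(box B) p)%:E)%E); last by apply/funext => p; rewrite /g EFinM.
  apply: integrableZl => //; apply: (integrableS (E := setT)) => //.
  have mb := box_measurable B.
  apply/integrableP; split; first by apply/measurable_EFinP; exact: measurable_indic.
  under eq_integral do rewrite gee0_abs ?lee_fin//.
  by rewrite integral_indic// setIT; exact: box_finite.
apply: le_integrable ig => //.
  by apply/measurable_EFinP; exact: measurable_funTS.
move=> p /= /andP[p0 p1]; rewrite lee_fin.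
have [fp|fp] := eqVneq (f p) 0; first by rewrite fp normr0.
have [pa pb] := sf p fp; have bp : box B p by split => //; rewrite p0 ltW.
rewrite indicE mem_set// mulr1; apply: le_trans (ler_norm _); exact: Mf.
Qed.

Lemma integrable_continuous (f : R3 -> R) (B : R) : continuous f -> bsupp f B ->
  l3.-integrable (@fundamental R) (EFin \o f).
Proof.
move=> cf sf; have [M _ hM] := continuous_box_bounded B cf.
by apply: integrable_bsupp sf hM; exact: continuous_measurable3.
Qed.

End ContinuousMeasurable.

(** * Rules for directional derivatives *)

Section DeriveRules.
Variables (R : realType) (V : normedModType R).
Implicit Types (f g : V -> R) (p v : V) (a b : R).

Lemma der_eq f p v a b : is_derive p v f a -> a = b -> is_derive p v f b.
Proof. by move=> ? <-. Qed.

Lemma derD f g p v a b : is_derive p v f a -> is_derive p v g b ->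
  is_derive p v (fun x => f x + g x) (a + b).
Proof. exact: is_deriveD. Qed.

Lemma derN f p v a : is_derive p v f a -> is_derive p v (fun x => - f x) (- a).
Proof. exact: is_deriveN. Qed.

Lemma derM f g p v a b : is_derive p v f a -> is_derive p v g b ->
  is_derive p v (fun x => f x * g x) (f p * b + g p * a).
Proof. exact: is_deriveM. Qed.

Lemma derC (c : R) p v : is_derive p v (fun=> c) 0.
Proof. exact: is_derive_cst. Qed.

Lemma derX f n p v a : is_derive p v f a ->
  is_derive p v (fun x => f x ^+ n) (n%:R * f p ^+ n.-1 * a).
Proof.
move=> df; have -> : (fun x => f x ^+ n) = f ^+ n by apply/funext => x; rewrite exprfctE.
exact: is_deriveX.
Qed.

Lemma der_comp (h : R -> R) f p v a b :
  is_derive (f p) 1 h a -> is_derive p v f b -> is_derive p v (fun x => h (f x)) (a * b).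
Proof. exact: is_derive_chain. Qed.

Lemma derV f p v a : f p != 0 -> is_derive p v f a ->
  is_derive p v (fun x => (f x)^-1) (- (f p) ^- 2 * a).
Proof.
move=> f0; apply: (der_comp (h := fun y => y^-1)).
by have := @is_deriveV R id (f p) 1 1 f0 (is_derive_id _ _); rewrite /GRing.scale/= mulr1.
Qed.

Lemma der_sqrt f p v a : 0 < f p -> is_derive p v f a ->
  is_derive p v (fun x => Num.sqrt (f x)) ((2 * Num.sqrt (f p))^-1 * a).
Proof. by move=> f0; apply: der_comp; exact: is_derive1_sqrt. Qed.

Lemma der_cos f p v a : is_derive p v f a ->
  is_derive p v (fun x => cos (f x)) (- sin (f p) * a).
Proof. by apply: der_comp; exact: is_derive_cos. Qed.

Lemma der_sin f p v a : is_derive p v f a ->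
  is_derive p v (fun x => sin (f x)) (cos (f p) * a).
Proof. by apply: der_comp; exact: is_derive_sin. Qed.

End DeriveRules.

Section Coordinates.
Variable R : realType.
Implicit Types (p : R * R * R) (i : 'I_3).
Lemma der_co0 p i : is_derive p (pbasis R i) (fun p : R * R * R => p.1.1) (i == 0 :> nat)%:R.
Proof. by have := is_derive_co (Ordinal (isT : (0 < 3)%N)) i p; rewrite eq_sym -val_eqE. Qed.
Lemma der_co1 p i : is_derive p (pbasis R i) (fun p : R * R * R => p.1.2) (i == 1%N :> nat)%:R.
Proof. by have := is_derive_co (Ordinal (isT : (1 < 3)%N)) i p; rewrite eq_sym -val_eqE. Qed.
Lemma der_co2 p i : is_derive p (pbasis R i) (fun p : R * R * R => p.2) (i == 2%N :> nat)%:R.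
Proof. by have := is_derive_co (Ordinal (isT : (2 < 3)%N)) i p; rewrite eq_sym -val_eqE. Qed.
End Coordinates.

Ltac der := lazymatch goal with
  | |- is_derive _ _ (fun=> ?c) _ => exact: derC
  | |- is_derive _ _ (fun x => (@?f x + @?g x)%R) _ => notypeclasses refine (@derD _ _ f g _ _ _ _ _ _); [der|der]
  | |- is_derive _ _ (fun x => (@?f x * @?g x)%R) _ => notypeclasses refine (@derM _ _ f g _ _ _ _ _ _); [der|der]
  | |- is_derive _ _ (fun x => (- @?f x)%R) _ => notypeclasses refine (@derN _ _ f _ _ _ _); der
  | |- is_derive _ _ (fun x => (@?f x ^+ ?n)%R) _ => notypeclasses refine (@derX _ _ f n _ _ _ _); der
  | |- is_derive _ _ (fun x => (@?f x)^-1%R) _ => notypeclasses refine (@derV _ _ f _ _ _ _ _); [try assumption|der]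
  | |- is_derive _ _ (fun x => Num.sqrt (@?f x)) _ => notypeclasses refine (@der_sqrt _ _ f _ _ _ _ _); [try assumption|der]
  | |- is_derive _ _ (fun x => cos (@?f x)) _ => notypeclasses refine (@der_cos _ _ f _ _ _ _); der
  | |- is_derive _ _ (fun x => sin (@?f x)) _ => notypeclasses refine (@der_sin _ _ f _ _ _ _); der
  | |- is_derive _ _ (fun x => fst (fst x)) _ => exact: der_co0
  | |- is_derive _ _ (fun x => snd (fst x)) _ => exact: der_co1
  | |- is_derive _ _ (fun x => snd x) _ => exact: der_co2
  | |- is_derive _ _ (fun x => x) _ => exact: is_derive_id
  | H : forall p, is_derive p ?v ?f _ |- is_derive _ ?v ?f _ => exact: H
  | H : is_derive ?p ?v ?f _ |- is_derive ?p ?v ?f _ => exact: H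
  | |- _ => idtac
  end.

(** * Divergence theorem on a fundamental domain *)

Section Divergence.
Variable R : realType.
Local Notation mR := (measurableTypeR R).
Local Notation R3 := (R * R * R)%type.
Local Notation mR3 := (mR * mR * mR)%type.
Local Notation mu := (@lebesgue_measure R).
Local Notation l2 := (@leb2 R).
Local Notation l3 := (@leb3 R).
Local Notation pb := (@pbasis R).
Local Notation fund := (@fundamental R).
Local Open Scope ereal_scope.

Lemma ae_zero_integral (F : mR -> \bar R) : measurable_fun setT F ->
  {ae mu, forall b, F b = 0} -> \int[mu]_b F b = 0.
Proof.
move=> mF F0; rewrite (ae_eq_integral (cst 0))//; first by rewrite integral0.
by apply: filterS F0 => b /= Fb _.
Qed.

(** Fubini, in an order that puts the vanishing line integral innermost. It applies to total
    derivatives, and equally to the difference between a factor and its mean along one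
    coordinate. *)
Lemma fund_integral0 (f : R3 -> R) : measurable_fun setT (f : mR3 -> mR) ->
  l3.-integrable fund (EFin \o f) ->
  [\/ forall a b : R, \int[mu]_(t in `[0%R, (2 * pi)%R[) (f (t, a, b))%:E = 0,
      forall t b : R, \int[mu]_a (f (t, a, b))%:E = 0 |
      forall t a : R, \int[mu]_b (f (t, a, b))%:E = 0] ->
  \int[l3]_(p in fund) (f p)%:E = 0.
Proof.
move=> mf intf H; pose T := `[0%R, (2 * pi)%R[%classic : set mR.
have mT : measurable T by exact: measurable_itv.
have mfund := @fundamental_measurable R.
have := intf; move=> /(integrable_mkcond _ mfund).
set F := (EFin \o f) \_ fund => iF.
have FE (t a b : R) : F (t, a, b) = (\1_T t)%:E * (f (t, a, b))%:E.
  rewrite /F patchE indicE fundamentalE; case: ifPn.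
    by rewrite inE /= => tT; rewrite mem_set// mul1e.
  by rewrite notin_setE /= => tT; rewrite memNset// mul0e.
have mF : measurable_fun setT F by case/integrableP : iF.
have mfa (t b : R) : measurable_fun setT (fun a : mR => (f (t, a, b))%:E).
  by apply/measurable_EFinP; apply: (measurableT_comp mf (g := fun a : mR => (t, a, b))); mfun.
have mfb (t a : R) : measurable_fun setT (fun b : mR => (f (t, a, b))%:E).
  by apply/measurable_EFinP; apply: (measurableT_comp mf (g := fun b : mR => (t, a, b))); mfun.
rewrite integral_mkcond -/F.
case: H => [H|H|H].
- rewrite -(@integral21_prod_meas1 _ _ _ _ R l2 mu F iF); apply: ae_zero_integral.
    exact: (measurable_fubini_G iF).
  have := ae_integrable2 iF; apply: filterS => b iFb.
  rewrite /fubini_G -(@integral21_prod_meas1 _ _ _ _ R mu mu _ iFb).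
  rewrite [LHS](_ : _ = \int[mu]_a 0); first by rewrite integral0.
  apply: eq_integral => a _; rewrite /fubini_G -(H a b) [RHS]integral_mkcond.
  apply: eq_integral => t _; rewrite FE patchE indicE.
  by case: ifPn => _; rewrite ?mul1e ?mul0e.
- rewrite -(@integral21_prod_meas1 _ _ _ _ R l2 mu F iF); apply: ae_zero_integral.
    exact: (measurable_fubini_G iF).
  have := ae_integrable2 iF; apply: filterS => b iFb.
  rewrite /fubini_G -(@integral12_prod_meas1 _ _ _ _ R mu mu _ iFb).
  rewrite [LHS](_ : _ = \int[mu]_t 0); first by rewrite integral0.
  apply: eq_integral => t _; rewrite /fubini_F.
  under eq_integral do rewrite FE.
  rewrite indicE; case: (t \in T); last by under eq_integral do rewrite mul0e; rewrite integral0.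
  by under eq_integral do rewrite mul1e.
- rewrite -(@integral12_prod_meas1 _ _ _ _ R l2 mu F iF).
  rewrite [LHS](_ : _ = \int[l2]_z 0); first by rewrite integral0.
  apply: eq_integral => -[t a] _; rewrite /fubini_F.
  under eq_integral do rewrite FE.
  rewrite indicE; case: (t \in T); last by under eq_integral do rewrite mul0e; rewrite integral0.
  by under eq_integral do rewrite mul1e.
Qed.

Local Close Scope ereal_scope.

Lemma continuous_line (i : 'I_3) (p : R3) : continuous (fun s : R => (s - co i p) *: pb i + p).
Proof.
move=> s; apply: cvgD; last exact: cvg_cst.
by apply: cvgZr_tmp; apply: cvgB; [exact: cvg_id|exact: cvg_cst].
Qed.

Lemma line0 (s t a b : R) : (s - t) *: pb (inord 0) + (t, a, b) = (s, a, b).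
Proof. by rewrite /pbasis inordK//=; congr (_, _, _); rewrite /= ?scaler0 ?add0r// [_ *: _]mulr1 subrK. Qed.

Lemma line1 (s t a b : R) : (s - a) *: pb (inord 1) + (t, a, b) = (t, s, b).
Proof. by rewrite /pbasis inordK//=; congr (_, _, _); rewrite /= ?scaler0 ?add0r// [_ *: _]mulr1 subrK. Qed.

Lemma line2 (s t a b : R) : (s - b) *: pb (inord 2) + (t, a, b) = (t, a, s).
Proof. by rewrite /pbasis inordK//=; congr (_, _, _); rewrite /= ?scaler0 ?add0r// [_ *: _]mulr1 subrK. Qed.

Lemma FTC2_line (i : 'I_3) (X Xi : R3 -> R) (p : R3) (x y : R) : x <= y ->
  (forall p, is_derive p (pb i) X (Xi p)) -> continuous Xi ->
  (\int[mu]_(s in `[x, y]) (Xi ((s - co i p) *: pb i + p))%:E =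
   (X ((y - co i p) *: pb i + p) - X ((x - co i p) *: pb i + p))%:E)%E.
Proof.
move=> xy dX cX; apply: (FTC2 (F := fun s : R => X ((s - co i p) *: pb i + p)) xy) => s _.
  apply/(@is_derive_lineP R _ _ (fun s : R => X ((s - co i p) *: pb i + p)) s 1 _ 0).
  have /(is_derive_lineP _ _ _ _ 0) := dX ((s - co i p) *: pb i + p).
  congr (is_derive _ _ _ _); apply/funext => z; congr X.
  by rewrite addrA -scalerDl [_ *: (1 : R)]mulr1 !subr0 addrA.
apply: (@continuous_comp _ _ _ (fun s : R => (s - co i p) *: pb i + p) Xi); last exact: cX.
exact: continuous_line.
Qed.

(** The boundary terms cancel by periodicity in t and vanish by the support condition in a and b. *)
Lemma fund_divergence (i : 'I_3) (X Xi : R3 -> R) (B : R) :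
  (forall p, is_derive p (pb i) X (Xi p)) -> continuous Xi ->
  bsupp X B -> bsupp Xi B ->
  (forall t a b, X (t + 2 * pi, a, b) = X (t, a, b)) ->
  (\int[l3]_(p in fund) (Xi p)%:E = 0)%E.
Proof.
move=> dX cX sX sXi pX.
apply: (fund_integral0 (continuous_measurable3 cX) (integrable_continuous cX sXi)).
(* The support condition says nothing about the value at distance B itself; the bounds of
   integration are put strictly beyond, at |B| + 1. *)
have B1 : B < `|B| + 1 by rewrite ltr_pwDr// ler_norm.
have mXi (q : R -> R3) : (forall s, q s = (s - co i (q 0)) *: pb i + q 0) ->
    (forall s, Xi (q s) != 0 -> `|s| <= B) -> (forall s, X (q s) != 0 -> `|s| <= B) ->
    (\int[mu]_s (Xi (q s))%:E = 0)%E.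
  move=> qE q0 q1.
  transitivity (\int[mu]_(s in `[(- (`|B| + 1))%R, (`|B| + 1)%R]) (Xi (q s))%:E)%E.
    rewrite [RHS]integral_mkcond; apply: eq_integral => s _; rewrite patchE.
    case: ifPn => //; rewrite notin_setE/= in_itv/= -ler_norml => sB.
    have [->//|/q0] := eqVneq (Xi (q s)) 0.
    by move=> sB'; exfalso; apply: sB; rewrite (le_trans sB') ?ltW.
  under eq_integral do rewrite qE.
  rewrite (FTC2_line _ _ dX)//; last by rewrite -subr_ge0; have := normr_ge0 B; lra.
  have X0 s : B < `|s| -> X (q s) = 0.
    by move=> Bs; apply/eqP; apply: contraTT Bs => /q1; rewrite -leNgt.
  by rewrite -!qE !X0 ?subrr// ?normrN ger0_norm ?addr_ge0.
case: i dX mXi => -[|[|[|//]]] iP dX mXi; [apply: Or31|apply: Or32|apply: Or33].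
- move=> a b; have iE : Ordinal iP = inord 0 by apply/val_inj; rewrite /= inordK.
  have lE s : (s - co (Ordinal iP) (0, a, b)) *: pb (Ordinal iP) + (0, a, b) = (s, a, b).
    by rewrite /co/= iE line0.
  rewrite integral_itv_bndo_bndc; last first.
    apply/measurable_EFinP; apply: measurable_funTS.
    have mf : measurable_fun setT (Xi : mR3 -> mR) by exact: continuous_measurable3.
    by apply: (measurableT_comp mf (g := fun t : mR => (t, a, b))); mfun.
  have := FTC2_line (0, a, b) (x := 0) (y := 2 * pi) _ dX cX.
  rewrite mulr_ge0 ?pi_ge0// !lE => /(_ isT).
  under eq_integral do rewrite lE.
  by move=> ->; rewrite -(add0r (2 * pi)) pX subrr.
- move=> t b; have iE : Ordinal iP = inord 1 by apply/val_inj; rewrite /= inordK.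
  apply: (mXi (fun a => (t, a, b))) => s; first by rewrite /co/= iE line1.
  + by move=> /sXi[].
  + by move=> /sX[].
- move=> t a; have iE : Ordinal iP = inord 2 by apply/val_inj; rewrite /= inordK.
  apply: (mXi (fun b => (t, a, b))) => s; first by rewrite /co/= iE line2.
  + by move=> /sXi[].
  + by move=> /sX[].
Qed.

End Divergence.

Section ContinuityRules.
Variables (R : realType) (T : topologicalType).
Implicit Types (f g : T -> R).
Lemma cntC (c : R) : continuous (fun _ : T => c).
Proof. by move=> x; exact: cvg_cst. Qed.
Lemma cntD f g : continuous f -> continuous g -> continuous (fun x => f x + g x).
Proof. by move=> cf cg x; apply: cvgD; [exact: cf|exact: cg]. Qed.
Lemma cntN f : continuous f -> continuous (fun x => - f x).
Proof. by move=> cf x; apply: cvgN; exact: cf. Qed.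
Lemma cntM f g : continuous f -> continuous g -> continuous (fun x => f x * g x).
Proof. by move=> cf cg x; apply: cvgM; [exact: cf|exact: cg]. Qed.
Lemma cnt_comp (h : R -> R) f : continuous h -> continuous f -> continuous (fun x => h (f x)).
Proof. by move=> ch cf x; apply: (@continuous_comp _ _ _ f h); [exact: cf|exact: ch]. Qed.
Lemma cntX f n : continuous f -> continuous (fun x => f x ^+ n).
Proof. by apply: (cnt_comp (h := fun y => y ^+ n)); exact: exprn_continuous. Qed.
Lemma cntV f : (forall x, f x != 0) -> continuous f -> continuous (fun x => (f x)^-1).
Proof. by move=> f0 cf x; apply: cvgV; [exact: f0|exact: cf]. Qed.
Lemma cnt_sqrt f : continuous f -> continuous (fun x => Num.sqrt (f x)).
Proof. by apply: cnt_comp; exact: sqrt_continuous. Qed.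
Lemma cnt_cos f : continuous f -> continuous (fun x => cos (f x)).
Proof. by apply: cnt_comp; exact: continuous_cos. Qed.
Lemma cnt_sin f : continuous f -> continuous (fun x => sin (f x)).
Proof. by apply: cnt_comp; exact: continuous_sin. Qed.
End ContinuityRules.

Section CoordinatesContinuous.
Variable R : realType.
Lemma cnt_co0 : continuous (fun p : R * R * R => p.1.1).
Proof. by move=> x; apply: (@continuous_comp _ _ _ fst fst); exact: cvg_fst. Qed.
Lemma cnt_co1 : continuous (fun p : R * R * R => p.1.2).
Proof. by move=> x; apply: (@continuous_comp _ _ _ fst snd); [exact: cvg_fst|exact: cvg_snd]. Qed.
Lemma cnt_co2 : continuous (fun p : R * R * R => p.2).
Proof. by move=> x; exact: cvg_snd. Qed.
End CoordinatesContinuous.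

Ltac cnt := lazymatch goal with
  | |- continuous (fun=> ?c) => exact: cntC
  | |- continuous (fun x => x) => move=> ?; exact: cvg_id
  | |- continuous (fun x => (@?f x + @?g x)%R) => refine (@cntD _ _ f g _ _); [cnt|cnt]
  | |- continuous (fun x => (@?f x * @?g x)%R) => refine (@cntM _ _ f g _ _); [cnt|cnt]
  | |- continuous (fun x => (- @?f x)%R) => refine (@cntN _ _ f _); cnt
  | |- continuous (fun x => (@?f x ^+ ?n)%R) => refine (@cntX _ _ f n _); cnt
  | |- continuous (fun x => (@?f x)^-1%R) => refine (@cntV _ _ f _ _); [try assumption|cnt]
  | |- continuous (fun x => Num.sqrt (@?f x)) => refine (@cnt_sqrt _ _ f _); cnt
  | |- continuous (fun x => cos (@?f x)) => refine (@cnt_cos _ _ f _); cnt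
  | |- continuous (fun x => sin (@?f x)) => refine (@cnt_sin _ _ f _); cnt
  | |- continuous (fun x => fst (fst x)) => exact: cnt_co0
  | |- continuous (fun x => snd (fst x)) => exact: cnt_co1
  | |- continuous (fun x => snd x) => exact: cnt_co2
  | H : continuous ?f |- continuous ?f => exact: H
  | |- _ => try by []
  end.

(** * Green's formula for functions of zeta *)

Section Green.
Variable R : realType.
Local Notation R3 := (R * R * R)%type.
Local Notation l3 := (@leb3 R).
Local Notation fund := (@fundamental R).
Local Notation e0 := (@pbasis R (inord 0)).
Local Notation e1 := (@pbasis R (inord 1)).
Local Notation e2 := (@pbasis R (inord 2)).

Definition rsq (p : R3) : R := 1 + p.1.2 ^+ 2 + p.2 ^+ 2.

Lemma rsq_gt0 p : 0 < rsq p.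
Proof. by rewrite /rsq; have := sqr_ge0 p.1.2; have := sqr_ge0 p.2; lra. Qed.

Lemma rsq_neq0 p : rsq p != 0.
Proof. by rewrite gt_eqF// rsq_gt0. Qed.

(** The derivatives are explicit functions; [f12] differentiates [f2] in the direction 1, and [f21]
    the other way round, so that no symmetry of second derivatives enters. Mixed derivatives with
    the index 0 do not occur in the operator, since the metric has no cross terms with dt. *)
Record C2data (f f0 f1 f2 f00 f11 f12 f21 f22 : R3 -> R) (B : R) : Prop := {
  c2_0 : forall p, is_derive p e0 f (f0 p);
  c2_1 : forall p, is_derive p e1 f (f1 p);
  c2_2 : forall p, is_derive p e2 f (f2 p);
  c2_00 : forall p, is_derive p e0 f0 (f00 p);
  c2_11 : forall p, is_derive p e1 f1 (f11 p);
  c2_12 : forall p, is_derive p e1 f2 (f12 p);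
  c2_21 : forall p, is_derive p e2 f1 (f21 p);
  c2_22 : forall p, is_derive p e2 f2 (f22 p);
  c2_c : continuous f;
  c2_c0 : continuous f0; c2_c1 : continuous f1; c2_c2 : continuous f2;
  c2_c00 : continuous f00; c2_c11 : continuous f11; c2_c12 : continuous f12;
  c2_c21 : continuous f21; c2_c22 : continuous f22;
  c2_s : bsupp f B;
  c2_per : forall t a b, f (t + 2 * pi, a, b) = f (t, a, b) }.

(** The operator - div grad in the chart: the volume density is 1, and the inverse metric is - 1 /
    [rsq] in the direction t and the matrix with entries 1 + a^2, a b, a b, 1 + b^2 in the
    directions (a, b). *)
Definition box_op (f1 f2 f00 f11 f12 f21 f22 : R3 -> R) (p : R3) : R :=
  let a := p.1.2 in let b := p.2 in
  (rsq p)^-1 * f00 p - ((1 + a ^+ 2) * f11 p + a * b * f12 p + a * b * f21 p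
     + (1 + b ^+ 2) * f22 p + 3 * a * f1 p + 3 * b * f2 p).

Lemma bsuppP (f : R3 -> R) B :
  bsupp f B <-> forall p : R3, (B < `|p.1.2|) || (B < `|p.2|) -> f p = 0.
Proof.
split=> [sf p out|sf p fp].
  apply/eqP; apply: contraTT out => /sf[p1 p2].
  by rewrite negb_or -!leNgt p1 p2.
by apply/andP; rewrite !leNgt -negb_or; apply: contraNN fp => /sf ->.
Qed.

Lemma bsupp_derive (f g : R3 -> R) (v : R3) B :
  (forall p, is_derive p v f (g p)) -> bsupp f B -> bsupp g B.
Proof.
move=> df /bsuppP sf; apply/bsuppP => p out.
have : \forall q \near p, 0 = f q.
  have n1 : continuous (fun q : R3 => `|q.1.2|).
    by apply: (cnt_comp (h := Num.norm)); [exact: (@norm_continuous _ R^o)|exact: cnt_co1].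
  have n2 : continuous (fun q : R3 => `|q.2|).
    by apply: (cnt_comp (h := Num.norm)); [exact: (@norm_continuous _ R^o)|exact: cnt_co2].
  case/orP: out => out.
    have : \forall q \near p, B < `|q.1.2|.
      exact: (n1 p _ (lt_nbhsr out)).
    by apply: filterS => q Bq; rewrite sf ?Bq.
  have : \forall q \near p, B < `|q.2|.
    exact: (n2 p _ (lt_nbhsr out)).
  by apply: filterS => q Bq; rewrite sf ?Bq ?orbT.
move=> near0; have := near_eq_is_derive near0 (derC 0 p v) => -[_ <-].
by have [_ <-] := df p.
Qed.

Variables (Y1 Y2 y3 y4 : R).
Hypothesis Yads : Y1 ^+ 2 + Y2 ^+ 2 = 1 + y3 ^+ 2 + y4 ^+ 2.

Let cc (p : R3) : R := cos p.1.1 * Y1 + sin p.1.1 * Y2.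
Let ss (p : R3) : R := cos p.1.1 * Y2 - sin p.1.1 * Y1.

(** The function - q(x, y) in the chart of x, for y = (Y1, Y2, y3, y4). *)
Definition zeta (p : R3) : R :=
  Num.sqrt (rsq p) * (cos p.1.1 * Y1 + sin p.1.1 * Y2) - p.1.2 * y3 - p.2 * y4.

Let r (p : R3) : R := Num.sqrt (rsq p).
Let r0 p : r p != 0. Proof. by rewrite gt_eqF// sqrtr_gt0 rsq_gt0. Qed.
Let r2 p : r p ^+ 2 = rsq p. Proof. by rewrite sqr_sqrtr// ltW// rsq_gt0. Qed.

Let z0 p := r p * ss p.
Let z1 p := p.1.2 / r p * cc p - y3.
Let z2 p := p.2 / r p * cc p - y4.
Let z00 p := - (r p * cc p).
Let z11 p := (r p)^-1 * (1 - p.1.2 ^+ 2 / rsq p) * cc p.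
Let z12 p := - (p.1.2 * p.2 / rsq p / r p * cc p).
Let z22 p := (r p)^-1 * (1 - p.2 ^+ 2 / rsq p) * cc p.

(* The tactics [der] and [cnt] take the derivatives and continuity facts below from the context. *)
Let dr1 p : is_derive p e1 r (p.1.2 / r p).
Proof.
have h := rsq_gt0 p.
apply: der_eq; first by rewrite /r /rsq; der.
by rewrite !inordK//= /r /rsq /=; field; rewrite -/(rsq p) -/(r p).
Qed.

Let dr2 p : is_derive p e2 r (p.2 / r p).
Proof.
have h := rsq_gt0 p.
apply: der_eq; first by rewrite /r /rsq; der.
by rewrite !inordK//= /r /rsq /=; field; rewrite -/(rsq p) -/(r p).
Qed.

Let dr0 p : is_derive p e0 r 0.
Proof.
have h := rsq_gt0 p.
apply: der_eq; first by rewrite /r /rsq; der.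
by rewrite !inordK//= !(mulr0, addr0).
Qed.

Let dcc0 p : is_derive p e0 cc (ss p).
Proof. by apply: der_eq; [rewrite /cc; der|rewrite !inordK//= /ss; ring]. Qed.
Let dss0 p : is_derive p e0 ss (- cc p).
Proof. by apply: der_eq; [rewrite /ss; der|rewrite !inordK//= /cc; ring]. Qed.
Let dcc1 p : is_derive p e1 cc 0.
Proof. by apply: der_eq; [rewrite /cc; der|rewrite !inordK//=; ring]. Qed.
Let dcc2 p : is_derive p e2 cc 0.
Proof. by apply: der_eq; [rewrite /cc; der|rewrite !inordK//=; ring]. Qed.

Let zetaE : zeta = fun p => r p * cc p - p.1.2 * y3 - p.2 * y4.
Proof. by []. Qed.

Let dz0 p : is_derive p e0 zeta (z0 p).
Proof. by rewrite zetaE; apply: der_eq; [der|rewrite !inordK//= /z0; ring]. Qed.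
Let dz1 p : is_derive p e1 zeta (z1 p).
Proof. by rewrite zetaE; apply: der_eq; [der|rewrite !inordK//= /z1; ring]. Qed.
Let dz2 p : is_derive p e2 zeta (z2 p).
Proof. by rewrite zetaE; apply: der_eq; [der|rewrite !inordK//= /z2; ring]. Qed.
Let dz00 p : is_derive p e0 z0 (z00 p).
Proof. by rewrite /z0; apply: der_eq; [der|rewrite /z00; ring]. Qed.
Let dz11 p : is_derive p e1 z1 (z11 p).
Proof.
have h := r0 p; rewrite /z1; apply: der_eq; first by der.
by rewrite !inordK//= /z11 -r2; field.
Qed.
Let dz12 p : is_derive p e1 z2 (z12 p).
Proof.
have h := r0 p; rewrite /z2; apply: der_eq; first by der.
by rewrite !inordK//= /z12 -r2; field.
Qed.
Let dz21 p : is_derive p e2 z1 (z12 p).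
Proof.
have h := r0 p; rewrite /z1; apply: der_eq; first by der.
by rewrite !inordK//= /z12 -r2; field.
Qed.
Let dz22 p : is_derive p e2 z2 (z22 p).
Proof.
have h := r0 p; rewrite /z2; apply: der_eq; first by der.
by rewrite !inordK//= /z22 -r2; field.
Qed.

Variables (h h1 h2 : R -> R).
Hypothesis dh : forall x : R, is_derive x (1 : R) h (h1 x).
Hypothesis dh1 : forall x : R, is_derive x (1 : R) h1 (h2 x).
Hypothesis ch2 : continuous h2.

Let u p := h (zeta p).
Let u0 p := h1 (zeta p) * z0 p.
Let u1 p := h1 (zeta p) * z1 p.
Let u2 p := h1 (zeta p) * z2 p.
Let u00 p := h2 (zeta p) * z0 p ^+ 2 + h1 (zeta p) * z00 p.
Let u11 p := h2 (zeta p) * z1 p ^+ 2 + h1 (zeta p) * z11 p.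
Let u12 p := h2 (zeta p) * z1 p * z2 p + h1 (zeta p) * z12 p.
Let u22 p := h2 (zeta p) * z2 p ^+ 2 + h1 (zeta p) * z22 p.

(** Two facts about zeta are behind this: its squared gradient is zeta^2 - 1 ([hz], where y on AdS3
    is used) and Box zeta = - 3 zeta ([hz1]). *)
Let bu p : box_op u1 u2 u00 u11 u12 u12 u22 p =
  - ((zeta p ^+ 2 - 1) * h2 (zeta p) + 3 * zeta p * h1 (zeta p)).
Proof.
rewrite /box_op /u1 /u2 /u00 /u11 /u12 /u22.
have rn := r0 p; have rs := rsq_neq0 p.
(* In terms of d the square root disappears: zeta and its derivatives in a and b become rational in
   a, b and d. *)
pose d := cc p / r p.
have cE : cc p = d * r p by rewrite /d divfK.
have z1E : z1 p = p.1.2 * d - y3 by rewrite /z1 /d; ring.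
have z2E : z2 p = p.2 * d - y4 by rewrite /z2 /d; ring.
have zE : zeta p = rsq p * d - p.1.2 * y3 - p.2 * y4.
  by rewrite zetaE cE -r2; ring.
have z0E : (rsq p)^-1 * z0 p ^+ 2 = 1 + y3 ^+ 2 + y4 ^+ 2 - rsq p * d ^+ 2.
  have -> : rsq p * d ^+ 2 = cc p ^+ 2 by rewrite cE -r2; ring.
  rewrite -Yads /z0 exprMn r2 mulKf// /ss /cc -[Y1 ^+ 2 + _]mul1r -(cos2Dsin2 p.1.1); ring.
have hz : h2 (zeta p) * ((rsq p)^-1 * z0 p ^+ 2 - ((1 + p.1.2 ^+ 2) * z1 p ^+ 2
    + 2 * p.1.2 * p.2 * z1 p * z2 p + (1 + p.2 ^+ 2) * z2 p ^+ 2)) = - (zeta p ^+ 2 - 1) * h2 (zeta p).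
  by rewrite [RHS]mulrC; congr (_ * _); rewrite z0E zE z1E z2E /rsq; ring.
have hz1 : (rsq p)^-1 * z00 p - ((1 + p.1.2 ^+ 2) * z11 p + 2 * p.1.2 * p.2 * z12 p
    + (1 + p.2 ^+ 2) * z22 p + 3 * p.1.2 * z1 p + 3 * p.2 * z2 p) = - 3 * zeta p.
  have -> : (rsq p)^-1 * z00 p = - d by rewrite /z00 /d -r2; field.
  have -> : z11 p = d * (1 - p.1.2 ^+ 2 / rsq p) by rewrite /z11 /d; ring.
  have -> : z22 p = d * (1 - p.2 ^+ 2 / rsq p) by rewrite /z22 /d; ring.
  have -> : z12 p = - d * (p.1.2 * p.2 / rsq p) by rewrite /z12 /d; ring.
  by rewrite zE z1E z2E; move: rs; rewrite /rsq => rs; field.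
transitivity (h2 (zeta p) * ((rsq p)^-1 * z0 p ^+ 2 - ((1 + p.1.2 ^+ 2) * z1 p ^+ 2
    + 2 * p.1.2 * p.2 * z1 p * z2 p + (1 + p.2 ^+ 2) * z2 p ^+ 2))
  + h1 (zeta p) * ((rsq p)^-1 * z00 p - ((1 + p.1.2 ^+ 2) * z11 p + 2 * p.1.2 * p.2 * z12 p
    + (1 + p.2 ^+ 2) * z22 p + 3 * p.1.2 * z1 p + 3 * p.2 * z2 p))).
  by ring.
by rewrite hz hz1; ring.
Qed.

Let dhz v p a : is_derive p v zeta a -> is_derive p v u (h1 (zeta p) * a).
Proof. exact: der_comp. Qed.
Let dh1z v p a : is_derive p v zeta a -> is_derive p v (fun p => h1 (zeta p)) (h2 (zeta p) * a).
Proof. exact: der_comp. Qed.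

Let du0 p : is_derive p e0 u (u0 p). Proof. exact: dhz. Qed.
Let du1 p : is_derive p e1 u (u1 p). Proof. exact: dhz. Qed.
Let du2 p : is_derive p e2 u (u2 p). Proof. exact: dhz. Qed.
Let du00 p : is_derive p e0 u0 (u00 p).
Proof.
have d := dh1z (dz0 p); rewrite /u0; apply: der_eq; first by der.
by rewrite /u00; ring.
Qed.
Let du11 p : is_derive p e1 u1 (u11 p).
Proof.
have d := dh1z (dz1 p); rewrite /u1; apply: der_eq; first by der.
by rewrite /u11; ring.
Qed.
Let du12 p : is_derive p e1 u2 (u12 p).
Proof.
have d := dh1z (dz1 p); rewrite /u2; apply: der_eq; first by der.
by rewrite /u12; ring.
Qed.
Let du21 p : is_derive p e2 u1 (u12 p).
Proof.
have d := dh1z (dz2 p); rewrite /u1; apply: der_eq; first by der.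
by rewrite /u12; ring.
Qed.
Let du22 p : is_derive p e2 u2 (u22 p).
Proof.
have d := dh1z (dz2 p); rewrite /u2; apply: der_eq; first by der.
by rewrite /u22; ring.
Qed.

Let crsq : continuous rsq. Proof. by rewrite /rsq; cnt. Qed.
Let cr : continuous r. Proof. by rewrite /r; cnt. Qed.
Let ccc : continuous cc. Proof. by rewrite /cc; cnt. Qed.
Let css : continuous ss. Proof. by rewrite /ss; cnt. Qed.
Lemma zeta_continuous : continuous zeta. Proof. by rewrite zetaE; cnt. Qed.
Let cz0 : continuous z0. Proof. by rewrite /z0; cnt. Qed.
Let cz1 : continuous z1. Proof. by rewrite /z1; have H := r0; cnt. Qed.
Let cz2 : continuous z2. Proof. by rewrite /z2; have H := r0; cnt. Qed.
Let cz00 : continuous z00. Proof. by rewrite /z00; cnt. Qed.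
Let cz11 : continuous z11. Proof. by rewrite /z11; have H := r0; have H1 := rsq_neq0; cnt. Qed.
Let cz12 : continuous z12. Proof. by rewrite /z12; have H := r0; have H1 := rsq_neq0; cnt. Qed.
Let cz22 : continuous z22. Proof. by rewrite /z22; have H := r0; have H1 := rsq_neq0; cnt. Qed.
Let ch1 : continuous h1.
Proof. by move=> x; exact: (is_derive_continuous (dh1 x)). Qed.
Let ch : continuous h.
Proof. by move=> x; exact: (is_derive_continuous (dh x)). Qed.
Let chz : continuous (fun p => h (zeta p)).
Proof. by apply: cnt_comp => //; exact: zeta_continuous. Qed.
Let ch1z : continuous (fun p => h1 (zeta p)).
Proof. by apply: cnt_comp => //; exact: zeta_continuous. Qed.
Let ch2z : continuous (fun p => h2 (zeta p)).
Proof. by apply: cnt_comp => //; exact: zeta_continuous. Qed.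
Let cu1 : continuous u1. Proof. by rewrite /u1; cnt. Qed.
Let cu2 : continuous u2. Proof. by rewrite /u2; cnt. Qed.
Let cu00 : continuous u00. Proof. by rewrite /u00; cnt. Qed.
Let cu11 : continuous u11. Proof. by rewrite /u11; cnt. Qed.
Let cu12 : continuous u12. Proof. by rewrite /u12; cnt. Qed.
Let cu22 : continuous u22. Proof. by rewrite /u22; cnt. Qed.

Lemma zeta_periodic t a b : zeta (t + 2 * pi, a, b) = zeta (t, a, b).
Proof. by rewrite /zeta/= (mulr_natl (@pi R) 2) cosD2pi sinD2pi. Qed.

(** The difference u Box f - f Box u is the divergence of the field ([X0], - [X1], - [X2]), and each
    of its three terms integrates to 0 over the fundamental domain. *)
Lemma green (f f0 f1 f2 f00 f11 f12 f21 f22 : R3 -> R) (B : R) :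
  C2data f f0 f1 f2 f00 f11 f12 f21 f22 B ->
  \int[l3]_(p in fund) (h (zeta p) * box_op f1 f2 f00 f11 f12 f21 f22 p) =
  \int[l3]_(p in fund)
     (- ((zeta p ^+ 2 - 1) * h2 (zeta p) + 3 * zeta p * h1 (zeta p)) * f p).
Proof.
move=> [d0 d1 d2 d00 d11 d12 d21 d22 cf cf0 cf1 cf2 cf00 cf11 cf12 cf21 cf22 sf pf].
have s0 := bsupp_derive d0 sf; have s1 := bsupp_derive d1 sf; have s2 := bsupp_derive d2 sf.
have s00 := bsupp_derive d00 s0; have s11 := bsupp_derive d11 s1; have s12 := bsupp_derive d12 s2.
have s21 := bsupp_derive d21 s1; have s22 := bsupp_derive d22 s2.
(* Periodicity passes to the derivatives, which occur in the fields to be integrated. *)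
have per_der (g dg : R3 -> R) (i : 'I_3) : (forall t a b, g (t + 2 * pi, a, b) = g (t, a, b)) ->
    (forall p, is_derive p (@pbasis R i) g (dg p)) -> forall t a b, dg (t + 2 * pi, a, b) = dg (t, a, b).
  move=> pg dgp t a b; have [_ <-] := dgp (t + 2 * pi, a, b); have [_ <-] := dgp (t, a, b).
  have E s : g (s *: pbasis R i + (t + 2 * pi, a, b)) = g (s *: pbasis R i + (t, a, b)).
    have pg' (q : R3) : g (q.1.1 + 2 * pi, q.1.2, q.2) = g q by case: q => -[? ?] ?; exact: pg.
    by rewrite -[RHS]pg'; congr (g (_, _, _)); exact: addrA.
  rewrite /derive; set F := (X in _ = lim (X @ _)).
  rewrite [X in lim (X @ _) = _](_ : _ = F)//.
  by apply/funext => s; rewrite /F /= E pg.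
have p0 := per_der _ _ _ pf d0; have p1 := per_der _ _ _ pf d1; have p2 := per_der _ _ _ pf d2.
have zper := fun t a b => zeta_periodic t a b.
have cu : continuous u by exact: chz.
have Hr := rsq_neq0.
pose X0 p := (rsq p)^-1 * (u p * f0 p - f p * u0 p).
pose X0' p := (rsq p)^-1 * (u p * f00 p - f p * u00 p).
pose X1 p := u p * ((1 + p.1.2 ^+ 2) * f1 p + p.1.2 * p.2 * f2 p)
  - f p * ((1 + p.1.2 ^+ 2) * u1 p + p.1.2 * p.2 * u2 p).
pose X1' p := u p * (2 * p.1.2 * f1 p + (1 + p.1.2 ^+ 2) * f11 p + p.2 * f2 p + p.1.2 * p.2 * f12 p)
  + u1 p * (p.1.2 * p.2 * f2 p) - f1 p * (p.1.2 * p.2 * u2 p)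
  - f p * (2 * p.1.2 * u1 p + (1 + p.1.2 ^+ 2) * u11 p + p.2 * u2 p + p.1.2 * p.2 * u12 p).
pose X2 p := u p * (p.1.2 * p.2 * f1 p + (1 + p.2 ^+ 2) * f2 p)
  - f p * (p.1.2 * p.2 * u1 p + (1 + p.2 ^+ 2) * u2 p).
pose X2' p := u p * (p.1.2 * f1 p + p.1.2 * p.2 * f21 p + 2 * p.2 * f2 p + (1 + p.2 ^+ 2) * f22 p)
  + u2 p * (p.1.2 * p.2 * f1 p) - f2 p * (p.1.2 * p.2 * u1 p)
  - f p * (p.1.2 * u1 p + p.1.2 * p.2 * u12 p + 2 * p.2 * u2 p + (1 + p.2 ^+ 2) * u22 p).
have I0 : (\int[l3]_(p in fund) (X0' p)%:E = 0)%E.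
  apply: (@fund_divergence _ (inord 0) X0 X0' B).
  - move=> p; have H := rsq_neq0 p; rewrite /X0 /rsq; apply: der_eq; first by der.
    by rewrite !inordK//= /X0' /rsq; ring.
  - by rewrite /X0'; cnt.
  - by apply/bsuppP => p out; rewrite /X0 (proj1 (bsuppP _ _) sf)// (proj1 (bsuppP _ _) s0)//; ring.
  - by apply/bsuppP => p out; rewrite /X0' (proj1 (bsuppP _ _) sf)// (proj1 (bsuppP _ _) s00)//; ring.
  - by move=> t a b; rewrite /X0 /u /u0 /z0 /ss /r /rsq/= pf p0 zper (mulr_natl (@pi R) 2) cosD2pi sinD2pi.
have I1 : (\int[l3]_(p in fund) (X1' p)%:E = 0)%E.
  apply: (@fund_divergence _ (inord 1) X1 X1' B).
  - move=> p; rewrite /X1; apply: der_eq; first by der.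
    by rewrite !inordK//= /X1'; ring.
  - by rewrite /X1'; cnt.
  - by apply/bsuppP => p out; rewrite /X1 (proj1 (bsuppP _ _) sf)// (proj1 (bsuppP _ _) s1)// (proj1 (bsuppP _ _) s2)//; ring.
  - by apply/bsuppP => p out; rewrite /X1' (proj1 (bsuppP _ _) sf)// (proj1 (bsuppP _ _) s1)// (proj1 (bsuppP _ _) s2)// (proj1 (bsuppP _ _) s11)// (proj1 (bsuppP _ _) s12)//; ring.
  - by move=> t a b; rewrite /X1 /u /u1 /u2 /z1 /z2 /cc /r /rsq/= pf p1 p2 zper (mulr_natl (@pi R) 2) cosD2pi sinD2pi.
have I2 : (\int[l3]_(p in fund) (X2' p)%:E = 0)%E.
  apply: (@fund_divergence _ (inord 2) X2 X2' B).
  - move=> p; rewrite /X2; apply: der_eq; first by der.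
    by rewrite !inordK//= /X2'; ring.
  - by rewrite /X2'; cnt.
  - by apply/bsuppP => p out; rewrite /X2 (proj1 (bsuppP _ _) sf)// (proj1 (bsuppP _ _) s1)// (proj1 (bsuppP _ _) s2)//; ring.
  - by apply/bsuppP => p out; rewrite /X2' (proj1 (bsuppP _ _) sf)// (proj1 (bsuppP _ _) s1)// (proj1 (bsuppP _ _) s2)// (proj1 (bsuppP _ _) s21)// (proj1 (bsuppP _ _) s22)//; ring.
  - by move=> t a b; rewrite /X2 /u /u1 /u2 /z1 /z2 /cc /r /rsq/= pf p1 p2 zper (mulr_natl (@pi R) 2) cosD2pi sinD2pi.
have Z (g : R3 -> R) : (\int[l3]_(p in fund) (g p)%:E = 0)%E -> \int[l3]_(p in fund) g p = 0.
  by move=> E; rewrite /Rintegral E.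
have mfund := @fundamental_measurable R.
have sX0' : bsupp X0' B.
  by apply/bsuppP => p out; rewrite /X0' (proj1 (bsuppP _ _) sf)// (proj1 (bsuppP _ _) s00)//; ring.
have cX0' : continuous X0' by rewrite /X0'; cnt.
have s1' : bsupp X1' B.
  by apply/bsuppP => p out; rewrite /X1' (proj1 (bsuppP _ _) sf)// (proj1 (bsuppP _ _) s1)// (proj1 (bsuppP _ _) s2)// (proj1 (bsuppP _ _) s11)// (proj1 (bsuppP _ _) s12)//; ring.
have s2' : bsupp X2' B.
  by apply/bsuppP => p out; rewrite /X2' (proj1 (bsuppP _ _) sf)// (proj1 (bsuppP _ _) s1)// (proj1 (bsuppP _ _) s2)// (proj1 (bsuppP _ _) s21)// (proj1 (bsuppP _ _) s22)//; ring.
have c1' : continuous X1' by rewrite /X1'; cnt.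
have c2' : continuous X2' by rewrite /X2'; cnt.
pose Y p := - ((zeta p ^+ 2 - 1) * h2 (zeta p) + 3 * zeta p * h1 (zeta p)) * f p.
have cY : continuous Y by have := zeta_continuous; rewrite /Y => ?; cnt.
have sY : bsupp Y B by apply/bsuppP => p out; rewrite /Y (proj1 (bsuppP _ _) sf)// mulr0.
have iY := integrable_continuous cY sY.
have i0 := integrable_continuous cX0' sX0'.
have i1 := integrable_continuous c1' s1'.
have i2 := integrable_continuous c2' s2'.
transitivity (\int[l3]_(p in fund) (Y p + (X0' p - (X1' p + X2' p)))).
  apply: eq_Rintegral => p _; rewrite /Y -bu /X0' /X1' /X2' /box_op -/(u p); cbv zeta; ring.
have i12 : l3.-integrable fund (EFin \o (fun p => X1' p + X2' p)).
  by rewrite (_ : _ \o _ = (EFin \o X1') \+ (EFin \o X2'))%E; first exact: integrableD.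
have i012 : l3.-integrable fund (EFin \o (fun p => X0' p - (X1' p + X2' p))).
  by rewrite (_ : _ \o _ = (EFin \o X0') \- (EFin \o (fun p => X1' p + X2' p)%R))%E; first exact: integrableB.
by rewrite RintegralD// RintegralB// RintegralD// (Z X0')// (Z X1')// (Z X2')// addr0 subr0 addr0.
Qed.

End Green.

Ltac dereq := notypeclasses refine (der_eq _ _); [der|].

(** * Radial functions singular on the light cone *)

Section Spline.
Variable R : realType.
Implicit Types x : R.

Definition pp x : R := (x + `|x|) / 2.

Lemma pp_le0 x : x <= 0 -> pp x = 0.
Proof. by move=> x0; rewrite /pp ler0_norm// subrr mul0r. Qed.

Lemma pp_ge0 x : 0 <= x -> pp x = x.
Proof. by move=> x0; rewrite /pp ger0_norm//; field. Qed.

Lemma pp_continuous : continuous pp.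
Proof.
rewrite /pp; cnt; exact: (@norm_continuous _ R^o).
Qed.

Lemma is_derive_pp2 x : is_derive x (1 : R) (fun y => pp y ^+ 2) (2 * pp x).
Proof.
pose q (y : R) := y * `|y|.
have -> : (fun y => pp y ^+ 2) = (fun y => (y ^+ 2 + q y) / 2).
  by apply/funext => y; rewrite /q /pp expr_div_n sqrrD real_normK ?num_real//; field.
have d : is_derive x (1 : R) q (2 * `|x|) := is_derive_mulnorm x.
dereq.
by rewrite /q /pp /=; field.
Qed.

Lemma is_derive_pp3 x : is_derive x (1 : R) (fun y => pp y ^+ 3) (3 * pp x ^+ 2).
Proof.
pose q (y : R) := y * `|y|.
have -> : (fun y => pp y ^+ 3) = (fun y => (y ^+ 3 + y * q y) / 2).
  apply/funext => y; rewrite /q; case: (ger0P y) => y0.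
    by rewrite pp_ge0//; field.
  by rewrite pp_le0 ?ltW//; field.
have d : is_derive x (1 : R) q (2 * `|x|) := is_derive_mulnorm x.
dereq.
rewrite /q /=; case: (ger0P x) => x0; first by rewrite pp_ge0//; field.
by rewrite pp_le0 ?ltW//; field.
Qed.

(** A step from 0 to 1 on [0, 3] whose derivative is the quadratic B-spline: a third difference of
    truncated cubes. It is of class C^2, which is what a second order operator asks for. *)
Definition spl x : R := (pp x ^+ 3 - 3 * pp (x - 1) ^+ 3 + 3 * pp (x - 2) ^+ 3 - pp (x - 3) ^+ 3) / 6.
Definition spl1 x : R := (pp x ^+ 2 - 3 * pp (x - 1) ^+ 2 + 3 * pp (x - 2) ^+ 2 - pp (x - 3) ^+ 2) / 2.
Definition spl2 x : R := pp x - 3 * pp (x - 1) + 3 * pp (x - 2) - pp (x - 3).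

Lemma is_derive_spl x : is_derive x (1 : R) spl (spl1 x).
Proof.
have d (c : R) : is_derive x (1 : R) (fun y => pp (y - c) ^+ 3) (3 * pp (x - c) ^+ 2).
  notypeclasses refine (der_eq _ (mulr1 _)).
  apply: (der_comp (f := fun y => y - c) (h := fun y => pp y ^+ 3)); first exact: is_derive_pp3.
  by dereq; rewrite addr0.
pose q0 (y : R) := pp y ^+ 3; pose q (c y : R) := pp (y - c) ^+ 3.
have d0 : is_derive x (1 : R) q0 _ := is_derive_pp3 x.
have d1 : is_derive x (1 : R) (q 1) _ := d 1.
have d2 : is_derive x (1 : R) (q 2) _ := d 2.
have d3 : is_derive x (1 : R) (q 3) _ := d 3.
have -> : spl = fun y => (q0 y - 3 * q 1 y + 3 * q 2 y - q 3 y) / 6 by [].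
dereq.
by rewrite /spl1 /=; field.
Qed.

Lemma is_derive_spl1 x : is_derive x (1 : R) spl1 (spl2 x).
Proof.
have d (c : R) : is_derive x (1 : R) (fun y => pp (y - c) ^+ 2) (2 * pp (x - c)).
  notypeclasses refine (der_eq _ (mulr1 _)).
  apply: (der_comp (f := fun y => y - c) (h := fun y => pp y ^+ 2)); first exact: is_derive_pp2.
  by dereq; rewrite addr0.
pose q0 (y : R) := pp y ^+ 2; pose q (c y : R) := pp (y - c) ^+ 2.
have d0 : is_derive x (1 : R) q0 _ := is_derive_pp2 x.
have d1 : is_derive x (1 : R) (q 1) _ := d 1.
have d2 : is_derive x (1 : R) (q 2) _ := d 2.
have d3 : is_derive x (1 : R) (q 3) _ := d 3.
have -> : spl1 = fun y => (q0 y - 3 * q 1 y + 3 * q 2 y - q 3 y) / 2 by [].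
dereq.
by rewrite /spl2 /=; field.
Qed.

Lemma spl2_continuous : continuous spl2.
Proof.
have c (a : R) : continuous (fun x => pp (x - a)).
  apply: (cnt_comp (f := fun x => x - a)); first exact: pp_continuous.
  by cnt.
have c0 := pp_continuous; have c1 := c 1; have c2 := c 2; have c3 := c 3.
by rewrite /spl2; cnt.
Qed.

Lemma spl_le0 x : x <= 0 -> [/\ spl x = 0, spl1 x = 0 & spl2 x = 0].
Proof.
move=> x0; rewrite /spl /spl1 /spl2 !pp_le0; [|lra..].
by split; ring.
Qed.

Lemma spl_ge3 x : 3 <= x -> [/\ spl x = 1, spl1 x = 0 & spl2 x = 0].
Proof.
move=> x0; rewrite /spl /spl1 /spl2 !pp_ge0; [|lra..].
by split; field.
Qed.

(** On [0, 3] the triangle inequality gives (1 + 3 + 3 + 1) 27 / 6 for the cubes and (1 + 3 + 3 + 1)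
    9 / 2 for the squares, both equal to 36. *)
Lemma spl_bound x : [/\ `|spl x| <= 36, `|spl1 x| <= 36 & `|spl2 x| <= 36].
Proof.
have [x0|x0] := leP x 0; first by have [-> -> ->] := spl_le0 x0; rewrite normr0; split; lra.
have [x3|x3] := leP 3 x; first by have [-> -> ->] := spl_ge3 x3; rewrite normr0 normr1; split; lra.
have B (c : R) : 0 <= c -> 0 <= pp (x - c) <= 3.
  move=> c0; have [h|h] := leP 0 (x - c); first by rewrite pp_ge0//; lra.
  by rewrite pp_le0 ?lexx ?ltW.
have B2 (u : R) : 0 <= u <= 3 -> 0 <= u ^+ 2 <= 9 by move=> ?; nra.
have B3 (u : R) : 0 <= u <= 3 -> 0 <= u ^+ 3 <= 27 by move=> ?; rewrite exprS; nra.
have b0 := B 0 (lexx _); rewrite subr0 in b0.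
have b1 := B 1 ler01; have b2 := B 2 (ler0n _ 2); have b3 := B 3 (ler0n _ 3).
have := (B2 _ b0, B2 _ b1, B2 _ b2, B2 _ b3, B3 _ b0, B3 _ b1, B3 _ b2, B3 _ b3).
rewrite /spl /spl1 /spl2 !ler_norml => -[[[[[[[c0 c1] c2] c3] d0] d1] d2] d3].
split; lra.
Qed.

End Spline.

(** * The cut-off around the light cone *)

Section Cutoff.
Variable R : realType.
Local Notation mu := (@lebesgue_measure R).

(** The affine map sends 1/16 to 0 and 1 to 3, so the cut-off is 0 for |z - 1| <= d / 4 and 1 for |z
    - 1| >= d. Squaring makes the argument smooth and symmetric around z = 1. *)
Definition chi (d z : R) : R := spl (16/5 * ((z - 1) / d) ^+ 2 - 1/5).
Definition chi1 (d z : R) : R :=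
  spl1 (16/5 * ((z - 1) / d) ^+ 2 - 1/5) * (32/5 * ((z - 1) / d) / d).
Definition chi2 (d z : R) : R :=
  spl2 (16/5 * ((z - 1) / d) ^+ 2 - 1/5) * (32/5 * ((z - 1) / d) / d) ^+ 2 +
  spl1 (16/5 * ((z - 1) / d) ^+ 2 - 1/5) * (32/5 / d / d).

Lemma is_derive_arg (d z : R) :
  is_derive z (1 : R) (fun y => 16/5 * ((y - 1) / d) ^+ 2 - 1/5) (32/5 * ((z - 1) / d) / d).
Proof. by dereq; rewrite /=; ring. Qed.

Lemma is_derive_chi (d z : R) : is_derive z (1 : R) (chi d) (chi1 d z).
Proof.
have h := der_comp (h := @spl R) (f := fun y : R => 16/5 * ((y - 1) / d) ^+ 2 - 1/5)
  (is_derive_spl _) (is_derive_arg d z).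
exact: h.
Qed.

Lemma is_derive_chi1 (d z : R) : is_derive z (1 : R) (chi1 d) (chi2 d z).
Proof.
have h := der_comp (h := @spl1 R) (f := fun y : R => 16/5 * ((y - 1) / d) ^+ 2 - 1/5)
  (is_derive_spl1 _) (is_derive_arg d z).
rewrite /chi1; pose s (z : R) := spl1 (16/5 * ((z - 1) / d) ^+ 2 - 1/5).
have {}h : is_derive z (1:R) s _ := h.
have -> : (fun z => spl1 (16/5 * ((z - 1) / d) ^+ 2 - 1/5) * (32/5 * ((z - 1) / d) / d)) =
  (fun z => s z * (32/5 * ((z - 1) / d) / d)) by [].
by dereq; rewrite /s /chi2 /=; ring.
Qed.

Lemma chi2_continuous d : continuous (chi2 d).
Proof.
have c : continuous (fun z : R => 16/5 * ((z - 1) / d) ^+ 2 - 1/5) by cnt.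
have s1c : continuous (@spl1 R) by move=> x; exact: (is_derive_continuous (is_derive_spl1 x)).
have a1 := cnt_comp s1c c; have a2 := cnt_comp (@spl2_continuous R) c.
rewrite /chi2; apply: cntD; apply: cntM => //; cnt.
Qed.

Lemma chi_near d z : 0 < d -> `|z - 1| <= d / 4 -> [/\ chi d z = 0, chi1 d z = 0 & chi2 d z = 0].
Proof.
move=> d0 zd; have x2 : ((z - 1) / d) ^+ 2 <= 1/16.
  rewrite -real_normK ?num_real// normrM normfV (gtr0_norm d0).
  have : `|z - 1| / d <= 1/4 by rewrite ler_pdivrMr//; lra.
  have : 0 <= `|z - 1| / d by rewrite divr_ge0// ltW.
  by nra.
rewrite /chi /chi1 /chi2; have [|-> -> ->] := @spl_le0 R (16/5 * ((z - 1) / d) ^+ 2 - 1/5).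
  by lra.
by rewrite !mul0r addr0.
Qed.

Lemma chi_far d z : 0 < d -> d <= `|z - 1| -> [/\ chi d z = 1, chi1 d z = 0 & chi2 d z = 0].
Proof.
move=> d0 zd; have x2 : 1 <= ((z - 1) / d) ^+ 2.
  rewrite -real_normK ?num_real// normrM normfV (gtr0_norm d0).
  have : 1 <= `|z - 1| / d by rewrite ler_pdivlMr// mul1r.
  by nra.
rewrite /chi /chi1 /chi2; have [|-> -> ->] := @spl_ge3 R (16/5 * ((z - 1) / d) ^+ 2 - 1/5).
  by lra.
by rewrite !mul0r addr0.
Qed.

(** The chain rule contributes at most 32/5 <= 8 to the first derivative and (32/5)^2 + 32/5 <= 48
    to the second. *)
Lemma chi_bound d z : 0 < d ->
  [/\ `|chi d z| <= 36, `|chi1 d z| <= 36 * 8 / d & `|chi2 d z| <= 36 * 48 / d ^+ 2].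
Proof.
move=> d0; have [h|h] := leP d `|z - 1|.
  have [-> -> ->] := chi_far d0 h; rewrite !normr0 normr1; split; first lra.
    by apply: divr_ge0; [lra|exact: ltW].
  by apply: divr_ge0; [lra|exact: exprn_ge0 (ltW d0)].
rewrite /chi /chi1 /chi2; have [b0 b1 b2] := spl_bound (16/5 * ((z - 1) / d) ^+ 2 - 1/5).
have x1 : `|(z - 1) / d| <= 1 by rewrite normrM normfV (gtr0_norm d0) ler_pdivrMr// mul1r ltW.
have dV : 0 < d^-1 by rewrite invr_gt0.
set u := (z - 1) / d in x1 *; set S := 16/5 * u ^+ 2 - 1/5 in b0 b1 b2 *.
suff key (n : R) : 0 <= n -> n <= 32/5 -> [/\ `|spl S| <= 36, `|spl1 S * (n * u / d)| <= 36 * 8 / d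
    & `|spl2 S * (n * u / d) ^+ 2 + spl1 S * (n / d / d)| <= 36 * 48 / d ^+ 2].
  by apply: key; lra.
move=> n0 n6; move: b0 b1 b2; move: (spl S) (spl1 S) (spl2 S) => s0 s1 s2 b0 b1 b2.
move: u x1 {S} => u x1.
split => //.
  rewrite !mulrA normrM (gtr0_norm dV) ler_pM2r// !normrM (ger0_norm n0) -mulrA.
  have nu : 0 <= n * `|u| <= 8 by have := normr_ge0 u; nra.
  by have := normr_ge0 s1; nra.
rewrite (_ : _ + _ = (s2 * (n * u) ^+ 2 + s1 * n) / d ^+ 2); last by field; rewrite gt_eqF.
rewrite normrM (gtr0_norm (x := _^-1)) ?invr_gt0 ?exprn_gt0// ler_pM2r ?invr_gt0 ?exprn_gt0//.
apply: (le_trans (ler_normD _ _)); rewrite (normrM s2) normrX (normrM n) (normrM s1) (ger0_norm n0).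
have nu : (n * `|u|) ^+ 2 <= 41.
  have : 0 <= n * `|u| <= 32/5 by have := normr_ge0 u; nra.
  by nra.
have : 0 <= (n * `|u|) ^+ 2 by rewrite sqr_ge0.
have := normr_ge0 s1; have := normr_ge0 s2; move: (`|s1|) (`|s2|) b1 b2 ((n * `|u|) ^+ 2) nu => a b b1 b2 m m1 b3 a3 m2.
by have : b * m <= 36 * 41; [nra|]; have : a * n <= 36 * (32/5); nra.
Qed.

End Cutoff.

Section IntegralsOnSegments.
Variable R : realType.
Local Notation mu := (@lebesgue_measure R).

Lemma continuous_integrable_segment (f : R -> R) (a b : R) : continuous f ->
  mu.-integrable `[a, b] (EFin \o f).
Proof.
move=> cf; apply: (@continuous_compact_integrable R f); first exact: segment_compact.
exact: continuous_subspaceT.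
Qed.

Lemma Rintegral_segment_close (f g : R -> R) (a b B : R) : a <= b ->
  continuous f -> continuous g -> (forall x, a <= x <= b -> `|f x - g x| <= B) ->
  `|\int[mu]_(x in `[a, b]) f x - \int[mu]_(x in `[a, b]) g x| <= B * (b - a).
Proof.
move=> ab cf cg fgB; have i h := @continuous_integrable_segment h a b.
rewrite -RintegralB//; [|exact: i..].
have cfg : continuous (fun x => f x - g x) by move=> x; apply: cvgB; [exact: cf|exact: cg].
apply: (le_trans (le_normr_Rintegral _ (i _ cfg))) => //.
apply: (@le_trans _ _ (\int[mu]_(x in `[a, b]) B)).
  apply: le_Rintegral => //.
    by apply: i; apply: (cnt_comp _ cfg); exact: (@norm_continuous _ R^o).
  by apply: i; exact: cntC.
have E : mu `[a, b]%classic = (b - a)%:E.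
  rewrite lebesgue_measure_itv/= lte_fin; case: ifPn => [_|]; first by rewrite -EFinB.
  by rewrite -leNgt => ba; rewrite (le_anti (_ : a <= b <= a)) ?ab// subrr.
by rewrite Rintegral_cst// (_ : fine _ = b - a)//; exact: (congr1 fine E).
Qed.

End IntegralsOnSegments.

(** * The function left over by the cut-off, and its two moments *)

Section CutoffFamily.
Variable R : realType.
Local Notation mu := (@lebesgue_measure R).

(** A solution [V] of the radial equation with right-hand side [W], singular like |z - 1|^(-1/2) at
    1. The condition [sg_N] is the matching across the light cone: the flux z V + (z^2 - 1) V' has
    no jump. The number g of [sg_g] is the strength of the singularity as seen from below 1. The
    equation is imposed only for z >= -1 + delta. *)
Record singular (V V1 V2 W : R -> R) (C d0 g delta : R) : Prop := {
  sg_d : forall z : R, z != 1 -> is_derive z (1 : R) V (V1 z);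
  sg_d1 : forall z : R, z != 1 -> is_derive z (1 : R) V1 (V2 z);
  sg_c2 : forall z, z != 1 -> {for z, continuous V2};
  sg_cW : forall z, z != 1 -> {for z, continuous W};
  sg_ode : forall z, -1 + delta <= z -> z != 1 -> (z ^+ 2 - 1) * V2 z + 3 * z * V1 z = W z;
  sg_V : forall z, `|z - 1| <= d0 -> `|V z| * Num.sqrt `|z - 1| <= C;
  sg_V1 : forall z, `|z - 1| <= d0 -> `|V1 z| * Num.sqrt `|z - 1| ^+ 3 <= C;
  sg_W : forall z, `|z - 1| <= d0 -> `|W z| * Num.sqrt `|z - 1| <= C;
  sg_N : forall d, 0 < d <= d0 ->
    `|((1 + d) * V (1 + d) + ((1 + d) ^+ 2 - 1) * V1 (1 + d)) -
      ((1 - d) * V (1 - d) + ((1 - d) ^+ 2 - 1) * V1 (1 - d))| <= C * Num.sqrt d;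
  sg_g : forall d, 0 < d <= d0 ->
    `|Num.sqrt (1 - (1 - d) ^+ 2) ^+ 3 * V1 (1 - d) - g| <= C * Num.sqrt d;
  sg_d0 : 0 < d0 <= 1/4;
  sg_C : 0 <= C;
  sg_delta : 0 < delta <= 1/2 }.

Variables (V V1 V2 W : R -> R) (C d0 g delta : R).
Hypothesis sg : singular V V1 V2 W C d0 g delta.

Definition cutH d z := chi d z * V z.
Definition cutH1 d z := chi1 d z * V z + chi d z * V1 z.
Definition cutH2 d z := chi2 d z * V z + 2 * chi1 d z * V1 z + chi d z * V2 z.
(** The total coefficient of phi once Green's formula has been applied to chi V, the term chi W
    included. For z >= -1 + delta it vanishes wherever chi is locally constant, by the equation. *)
Definition cutk d z := - ((z ^+ 2 - 1) * cutH2 d z + 3 * z * cutH1 d z) + chi d z * W z.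

Lemma near_chi0 d (z : R) : 0 < d -> z = 1 ->
  \near z, [/\ chi d z = 0, chi1 d z = 0 & chi2 d z = 0].
Proof.
move=> dp ->; have d4 : 0 < d / 4 by lra.
apply: filterS (nbhsx_ballx (1 : R) (d / 4) d4) => x.
by rewrite /ball/= distrC => xd; apply: chi_near => //; exact: ltW.
Qed.

Lemma is_derive_cutH d z : 0 < d -> is_derive z (1 : R) (cutH d) (cutH1 d z).
Proof.
move=> dp; have [z1|z1] := eqVneq z 1.
  rewrite /cutH1; have [-> -> _] := nbhs_singleton (near_chi0 dp z1).
  rewrite !mul0r addr0; have e0 := derC (0 : R) z (1 : R); apply: near_eq_is_derive e0.
  by apply: filterS (near_chi0 dp z1) => x [x0 _ _]; rewrite /cutH x0 mul0r.
have a := is_derive_chi d z; have b := sg_d sg z1.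
have c : is_derive z (1 : R) (fun x => chi d x * V x) (chi d z * V1 z + V z * chi1 d z) by exact: derM.
by notypeclasses refine (der_eq c _); rewrite /cutH1; ring.
Qed.

Lemma is_derive_cutH1 d z : 0 < d -> is_derive z (1 : R) (cutH1 d) (cutH2 d z).
Proof.
move=> dp; have [z1|z1] := eqVneq z 1.
  rewrite /cutH2; have [-> -> ->] := nbhs_singleton (near_chi0 dp z1).
  rewrite !mul0r mulr0 mul0r !addr0; have e0 := derC (0 : R) z (1 : R); apply: near_eq_is_derive e0.
  by apply: filterS (near_chi0 dp z1) => x [x0 x1 _]; rewrite /cutH1 x0 x1 !mul0r addr0.
have a := is_derive_chi d z; have b := sg_d sg z1.
have a1 := is_derive_chi1 d z; have b1 := sg_d1 sg z1.
have c : is_derive z (1 : R) (fun x => chi1 d x * V x + chi d x * V1 x)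
    ((chi1 d z * V1 z + V z * chi2 d z) + (chi d z * V2 z + V1 z * chi1 d z)).
  by apply: derD; exact: derM.
by notypeclasses refine (der_eq c _); rewrite /cutH2; ring.
Qed.

Lemma cutH_continuous d : 0 < d -> continuous (cutH d).
Proof. by move=> dp z; exact: is_derive_continuous (is_derive_cutH z dp). Qed.

Lemma cutH1_continuous d : 0 < d -> continuous (cutH1 d).
Proof. by move=> dp z; exact: is_derive_continuous (is_derive_cutH1 z dp). Qed.

Lemma cut_continuous (U : R -> R) (c : R -> R) : continuous c ->
  (forall z, z != 1 -> {for z, continuous U}) ->
  (\forall z \near (1 : R), c z = 0) -> continuous (fun z => c z * U z).
Proof.
move=> cc cU c0 z; have [z1|z1] := eqVneq z 1; last first.
  by apply: cvgM; [exact: cc|exact: cU].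
subst z; have E : \forall z \near (1 : R), 0 = c z * U z.
  by apply: filterS c0 => x ->; rewrite mul0r.
rewrite /continuous_at -(nbhs_singleton E).
by apply: cvg_trans (near_eq_cvg E) _; exact: cvg_cst.
Qed.

Lemma cutH2_continuous d : 0 < d -> continuous (cutH2 d).
Proof.
move=> dp; have nc := near_chi0 dp (erefl (1 : R)).
have cc : continuous (@chi R d) by move=> z; exact: is_derive_continuous (is_derive_chi d z).
have cc1 : continuous (@chi1 R d) by move=> z; exact: is_derive_continuous (is_derive_chi1 d z).
have cV z : z != 1 -> {for z, continuous V} by move=> /(sg_d sg) /is_derive_continuous.
have cV1 z : z != 1 -> {for z, continuous V1} by move=> /(sg_d1 sg) /is_derive_continuous.
apply: cntD; first apply: cntD.
- apply: cut_continuous => //; first exact: chi2_continuous.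
  by apply: filterS nc => x [].
- apply: (@cut_continuous V1 (fun z => 2 * chi1 d z)) => //.
    by apply: cntM => //; exact: cntC.
  by apply: filterS nc => x [_ -> _]; rewrite mulr0.
- apply: cut_continuous => //; first exact: (sg_c2 sg).
  by apply: filterS nc => x [].
Qed.

Lemma chiW_continuous d : 0 < d -> continuous (fun z => chi d z * W z).
Proof.
move=> dp; have nc := near_chi0 dp (erefl (1 : R)).
apply: cut_continuous => //; last by apply: filterS nc => x [].
  by move=> z; exact: is_derive_continuous (is_derive_chi d z).
exact: (sg_cW sg).
Qed.

Lemma cutk_continuous d : 0 < d -> continuous (cutk d).
Proof.
move=> dp; have c1 := cutH1_continuous dp; have c2 := cutH2_continuous dp.
have c3 := chiW_continuous dp.
by apply: cntD => //; cnt.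
Qed.

Lemma cutk_far d z : 0 < d -> -1 + delta <= z -> d <= `|z - 1| -> cutk d z = 0.
Proof.
move=> dp zd dz; have z1 : z != 1.
  by apply: contraTneq dz => ->; rewrite subrr normr0 -ltNge.
rewrite /cutk /cutH2 /cutH1; have [-> -> ->] := chi_far dp dz.
rewrite -(sg_ode sg zd z1); ring.
Qed.

(** Here w is the square root of the width. Unless the cut-off vanishes with its derivatives, |z -
    1| > w^2 / 4, so sqrt |z - 1| is at least w / 2; the growth bounds become powers of w at the
    cost of the factors 2 and 2^3. *)
Lemma cut_dichotomy z w : 0 < w -> w ^+ 2 <= d0 -> `|z - 1| <= w ^+ 2 ->
  [/\ chi (w ^+ 2) z = 0, chi1 (w ^+ 2) z = 0 & chi2 (w ^+ 2) z = 0] \/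
  [/\ -1 + delta <= z, z != 1 & [/\ `|V z| * w <= 2 * C, `|V1 z| * w ^+ 3 <= 8 * C & `|W z| * w <= 2 * C]].
Proof.
move=> wp wd zw; have w2 : 0 < w ^+ 2 by rewrite exprn_gt0.
have [h|h] := leP (`|z - 1|) (w ^+ 2 / 4); [left; exact: chi_near|right].
have z1 : z != 1 by apply: contraTneq h => ->; rewrite subrr normr0 -leNgt; lra.
have [/andP[_ d0l] Cp dl] := And3 (sg_d0 sg) (sg_C sg) (sg_delta sg).
split => //; first by move: zw; rewrite ler_norml; lra.
have zd : `|z - 1| <= d0 by exact: le_trans wd.
have := (sg_V sg zd, sg_V1 sg zd, sg_W sg zd).
set u := Num.sqrt _ => -[[hV hV1] hW].
have u0 : 0 <= u by exact: sqrtr_ge0.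
have u2 : u ^+ 2 = `|z - 1| by rewrite sqr_sqrtr.
have uw : w <= 2 * u by nra.
split.
- apply: (le_trans (ler_wpM2l (normr_ge0 _) uw)); have := normr_ge0 (V z); nra.
- apply: (@le_trans _ _ (`|V1 z| * (2 * u) ^+ 3)).
    by apply: ler_wpM2l => //; rewrite lerXn2r// nnegrE; [exact: ltW|lra].
  by rewrite (_ : _ * _ = 8 * (`|V1 z| * u ^+ 3)); [rewrite ler_pM2l; lra|ring].
- apply: (le_trans (ler_wpM2l (normr_ge0 _) uw)); have := normr_ge0 (W z); nra.
Qed.

(** The terms in which chi is not differentiated cancel by the equation. In each of the three others
    the powers of w balance to w^(-3) once the factors are normalised to bounded quantities; the
    constant is the sum of the three products of their bounds. *)
Lemma cutk_bound z w : 0 < w -> w ^+ 2 <= d0 -> `|z - 1| <= w ^+ 2 ->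
  `|cutk (w ^+ 2) z| * w ^+ 3 <=
  (2 * (3 * (36 * 8) * 8) + 3 * (36 * 48) * 2 + 6 * (36 * 8) * 2) * C.
Proof.
move=> wp wd zw; have w2 : 0 < w ^+ 2 by rewrite exprn_gt0.
have Cp := sg_C sg.
have [[c0 c1 c2]|[zd z1 [bV bV1 _]]] := cut_dichotomy wp wd zw.
  rewrite /cutk /cutH2 /cutH1 c0 c1 c2 !mulr0 !mul0r !(addr0, mulr0) oppr0 normr0 mul0r.
  by apply: mulr_ge0 => //; lra.
have [_ b1 b2] := chi_bound z w2.
have w0 : w != 0 by rewrite gt_eqF.
have -> : cutk (w ^+ 2) z = - (2 * (z ^+ 2 - 1) * chi1 (w ^+ 2) z * V1 z +
    (z ^+ 2 - 1) * chi2 (w ^+ 2) z * V z + 3 * z * chi1 (w ^+ 2) z * V z).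
  by rewrite /cutk /cutH2 /cutH1 -(sg_ode sg zd z1); ring.
rewrite normrN -(ger0_norm (exprn_ge0 3 (ltW wp))) -normrM.
have E3 : `|(z ^+ 2 - 1) / w ^+ 2| <= 3.
  rewrite normrM (gtr0_norm (x := _^-1)) ?invr_gt0// ler_pdivrMr//.
  have [/andP[_ d0l] _] := conj (sg_d0 sg) Cp.
  rewrite (_ : z ^+ 2 - 1 = (z - 1) * (z + 1)); last by ring.
  have z3 : `|z + 1| <= 3.
    by move: (le_trans zw wd); rewrite !ler_norml => ?; lra.
  rewrite normrM mulrC; apply: ler_pM => //; exact: normr_ge0.
have A : `|chi1 (w ^+ 2) z * w ^+ 2| <= 36 * 8.
  by rewrite normrM (gtr0_norm w2) -ler_pdivlMr.
have B : `|chi2 (w ^+ 2) z * w ^+ 4| <= 36 * 48.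
  rewrite normrM (gtr0_norm (x := w ^+ 4)) ?exprn_gt0// -ler_pdivlMr ?exprn_gt0//.
  by move: b2; rewrite -exprM.
have P : `|V z * w| <= 2 * C by rewrite normrM (gtr0_norm wp).
have Q : `|V1 z * w ^+ 3| <= 8 * C by rewrite normrM (gtr0_norm (x := w ^+ 3)) ?exprn_gt0.
have z2 : `|z| <= 2.
  have [/andP[_ d0l] _] := conj (sg_d0 sg) Cp.
  by move: (le_trans zw wd); rewrite !ler_norml => ?; lra.
move: E3 A B P Q; set e := _ / _; set a := chi1 _ _ * _; set b := chi2 _ _ * _; set p := V z * w; set q := V1 z * _ => E3 A B P Q.
have -> : (2 * (z ^+ 2 - 1) * chi1 (w ^+ 2) z * V1 z + (z ^+ 2 - 1) * chi2 (w ^+ 2) z * V z +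
    3 * z * chi1 (w ^+ 2) z * V z) * w ^+ 3 = 2 * (e * a * q) + e * b * p + 3 * (z * a * p).
  by rewrite /e /a /b /p /q; field.
have m3 (x y t X Y T : R) : `|x| <= X -> `|y| <= Y -> `|t| <= T -> `|x * y * t| <= X * Y * T.
  by move=> hx hy ht; rewrite !normrM; do ! (apply: ler_pM => //; try exact: mulr_ge0).
have t1 := m3 _ _ _ _ _ _ E3 A Q; have t2 := m3 _ _ _ _ _ _ E3 B P.
have t3 := m3 _ _ _ _ _ _ z2 A P.
apply: (@le_trans _ _ (2 * `|e * a * q| + `|e * b * p| + 3 * `|z * a * p|)).
  apply: (le_trans (ler_normD _ _)); rewrite [X in _ + X]normrM (@ger0_norm _ 3) ?ler0n// lerD2r.
  by apply: (le_trans (ler_normD _ _)); rewrite normrM (@ger0_norm _ 2) ?ler0n.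
lra.
Qed.

(** With H = chi V, the function - k is, up to chi (V + W), the derivative of (z^2 - 1) H' + z H.
    The boundary values form the difference in [sg_N], and chi (V + W) is O(1 / w) on an interval of
    length 2 w^2. *)
Lemma cutk_integral w : 0 < w -> w ^+ 2 <= d0 ->
  `|\int[mu]_(z in `[1 - w ^+ 2, 1 + w ^+ 2]) cutk (w ^+ 2) z| <= (36 * 8 + 1) * C * w.
Proof.
move=> wp wd; have w2 : 0 < w ^+ 2 by rewrite exprn_gt0.
set d := w ^+ 2 in wd w2 *; have Cp := sg_C sg.
pose P z := (z ^+ 2 - 1) * cutH1 d z + z * cutH d z.
pose P1 z := (z ^+ 2 - 1) * cutH2 d z + 3 * z * cutH1 d z + cutH d z.
have c := cutH_continuous w2; have c1 := cutH1_continuous w2; have c2 := cutH2_continuous w2.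
have ck := cutk_continuous w2.
have cP1 : continuous P1 by rewrite /P1; cnt.
have dP z : is_derive z (1 : R) P (P1 z).
  have a1 := is_derive_cutH z w2; have a2 := is_derive_cutH1 z w2.
  rewrite /P; dereq; rewrite /P1 /=; ring.
have intP : \int[mu]_(z in `[1 - d, 1 + d]) (- P1 z) = - (P (1 + d) - P (1 - d)).
  rewrite /Rintegral (FTC2 (F := fun z => - P z)); [by rewrite /= opprB opprK addrC|lra|].
  by move=> z _; exact: (cntN cP1).
have cl : `|\int[mu]_(z in `[1 - d, 1 + d]) cutk d z - \int[mu]_(z in `[1 - d, 1 + d]) (- P1 z)| <=
    (36 * 4 * C / w) * ((1 + d) - (1 - d)).
  apply: Rintegral_segment_close => //; [lra|exact: cntN|].
  move=> z zd; have {}zd : `|z - 1| <= d by rewrite ler_norml; lra.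
  rewrite (_ : _ - _ = chi d z * (V z + W z)); last by rewrite /cutk /P1 /cutH; ring.
  have [[-> _ _]|[_ _ [bV _ bW]]] := cut_dichotomy wp wd zd.
    by rewrite mul0r normr0; apply: divr_ge0; [lra|exact: ltW].
  have [b0 _ _] := chi_bound z w2.
  rewrite ler_pdivlMr// normrM -[X in X <= _]mulrA -[X in _ <= X]mulrA.
  apply: ler_pM => //; first by rewrite mulr_ge0// ltW.
  by rewrite (le_trans (ler_wpM2r (ltW wp) (ler_normD _ _)))// mulrDl; lra.
have N : `|P (1 + d) - P (1 - d)| <= C * w.
  have := sg_N sg (_ : 0 < d <= d0); rewrite w2 wd => /(_ isT).
  have -> : Num.sqrt d = w by rewrite sqrtr_sqr gtr0_norm.
  apply: le_trans.
  rewrite /P /cutH1 /cutH.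
  have [|-> -> _] := @chi_far R d (1 + d) w2; first by rewrite (_ : 1 + d - 1 = d) ?gtr0_norm//; ring.
  have [|-> -> _] := @chi_far R d (1 - d) w2; first by rewrite (_ : 1 - d - 1 = - d) ?normrN ?gtr0_norm//; ring.
  by rewrite !mul0r !mul1r !add0r (addrC (_ * V1 _)) (addrC (_ * V1 _)).
rewrite intP in cl; have E : (36 * 4 * C / w) * ((1 + d) - (1 - d)) = 36 * 8 * C * w.
  by rewrite /d; field; rewrite gt_eqF.
rewrite E in cl; move: cl N; set I := \int[mu]_(_ in _) _; set PP := P _ - P _.
rewrite opprK => cl N; rewrite -(addrK PP I).
by apply: (le_trans (ler_normB _ _)); move: cl N; lra.
Qed.

(** The weight m = sqrt(1 - z^2) puts the operator in divergence form: (m^3 H')' = - m ((z^2 - 1)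
    H'' + 3 z H') for H = chi V. As H' vanishes near 1, what remains is - m^3 V' at 1 - w^2, close
    to - g. *)
Lemma cutk_integral_sqrt w : 0 < w -> w ^+ 2 <= d0 ->
  `|\int[mu]_(z in `[1 - w ^+ 2, 1]) (cutk (w ^+ 2) z * Num.sqrt (1 - z ^+ 2)) + g| <= (36 * 2 + 1) * C * w.
Proof.
move=> wp wd; have w2 : 0 < w ^+ 2 by rewrite exprn_gt0.
set d := w ^+ 2 in wd w2 *; have Cp := sg_C sg.
have [/andP[_ d0l] _] := conj (sg_d0 sg) Cp.
pose m (z : R) := Num.sqrt (1 - z ^+ 2).
pose P z := m z ^+ 3 * cutH1 d z.
pose P1 z := - (m z * ((z ^+ 2 - 1) * cutH2 d z + 3 * z * cutH1 d z)).
have c := cutH_continuous w2; have c1 := cutH1_continuous w2; have c2 := cutH2_continuous w2.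
have ck := cutk_continuous w2.
have cm : continuous m by rewrite /m; cnt.
have cP1 : continuous P1 by rewrite /P1; cnt.
have dP z : 1 - d <= z <= 1 -> is_derive z (1 : R) P (P1 z).
  move=> /andP[dz]; rewrite le_eqVlt => /predU1P[z1|z1].
    have nc := near_chi0 w2 z1.
    rewrite /P1 /cutH2 /cutH1; have [-> -> ->] := nbhs_singleton nc.
    rewrite !(mul0r, mulr0, addr0, oppr0).
    have e0 := derC (0 : R) z (1 : R); apply: near_eq_is_derive e0.
    by apply: filterS nc => x [x0 x1 _]; rewrite /P /cutH1 x0 x1 !mul0r addr0 mulr0.
  have a2 := is_derive_cutH1 z w2.
  have z2 : 0 < 1 - z ^+ 2 by nra.
  have mp : 0 < m z by rewrite sqrtr_gt0.
  have dm : is_derive z (1 : R) m (- z / m z).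
    rewrite /m; dereq; rewrite /= -/(m z); field; by rewrite gt_eqF.
  have m2 : m z ^+ 2 = 1 - z ^+ 2 by rewrite sqr_sqrtr// ltW.
  rewrite /P; dereq; rewrite /P1 /=.
  rewrite (_ : z ^+ 2 - 1 = - m z ^+ 2); last by rewrite m2; ring.
  by field; rewrite gt_eqF.
have intP : \int[mu]_(z in `[1 - d, 1]) P1 z = P 1 - P (1 - d).
  rewrite /Rintegral (FTC2 (F := P))//; first lra.
  by move=> z _; exact: cP1.
have cl : `|\int[mu]_(z in `[1 - d, 1]) (cutk d z * m z) - \int[mu]_(z in `[1 - d, 1]) P1 z| <=
    (36 * 2 * C / w) * (1 - (1 - d)).
  apply: Rintegral_segment_close => //; [lra|exact: cntM|].
  move=> z zd; have zd' : `|z - 1| <= d by rewrite ler_norml; lra.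
  rewrite (_ : _ - _ = chi d z * (W z * m z)); last by rewrite /cutk /P1; ring.
  have [[-> _ _]|[_ _ [bV _ bW]]] := cut_dichotomy wp wd zd'.
    by rewrite mul0r normr0; apply: divr_ge0; [lra|exact: ltW].
  have [b0 _ _] := chi_bound z w2.
  rewrite ler_pdivlMr// normrM -[X in X <= _]mulrA -[X in _ <= X]mulrA.
  apply: ler_pM => //; first by rewrite mulr_ge0// ltW.
  have m1 : `|m z| <= 1.
    rewrite ger0_norm ?sqrtr_ge0// -(sqrtr1 R) ler_sqrt// ?ler01//; have := sqr_ge0 z; lra.
  rewrite normrM mulrAC; apply: le_trans bW; rewrite ler_piMr//.
  by rewrite mulr_ge0// ltW.
have P10 : P 1 = 0 by rewrite /P /m expr1n subrr sqrtr0 expr0n mul0r.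
have N : `|P (1 - d) - g| <= C * w.
  have := sg_g sg (_ : 0 < d <= d0); rewrite w2 wd => /(_ isT).
  have -> : Num.sqrt d = w by rewrite sqrtr_sqr gtr0_norm.
  apply: le_trans.
  rewrite /P /cutH1.
  have [|-> -> _] := @chi_far R d (1 - d) w2; first by rewrite (_ : 1 - d - 1 = - d) ?normrN ?gtr0_norm//; ring.
  by rewrite mul0r add0r mul1r.
rewrite intP P10 in cl; have E : (36 * 2 * C / w) * (1 - (1 - d)) = 36 * 2 * C * w.
  by rewrite /d; field; rewrite gt_eqF.
rewrite E in cl; move: cl N; set I := \int[mu]_(_ in _) _; set PP := P _.
rewrite !ler_norml => cl N; lra.
Qed.

End CutoffFamily.

(** * Concentration at the base point *)

Section RealIntegrable.
Context d (T : measurableType d) (R : realType) (m : {measure set T -> \bar R}).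
Variables (D : set T) (mD : measurable D).
Implicit Types f g : T -> R.

Lemma integrable_realD f g : m.-integrable D (EFin \o f) -> m.-integrable D (EFin \o g) ->
  m.-integrable D (EFin \o (fun x => f x + g x)).
Proof. by move=> fi gi; have := integrableD mD fi gi. Qed.

Lemma integrable_realB f g : m.-integrable D (EFin \o f) -> m.-integrable D (EFin \o g) ->
  m.-integrable D (EFin \o (fun x => f x - g x)).
Proof. by move=> fi gi; have := integrableB mD fi gi. Qed.

Lemma integrable_realZ (c : R) f : m.-integrable D (EFin \o f) ->
  m.-integrable D (EFin \o (fun x => c * f x)).
Proof. by move=> fi; have := integrableZl mD c fi. Qed.

End RealIntegrable.

(** * Slabs around the light cone *)

Section Slabs.
Variable R : realType.
Local Notation mR := (measurableTypeR R).
Local Notation mu := (@lebesgue_measure R).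
Local Notation l3 := (@leb3 R).
Local Notation fund := (@fundamental R).
Local Notation R3 := (mR * mR * mR)%type.

Definition slab (a b S : R) : set R3 := [set p | a <= p.1.2 <= b /\ `|p.2| <= S].

Lemma slabE a b S : slab a b S = (setT `*` `[a, b]) `*` `[- S, S].
Proof.
apply/seteqP; split => p; rewrite /slab/= !in_itv/= !ler_norml; first by move=> [-> ->].
by move=> [[_ ->] ->].
Qed.

Lemma slab_measurable a b S : measurable (slab a b S).
Proof. by rewrite slabE; apply: measurableX; [apply: measurableX|]. Qed.

Lemma slab_volume a b S : a <= b -> 0 <= S ->
  l3 (slab a b S `&` fund) = (2 * pi * (b - a) * (2 * S))%:E.
Proof.
move=> ab S0.
have -> : slab a b S `&` fund = (`[0, 2 * pi[ `*` `[a, b]) `*` `[- S, S].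
  rewrite slabE fundamentalE; apply/seteqP; split => p /=; first by move=> [[[_ ?] ?] ?].
  by move=> [[? ?] ?].
have m (x y : R) : x <= y -> mu `[x, y]%classic = (y - x)%:E.
  move=> xy; rewrite lebesgue_measure_itv/= lte_fin; case: ifPn => [_|]; first by rewrite -EFinB.
  by rewrite -leNgt => yx; rewrite (le_anti (_ : x <= y <= x)) ?xy// subrr.
have m' (x y : R) : x <= y -> mu `[x, y[%classic = (y - x)%:E.
  move=> xy; rewrite lebesgue_measure_itv/= lte_fin; case: ifPn => [_|]; first by rewrite -EFinB.
  by rewrite -leNgt => yx; rewrite (le_anti (_ : x <= y <= x)) ?xy// subrr.
have e1 : l3 ((`[0, 2 * pi[ `*` `[a, b]) `*` `[- S, S]) =
    (leb2 (`[0%R, (2 * pi)%R[ `*` `[a, b]) * mu `[(- S)%R, S])%E.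
  by apply: product_measure1E => //; apply: measurableX.
have e2 : leb2 (`[0%R, (2 * pi)%R[ `*` `[a, b]) = (mu `[0%R, (2 * pi)%R[ * mu `[a, b])%E.
  by apply: product_measure1E.
transitivity (((2 * pi - 0)%:E * (b - a)%:E) * (S - - S)%:E)%E.
  rewrite e1 e2; congr (_ * _ * _)%E; [apply: m'|exact: m|apply: m]; last lra.
  by rewrite mulr_ge0 ?pi_ge0.
by rewrite -!EFinM; congr (_%:E); rewrite subr0; ring.
Qed.

Lemma integrable_slab_indic a b S : a <= b -> 0 <= S ->
  l3.-integrable fund (fun p => (\1_(slab a b S) p)%:E).
Proof.
move=> ab S0; have ms := slab_measurable a b S; have mf := @fundamental_measurable R.
apply/integrableP; split.
  by apply/measurable_EFinP; apply: measurable_funTS; exact: measurable_indic.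
under eq_integral do rewrite gee0_abs ?lee_fin//.
have h : (l3 (slab a b S `&` fund) < +oo)%E by rewrite slab_volume// ltry.
by rewrite integral_indic.
Qed.

Lemma Rintegral_slab_indic a b S : a <= b -> 0 <= S ->
  \int[l3]_(p in fund) \1_(slab a b S) p = 2 * pi * (b - a) * (2 * S).
Proof.
move=> ab S0; rewrite /Rintegral integral_indic//; last 2 first.
- exact: fundamental_measurable.
- exact: slab_measurable.
exact: (congr1 fine (slab_volume ab S0)).
Qed.

Lemma integrable_slab (F : R3 -> R) a b S N : a <= b -> 0 <= S -> measurable_fun setT (F : R3 -> mR) ->
  (forall p, `|F p| <= N * \1_(slab a b S) p) -> l3.-integrable fund (EFin \o F).
Proof.
move=> ab S0 mF FN; have mfund := @fundamental_measurable R.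
have iN : l3.-integrable fund (fun p => (N%:E * (\1_(slab a b S) p)%:E)%E).
  by apply: integrableZl => //; exact: integrable_slab_indic.
apply: le_integrable iN => //; first by apply/measurable_EFinP; exact: measurable_funTS.
by move=> p _; rewrite -EFinM /= lee_fin (le_trans (FN p))// ler_norm.
Qed.

Lemma Rintegral_slab_le (F : R3 -> R) a b S N : a <= b -> 0 <= S -> measurable_fun setT (F : R3 -> mR) ->
  (forall p, `|F p| <= N * \1_(slab a b S) p) ->
  `|\int[l3]_(p in fund) F p| <= N * (2 * pi * (b - a) * (2 * S)).
Proof.
move=> ab S0 mF FN; have mfund := @fundamental_measurable R.
have i1 := integrable_slab ab S0 mF FN.
apply: (le_trans (le_normr_Rintegral mfund i1)).
have iN : l3.-integrable fund (fun p => (\1_(slab a b S) p)%:E) by exact: integrable_slab_indic.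
rewrite -Rintegral_slab_indic// -RintegralZl//; apply: le_Rintegral => //.
- exact: integrable_abse i1.
- by rewrite (_ : _ \o _ = fun p => (N%:E * (\1_(slab a b S) p)%:E)%E); [exact: integrableZl|].
Qed.

End Slabs.

(** * Limit of the leftover integral *)

Section Core.
Variable R : realType.
Local Notation mR := (measurableTypeR R).
Local Notation mu := (@lebesgue_measure R).
Local Notation l3 := (@leb3 R).
Local Notation fund := (@fundamental R).
Local Notation R3 := (mR * mR * mR)%type.
Local Notation R4 := ((mR * mR) * (mR * mR))%type.

Definition on_ads (x : R4) := @nsq R x.2 - @nsq R x.1 = -1.

Definition outside : set R3 := [set p | 0 < -1 + @nsq R (p.1.2, p.2) :> R].

Variables (Psi : R4 -> R) (M L S delta : R).
Hypotheses (mPsi : measurable_fun setT (Psi : R4 -> mR)) (PsiM : forall x, `|Psi x| <= M)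
  (PsiL : forall x y, on_ads x -> on_ads y -> `|Psi x - Psi y| <=
    L * (`|x.1.1 - y.1.1| + `|x.1.2 - y.1.2| + `|x.2.1 - y.2.1| + `|x.2.2 - y.2.2|))
  (PsiS : forall x, on_ads x -> Psi x != 0 -> -1 + delta <= x.1.1 /\ `|x.1.2| <= S)
  (S1 : 1 <= S) (L0 : 0 <= L).
Let kap := Psi ((1, 0), (0, 0)).

Lemma on_ads_cyl (p : R3) : 0 <= -1 + @nsq R (p.1.2, p.2) -> on_ads (cyl4 p).
Proof.
move=> E; rewrite /on_ads /cyl4 /nsq /= in E *; rewrite !exprMn !sqr_sqrtr//.
have := cos2Dsin2 p.1.1; nra.
Qed.

(** [Psi] is the test function in the frame of the base point, and [kap] its value there. Moving z
    to 1 with theta and s fixed changes the radius rho = sqrt(z^2 + s^2 - 1) into |s|, where |rho^2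
    - s^2| <= 3 eta^4. For |s| > 2 eta, division by rho + |s| gives 3/2 eta^3; for smaller |s| only
    2 eta^2 is available, but on a set of s of length 4 eta. Where the level z has no point, the
    point on the level 1 is within O(eta^2) of the base point, and [kap] compensates its value. *)
Lemma cyl_near (t z s eta : R) : 0 < eta <= 1/2 -> `|z - 1| <= eta ^+ 4 -> `|s| <= S ->
  `|\1_outside (t, z, s) * Psi (cyl4 (t, z, s)) - Psi (cyl4 (t, 1, s)) +
     (~~ (0 < -1 + @nsq R (z, s) :> R)%R)%:R * kap| <=
  6 * L * (eta ^+ 3 + eta ^+ 2 * (`|s| <= 2 * eta)%R%:R).
Proof.
move=> e1 ze sS; have e4 : 0 < eta ^+ 4 <= 1/16.
  have e2 : 0 < eta ^+ 2 <= 1/4 by nra.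
  by rewrite (_ : eta ^+ 4 = (eta ^+ 2) ^+ 2) -?exprM//; nra.
have e43 : eta ^+ 4 <= eta ^+ 3 by rewrite exprSr; have := exprn_ge0 3 (ltW (andP e1).1); nra.
have z1 : on_ads (cyl4 (t, 1, s)) by apply: on_ads_cyl; rewrite /nsq/=; have := sqr_ge0 s; lra.
have r1 : Num.sqrt (-1 + @nsq R ((1 : R), s)) = `|s|.
  by rewrite /nsq/= expr1n addrA addNr add0r sqrtr_sqr.
have zz : `|z ^+ 2 - 1| <= 3 * eta ^+ 4.
  rewrite (_ : _ - 1 = (z - 1) * (z + 1)); last by ring.
  rewrite normrM mulrC; apply: ler_pM => //.
  by move: ze; rewrite !ler_norml; lra.
have cs : `|cos t| <= 1 by rewrite ler_norml cos_geN1 cos_le1.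
have sn : `|sin t| <= 1 by rewrite ler_norml sin_geN1 sin_le1.
have eta3 : 0 < eta ^+ 3 by rewrite exprn_gt0//; lra.
have eta2 : 0 < eta ^+ 2 by rewrite exprn_gt0//; lra.
rewrite indicE; have [E|E] := ltP (0 : R) (-1 + @nsq R (z, s)); last first.
  rewrite memNset; last by rewrite /outside/=; apply/negP; rewrite -leNgt.
  have s2 : s ^+ 2 <= 3 * eta ^+ 4 by move: E zz; rewrite /nsq/= ler_norml; lra.
  have s3 : `|s| <= 2 * eta ^+ 2.
    rewrite -ler_sqr ?nnegrE ?normr_ge0//; last lra.
    by rewrite real_normK ?num_real// exprMn -exprM; lra.
  have -> : `|s| <= 2 * eta by nra.
  rewrite mul0r sub0r mul1r addrC mulr1.
  have := PsiL (_ : on_ads ((1, 0), (0, 0))) z1.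
  rewrite /on_ads/cyl4/= r1 /nsq/= expr0n expr1n => /(_ _)/le_trans; apply; first by rewrite !addr0 sub0r.
  rewrite subrr normr0 !sub0r !normrN !normrM normr_id add0r.
  have c1 := ler_wpM2l (normr_ge0 s) cs; have c2 := ler_wpM2l (normr_ge0 s) sn.
  have : `|s| + `|s| * `|cos t| + `|s| * `|sin t| <= 6 * eta ^+ 2 by lra.
  move=> h; rewrite (mulrC 6) -mulrA ler_wpM2l//; lra.
rewrite mem_set// mul1r mul0r addr0.
have zE : on_ads (cyl4 (t, z, s)) by apply: on_ads_cyl; exact: ltW.
have := PsiL zE z1; rewrite /cyl4/= r1 => /le_trans; apply.
set rho := Num.sqrt _.
have rho0 : 0 <= rho by exact: sqrtr_ge0.
have rho2 : rho ^+ 2 = -1 + (z ^+ 2 + s ^+ 2) by rewrite sqr_sqrtr// ltW.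
rewrite subrr normr0 addr0 -!mulrBl !normrM.
have rs : `|rho - `|s| | <= 3 * (eta ^+ 3 + eta ^+ 2 * (`|s| <= 2 * eta)%R%:R) / 2 + eta ^+ 2 * (`|s| <= 2 * eta)%R%:R.
  have f : `|rho - `|s| | * (rho + `|s|) <= 3 * eta ^+ 4.
    rewrite -(ger0_norm (addr_ge0 rho0 (normr_ge0 s))) -normrM.
    apply: le_trans zz; rewrite (_ : _ * _ = z ^+ 2 - 1)//.
    transitivity (rho ^+ 2 - `|s| ^+ 2); first by ring.
    by rewrite real_normK ?num_real// rho2; ring.
  have [hs|hs] := leP (`|s|) (2 * eta).
    rewrite mulr1; have h2 : `|rho - `|s| | <= 2 * eta ^+ 2.
      have : `|rho - `|s| | <= rho + `|s|.
        by rewrite (le_trans (ler_normB _ _))// normr_id ger0_norm.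
      have : 0 <= `|rho - `|s| | by exact: normr_ge0.
      move: f; rewrite (_ : eta ^+ 4 = (eta ^+ 2) ^+ 2); last by rewrite -exprM.
      have key (u v x : R) : 0 < x -> u * v <= 3 * x ^+ 2 -> 0 <= u -> u <= v -> u <= 2 * x.
        by move=> *; nra.
      exact: key.
    lra.
  rewrite mulr0 !addr0 ler_pdivlMr//; have eta0 : 0 < eta by case/andP : e1.
  rewrite -(ler_pM2r eta0) (_ : 3 * _ * _ = 3 * eta ^+ 4); last by rewrite [in RHS]exprS; ring.
  by apply: le_trans f; rewrite -mulrA ler_wpM2l//; lra.
set X := eta ^+ 3 + _ in rs *.
have c1 := ler_wpM2l (normr_ge0 (rho - `|s|)) cs; have c2 := ler_wpM2l (normr_ge0 (rho - `|s|)) sn.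
rewrite (mulrC 6) -mulrA ler_wpM2l//.
move: rs; rewrite /X; move: c1 c2; case: (`|s| <= 2 * eta) => c1 c2; rewrite ?mulr1 ?mulr0 ?addr0 => rs; lra.
Qed.

Lemma Rintegral_eq0 (D : set mR) (f : R -> R) : mu.-integrable D (EFin \o f) -> measurable D ->
  \int[mu]_(x in D) f x = 0 -> (\int[mu]_(x in D) (f x)%:E = 0)%E.
Proof.
move=> fi mD f0; have h := fineK (integrable_fin_num mD fi).
by transitivity (fine (\int[mu]_(x in D) (EFin \o f) x))%:E; [exact: esym|exact: congr1 f0].
Qed.

(** Allows a function of z to be replaced by its mean over the slab, against a factor that is
    constant in z. *)
Lemma slab_integral_z (a b c t s : R) (u : R -> R) : continuous u ->
  \int[mu]_(z in `[a, b]) u z = 0 ->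
  (\int[mu]_z (\1_(slab a b S) (t, z, s) * (u z * c))%:E = 0)%E.
Proof.
move=> cu u0; have [sS|sS] := leP `|s| S; last first.
  apply: integral0_eq => z _; rewrite indicE memNset ?mul0r//.
  by move=> [_]/=; rewrite leNgt sS.
have cuc : continuous (fun z => u z * c) by cnt.
rewrite -(Rintegral_eq0 (f := fun z => u z * c) (D := `[a, b])) //; last 2 first.
- exact: continuous_integrable_segment.
- rewrite RintegralZr ?u0 ?mul0r//; exact: continuous_integrable_segment.
rewrite [RHS]integral_mkcond; apply: eq_integral => z _; rewrite patchE indicE.
have [|] := boolP (z \in _).
  rewrite inE/= in_itv/= => zab; rewrite mem_set ?mul1r//.
rewrite notin_setE/= in_itv/= => zab; rewrite memNset ?mul0r//.
by move=> [].
Qed.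

(** The missing slice z^2 + s^2 <= 1 is the segment |s| <= sqrt(1 - z^2), a fraction sqrt(1 - z^2) /
    S of [- S, S]. For |z| > 1 it is empty, in accordance with the value 0 of the root of a negative
    number. *)
Lemma slab_integral_s (a b c t z : R) :
  (\int[mu]_s (\1_(slab a b S) (t, z, s) *
     (c * ((~~ (0 < -1 + @nsq R (z, s) :> R)%R)%:R - Num.sqrt (1 - z ^+ 2) / S)))%:E = 0)%E.
Proof.
have [zab|zab] := boolP (a <= z <= b); last first.
  apply: integral0_eq => s _; rewrite indicE memNset ?mul0r//.
  by move=> [] /=; rewrite (negbTE zab).
have S0 : 0 < S by rewrite (lt_le_trans _ S1).
set m := Num.sqrt _; have m0 : 0 <= m by exact: sqrtr_ge0.
have m1 : m <= 1.
  by rewrite -[leRHS]sqrtr1 ler_sqrt// ?ler01//; have := sqr_ge0 z; lra.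
pose D : set mR := [set s | ~~ (0 < -1 + @nsq R (z, s) :> R)].
have [mD vD] : measurable D /\ mu (D `&` `[- S, S]) = (2 * m)%:E.
  have [z1|z1] := leP (z ^+ 2) 1; last first.
    have -> : D = set0.
      apply/seteqP; split => // s; rewrite /D/= -leNgt /nsq/=; have := sqr_ge0 s; lra.
    by split => //; rewrite set0I measure0 /m ler0_sqrtr ?mulr0//; lra.
  have -> : D = `[- m, m]%classic.
    apply/seteqP; split => s; rewrite /D/= -leNgt /nsq/= in_itv/= -ler_norml.
      by move=> h; rewrite -ler_sqr ?nnegrE// real_normK ?num_real// sqr_sqrtr; lra.
    by rewrite -ler_sqr ?nnegrE// real_normK ?num_real// sqr_sqrtr; lra.
  split => //; rewrite setIidl; last first.
    by move=> s /=; rewrite !in_itv/= -!ler_norml => /le_trans; apply; exact: le_trans S1.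
  rewrite lebesgue_measure_itv/= lte_fin; case: ifPn => [_|]; first by rewrite -EFinB; congr (_%:E); ring.
  by rewrite -leNgt => h; have m00 : m = 0; [lra|rewrite m00 mulr0].
have vS : mu `[- S, S]%classic = (2 * S)%:E.
  by rewrite lebesgue_measure_itv/= lte_fin ifT; [by rewrite -EFinB; congr (_%:E); ring|lra].
have iD : mu.-integrable `[- S, S] (EFin \o (\1_D : mR -> R)).
  apply/integrableP; split.
    by apply/measurable_EFinP; apply: measurable_funTS; exact: measurable_indic.
  under eq_integral do rewrite gee0_abs ?lee_fin//.
  rewrite integral_indic//; have -> : (+oo : \bar R)%E = +oo%E by [].
  by apply: (@le_lt_trans _ _ (2 * m)%:E); [rewrite -vD|rewrite ltry].
have im : mu.-integrable `[- S, S] (EFin \o (fun=> m / S)).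
  apply: continuous_integrable_segment; exact: cntC.
have iDm : mu.-integrable `[- S, S] (EFin \o (fun s : R => \1_D s - m / S)) by exact: integrable_realB.
have iF : mu.-integrable `[- S, S] (EFin \o (fun s : R => c * (\1_D s - m / S))) by exact: integrable_realZ.
rewrite -(Rintegral_eq0 iF) //; last first.
  rewrite RintegralZl// RintegralB// Rintegral_cst//.
  have -> : \int[mu]_(x in `[- S, S]) \1_D x = 2 * m.
    by rewrite /Rintegral integral_indic//; exact: (congr1 fine vD).
  have -> : fine (mu `[- S, S]) = 2 * S by exact: (congr1 fine vS).
  rewrite (_ : _ - _ = 0) ?mulr0//; field; by rewrite gt_eqF.
rewrite [RHS]integral_mkcond; apply: eq_integral => s _; rewrite patchE indicE.
have [|] := boolP (s \in _).
  rewrite inE/= in_itv/= -ler_norml => sS; rewrite mem_set ?mul1r//=.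
  rewrite [\1_D s]indicE; have -> : (s \in D) = ~~ (0 < -1 + @nsq R (z, s) :> R) by apply/idP/idP; rewrite inE.
  by [].
rewrite notin_setE/= in_itv/= -ler_norml => sS; rewrite memNset ?mul0r//.
by move=> [].
Qed.

Section Limit.
Variables (V V1 V2 W : R -> R) (C d0 g : R).
Hypothesis sg : singular V V1 V2 W C d0 g delta.

Local Ltac keep := clear -mPsi PsiM PsiL PsiS S1 L0 sg kap.

(** The integrand [F0] is [F1] - [F2] up to the error of [cyl_near], whose integral is O(eta^(-6)
    eta^4 eta^3). In [F1] the test function is frozen at z = 1, so k can be replaced by its mean I /
    (2 d), which the first moment makes small. In [F2] averaging over s turns the indicator of the
    missing slice into sqrt(1 - z^2) / S, and averaging over z leaves the second moment J, close to
    - g. *)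
Lemma core_limit : exists A, forall eta, 0 < eta <= 1/2 -> eta ^+ 4 <= d0 ->
  `|\int[l3]_(p in fund) (\1_outside p * (cutk V V1 V2 W (eta ^+ 4) p.1.2 * Psi (cyl4 p))) -
    4 * pi * g * kap| <= A * eta.
Proof.
pose K0 : R := (2 * (3 * (36 * 8) * 8) + 3 * (36 * 48) * 2 + 6 * (36 * 8) * 2) * C.
(* The three summands bound the error of freezing z at 1, the contribution of the first moment, and
   the deviation of the second moment from - g. *)
exists (K0 * (6 * L) * (8 * pi * S + 16 * pi) + 4 * pi * S * M * ((36 * 8 + 1) * C)
  + 4 * pi * `|kap| * ((36 * 2 + 1) * C)) => eta e1 ed.
have [eta0 eta2] := andP e1.
have S0 : 0 < S by rewrite (lt_le_trans _ S1).
have M0 : 0 <= M by exact: le_trans (normr_ge0 _) (PsiM ((1, 0), (0, 0))).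
have [/andP[d0p d0l] C0 /andP[dl0 dl]] := And3 (sg_d0 sg) (sg_C sg) (sg_delta sg).
have pi0 := @pi_gt0 R.
pose w := eta ^+ 2; pose d := eta ^+ 4.
have w0 : 0 < w by rewrite exprn_gt0.
have we : w <= eta by rewrite /w expr2 ger_pMl//; lra.
have dw : w ^+ 2 = d by rewrite -exprM.
have dp : 0 < d by rewrite exprn_gt0.
have wd : w ^+ 2 <= d0 by rewrite dw.
have dd : 1 - d <= 1 + d by lra.
have dn : d != 0 by rewrite gt_eqF.
have e20 : 0 <= 2 * eta by move: eta0; keep => *; lra.
have v : mu `[1 - d, 1 + d]%classic = (2 * d)%:E.
  by rewrite lebesgue_measure_itv/= lte_fin ifT; [rewrite -EFinB; congr (_%:E); ring|move: dp; keep => *; lra].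
have Sn : S != 0 by rewrite gt_eqF.
rewrite -/d; pose k := cutk V V1 V2 W d; rewrite -/k.
have ck : continuous k by apply: (cutk_continuous sg).
have bk z : `|z - 1| <= d -> `|k z| <= K0 / w ^+ 3.
  by move=> zd; rewrite ler_pdivlMr ?exprn_gt0// /k -dw; apply: (cutk_bound sg) => //; rewrite dw.
have mk : measurable_fun setT (k : mR -> mR) by exact: continuous_measurable_fun.
pose m (z : R) := Num.sqrt (1 - z ^+ 2).
have cm : continuous m by rewrite /m; cnt.
have mm : measurable_fun setT (m : mR -> mR) by exact: continuous_measurable_fun.
pose I := \int[mu]_(z in `[1 - d, 1 + d]) k z.
pose J := \int[mu]_(z in `[1 - d, 1 + d]) (k z * m z).
have bI : `|I| <= (36 * 8 + 1) * C * w.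
  by have := cutk_integral sg w0 wd; rewrite dw.
(* Beyond 1 the root is that of a negative number, hence 0, and J reduces to the moment over
   [1 - d, 1]. *)
have bJ : `|J + g| <= (36 * 2 + 1) * C * w.
  have := cutk_integral_sqrt sg w0 wd; rewrite dw; congr (`|_ + g| <= _).
  rewrite /J Rintegral_mkcond [RHS]Rintegral_mkcond; apply: eq_Rintegral => z _.
  rewrite !patchE; case: ifPn; case: ifPn => //; rewrite ?inE ?notin_setE/= !in_itv/=.
    by move=> h h'; exfalso; apply: h; lra.
  move=> h' h; rewrite /m ler0_sqrtr ?mulr0//.
  have : 1 < z by rewrite ltNge; apply/negP => z1; apply: h; case/andP: h' => -> _.
  by move=> ?; nra.
have mQ (a b s : R) : measurable_fun setT (\1_(slab a b s) : R3 -> mR).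
  by apply: measurable_indic; exact: slab_measurable.
pose Q : R3 -> mR := \1_(slab (1 - d) (1 + d) S).
pose Q2 : R3 -> mR := \1_(slab (1 - d) (1 + d) (2 * eta)).
have mQ1 : measurable_fun setT Q by exact: mQ.
have mQ2 : measurable_fun setT Q2 by exact: mQ.
have mE : measurable outside.
  rewrite -[X in measurable X]setTI.
  have h : measurable_fun setT (fun p : R3 => -1 + @nsq R (p.1.2, p.2) : mR)%R by rewrite /nsq/=; mfun.
  exact: (measurable_fun_ltr (measurable_cst _) h measurableT (Y := [set true])).
have m1E : measurable_fun setT (\1_outside : R3 -> mR) by exact: measurable_indic.
have mG : measurable_fun setT (Psi \o (@cyl4 R) : R3 -> mR).
  by apply: measurableT_comp mPsi _; exact: cyl4_measurable.
have mG1 : measurable_fun setT (fun p : R3 => Psi (cyl4 (p.1.1, 1, p.2)) : mR).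
  have h : measurable_fun setT (fun p : R3 => (p.1.1, (1 : R) : mR, p.2) : R3) by mfun.
  exact: (measurableT_comp mG h).
have mkp : measurable_fun setT (fun p : R3 => k p.1.2 : mR).
  by apply: (measurableT_comp mk (g := fun p : R3 => p.1.2)); mfun.
have mmp : measurable_fun setT (fun p : R3 => m p.1.2 : mR).
  by apply: (measurableT_comp mm (g := fun p : R3 => p.1.2)); mfun.
have mN : measurable_fun setT (fun p : R3 => (~~ (0 < -1 + @nsq R (p.1.2, p.2) :> R)%R)%:R : mR).
  rewrite (_ : (fun p : R3 => _) = \1_(~` outside)); last first.
    apply/funext => p; rewrite indicE; congr ((nat_of_bool _)%:R : R).
    by apply/idP/idP; rewrite inE/= => /negP.
  by apply: measurable_indic; exact: measurableC.
pose F0 (p : R3) : mR := \1_outside p * (k p.1.2 * Psi (cyl4 p)).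
pose F1 (p : R3) : mR := Q p * (k p.1.2 * Psi (cyl4 (p.1.1, 1, p.2))).
pose F2 (p : R3) : mR := Q p * (k p.1.2 * ((~~ (0 < -1 + @nsq R (p.1.2, p.2) :> R)%R)%:R * kap)).
pose G1 (p : R3) : mR := Q p * (I / (2 * d) * Psi (cyl4 (p.1.1, 1, p.2))).
pose G2 (p : R3) : mR := Q p * (k p.1.2 * m p.1.2 * (kap / S)).
pose H2 (p : R3) : mR := Q p * (J / (2 * d) * (kap / S)).
have mF0 : measurable_fun setT F0.
  by apply: measurable_funM => //; apply: measurable_funM.
have mF1 : measurable_fun setT F1.
  by apply: measurable_funM => //; apply: measurable_funM.
have mF2 : measurable_fun setT F2.
  by apply: measurable_funM => //; apply: measurable_funM => //; apply: measurable_funM.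
have mG1' : measurable_fun setT G1.
  by apply: measurable_funM => //; apply: measurable_funM.
have mG2 : measurable_fun setT G2.
  by apply: measurable_funM => //; apply: measurable_funM => //; apply: measurable_funM.
have mH2 : measurable_fun setT H2.
  by apply: measurable_funM => //; exact: measurable_cst.
pose Kb := K0 / w ^+ 3.
have K00 : 0 <= K0 by apply: mulr_ge0 => //; lra.
have Kb0 : 0 <= Kb by apply: divr_ge0 => //; rewrite exprn_ge0// ltW.
have inQ (p : R3) : slab (1 - d) (1 + d) S p -> Q p = 1 by move=> h; rewrite /Q indicE mem_set.
have outQ (p : R3) : ~ slab (1 - d) (1 + d) S p -> Q p = 0 by move=> h; rewrite /Q indicE memNset.
have slab_d (p : R3) : slab (1 - d) (1 + d) S p -> `|p.1.2 - 1| <= d.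
  by move=> [h _]; rewrite ler_norml; move: h; keep => *; lra.
(* Off the slab, either |s| > S or z < -1 + delta and the test function vanishes, or k vanishes by
   the equation. *)
have out0 (p : R3) : ~ slab (1 - d) (1 + d) S p -> F0 p = 0.
  move=> np; rewrite /F0 indicE; have [|po] := boolP (p \in outside); last by rewrite mul0r.
  rewrite inE => po; rewrite mul1r; have [->|P0] := eqVneq (Psi (cyl4 p)) 0; first by rewrite mulr0.
  have [zd sS] := PsiS (on_ads_cyl (ltW po)) P0; rewrite /= in zd sS.
  rewrite /k (cutk_far sg dp zd) ?mul0r// leNgt; apply/negP => zd'; apply: np; split => //.
  by move: zd'; rewrite ltr_norml; keep => *; lra.
have bndQ (F : R3 -> R) N : (forall p, slab (1 - d) (1 + d) S p -> `|F p| <= N) ->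
    (forall p, ~ slab (1 - d) (1 + d) S p -> F p = 0) -> forall p, `|F p| <= N * Q p.
  move=> h1 h2 p; have [h|h] := pselect (slab (1 - d) (1 + d) S p).
    by rewrite inQ// mulr1; exact: h1.
  by rewrite h2// outQ// normr0 mulr0.
have bF0 : forall p, `|F0 p| <= (Kb * M) * Q p.
  apply: bndQ => // p sp; rewrite /F0 normrM -[leRHS]mul1r; apply: ler_pM => //.
    by rewrite indicE; case: (_ \in _); rewrite ?normr1 ?normr0.
  by rewrite normrM; apply: ler_pM => //; apply: bk; exact: slab_d.
have bF1 : forall p, `|F1 p| <= (Kb * M) * Q p.
  apply: bndQ => p sp; last by rewrite /F1 outQ ?mul0r.
  by rewrite /F1 inQ// mul1r normrM; apply: ler_pM => //; apply: bk; exact: slab_d.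
have bF2 : forall p, `|F2 p| <= (Kb * `|kap|) * Q p.
  apply: bndQ => p sp; last by rewrite /F2 outQ ?mul0r.
  rewrite /F2 inQ// mul1r normrM; apply: ler_pM => //; first by apply: bk; exact: slab_d.
  by rewrite normrM ler_piMl//; case: (~~ _); rewrite ?normr1 ?normr0.
have bG1 : forall p, `|G1 p| <= (`|I| / (2 * d) * M) * Q p.
  apply: bndQ => p sp; last by rewrite /G1 outQ ?mul0r.
  rewrite /G1 inQ// mul1r normrM; apply: ler_pM => //.
  by rewrite normrM (gtr0_norm (x := _^-1))// invr_gt0; move: dp; keep => *; lra.
have bG2 : forall p, `|G2 p| <= (Kb * `|kap / S|) * Q p.
  apply: bndQ => p sp; last by rewrite /G2 outQ ?mul0r.
  rewrite /G2 inQ// mul1r normrM ler_wpM2r// normrM -[leRHS]mulr1; apply: ler_pM => //.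
    by apply: bk; exact: slab_d.
  rewrite ger0_norm ?sqrtr_ge0// -[leRHS]sqrtr1 ler_sqrt// ?ler01//.
  by have s2 := sqr_ge0 p.1.2; move: s2; keep => *; lra.
have bH2 : forall p, `|H2 p| <= `|J / (2 * d) * (kap / S)| * Q p.
  apply: bndQ => p sp; last by rewrite /H2 outQ ?mul0r.
  by rewrite /H2 inQ// mul1r.
have iQ F N := @integrable_slab R F (1 - d) (1 + d) S N dd (ltW S0).
have iF0 := iQ _ _ mF0 bF0; have iF1 := iQ _ _ mF1 bF1; have iF2 := iQ _ _ mF2 bF2.
have iG1 := iQ _ _ mG1' bG1; have iG2 := iQ _ _ mG2 bG2; have iH2 := iQ _ _ mH2 bH2.
have mfund := @fundamental_measurable R.
have eq_int (F G : R3 -> R) : measurable_fun setT (F : R3 -> mR) -> measurable_fun setT (G : R3 -> mR) ->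
    l3.-integrable fund (EFin \o F) -> l3.-integrable fund (EFin \o G) ->
    (forall t s : R, (\int[mu]_z (F (t, z, s) - G (t, z, s))%:E = 0)%E) \/
    (forall t z : R, (\int[mu]_s (F (t, z, s) - G (t, z, s))%:E = 0)%E) ->
    \int[l3]_(p in fund) F p = \int[l3]_(p in fund) G p.
  move=> mF mG' iF iG h; apply/eqP; rewrite -subr_eq0 -RintegralB//; apply/eqP.
  rewrite /Rintegral (fund_integral0 (f := fun p => F p - G p))//.
  - exact: measurable_funB.
  - exact: integrable_realB.
  - by case: h => h; [apply: Or32|apply: Or33].
have E1 : \int[l3]_(p in fund) F1 p = \int[l3]_(p in fund) G1 p.
  apply: eq_int => //; left => t s.
  have cu : continuous (fun z => k z - I / (2 * d)) by cnt.
  have u0 : \int[mu]_(z in `[1 - d, 1 + d]) (k z - I / (2 * d)) = 0.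
    rewrite RintegralB//; [|exact: continuous_integrable_segment..|].
    by rewrite Rintegral_cst// -/I (_ : fine _ = 2 * d); [field|exact: (congr1 fine v)].
    by apply: continuous_integrable_segment; exact: cntC.
  rewrite -(@slab_integral_z (1 - d) (1 + d) (Psi (cyl4 (t, 1, s))) t s _ cu u0).
  by apply: eq_integral => z _; rewrite /F1 /G1 /Q /=; congr (_%:E); ring.
have E2 : \int[l3]_(p in fund) F2 p = \int[l3]_(p in fund) G2 p.
  apply: eq_int => //; right => t z.
  rewrite -(@slab_integral_s (1 - d) (1 + d) (k z * kap) t z).
  by apply: eq_integral => s _; rewrite /F2 /G2 /Q /m /=; congr (_%:E); ring.
have E3 : \int[l3]_(p in fund) G2 p = \int[l3]_(p in fund) H2 p.
  apply: eq_int => //; left => t s.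
  have ckm : continuous (fun z => k z * m z) by cnt.
  have cu : continuous (fun z => k z * m z - J / (2 * d)) by cnt.
  have u0 : \int[mu]_(z in `[1 - d, 1 + d]) (k z * m z - J / (2 * d)) = 0.
    rewrite RintegralB//; [|exact: continuous_integrable_segment..|].
    by rewrite Rintegral_cst// -/J (_ : fine _ = 2 * d); [field|exact: (congr1 fine v)].
    by apply: continuous_integrable_segment; exact: cntC.
  rewrite -(@slab_integral_z (1 - d) (1 + d) (kap / S) t s _ cu u0).
  by apply: eq_integral => z _; rewrite /G2 /H2 /Q /=; congr (_%:E); ring.
have iQ1 : l3.-integrable fund (EFin \o Q) by exact: (integrable_slab_indic dd (ltW S0)).
have iQ2 : l3.-integrable fund (EFin \o Q2) by exact: (integrable_slab_indic dd e20).
have vQ1 : \int[l3]_(p in fund) Q p = 2 * pi * ((1 + d) - (1 - d)) * (2 * S).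
  exact: (Rintegral_slab_indic dd (ltW S0)).
have vQ2 : \int[l3]_(p in fund) Q2 p = 2 * pi * ((1 + d) - (1 - d)) * (2 * (2 * eta)).
  exact: (Rintegral_slab_indic dd e20).
have E4 : \int[l3]_(p in fund) H2 p = 4 * pi * kap * J.
  have -> : H2 = fun p => (J / (2 * d) * (kap / S)) * Q p by apply/funext => p; rewrite /H2 mulrC.
  by rewrite RintegralZl// vQ1; field; rewrite dn Sn.
have B1 : `|\int[l3]_(p in fund) G1 p| <= 4 * pi * S * M * `|I|.
  apply: (le_trans (Rintegral_slab_le dd (ltW S0) mG1' bG1)).
  rewrite le_eqVlt; apply/orP; left; apply/eqP; field; exact: dn.
have be p : `|F0 p - F1 p + F2 p| <= Kb * (6 * L) * (eta ^+ 3 * Q p + eta ^+ 2 * Q2 p).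
  have [sp|sp] := pselect (slab (1 - d) (1 + d) S p); last first.
    rewrite out0// /F1 /F2 outQ// !mul0r subr0 addr0 normr0.
    apply: mulr_ge0; first by rewrite mulr_ge0// mulr_ge0.
    rewrite mulr0 add0r; apply: mulr_ge0; first by rewrite exprn_ge0// ltW.
    by rewrite /Q2 indicE ler0n.
  rewrite /F0 /F1 /F2 inQ// !mul1r mulr1.
  have -> : Q2 p = (`|p.2| <= 2 * eta)%R%:R.
    rewrite /Q2 indicE; congr ((nat_of_bool _)%:R); apply/idP/idP; rewrite inE; first by case.
    by move=> h; split => //; case: sp.
  rewrite mulrCA -mulrBr -mulrDr normrM -[leRHS]mulrA; apply: ler_pM => //.
    by apply: bk; exact: slab_d.
  case: p sp => [[t z] s] sp; apply: (cyl_near _ e1); first exact: (slab_d _ sp).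
  by case: sp.
have iE : l3.-integrable fund (EFin \o (fun p => F0 p - F1 p + F2 p)).
  by apply: integrable_realD => //; exact: integrable_realB.
have iR : l3.-integrable fund (EFin \o (fun p => eta ^+ 3 * Q p + eta ^+ 2 * Q2 p)).
  by apply: integrable_realD => //; exact: integrable_realZ.
have EE : `|\int[l3]_(p in fund) F0 p - \int[l3]_(p in fund) F1 p + \int[l3]_(p in fund) F2 p| <=
    K0 * (6 * L) * (8 * pi * S + 16 * pi) * eta.
  rewrite -RintegralB// -RintegralD//; last exact: integrable_realB.
  apply: (le_trans (le_normr_Rintegral mfund iE)).
  apply: (@le_trans _ _ (\int[l3]_(p in fund) (Kb * (6 * L) * (eta ^+ 3 * Q p + eta ^+ 2 * Q2 p)))).
    apply: le_Rintegral => //; first exact: integrable_abse iE.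
    exact: integrable_realZ.
  rewrite RintegralZl// RintegralD//; [|exact: integrable_realZ..].
  rewrite !RintegralZl// vQ1 vQ2 /Kb /d /w -exprM.
  rewrite le_eqVlt; apply/orP; left; apply/eqP; field; by rewrite gt_eqF.
have X : \int[l3]_(p in fund) F0 p - 4 * pi * g * kap =
  (\int[l3]_(p in fund) F0 p - \int[l3]_(p in fund) F1 p + \int[l3]_(p in fund) F2 p)
  + \int[l3]_(p in fund) G1 p - 4 * pi * kap * (J + g).
  by rewrite E1 E2 E3 E4; ring.
rewrite X; apply: (le_trans (ler_normB _ _)); rewrite [leRHS]mulrDl [Z in _ <= Z + _]mulrDl.
apply: lerD; last first.
  rewrite normrM (_ : `|4 * pi * kap| = 4 * pi * `|kap|); last by rewrite normrM gtr0_norm// mulr_gt0.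
  rewrite -[leRHS]mulrA; apply: ler_wpM2l; first by rewrite mulr_ge0// mulr_ge0// ltW.
  apply: (le_trans bJ); apply: ler_wpM2l; first by apply: mulr_ge0 => //; lra.
  exact: we.
apply: (le_trans (ler_normD _ _)); apply: lerD => //.
apply: (le_trans B1); rewrite -[leRHS]mulrA; apply: ler_wpM2l.
  by rewrite mulr_ge0// mulr_ge0 ?ltW// mulr_gt0// mulr_gt0.
apply: (le_trans bI); apply: ler_wpM2l; first by apply: mulr_ge0 => //; lra.
exact: we.
Qed.

End Limit.
End Core.

Lemma cnt_pair (T U V : topologicalType) (f : T -> U) (g : T -> V) :
  continuous f -> continuous g -> continuous (fun x => (f x, g x)).
Proof.
move=> cf cg x.
exact: (@cvg_pair _ _ _ (nbhs x) (nbhs (f x)) (nbhs (g x)) _ _ _ f g (cf x) (cg x)).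
Qed.

(** * Reduction to the base point by isometries *)

Section Argument.
Variable R : realType.
Local Notation mR := (measurableTypeR R).

(** The polar angle by the half-angle formula, with values in [- pi, pi]. Away from the origin the
    denominator vanishes exactly on the half-axis that is treated apart. *)
Definition arg (q : mR * mR) : mR :=
  if (q.2 == 0 :> R) && (q.1 < 0 :> R) then pi else 2 * atan (q.2 / (Num.sqrt (nsq q) + q.1)).

Lemma arg_measurable : measurable_fun setT arg.
Proof.
have m1 : measurable_fun setT (fst : mR * mR -> mR) by exact: measurable_fst.
have m2 : measurable_fun setT (snd : mR * mR -> mR) by exact: measurable_snd.
apply: measurable_fun_ifT; [|exact: measurable_cst|].
  apply: measurable_and; last by exact: measurable_fun_ltr.
  by apply: (@measurable_fun_eqr _ _ R setT (snd : mR * mR -> mR) (fun=> (0 : R) : mR)).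
have ma : measurable_fun setT (atan : mR -> mR).
  by apply: continuous_measurable_fun => x; exact: continuous_atan.
have mf : measurable_fun setT (fun q : mR * mR => q.2 / (Num.sqrt (nsq q) + q.1) : mR).
  by rewrite /nsq; mfun.
have h := measurableT_comp ma mf.
by apply: measurable_funM => //; exact: measurable_cst.
Qed.

(** With u the tangent of the half angle, the squared cosine of the half angle is (r + x) / (2 r);
    the duplication formulas do the rest. *)
Lemma argP (q : mR * mR) : 0 < nsq q :> R ->
  [/\ Num.sqrt (nsq q) * cos (arg q) = q.1, Num.sqrt (nsq q) * sin (arg q) = q.2
    & - pi <= arg q <= pi].
Proof.
case: q => x y; rewrite /arg; set r := Num.sqrt _ => n0 /=.
have r0 : 0 < r by rewrite sqrtr_gt0.
have r2 : r ^+ 2 = x ^+ 2 + y ^+ 2 by rewrite sqr_sqrtr// ltW.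
have pi0 := @pi_gt0 R.
case: ifPn => [/andP[/eqP y0 x0]|h].
  rewrite cospi sinpi mulr0 y0; split => //; last by lra.
  have : r = - x by apply/eqP; rewrite -(eqrXn2 (n := 2)) ?ltW ?oppr_gt0// r2 y0; apply/eqP; ring.
  by move=> ->; ring.
have rx : 0 < r + x.
  have rx : `|x| <= r.
    by rewrite -ler_sqr ?nnegrE ?(ltW r0)// real_normK ?num_real// r2 lerDl sqr_ge0.
  have [x0|x0] := leP 0 x; first by lra.
  move: h; rewrite x0 andbT => y0.
  have : `|x| < r.
    rewrite -ltr_sqr ?nnegrE ?(ltW r0)// real_normK ?num_real// r2 ltrDl lt0r sqr_ge0 andbT.
    by rewrite expf_neq0.
  by rewrite ltr0_norm//; lra.
set u := y / _; pose a := atan u.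
have c2 : cos a ^+ 2 = (r + x) / (2 * r).
  rewrite cos_atan exprVn sqr_sqrtr; last by have := sqr_ge0 u; lra.
  have -> : 1 + u ^+ 2 = (2 * r) / (r + x).
    have -> : 1 + u ^+ 2 = ((r + x) ^+ 2 + y ^+ 2) / (r + x) ^+ 2 by rewrite /u; field; rewrite gt_eqF.
    have -> : (r + x) ^+ 2 + y ^+ 2 = 2 * r * (r + x).
      by rewrite sqrrD -addrA -addrA -r2 -mulr_natl; ring.
    by field; rewrite gt_eqF.
  by rewrite invf_div.
have ca : cos a != 0 by rewrite -sqrf_eq0 c2 gt_eqF// divr_gt0// mulr_gt0.
have sa : sin a = cos a * u by rewrite -(atanK u) -/a /tan mulrC divfK.
have -> : 2 * atan u = a *+ 2 by rewrite mulr2n -/a mulrDl !mul1r.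
rewrite cos_mulr2n sin_mulr2n sa mulrA -expr2 c2; split.
- by rewrite -mulr_natl; field; rewrite gt_eqF.
- by rewrite -mulr_natl /u; field; rewrite !gt_eqF.
- by have := atan_gtNpi2 u; have := atan_ltpi2 u; rewrite -/a; lra.
Qed.

(** The angles to be compared are less than 3 pi apart: an angle of the fundamental domain and a
    value of [arg], or two values of [arg]. One of three shifts brings them within pi. *)
Lemma lift_near (t t' : R) : `|t - t'| < 3 * pi ->
  exists2 k : R, k \in [:: - (2 * pi); 0; 2 * pi] & `|t - (t' + k)| <= pi.
Proof.
have pi0 := @pi_gt0 R; rewrite ltr_norml => /andP[h1 h2].
have [h3|h3] := leP `|t - t'| pi; first by exists 0; rewrite ?addr0// !inE eqxx orbT.
have [h4|h4] := leP 0 (t - t').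
  exists (2 * pi); first by rewrite !inE eqxx !orbT.
  by move: h3; rewrite ger0_norm// ler_norml; lra.
exists (- (2 * pi)); first by rewrite !inE eqxx.
by move: h3; rewrite ltr0_norm// ler_norml; lra.
Qed.

(** By the mean value theorem sin |x| = |x| cos c with 0 < c < |x|, and cos c > 1/2 because cosine
    decreases on [0, pi]. *)
Lemma angle_le_sin (x : R) : `|x| <= pi -> 1/2 <= cos x -> `|x| <= 2 * `|sin x|.
Proof.
move=> xp cx; have [->|x0] := eqVneq x 0; first by rewrite sin0 normr0 mulr0.
have a0 : 0 < `|x| by rewrite normr_gt0.
have [c] := MVT a0 (fun y _ => is_derive_sin y) (continuous_subspaceT (@continuous_sin R)).
rewrite in_itv/= sin0 !subr0 => /andP[c0 cx'] E.
have cc : cos `|x| < cos c by rewrite ltr_cos// in_itv/= ?normr_ge0// ?(ltW c0)//= ltW// (lt_le_trans cx').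
rewrite cos_norm in cc.
have : `|x| <= 2 * sin `|x| by rewrite E; nra.
move=> /le_trans; apply; rewrite ler_pM2l//.
by case: (ger0P x) => _; rewrite ?sinN ?ler_norm// -normrN ler_norm.
Qed.

(** The projection of the hyperboloid to the negative plane avoids the open unit disc, and for radii
    r, r' >= 1 the chord controls the angle. A distance below 1/2 forces the cosine of the
    difference above 1/2. *)
Lemma angle_le_dist (r r' t t' m m' : R) : 0 <= r -> 0 <= r' -> r ^+ 2 = 1 + m -> r' ^+ 2 = 1 + m' ->
  0 <= m -> 0 <= m' -> `|t - t'| <= pi ->
  `|r * cos t - r' * cos t'| + `|r * sin t - r' * sin t'| < 1/2 ->
  `|t - t'| <= 2 * (`|r * cos t - r' * cos t'| + `|r * sin t - r' * sin t'|).
Proof.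
move=> r0 r0' q1 q2 m0 m0' kd.
have r1 : 1 <= r by nra.
have r1' : 1 <= r' by nra.
have rr : 1 <= r * r' by nra.
pose c := cos (t - t'); pose s := sin (t - t').
have cs : c ^+ 2 + s ^+ 2 = 1 by exact: cos2Dsin2.
have cl : c <= 1 by exact: cos_le1.
(* Law of cosines, with (r - r')^2 split off. *)
have E : (r - r') ^+ 2 + 2 * (r * r') * (1 - c) =
    (r * cos t - r' * cos t') ^+ 2 + (r * sin t - r' * sin t') ^+ 2.
  rewrite /c cosB; have c1' := cos2Dsin2 t; have c2' := cos2Dsin2 t'.
  transitivity (r ^+ 2 * (cos t ^+ 2 + sin t ^+ 2) + r' ^+ 2 * (cos t' ^+ 2 + sin t' ^+ 2)
     - 2 * (r * r') * (cos t * cos t' + sin t * sin t')); last by ring.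
  by rewrite c1' c2'; ring.
have S1 := real_normK (num_real (r * cos t - r' * cos t')).
have S2 := real_normK (num_real (r * sin t - r' * sin t')).
have D10 := normr_ge0 (r * cos t - r' * cos t'); have D20 := normr_ge0 (r * sin t - r' * sin t').
rewrite -S1 -S2 in E; move: E D10 D20 => {S1 S2 q1 q2 m0 m0'}.
set D1 := `|_ - _|; set D2 := `|r * sin t - _| => E D10 D20 small.
have E2 : 2 * (1 - c) <= D1 ^+ 2 + D2 ^+ 2 by rewrite -E; have := sqr_ge0 (r - r'); nra.
have c12 : 1/2 <= c by move: E2 small D10 D20; clear; nra.
apply: (le_trans (angle_le_sin kd c12)); rewrite ler_pM2l//.
rewrite -ler_sqr ?nnegrE ?addr_ge0// real_normK ?num_real// -/s.
have -> : s ^+ 2 = (1 - c) * (1 + c) by rewrite -[LHS](addKr (c ^+ 2)) cs; ring.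
by move: E2 cl c12 D10 D20; clear; nra.
Qed.

End Argument.

(** * Lipschitz continuity of test functions in the ambient coordinates *)

Section LipschitzLift.
Variable R : realType.
Local Notation mR := (measurableTypeR R).
Local Notation R3 := (mR * mR * mR)%type.
Local Notation R4 := ((mR * mR) * (mR * mR))%type.
Local Notation e0 := (@pbasis R (inord 0)).
Local Notation e1 := (@pbasis R (inord 1)).
Local Notation e2 := (@pbasis R (inord 2)).

Variables (f f0 f1 f2 : R * R * R -> R) (B : R).
Hypotheses (d0 : forall p, is_derive p e0 f (f0 p)) (d1 : forall p, is_derive p e1 f (f1 p))
  (d2 : forall p, is_derive p e2 f (f2 p)) (cf : continuous f) (c0 : continuous f0)
  (c1 : continuous f1) (c2 : continuous f2) (sf : bsupp f B)
  (pf : forall t a b, f (t + 2 * pi, a, b) = f (t, a, b)).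

(** The range |t| <= 4 pi leaves room for a value of [arg] shifted by a period. The bound on the
    standard box is transported by t |-> 4 t - 4 pi, which maps [0, 2 pi] onto [- 4 pi, 4 pi]. *)
Lemma bounded_long_box (h : R * R * R -> R) : continuous h -> bsupp h B ->
  exists2 M, 0 <= M & forall p, `|p.1.1| <= 4 * pi -> `|h p| <= M.
Proof.
move=> ch sh.
pose g (p : R * R * R) := h (4 * p.1.1 - 4 * pi, p.1.2, p.2).
have cg : continuous g.
  have cc : continuous (fun p : R * R * R => 4 * p.1.1 - 4 * pi) by cnt.
  move=> p; apply: (@continuous_comp _ _ _ (fun p : R * R * R => (4 * p.1.1 - 4 * pi, p.1.2, p.2)) h); last exact: ch.
  by apply: cnt_pair; [apply: cnt_pair; [exact: cc|exact: cnt_co1]|exact: cnt_co2].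
have [M M0 hM] := continuous_box_bounded B cg.
exists M => // -[[t a] b] /= tp.
have [->|h0] := eqVneq (h (t, a, b)) 0; first by rewrite normr0.
have [ha hb] := sh _ h0.
have := hM ((t + 4 * pi) / 4, a, b); rewrite /g /= (_ : 4 * ((t + 4 * pi) / 4) - 4 * pi = t); last by field.
by apply; split => //=; move: tp; rewrite ler_norml; lra.
Qed.

Lemma line_lipschitz (i : 'I_3) (h : R * R * R -> R) (dh : R * R * R -> R) (M : R) (p : R * R * R) (x y : R) :
  (forall p, is_derive p (pbasis R i) h (dh p)) ->
  (forall s, (x <= s <= y) || (y <= s <= x) -> `|dh ((s - co i p) *: pbasis R i + p)| <= M) ->
  `|h ((x - co i p) *: pbasis R i + p) - h ((y - co i p) *: pbasis R i + p)| <= M * `|x - y|.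
Proof.
move=> dhp; wlog xy : x y / x <= y.
  move=> w hM; have [xy|/ltW yx] := leP x y; first exact: w.
  by rewrite distrC (distrC x); apply: w => // s hs; apply: hM; rewrite orbC.
move=> hM; move: xy; rewrite le_eqVlt => /predU1P[->|xy].
  by rewrite !subrr normr0 mulr0.
pose u (s : R) := h ((s - co i p) *: pbasis R i + p).
have du s : is_derive s (1 : R) u (dh ((s - co i p) *: pbasis R i + p)).
  apply/(@is_derive_lineP R _ _ u s 1 _ 0).
  have /(is_derive_lineP _ _ _ _ 0) := dhp ((s - co i p) *: pbasis R i + p).
  congr (is_derive _ _ _ _); apply/funext => z; congr h.
  by rewrite addrA -scalerDl [_ *: (1 : R)]mulr1 !subr0 addrA.
have cu : continuous u by move=> s; exact: is_derive_continuous (du s).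
have [c] := MVT xy (fun s _ => du s) (continuous_subspaceT cu).
rewrite in_itv/= => /andP[xc cy] E.
rewrite distrC (distrC x) -/(u x) -/(u y) E normrM ler_wpM2r//.
by apply: hM; rewrite (ltW xc) (ltW cy).
Qed.

Lemma lipschitz_long : exists2 M, 0 <= M & forall t a b t' a' b' : R,
  `|t| <= 4 * pi -> `|t'| <= 4 * pi ->
  `|f (t, a, b) - f (t', a', b')| <= M * (`|t - t'| + `|a - a'| + `|b - b'|).
Proof.
have s0 := bsupp_derive d0 sf; have s1 := bsupp_derive d1 sf; have s2 := bsupp_derive d2 sf.
have [M0 p0 h0] := bounded_long_box c0 s0.
have [M1 p1 h1] := bounded_long_box c1 s1.
have [M2 p2 h2] := bounded_long_box c2 s2.
exists (M0 + M1 + M2) => [|t a b t' a' b' tp tp']; first by rewrite !addr_ge0.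
have l0 : `|f (t, a, b) - f (t', a, b)| <= M0 * `|t - t'|.
  have := @line_lipschitz (inord 0) f f0 M0 (t, a, b) t t' d0.
  rewrite /co inordK//= !line0; apply => s hs; apply: h0; rewrite line0 /=.
  move: hs tp tp'; rewrite !ler_norml => /orP[] *; lra.
have l1 : `|f (t', a, b) - f (t', a', b)| <= M1 * `|a - a'|.
  have := @line_lipschitz (inord 1) f f1 M1 (t', a, b) a a' d1.
  by rewrite /co inordK//= !line1; apply => s hs; apply: h1; rewrite line1.
have l2 : `|f (t', a', b) - f (t', a', b')| <= M2 * `|b - b'|.
  have := @line_lipschitz (inord 2) f f2 M2 (t', a', b) b b' d2.
  by rewrite /co inordK//= !line2; apply => s hs; apply: h2; rewrite line2.
have -> : f (t, a, b) - f (t', a', b') = (f (t, a, b) - f (t', a, b)) +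
  (f (t', a, b) - f (t', a', b)) + (f (t', a', b) - f (t', a', b')) by ring.
apply: (le_trans (ler_normD _ _)); apply: (le_trans (lerD (ler_normD _ _) (lexx _))).
have := normr_ge0 (t - t'); have := normr_ge0 (a - a'); have := normr_ge0 (b - b').
move: l0 l1 l2 => /le_trans l0 /le_trans l1 /le_trans l2 *.
rewrite !mulrDr; apply: lerD; first apply: lerD; [apply: l0|apply: l1|apply: l2]; by rewrite ler_wpM2r//; lra.
Qed.

(** The function on the hyperboloid whose lift to the chart is [f], given by a formula that is
    measurable on all of R^4. The jump of [arg] by 2 pi is absorbed by the periodicity of [f]. *)
Definition ext (x : R4) : mR := f (arg x.1, x.2.1, x.2.2).

Lemma ext_measurable : measurable_fun setT ext.
Proof.
have mf : measurable_fun setT (f : R3 -> mR) by exact: continuous_measurable3.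
have ma : measurable_fun setT (fun x : R4 => arg x.1 : mR).
  by apply: (measurableT_comp (@arg_measurable R)); exact: measurable_fst.
have mg : measurable_fun setT (fun x : R4 => (arg x.1, x.2.1, x.2.2) : R3).
  apply: measurable_fun_pair; first apply: measurable_fun_pair => //; mfun.
exact: (measurableT_comp mf mg).
Qed.

Lemma nsq_ads (x : R4) : on_ads x -> @nsq R x.1 = 1 + nsq x.2.
Proof. by rewrite /on_ads => h; lra. Qed.

Lemma nsq_ge0 (q : mR * mR) : 0 <= @nsq R q.
Proof. by rewrite /nsq addr_ge0// sqr_ge0. Qed.

Lemma lift_per (t k a b : R) : k \in [:: - (2 * pi); 0; 2 * pi] ->
  [/\ f (t + k, a, b) = f (t, a, b), cos (t + k) = cos t, sin (t + k) = sin t & `|k| <= 2 * pi].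
Proof.
have pi0 := @pi_gt0 R; have pE : 2 * pi = pi *+ 2 :> R by rewrite mulr_natl.
rewrite !inE => /or3P[]/eqP->.
- rewrite -[in f (t, a, b)](subrK (2 * pi) t) pf -[in cos t](subrK (2 * pi) t) -[in sin t](subrK (2 * pi) t).
  by rewrite pE cosD2pi sinD2pi normrN -pE ger0_norm//; lra.
- by rewrite addr0 normr0; split => //; lra.
- by rewrite pf pE cosD2pi sinD2pi -pE ger0_norm//; lra.
Qed.

Lemma ext_ads4 (p : R3) : 0 <= p.1.1 < 2 * pi -> ext (ads4 p) = f p.
Proof.
case: p => [[t a] b] /= tp; rewrite /ext /=.
have n0 := nsq_ge0 (a, b); have pi0 := @pi_gt0 R.
set r := Num.sqrt _; have r2 : r ^+ 2 = 1 + nsq (a, b) by rewrite sqr_sqrtr//; lra.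
have r0 : 0 < r by rewrite sqrtr_gt0; lra.
set q : mR * mR := (r * cos t, r * sin t).
have nq : @nsq R q = r ^+ 2 by rewrite /nsq /q /= !exprMn -mulrDr cos2Dsin2 mulr1.
have [] := @argP R q; first by rewrite nq exprn_gt0.
rewrite nq sqrtr_sqr gtr0_norm// /q /= => /(mulfI (lt0r_neq0 r0)) C /(mulfI (lt0r_neq0 r0)) S' ap.
have [|k kin kd] := @lift_near R t (arg q).
  by rewrite ltr_norml; lra.
have [fk ck sk _] := lift_per (arg q) a b kin.
rewrite -/q -fk; congr f; congr (_, _, _).
have c1' : cos (t - (arg q + k)) = 1 by rewrite cosB ck sk C S' -!expr2 cos2Dsin2.
have s0' : sin (t - (arg q + k)) = 0 by rewrite sinB ck sk C S' mulrC subrr.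
have := angle_le_sin kd; rewrite c1' s0' normr0 mulr0 normr_le0 subr_eq0 => h.
by apply/eqP; rewrite eq_sym; apply: h; lra.
Qed.

Lemma ext_bounded : exists2 M, 0 <= M & forall x, on_ads x -> `|ext x| <= M.
Proof.
have [M M0 hM] := bounded_long_box cf sf.
exists M => // x ax; apply: hM => /=.
have n0 := nsq_ge0 x.2; have := nsq_ads ax => nx; have pi0 := @pi_gt0 R.
have [_ _ h] := @argP R x.1 ltac:(lra).
by rewrite ler_norml; lra.
Qed.

(** For points at distance at least 1/2 boundedness is enough and costs 4 M. Closer points are
    compared after shifting one angle by a suitable period, so the jump of [arg] does no harm, and
    the angle is at most twice the distance. *)
Lemma ext_lipschitz : exists2 L, 0 <= L & forall x y : R4, on_ads x -> on_ads y ->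
  `|ext x - ext y| <=
    L * (`|x.1.1 - y.1.1| + `|x.1.2 - y.1.2| + `|x.2.1 - y.2.1| + `|x.2.2 - y.2.2|).
Proof.
have [M M0 hM] := ext_bounded; have [L L0 hL] := lipschitz_long; have pi0 := @pi_gt0 R.
exists (4 * M + 2 * L) => [|x y ax ay]; first by lra.
set D1 := `|x.1.1 - y.1.1|; set D2 := `|x.1.2 - _|; set D3 := `|x.2.1 - _|; set D4 := `|x.2.2 - _|.
have [D10 D20 D30 D40] : [/\ 0 <= D1, 0 <= D2, 0 <= D3 & 0 <= D4] by split; exact: normr_ge0.
have [big|small] := leP (1/2) (D1 + D2 + D3 + D4).
  apply: (le_trans (ler_normB _ _)); have hx := hM _ ax; have hy := hM _ ay.
  have : M <= M * (2 * (D1 + D2 + D3 + D4)) by rewrite ler_peMr//; lra.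
  have : 0 <= L * (D1 + D2 + D3 + D4) by rewrite mulr_ge0//; lra.
  rewrite mulrDl; lra.
have nx := nsq_ads ax; have ny := nsq_ads ay.
have nx2 := nsq_ge0 x.2; have ny2 := nsq_ge0 y.2.
have [cx sx px] := @argP R x.1 ltac:(lra).
have [cy sy py] := @argP R y.1 ltac:(lra).
have [|k kin kd] := @lift_near R (arg x.1) (arg y.1); first by rewrite ltr_norml; lra.
have [fk ck sk kp] := lift_per (arg y.1) y.2.1 y.2.2 kin.
rewrite -ck in cy; rewrite -sk in sy.
rewrite [ext y](esym fk) /ext.
set t := arg x.1 in cx sx px kd *; set t' := arg y.1 + k in cy sy kd *.
have tt' : `|t - t'| <= 2 * (D1 + D2).
  have q1 : Num.sqrt (@nsq R x.1) ^+ 2 = 1 + nsq x.2 by rewrite -nx sqr_sqrtr//; lra.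
  have q2 : Num.sqrt (@nsq R y.1) ^+ 2 = 1 + nsq y.2 by rewrite -ny sqr_sqrtr//; lra.
  have := angle_le_dist (sqrtr_ge0 (nsq x.1)) (sqrtr_ge0 (nsq y.1)) q1 q2 nx2 ny2 kd.
  by rewrite cx sx cy sy -/D1 -/D2; apply; move: small D30 D40; lra.
apply: (le_trans (hL _ _ _ _ _ _ _ _)).
- by rewrite ler_norml; lra.
- by rewrite ler_norml /t'; move: kp; rewrite ler_norml; lra.
- rewrite -/D3 -/D4; have : 0 <= M * (D1 + D2 + D3 + D4) by rewrite mulr_ge0//; lra.
  have : L * `|t - t'| <= L * (2 * (D1 + D2)) by rewrite ler_wpM2l.
  have := mulr_ge0 L0 D30; have := mulr_ge0 L0 D40; rewrite !mulrDl !mulrDr => *; lra.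
Qed.

End LipschitzLift.

(** * Isometries carrying the base point to a given point *)

Section Frame.
Variable R : realType.
Local Notation mR := (measurableTypeR R).
Local Notation mu := (@lebesgue_measure R).
Local Notation l2 := (@leb2 R).
Local Notation l3 := (@leb3 R).
Local Notation fund := (@fundamental R).
Local Notation R3 := (mR * mR * mR)%type.
Local Notation R4 := ((mR * mR) * (mR * mR))%type.

(** The function - q(x, y) in the coordinates grouped into two planes. *)
Definition zeta4 (y x : R4) : mR :=
  x.1.1 * y.1.1 + x.1.2 * y.1.2 - x.2.1 * y.2.1 - x.2.2 * y.2.2.

Lemma zeta4_measurable y : measurable_fun setT (zeta4 y).
Proof. by rewrite /zeta4; mfun. Qed.

Lemma zetaE (y : R4) (p : R3) : zeta y.1.1 y.1.2 y.2.1 y.2.2 p = zeta4 y (ads4 p).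
Proof. by rewrite /zeta /zeta4 /ads4 /nsq /rsq /= addrA; ring. Qed.

(** The boost has hyperbolic cosine |(y1, y2)| and hyperbolic sine |(y3, y4)|; the rotations are the
    directions of these two vectors. If (y3, y4) = 0, the second rotation is taken to be the
    identity. *)
Lemma frame (y : R4) : on_ads y -> exists c1 s1 c2 s2 c s : R,
  [/\ c1 ^+ 2 + s1 ^+ 2 = 1, c2 ^+ 2 + s2 ^+ 2 = 1, c ^+ 2 - s ^+ 2 = 1 &
      isom c1 s1 c2 s2 c s (((1 : R), (0 : R)), ((0 : R), (0 : R))) = y].
Proof.
case: y => [[y1 y2] [y3 y4]]; rewrite /on_ads /nsq /= => h.
pose r := Num.sqrt (y1 ^+ 2 + y2 ^+ 2); pose s := Num.sqrt (y3 ^+ 2 + y4 ^+ 2).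
have r2 : r ^+ 2 = y1 ^+ 2 + y2 ^+ 2 by rewrite sqr_sqrtr// addr_ge0// sqr_ge0.
have s2 : s ^+ 2 = y3 ^+ 2 + y4 ^+ 2 by rewrite sqr_sqrtr// addr_ge0// sqr_ge0.
have r0 : r != 0.
  rewrite -sqrf_eq0 r2; have := sqr_ge0 y3; have := sqr_ge0 y4 => *; rewrite gt_eqF//; lra.
have [s0|s0] := eqVneq s 0.
  exists (y1 / r), (y2 / r), 1, 0, r, s; split.
  - by rewrite !expr_div_n -mulrDl -r2 divff// sqrf_eq0.
  - by rewrite expr1n expr0n addr0.
  - by rewrite r2 s2; lra.
  - have [y30 y40] : y3 = 0 /\ y4 = 0.
      have : y3 ^+ 2 + y4 ^+ 2 = 0 by rewrite -s2 s0 expr0n.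
      by move=> /eqP; rewrite paddr_eq0 ?sqr_ge0// !sqrf_eq0 => /andP[/eqP -> /eqP ->].
    by rewrite /isom /rot /boost /= s0 y30 y40; congr ((_, _), (_, _)); field.
exists (y1 / r), (y2 / r), (y3 / s), (y4 / s), r, s; split.
- by rewrite !expr_div_n -mulrDl -r2 divff// sqrf_eq0.
- by rewrite !expr_div_n -mulrDl -s2 divff// sqrf_eq0.
- by rewrite r2 s2; lra.
- by rewrite /isom /rot /boost /=; congr ((_, _), (_, _)); field.
Qed.

Lemma on_ads_ads4 (p : R3) : on_ads (ads4 p).
Proof.
rewrite /on_ads /ads4 /nsq /= !exprMn -mulrDr cos2Dsin2 mulr1 sqr_sqrtr; first by ring.
by have := sqr_ge0 p.1.2; have := sqr_ge0 p.2; lra.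
Qed.

Lemma ads4_arg (x : R4) : on_ads x -> ads4 (arg x.1, x.2.1, x.2.2) = x.
Proof.
case: x => [q [a b]] h; have n := nsq_ads h; have n2 := nsq_ge0 (a, b).
rewrite /= in n; have [] := @argP R q; first by rewrite n; lra.
rewrite n => C S _; rewrite /ads4 /= C S; by case: (q).
Qed.

Lemma arg_bound (q : mR * mR) : - pi <= arg q <= pi.
Proof.
have pi0 := @pi_gt0 R; rewrite /arg; case: ifP => _; first by lra.
by set u := _ / _; have := atan_gtNpi2 u; have := atan_ltpi2 u; lra.
Qed.

Lemma comp_bound (x : R4) (B : R) : on_ads x -> `|x.2.1| <= B -> `|x.2.2| <= B ->
  `|x.1.1| <= 1 + 2 * B /\ `|x.1.2| <= 1 + 2 * B.
Proof.
case: x => [[x1 x2] [x3 x4]] /nsq_ads; rewrite /nsq /= => h h3 h4.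
have B0 : 0 <= B by exact: le_trans (normr_ge0 _) h3.
have q3 : x3 ^+ 2 <= B ^+ 2 by rewrite -real_normK ?num_real// ler_sqr ?nnegrE.
have q4 : x4 ^+ 2 <= B ^+ 2 by rewrite -real_normK ?num_real// ler_sqr ?nnegrE.
have := sqr_ge0 x1; have := sqr_ge0 x2 => h1 h2.
by split; rewrite -ler_sqr ?nnegrE ?addr_ge0 ?mulr_ge0// real_normK ?num_real// sqrrD expr1n; nra.
Qed.

Section Isometry.
Variables c1 s1 c2 s2 c s : R.
Hypotheses (h1 : c1 ^+ 2 + s1 ^+ 2 = 1) (h2 : c2 ^+ 2 + s2 ^+ 2 = 1) (h3 : c ^+ 2 - s ^+ 2 = 1).
Let g := isom c1 s1 c2 s2 c s.
Let o : R4 := ((1 : R, 0 : R), (0 : R, 0 : R)).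

Lemma isom_on_ads x : on_ads x -> on_ads (g x).
Proof.
rewrite /on_ads /g /isom /rot /boost /nsq /= => h.
transitivity ((c2 ^+ 2 + s2 ^+ 2) * ((s * x.1.1 + c * x.2.1) ^+ 2 + x.2.2 ^+ 2) -
  (c1 ^+ 2 + s1 ^+ 2) * ((c * x.1.1 + s * x.2.1) ^+ 2 + x.1.2 ^+ 2)); first by ring.
rewrite h1 h2 !mul1r -h.
transitivity ((c ^+ 2 - s ^+ 2) * (x.2.1 ^+ 2 - x.1.1 ^+ 2) + x.2.2 ^+ 2 - x.1.2 ^+ 2); first by ring.
by rewrite h3; ring.
Qed.

(** The isometry preserves the form, and the product of x with the base point is its first
    coordinate. *)
Lemma isom_zeta x : zeta4 (g o) (g x) = x.1.1.
Proof.
rewrite /zeta4 /g /isom /rot /boost /=.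
transitivity ((c1 ^+ 2 + s1 ^+ 2) * ((c * x.1.1 + s * x.2.1) * c) -
  (c2 ^+ 2 + s2 ^+ 2) * ((s * x.1.1 + c * x.2.1) * s)); first by ring.
rewrite h1 h2 !mul1r; transitivity ((c ^+ 2 - s ^+ 2) * x.1.1); first by ring.
by rewrite h3 mul1r.
Qed.

Lemma isom_coord x : x.1.2 = - s1 * (g x).1.1 + c1 * (g x).1.2.
Proof.
rewrite /g /isom /rot /boost /=; transitivity ((c1 ^+ 2 + s1 ^+ 2) * x.1.2); last by ring.
by rewrite h1 mul1r.
Qed.

(** The boost leaves the second coordinate alone, so it is recovered by the inverse rotation of the
    first plane, whose coefficients are at most 1. The bound is therefore the same for all
    isometries, that is, for all base points y. *)
Lemma isom_coord_bound x (B : R) : on_ads x -> `|(g x).2.1| <= B -> `|(g x).2.2| <= B ->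
  `|x.1.2| <= 2 + 4 * B.
Proof.
move=> ax b1 b2; have [k1 k2] := comp_bound (isom_on_ads ax) b1 b2.
have hc : `|c1| <= 1 by rewrite -ler_sqr ?nnegrE// real_normK ?num_real// expr1n -h1 lerDl sqr_ge0.
have hs : `|s1| <= 1 by rewrite -ler_sqr ?nnegrE// real_normK ?num_real// expr1n -h1 lerDr sqr_ge0.
rewrite isom_coord (le_trans (ler_normD _ _))// !normrM normrN.
have := normr_ge0 (g x).1.1; have := normr_ge0 (g x).1.2 => *.
have l1 := ler_wpM2r (normr_ge0 (g x).1.1) hs; have l2 := ler_wpM2r (normr_ge0 (g x).1.2) hc.
lra.
Qed.

Lemma isom_lipschitz : exists2 L, 0 <= L & forall x y : R4,
  `|(g x).1.1 - (g y).1.1| + `|(g x).1.2 - (g y).1.2| + `|(g x).2.1 - (g y).2.1| + `|(g x).2.2 - (g y).2.2|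
  <= L * (`|x.1.1 - y.1.1| + `|x.1.2 - y.1.2| + `|x.2.1 - y.2.1| + `|x.2.2 - y.2.2|).
Proof.
have n (a b : R) : 0 <= `|a| + `|b| by rewrite addr_ge0.
pose u := `|c1| + `|s1|; pose v := `|c2| + `|s2|; pose w := `|c| + `|s|.
have [u0 v0 w0] : [/\ 0 <= u, 0 <= v & 0 <= w] by split; exact: n.
have lin (a b X Y : R) : `|a * X + b * Y| <= (`|a| + `|b|) * (`|X| + `|Y|).
  rewrite (le_trans (ler_normD _ _))// !normrM mulrDl; apply: lerD; apply: ler_wpM2l => //; by rewrite ?lerDl ?lerDr normr_ge0.
exists (2 * (u + v) * (w + 1)) => [|x y]; first by rewrite !mulr_ge0 ?addr_ge0.
set x1 := x.1.1 - y.1.1; set x2 := x.1.2 - y.1.2; set x3 := x.2.1 - y.2.1; set x4 := x.2.2 - y.2.2.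
pose X := c * x1 + s * x3; pose Z := s * x1 + c * x3.
have bX : `|X| <= w * (`|x1| + `|x3|) by exact: lin.
have bZ : `|Z| <= w * (`|x1| + `|x3|) by rewrite /w addrC; exact: lin.
have e1 : `|(g x).1.1 - (g y).1.1| <= u * (`|X| + `|x2|).
  rewrite (_ : _ - _ = c1 * X + (- s1) * x2); last by rewrite /g /isom /rot /boost /X /x1 /x2 /x3 /=; ring.
  by apply: (le_trans (lin _ _ _ _)); rewrite normrN.
have e2 : `|(g x).1.2 - (g y).1.2| <= u * (`|X| + `|x2|).
  rewrite (_ : _ - _ = s1 * X + c1 * x2); last by rewrite /g /isom /rot /boost /X /x1 /x2 /x3 /=; ring.
  by apply: (le_trans (lin _ _ _ _)); rewrite /u addrC.
have e3 : `|(g x).2.1 - (g y).2.1| <= v * (`|Z| + `|x4|).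
  rewrite (_ : _ - _ = c2 * Z + (- s2) * x4); last by rewrite /g /isom /rot /boost /Z /x1 /x3 /x4 /=; ring.
  by apply: (le_trans (lin _ _ _ _)); rewrite normrN.
have e4 : `|(g x).2.2 - (g y).2.2| <= v * (`|Z| + `|x4|).
  rewrite (_ : _ - _ = s2 * Z + c2 * x4); last by rewrite /g /isom /rot /boost /Z /x1 /x3 /x4 /=; ring.
  by apply: (le_trans (lin _ _ _ _)); rewrite /v addrC.
have key (z1 z2 z3 z4 zX zZ a1 a2 a3 a4 : R) : 0 <= z1 -> 0 <= z2 -> 0 <= z3 -> 0 <= z4 ->
    zX <= w * (z1 + z3) -> zZ <= w * (z1 + z3) -> a1 <= u * (zX + z2) -> a2 <= u * (zX + z2) ->
    a3 <= v * (zZ + z4) -> a4 <= v * (zZ + z4) ->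
    a1 + a2 + a3 + a4 <= 2 * (u + v) * (w + 1) * (z1 + z2 + z3 + z4).
  move: u v w u0 v0 w0 {bX bZ e1 e2 e3 e4} => u v w u0 v0 w0 p1 p2 p3 p4 bX bZ e1 e2 e3 e4.
  have f1 : u * (zX + z2) <= u * ((w + 1) * (z1 + z2 + z3 + z4)) by rewrite ler_wpM2l//; nra.
  have f2 : v * (zZ + z4) <= v * ((w + 1) * (z1 + z2 + z3 + z4)) by rewrite ler_wpM2l//; nra.
  rewrite (_ : 2 * (u + v) * _ * _ = 2 * (u * ((w + 1) * (z1 + z2 + z3 + z4))) + 2 * (v * ((w + 1) * (z1 + z2 + z3 + z4)))); last by ring.
  lra.
by apply: key bX bZ e1 e2 e3 e4; exact: normr_ge0.
Qed.

End Isometry.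

Local Open Scope ereal_scope.

Definition ibox (B : R) : set R3 := [set p | (`|p.1.2| <= B)%R /\ (`|p.2| <= B)%R].

Lemma ibox_measurable B : measurable (ibox B).
Proof.
rewrite (_ : ibox B = (setT `*` `[(- B)%R, B]) `*` `[(- B)%R, B]).
  by apply: measurableX; [apply: measurableX|].
apply/seteqP; split => p; rewrite /ibox/= !in_itv/= -!ler_norml; first by move=> [-> ->].
by move=> [[_ ->] ->].
Qed.

(** In the frame of y the function zeta is the coordinate z, theta ranges over a length 2 pi and |s|
    <= 2 + 4 B on the box. The uniformity in y is what bounds the double integral. *)
Lemma integral_zeta_le (y : R4) (B : R) (k : mR -> \bar R) : on_ads y -> (0 <= B)%R ->
  measurable_fun setT k -> (forall z, 0 <= k z) ->
  \int[l3]_(p in fund) ((\1_(ibox B) p)%:E * k (zeta4 y (ads4 p))) <=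
  (2 * pi * (2 * (2 + 4 * B)))%:E * \int[mu]_z k z.
Proof.
move=> /frame[c1 [s1 [c2 [s2 [c [s [h1 h2 h3 gy]]]]]]] B0 mk k0.
pose D : set R4 := setT `*` (`[(- B)%R, B] `*` `[(- B)%R, B]).
have mD : measurable D by apply: measurableX => //; exact: measurableX.
have DE x : D x <-> (`|x.2.1| <= B)%R /\ (`|x.2.2| <= B)%R.
  by rewrite /D/= !in_itv/= -!ler_norml; split => [[_]|].
pose K (x : R4) := (\1_D x)%:E * k (zeta4 y x).
have mK : measurable_fun setT K.
  apply: emeasurable_funM.
    by apply/measurable_EFinP; exact: measurable_indic.
  exact: (measurableT_comp mk (zeta4_measurable y)).
have K0 x : 0 <= K x by rewrite mule_ge0// lee_fin.
pose S := (2 + 4 * B)%R; have S0 : (0 <= S)%R by rewrite /S; lra.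
have -> : \int[l3]_(p in fund) ((\1_(ibox B) p)%:E * k (zeta4 y (ads4 p))) =
    \int[l3]_(p in fund) K (ads4 p).
  apply: eq_integral => p _; rewrite /K !indicE; congr ((nat_of_bool _)%:R%:E * _).
  by apply/idP/idP; rewrite !inE DE.
rewrite (ge0_change_of_variables h1 h2 h3 mK K0).
have mfund := @fundamental_measurable R.
pose F (p : R3) := (\1_(`[(- S)%R, S]%classic : set mR) p.2)%:E * k p.1.2.
have mF : measurable_fun setT F.
  apply: emeasurable_funM.
    apply/measurable_EFinP; apply: (measurableT_comp (g := fun p : R3 => p.2)); last by mfun.
    exact: measurable_indic.
  by apply: (measurableT_comp mk (g := fun p : R3 => p.1.2)); mfun.
have F0 p : 0 <= F p by rewrite mule_ge0// lee_fin.
apply: (@le_trans _ _ (\int[l3]_(p in fund) F p)).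
  apply: (@le_trans _ _ (\int[l3]_(p in @cyl_dom R) F p)); last first.
    apply: ge0_subset_integral => //; [exact: cyl_dom_measurable|exact: measurable_funTS|].
    by move=> p [].
  apply: ge0_le_integral => //.
  - exact: cyl_dom_measurable.
  - apply: measurable_funTS; apply: (measurableT_comp mK).
    exact: (measurableT_comp (isom_measurable _ _ _ _ _ _) (@cyl4_measurable R)).
  - exact: measurable_funTS.
  move=> p [_ po]; rewrite /K -{1}gy isom_zeta//.
  rewrite [\1_D _]indicE; have [|] := boolP (isom c1 s1 c2 s2 c s (cyl4 p) \in D); last by rewrite mul0e F0.
  rewrite inE DE => -[b1 b2].
  have ap : on_ads (cyl4 p) by apply: on_ads_cyl; exact: ltW.
  have := isom_coord_bound h1 h2 h3 ap b1 b2.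
  move=> hs; have e : \1_(`[(- S)%R, S]%classic : set mR) p.2 = 1%R :> R.
    by rewrite indicE mem_set//= in_itv/= -ler_norml.
  by rewrite /F e.
rewrite leb3_cond//.
have E t : \int[l2]_q F (t, q.1, q.2) = (2 * S)%:E * \int[mu]_z k z.
  transitivity (\int[mu]_z \int[mu]_s F (t, z, s)).
    apply: (fubini_tonelli1 (m1 := mu) (m2 := mu) (fun q : mR * mR => F (t, q.1, q.2))) => //.
    by apply: (measurableT_comp mF (g := fun q : mR * mR => (t, q.1, q.2))); mfun.
  rewrite -ge0_integralZl//; last by rewrite lee_fin mulr_ge0.
  apply: eq_integral => z _; rewrite /F /=.
  rewrite ge0_integralZr//; last by apply/measurable_EFinP; exact: measurable_indic.
  congr (_ * _); rewrite integral_indic// setIT.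
  transitivity (mu `[(- S)%R, S]) => //.
  rewrite lebesgue_measure_itv/= lte_fin; case: ifPn => [_|]; first by rewrite -EFinB; congr (_%:E); ring.
  by rewrite -leNgt => hS; have -> : S = 0%R; [lra|rewrite mulr0].
rewrite (eq_integral (fun=> (2 * S)%:E * \int[mu]_z k z)); last by move=> t _; rewrite E.
rewrite integral_cst//.
have vv : mu `[0%R, (2 * pi)%R[%classic = (2 * pi)%:E.
  by rewrite lebesgue_measure_itv/= lte_fin mulr_gt0 ?pi_gt0// -EFinB subr0.
apply: (@le_trans _ _ (((2 * S)%:E * \int[mu]_z k z) * (2 * pi)%:E)).
  by rewrite le_eqVlt; apply/orP; left; apply/eqP; congr (_ * _); exact: vv.
by rewrite muleAC -EFinM mulrC.
Qed.

Lemma integral_sym (G : mR -> \bar R) (c : R) : measurable_fun setT G -> (forall x, 0 <= G x) ->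
  \int[mu]_z G `|z - c|%R = 2%:E * \int[mu]_(x in `]0%R, +oo[) G x.
Proof.
move=> mG G0.
have mN : measurable_fun setT (fun x : mR => G `|x|%R).
  apply: (measurableT_comp mG (g := fun x : mR => `|x|%R : mR)).
  exact: (@normr_measurable R setT).
have -> : \int[mu]_z G `|z - c|%R = \int[mu]_x G `|x|%R.
  have := @ge0_substitution_affine R 1 (- c)%R (fun x => G `|x|%R) (oner_neq0 _) mN (fun x => G0 _).
  by move=> <-; apply: eq_integral => z _; rewrite mul1r normr1 mule1.
pose P := `]0%R, +oo[%classic : set mR; have mP : measurable P by exact: measurable_itv.
pose N := `]-oo, 0%R[%classic : set mR; have mN' : measurable N by exact: measurable_itv.
rewrite integral_neq0//.
have -> : [set~ 0%R] = P `|` N.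
  apply/seteqP; split => x; rewrite /P /N/= !in_itv/= andbT.
    by move=> /eqP; rewrite neq_lt => /orP[]; [right|left].
  by move=> [] h e; rewrite e ltxx in h.
rewrite ge0_integral_setU//; last 2 first.
- exact: measurable_funTS.
- apply/eqP; rewrite -subset0 => x []; rewrite /P /N/= !in_itv/= andbT => h1 h2.
  by have := lt_trans h1 h2; rewrite ltxx.
have -> : \int[mu]_(x in P) G `|x|%R = \int[mu]_(x in P) G x.
  by apply: eq_integral => x; rewrite inE /P/= in_itv/= andbT => x0; rewrite gtr0_norm.
have -> : \int[mu]_(x in N) G `|x|%R = \int[mu]_(x in P) G x.
  rewrite -(ge0_integral_cond0 _ mN') -(ge0_integral_cond0 _ mP).
  have n1 : ((-1 : R) != 0)%R by rewrite oppr_eq0 oner_neq0.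
  rewrite -(@ge0_substitution_affine R (-1) 0 (fun x => G `|x|%R * (\1_N x)%:E) n1).
  - apply: eq_integral => x _; rewrite addr0 mulN1r normrN normrN1 mule1 !indicE.
    have -> : ((- x)%R \in N) = (x \in P).
      by apply/idP/idP; rewrite !inE /N /P/= !in_itv/= andbT oppr_lt0.
    have [|] := boolP (x \in P); last by rewrite !mule0.
    by rewrite inE /P/= in_itv/= andbT => x0; rewrite gtr0_norm.
  - apply: emeasurable_funM => //; apply/measurable_EFinP; exact: measurable_indic.
  - by move=> x; rewrite mule_ge0// lee_fin.
by rewrite (_ : 2%:E = 1 + 1)// ge0_muleDl// !mul1e.
Qed.

(** Integrable model of the singularity at distance at most d from c. At z = c its value is 0, the
    inverse of 0 being 0. *)
Definition invsqrt (c d z : R) : R := ((Num.sqrt `|z - c|)^-1 * (`|z - c| <= d)%R%:R)%R.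

Lemma invsqrt_ge0 c d z : (0 <= invsqrt c d z)%R.
Proof. by rewrite /invsqrt mulr_ge0// invr_ge0 sqrtr_ge0. Qed.

Lemma invsqrt_measurable c d : measurable_fun setT (invsqrt c d : mR -> mR).
Proof.
have mn : measurable_fun setT (fun z : mR => `|z - c|%R : mR).
  apply: (measurableT_comp (@normr_measurable R setT) (g := fun z : mR => z - c : mR)%R).
  by mfun.
apply: measurable_funM.
  by apply: (measurableT_comp (@inv_measurable R)); apply: (measurableT_comp (@sqrt_measurable R)).
have mb : measurable_fun setT (fun z : mR => (`|z - c| <= d)%R).
  by apply: measurable_fun_ler => //; exact: measurable_cst.
rewrite (_ : (fun z => _) = (fun z : mR => if (`|z - c| <= d)%R then 1%R else 0%R : mR)); last first.
  by apply/funext => z; case: (_ <= _)%R.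
by apply: measurable_fun_ifT => //; exact: measurable_cst.
Qed.

Lemma integral_invsqrt (c d : R) : (0 <= d)%R ->
  \int[mu]_z (invsqrt c d z)%:E = (4 * Num.sqrt d)%:E.
Proof.
move=> d0; pose G (x : mR) : \bar R := (invsqrt 0 d x)%:E.
have mG : measurable_fun setT G by apply/measurable_EFinP; exact: invsqrt_measurable.
have G0 x : 0 <= G x by rewrite lee_fin invsqrt_ge0.
transitivity (\int[mu]_z G `|z - c|%R).
  by apply: eq_integral => z _; rewrite /G /invsqrt subr0 normr_id.
rewrite integral_sym// -ge0_substitution_square//.
transitivity (2%:E * \int[mu]_(x in `]0%R, Num.sqrt d]) (2%:E : \bar R)).
  congr (_ * _); rewrite [LHS]integral_mkcond [RHS]integral_mkcond; apply: eq_integral => x _.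
  rewrite !patchE; have [|] := boolP (x \in `]0%R, +oo[%classic).
    rewrite inE/= in_itv/= andbT => x0; rewrite /G /invsqrt subr0 (ger0_norm (sqr_ge0 x)) sqrtr_sqr gtr0_norm//.
    have e : (x ^+ 2 <= d)%R = (x <= Num.sqrt d)%R.
      by rewrite -{1}(sqr_sqrtr d0) ler_sqr// nnegrE ?sqrtr_ge0 ?(ltW x0).
    rewrite e; case: ifPn; rewrite ?inE ?notin_setE/= in_itv/= x0 /=.
      by move=> ->; rewrite mulr1 -EFinM; congr (_%:E); field; rewrite gt_eqF.
    by move=> /negP/negbTE ->; rewrite mulr0 mul0e.
  rewrite notin_setE/= in_itv/= andbT => x0; rewrite memNset//= in_itv/=.
  by move=> /andP[].
transitivity (2%:E * (2%:E * mu `]0%R, Num.sqrt d])).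
  by congr (_ * _); rewrite integral_cst.
by rewrite mu_itv0c ?sqrtr_ge0// -!EFinM mulrA -natrM.
Qed.

End Frame.

(** * Pairing of a singular radial function with a test function *)

Section Pairing.
Variable R : realType.
Local Notation mR := (measurableTypeR R).
Local Notation mu := (@lebesgue_measure R).
Local Notation l3 := (@leb3 R).
Local Notation fund := (@fundamental R).
Local Notation R3 := (mR * mR * mR)%type.
Local Notation R4 := ((mR * mR) * (mR * mR))%type.

Lemma small_le0 (x A e0 : R) : 0 < e0 -> (forall e, 0 < e <= e0 -> x <= A * e) -> x <= 0.
Proof.
move=> e00 h; rewrite leNgt; apply/negP => x0.
have hA := h e0; have A0 : 0 < A.
  by rewrite -(pmulr_lgt0 _ e00) (lt_le_trans x0)// hA// e00 lexx.
have := h (Num.min e0 (x / (2 * A))); rewrite lt_min ge_min e00 lexx/= divr_gt0// ?mulr_gt0//.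
move=> /(_ isT) xe; have : A * Num.min e0 (x / (2 * A)) <= A * (x / (2 * A)).
  by rewrite ler_pM2l// ge_min lexx orbT.
rewrite (_ : A * (x / _) = x / 2); last by field; rewrite gt_eqF.
by move=> /(le_trans xe); lra.
Qed.

Lemma box_op_continuous (f1 f2 f00 f11 f12 f21 f22 : R * R * R -> R) :
  continuous f1 -> continuous f2 -> continuous f00 -> continuous f11 -> continuous f12 ->
  continuous f21 -> continuous f22 -> continuous (box_op f1 f2 f00 f11 f12 f21 f22).
Proof.
move=> ? ? ? ? ? ? ?; have c : continuous (@rsq R) by rewrite /rsq; cnt.
pose ir p := (@rsq R p)^-1.
have ci : continuous ir by apply: cntV => //; exact: rsq_neq0.
rewrite (_ : box_op _ _ _ _ _ _ _ = fun p : R * R * R => ir p * f00 p - ((1 + p.1.2 ^+ 2) * f11 p +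
  p.1.2 * p.2 * f12 p + p.1.2 * p.2 * f21 p + (1 + p.2 ^+ 2) * f22 p + 3 * p.1.2 * f1 p + 3 * p.2 * f2 p))//.
by cnt.
Qed.

Lemma box_op_supp f f0 f1 f2 f00 f11 f12 f21 f22 (B : R) :
  C2data f f0 f1 f2 f00 f11 f12 f21 f22 B -> bsupp (box_op f1 f2 f00 f11 f12 f21 f22) B.
Proof.
move=> D; have s0 := bsupp_derive (c2_0 D) (c2_s D).
have s1 := bsupp_derive (c2_1 D) (c2_s D); have s2 := bsupp_derive (c2_2 D) (c2_s D).
have s00 := bsupp_derive (c2_00 D) s0; have s11 := bsupp_derive (c2_11 D) s1.
have s12 := bsupp_derive (c2_12 D) s2; have s21 := bsupp_derive (c2_21 D) s1.
have s22 := bsupp_derive (c2_22 D) s2.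
move=> p; have [h|h] := pselect (`|p.1.2| <= B /\ `|p.2| <= B) => //.
have z (g : R * R * R -> R) : bsupp g B -> g p = 0.
  by move=> sg; apply/eqP; apply: contraT => /sg.
by rewrite /box_op (z _ s00) (z _ s11) (z _ s12) (z _ s21) (z _ s22) (z _ s1) (z _ s2) !(mulr0, addr0, subr0) eqxx.
Qed.

Lemma bsupp_ibox (g : R * R * R -> R) (B M : R) : bsupp g B ->
  (forall p, box B p -> `|g p| <= M) -> forall p, fund p -> `|g p| <= M * \1_(ibox B) p.
Proof.
move=> sg gM p fp; have [->|g0] := eqVneq (g p) 0.
  rewrite normr0 indicE; case: (boolP (p \in _)); last by rewrite mulr0.
  rewrite inE mulr1 => -[h1 h2]; apply: (le_trans (normr_ge0 (g p))); apply: gM; split => //.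
  by case/andP : fp => -> /ltW ->.
have [h1 h2] := sg _ g0; rewrite indicE mem_set// mulr1; apply: gM; split => //.
by case/andP : fp => -> /ltW ->.
Qed.

(* The operator [Box] is applied to [f] by [box_op]; [W] is what [Box V] equals away from [1]. *)
Lemma pairing (V V1 V2 W : R -> R) (C d0 g delta : R)
    (f f0 f1 f2 f00 f11 f12 f21 f22 : R * R * R -> R) (B : R) (p0 : R3) :
  singular V V1 V2 W C d0 g delta -> V 1 = 0 -> W 1 = 0 ->
  measurable_fun setT (V : mR -> mR) -> measurable_fun setT (W : mR -> mR) ->
  C2data f f0 f1 f2 f00 f11 f12 f21 f22 B -> 0 <= B -> 0 <= p0.1.1 < 2 * pi ->
  (forall p, f p != 0 -> -1 + delta <= zeta4 (ads4 p0) (ads4 p)) ->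
  let T p := V (zeta4 (ads4 p0) (ads4 p)) * box_op f1 f2 f00 f11 f12 f21 f22 p +
             W (zeta4 (ads4 p0) (ads4 p)) * f p in
  l3.-integrable fund (EFin \o T) /\ \int[l3]_(p in fund) T p = 4 * pi * g * f p0.
Proof.
move=> sg V10 W10 mV mW D B0 tp0 suppf T.
pose Y := ads4 p0; have aY : on_ads Y := on_ads_ads4 p0.
pose z p := zeta4 Y (ads4 p); pose Bf := box_op f1 f2 f00 f11 f12 f21 f22.
have [/andP[d0p d0l] C0 /andP[dl0 dl]] := And3 (sg_d0 sg) (sg_C sg) (sg_delta sg).
have d01 : d0 <= 1 by lra.
have d012 : d0 <= 1/2 by lra.
have S1 : 1 <= 2 + 4 * B by lra.
have mfund := @fundamental_measurable R.
have zE : zeta Y.1.1 Y.1.2 Y.2.1 Y.2.2 = z by apply/funext => p; rewrite zetaE.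
have cz : continuous (z : R * R * R -> R) by rewrite -zE; exact: zeta_continuous.
have mz : measurable_fun setT (z : R3 -> mR) by exact: continuous_measurable3.
have cBf : continuous Bf.
  by apply: box_op_continuous; [exact: (c2_c1 D)|exact: (c2_c2 D)|exact: (c2_c00 D)|
    exact: (c2_c11 D)|exact: (c2_c12 D)|exact: (c2_c21 D)|exact: (c2_c22 D)].
have sBf : bsupp Bf B by exact: (box_op_supp D).
have cf := c2_c D; have sf := c2_s D.
have [Nb Nb0 hNb] := continuous_box_bounded B cBf.
have [Nf Nf0 hNf] := continuous_box_bounded B cf.
have bBf := bsupp_ibox sBf hNb; have bf := bsupp_ibox sf hNf.
have mBf : measurable_fun setT (Bf : R3 -> mR) by exact: continuous_measurable3.
have mf : measurable_fun setT (f : R3 -> mR) by exact: continuous_measurable3.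
have Yads : Y.1.1 ^+ 2 + Y.1.2 ^+ 2 = 1 + Y.2.1 ^+ 2 + Y.2.2 ^+ 2.
  by have := nsq_ads aY; rewrite /nsq addrA.
(* The integrand splits as E + G. The part E removed by the cut-off is at most a multiple of |z -
   1|^(-1/2) on |z - 1| < d, so its integral is O(sqrt d); G is regular and admits Green's
   formula. *)
pose E d p := (V (z p) - cutH V d (z p)) * Bf p + ((1 - chi d (z p)) * W (z p)) * f p.
pose G d p := cutH V d (z p) * Bf p + (chi d (z p) * W (z p)) * f p.
have TE d : T = fun p => E d p + G d p by apply/funext => p; rewrite /T /E /G -/(z p) -/(Bf p); ring.
have cchi d : continuous (@chi R d) by move=> x; exact: is_derive_continuous (is_derive_chi d x).
have mchi d : measurable_fun setT (chi d : mR -> mR) by exact: continuous_measurable_fun.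
have mcomp (h : R -> R) : measurable_fun setT (h : mR -> mR) -> measurable_fun setT (fun p : R3 => h (z p) : mR).
  by move=> mh; exact: (measurableT_comp mh mz).
have mE d : measurable_fun setT (E d : R3 -> mR).
  apply: measurable_funD; apply: measurable_funM => //.
    apply: measurable_funB; first exact: mcomp.
    by apply: (mcomp (cutH V d)); exact: (measurable_funM (mchi d) mV).
  apply: measurable_funM; last exact: mcomp.
  by apply: measurable_funB; [exact: measurable_cst|exact: mcomp].
have cH d : 0 < d -> continuous (fun p => cutH V d (z p)).
  by move=> dp; apply: cnt_comp cz; exact: (cutH_continuous sg).
have cW d : 0 < d -> continuous (fun p => chi d (z p) * W (z p)).
  by move=> dp; apply: (@cnt_comp _ _ (fun x => chi d x * W x)) cz; exact: (chiW_continuous sg).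
have iH d : 0 < d -> l3.-integrable fund (EFin \o (fun p => cutH V d (z p) * Bf p)).
  move=> dp; apply: (@integrable_continuous _ _ B); first by apply: cntM => //; exact: cH.
  by move=> p; rewrite mulf_eq0 => /norP[_ /sBf].
have iW d : 0 < d -> l3.-integrable fund (EFin \o (fun p => chi d (z p) * W (z p) * f p)).
  move=> dp; apply: (@integrable_continuous _ _ B); first by apply: cntM => //; exact: cW.
  by move=> p; rewrite mulf_eq0 => /norP[_ /sf].
have iG d : 0 < d -> l3.-integrable fund (EFin \o G d).
  by move=> dp; apply: integrable_realD => //; [exact: iH|exact: iW].
pose Nn := 37 * C * (Nb + Nf).
have Nn0 : 0 <= Nn by rewrite /Nn !mulr_ge0 ?addr_ge0.
have bV (U : R -> R) x : U 1 = 0 -> (forall x, `|x - 1| <= d0 -> `|U x| * Num.sqrt `|x - 1| <= C) ->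
    forall d, 0 < d <= d0 -> `|(1 - chi d x) * U x| <= 37 * C * invsqrt 1 d x.
  move=> U1 hU d /andP[dp dd0].
  have [h|h] := ltP `|x - 1| d; last first.
    have [-> _ _] := chi_far dp h; rewrite subrr mul0r normr0.
    by rewrite mulr_ge0 ?invsqrt_ge0 ?mulr_ge0.
  (* At 1 the majorant is 0, and the bound holds because U 1 = 0. *)
  have [->|x1] := eqVneq x 1.
    by rewrite U1 mulr0 normr0 mulr_ge0 ?invsqrt_ge0 ?mulr_ge0.
  have s0 : 0 < Num.sqrt `|x - 1| by rewrite sqrtr_gt0 normr_gt0 subr_eq0.
  rewrite normrM -mulrA; apply: ler_pM => //.
    have [b0 _ _] := chi_bound x dp.
    by apply: (le_trans (ler_normB _ _)); rewrite normr1; clear -b0; lra.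
  by rewrite /invsqrt (ltW h) mulr1 ler_pdivlMr// hU// (le_trans (ltW h)).
have bE d : 0 < d <= d0 -> forall p, fund p -> `|E d p| <= Nn * (\1_(ibox B) p * invsqrt 1 d (z p)).
  move=> dd p fp; rewrite /E.
  have b1 := bV V (z p) V10 (sg_V sg) d dd; have b2 := bV W (z p) W10 (sg_W sg) d dd.
  have -> : V (z p) - cutH V d (z p) = (1 - chi d (z p)) * V (z p) by rewrite /cutH; ring.
  apply: (le_trans (ler_normD _ _)); rewrite !normrM -!(normrM (1 - chi d (z p))).
  rewrite (_ : Nn * _ = (37 * C * invsqrt 1 d (z p)) * (Nb * \1_(ibox B) p) +
    (37 * C * invsqrt 1 d (z p)) * (Nf * \1_(ibox B) p)); last by rewrite /Nn; ring.
  by apply: lerD; apply: ler_pM => //; [exact: bBf|exact: bf].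
pose Q := 2 * pi * (2 * (2 + 4 * B)).
have Q0 : 0 <= Q by rewrite /Q; apply: mulr_ge0; [rewrite mulr_ge0 ?pi_ge0|clear -B0; lra].
have lE d : 0 < d <= d0 -> (\int[l3]_(p in fund) `|(E d p)%:E| <= (Nn * (Q * (4 * Num.sqrt d)))%:E)%E.
  move=> dd; have d0' : 0 <= d by case/andP : dd => /ltW.
  have mk : measurable_fun setT (fun x : mR => (invsqrt 1 d x)%:E).
    by apply/measurable_EFinP; exact: invsqrt_measurable.
  have mi : measurable_fun setT (fun p : R3 => (\1_(ibox B) p)%:E * (invsqrt 1 d (z p))%:E)%E.
    apply: emeasurable_funM.
      by apply/measurable_EFinP; apply: measurable_indic; exact: ibox_measurable.
    exact: (measurableT_comp mk mz).
  apply: (@le_trans _ _ (\int[l3]_(p in fund) (Nn%:E * ((\1_(ibox B) p)%:E * (invsqrt 1 d (z p))%:E)))%E).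
    apply: ge0_le_integral => //.
    - have h := measurableT_comp (@normr_measurable R setT) (mE d).
      by apply: measurable_funTS; apply/measurable_EFinP; exact: h.
    - by apply: emeasurable_funM; [exact: measurable_cst|exact: measurable_funTS].
    - by move=> p fp; rewrite -!EFinM lee_fin; exact: bE.
  rewrite ge0_integralZl//; last 2 first.
  - exact: measurable_funTS.
  - by move=> p _; rewrite -EFinM lee_fin mulr_ge0 ?invsqrt_ge0.
  rewrite [X in (_ <= X)%E]EFinM; apply: lee_wpmul2l; first by rewrite lee_fin.
  apply: (le_trans (integral_zeta_le aY B0 mk _)); first by move=> x; rewrite lee_fin invsqrt_ge0.
  by rewrite integral_invsqrt// EFinM.
have iE d : 0 < d <= d0 -> l3.-integrable fund (EFin \o E d).
  move=> dd; apply/integrableP; split; first by apply/measurable_EFinP; exact: (measurable_funTS (mE d)).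
  by apply: le_lt_trans (lE d dd) _; rewrite ltry.
have iT : l3.-integrable fund (EFin \o T).
  rewrite (TE d0); apply: integrable_realD => //; first by apply: iE; rewrite d0p lexx.
  exact: iG.
split => //.
have [c1 [s1 [c2 [s2 [c [s [h1 h2 h3 gy]]]]]]] := frame aY.
pose iso := isom c1 s1 c2 s2 c s.
pose e := ext f; pose Psi x := e (iso x).
have me : measurable_fun setT (e : R4 -> mR) by exact: ext_measurable.
have mPsi : measurable_fun setT (Psi : R4 -> mR) by exact: (measurableT_comp me (isom_measurable _ _ _ _ _ _)).
have [M M0 hM] := bounded_long_box cf sf.
have PsiM x : `|Psi x| <= M.
  apply: hM => /=; have ab := arg_bound (iso x).1; have pp := @pi_gt0 R.
  by clear -ab pp; rewrite ler_norml; lra.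
have [L1 L10 hL1] := ext_lipschitz (c2_0 D) (c2_1 D) (c2_2 D) cf (c2_c0 D) (c2_c1 D) (c2_c2 D) sf (c2_per D).
have [L2 L20 hL2] := isom_lipschitz c1 s1 c2 s2 c s.
have PsiL x y : on_ads x -> on_ads y -> `|Psi x - Psi y| <=
    (L1 * L2) * (`|x.1.1 - y.1.1| + `|x.1.2 - y.1.2| + `|x.2.1 - y.2.1| + `|x.2.2 - y.2.2|).
  move=> ax ay; apply: (le_trans (hL1 _ _ (isom_on_ads h1 h2 h3 ax) (isom_on_ads h1 h2 h3 ay))).
  by rewrite -mulrA ler_wpM2l//; exact: hL2.
pose S := 2 + 4 * B.
have isoz x : zeta4 Y (iso x) = x.1.1 by rewrite -gy isom_zeta.
have PsiS x : on_ads x -> Psi x != 0 -> -1 + delta <= x.1.1 /\ `|x.1.2| <= S.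
  move=> ax Px; have ai := isom_on_ads h1 h2 h3 ax; split.
    have := suppf _ Px; rewrite ads4_arg//.
    by rewrite -/Y -/iso isoz.
  have [b1 b2] := sf _ Px; exact: (isom_coord_bound h1 h2 h3 ax).
have [A hA] := core_limit mPsi PsiM PsiL PsiS S1 (mulr_ge0 L10 L20) sg.
have kap : Psi ((1, 0), (0, 0)) = f p0.
  rewrite /Psi /iso gy /e /Y ext_ads4//; exact: (c2_per D).
(* Green's formula turns G into k(zeta) f, and the change of variables in the frame of the base
   point replaces zeta by the coordinate z. *)
have intG eta : 0 < eta -> \int[l3]_(p in fund) G (eta ^+ 4) p =
   \int[l3]_(p in fund) (\1_(@outside R) p * (cutk V V1 V2 W (eta ^+ 4) p.1.2 * Psi (cyl4 p))).
  move=> ep; have dp : 0 < eta ^+ 4 by rewrite exprn_gt0.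
  set d := eta ^+ 4 in dp *; pose k := cutk V V1 V2 W d.
  have ck : continuous k by exact: (cutk_continuous sg).
  have gr : \int[l3]_(p in fund) (cutH V d (z p) * Bf p) =
      \int[l3]_(p in fund) ((k (z p) - chi d (z p) * W (z p)) * f p).
    have := @green R _ _ _ _ Yads _ _ _ (fun x => is_derive_cutH sg x dp)
      (fun x => is_derive_cutH1 sg x dp) (cutH2_continuous sg dp) _ _ _ _ _ _ _ _ _ _ D.
    rewrite zE => ->; apply: eq_Rintegral => p _; congr (_ * _).
    by rewrite /k /cutk; ring.
  have ikf : l3.-integrable fund (EFin \o (fun p => k (z p) * f p)).
    apply: (@integrable_continuous _ _ B); first by apply: cntM => //; exact: cnt_comp cz.
    by move=> p; rewrite mulf_eq0 => /norP[_ /sf].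
  rewrite /G RintegralD//; [|exact: iH|exact: iW].
  rewrite gr -RintegralD//; [|by apply: (eq_integrable mfund (EFin \o (fun p => k (z p) * f p - chi d (z p) * W (z p) * f p))) => [p _|]; [rewrite /= mulrBl|apply: integrable_realB => //; exact: iW]|exact: iW].
  pose K (x : R4) : \bar R := (k (zeta4 Y x) * e x)%:E.
  have mK : measurable_fun setT K.
    apply/measurable_EFinP; apply: measurable_funM => //.
    apply: (measurableT_comp _ (zeta4_measurable Y)); exact: continuous_measurable_fun.
  have cov := change_of_variables h1 h2 h3 mK.
  transitivity (fine (\int[l3]_(p in fund) K (ads4 p))%E).
    congr fine; apply: eq_integral => p; rewrite inE => fp.
    rewrite /K /e ext_ads4//; last exact: (c2_per D).
    congr (_%:E); rewrite -/(z p); ring.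
  rewrite cov; transitivity (\int[l3]_(p in @cyl_dom R) (k p.1.2 * Psi (cyl4 p))).
    by congr fine; apply: eq_integral => p _; rewrite /K -/iso isoz.
  rewrite Rintegral_mkcond [RHS]Rintegral_mkcond; apply: eq_Rintegral => p _.
  rewrite !patchE indicE /cyl_dom in_setI.
  by case: (p \in fund) => //=; case: (p \in _) => /=; rewrite ?mul1r ?mul0r.
(* The quantity to be shown zero is independent of eta, while both errors, from E and from the
   limit, are O(eta). *)
apply/eqP; rewrite -subr_eq0 -normr_le0.
have d05 : 0 < d0 by [].
apply: (small_le0 (A := A + Nn * (Q * 4)) d05) => eta /andP[ep ed].
have e12 : 0 < eta <= 1/2 by rewrite ep (le_trans ed).
have e4 : eta ^+ 4 <= d0.
  by rewrite (le_trans _ ed)// exprS ger_pMr// exprn_ile1// ?(ltW ep)// (le_trans ed d01).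
have e40 : 0 < eta ^+ 4 <= d0 by rewrite exprn_gt0.
rewrite (TE (eta ^+ 4)) RintegralD//; [|exact: iE|by apply: iG; case/andP : e40].
rewrite intG//; have := hA _ e12 e4; rewrite kap => hk.
have le : `|\int[l3]_(p in fund) E (eta ^+ 4) p| <= Nn * (Q * 4) * eta.
  have iEe := iE _ e40.
  rewrite -lee_fin EFin_normr_Rintegral//.
  have mEe : measurable_fun fund (EFin \o E (eta ^+ 4)) by apply/measurable_EFinP; exact: (measurable_funTS (mE _)).
  apply: (le_trans (le_abse_integral l3 mfund mEe)); apply: (le_trans (lE _ e40)).
  rewrite lee_fin (_ : eta ^+ 4 = (eta ^+ 2) ^+ 2) -?exprM// exprM sqrtr_sqr ger0_norm ?sqr_ge0//.
  rewrite -(mulrA Nn) -(mulrA Q); apply: (ler_wpM2l Nn0); apply: (ler_wpM2l Q0); apply: ler_wpM2l => //.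
  by rewrite expr2 ger_pMr// (le_trans ed d01).
rewrite -addrA; apply: (le_trans (ler_normD _ _)); rewrite [leRHS]mulrDl [leLHS]addrC; exact: lerD.
Qed.

End Pairing.

(** * The branches of the radial kernel *)

Section Branches.
Variable R : realType.
Local Notation mR := (measurableTypeR R).
Implicit Types hR hL : R -> R.

(** Mirrors the case distinction of [Fh], including the value 0 at 1 and at -1. *)
Definition br hR hL (z : R) : R :=
  if 1 < z then hR z else if (-1 < z) && (z < 1) then hL z else 0.

Lemma br_right hR hL z : 1 < z -> br hR hL z = hR z. Proof. by rewrite /br => ->. Qed.
Lemma br_mid hR hL z : -1 < z < 1 -> br hR hL z = hL z.
Proof. by move=> h; have /andP[_ /ltW z1] := h; rewrite /br ltNge z1 h. Qed.
Lemma br_left hR hL z : z <= -1 -> br hR hL z = 0.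
Proof. by move=> h; rewrite /br ltNge (le_trans h)/= ?ltNge ?h// lerN10. Qed.
Lemma br_1 hR hL : br hR hL 1 = 0.
Proof. by rewrite /br ltxx andbF. Qed.

(** A property that depends only on the germ of the function can be checked branch by branch away
    from 1 and -1. *)
Lemma br_near hR hL (P : (R -> R) -> R -> Prop) (z : R) :
  (forall f g x, (\forall y \near x, f y = g y) -> P f x -> P g x) ->
  (1 < z -> P hR z) -> (-1 < z < 1 -> P hL z) -> (z < -1 -> P (fun=> 0) z) ->
  z != 1 -> z != -1 -> P (br hR hL) z.
Proof.
move=> Pn PR PL P0 z1 zN1; have [h|h|h] := ltgtP z 1.
- have [h'|h'|h'] := ltgtP (-1) z.
  + apply: Pn (PL _); last by rewrite h' h.
    have : \forall y \near z, -1 < y < 1.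
      by apply: filterS2 (lt_nbhsr h') (lt_nbhsl h) => y -> ->.
    by apply: filterS => y hy; rewrite br_mid.
  + apply: Pn (P0 h'); apply: filterS (lt_nbhsl h') => y /ltW hy; by rewrite br_left.
  + by rewrite -h' eqxx in zN1.
- by apply: Pn (PR h); apply: filterS (lt_nbhsr h) => y hy; rewrite br_right.
- by rewrite h eqxx in z1.
Qed.

Lemma is_derive_br (hR hL dR dL : R -> R) (z : R) :
  (1 < z -> is_derive z (1 : R) hR (dR z)) -> (-1 < z < 1 -> is_derive z (1 : R) hL (dL z)) ->
  z != 1 -> z != -1 -> is_derive z (1 : R) (br hR hL) (br dR dL z).
Proof.
move=> h1 h2; apply: (@br_near _ _ (fun f x => is_derive x (1 : R) f (br dR dL x))).
- by move=> f g x fg df; exact: near_eq_is_derive fg df.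
- by move=> h; rewrite br_right//; exact: h1.
- by move=> h; rewrite br_mid//; exact: h2.
- by move=> h; rewrite br_left ?ltW//; exact: derC.
Qed.

Lemma br_continuous hR hL (z : R) :
  (1 < z -> {for z, continuous hR}) -> (-1 < z < 1 -> {for z, continuous hL}) ->
  z != 1 -> z != -1 -> {for z, continuous (br hR hL)}.
Proof.
move=> h1 h2; apply: (@br_near _ _ (fun f x => {for x, continuous f})) => //.
- move=> f g x fg cf; have e : f x = g x := nbhs_singleton fg.
  suff : g @ x --> f x by rewrite e.
  by apply: cvg_trans cf; exact: near_eq_cvg fg.
- by move=> _; exact: cvg_cst.
Qed.

Lemma measurable_off_pm1 (f : R -> R) :
  (forall z, z != 1 -> z != -1 -> {for z, continuous f}) -> measurable_fun setT (f : mR -> mR).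
Proof.
move=> cf; pose D : set R := `]-oo, -1[ `|` `]-1, 1[ `|` `]1, +oo[.
have oD : open D by rewrite /D; do 2 (apply: openU => //); exact: interval_open.
have mD : measurable (D : set mR) by exact: open_measurable.
have mD' : measurable_fun (D : set mR) (f : mR -> mR).
  apply: open_continuous_measurable_fun => // x; rewrite inE /D/= !in_itv/= ?andbT => h.
  by apply: cf; apply/eqP => e; move: h; rewrite e; case=> [[|]|]; lra.
have -> : [set: mR] = D `|` ([set 1] `|` [set -1]).
  apply/seteqP; split => x // _; rewrite /D/= !in_itv/= ?andbT.
  have [h|h|->] := ltgtP x 1; [|by left; right|by right; left].
  by have [h'|h'|->] := ltgtP x (-1); [left; left; left|left; left; right|right; right].
apply/measurable_funU => //; first by apply: measurableU.
by split => //; apply/measurable_funU => //; split; exact: measurable_fun_set1.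
Qed.

End Branches.

(** * Damped trigonometric functions *)

Section ExponentialFamily.
Variable R : realType.

(** These are the real parts of the multiples of exp((p + i q) x). The family is closed under
    differentiation, which acts linearly on (u, v). *)
Definition expo (p q u v x : R) : R := expR (p * x) * (u * cos (q * x) + v * sin (q * x)).

Lemma is_derive_expo (p q u v x : R) :
  is_derive x (1 : R) (expo p q u v) (expo p q (p * u + q * v) (p * v - q * u) x).
Proof.
have dl (c : R) : is_derive x (1 : R) (fun x => c * x) c by dereq; rewrite /=; ring.
have de : is_derive x (1 : R) (fun x => expR (p * x)) (expR (p * x) * p).
  exact: (der_comp (h := @expR R) (f := fun x => p * x) (is_derive_expR _) (dl p)).
pose e x := expR (p * x); have {}de : is_derive x (1 : R) e (e x * p) := de.
rewrite (_ : expo p q u v = fun x => e x * (u * cos (q * x) + v * sin (q * x)))//.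
by dereq; rewrite /expo /e /=; ring.
Qed.

Lemma expo0 p q u v : expo p q u v 0 = u.
Proof. by rewrite /expo !mulr0 expR0 cos0 sin0 mulr0 addr0 mulr1 mul1r. Qed.

Lemma expo_continuous p q u v : continuous (expo p q u v).
Proof. by move=> x; exact: is_derive_continuous (is_derive_expo p q u v x). Qed.

Lemma bounded_segment (f : R -> R) (b : R) : continuous f ->
  exists2 M, 0 <= M & forall x, 0 <= x <= b -> `|f x| <= M.
Proof.
move=> cf; have : compact (f @` `[0, b]).
  by apply: continuous_compact; [exact: continuous_subspaceT|exact: segment_compact].
move=> /compact_bounded[M [_ hM]]; exists (`|M| + 1); first by rewrite addr_ge0.
move=> x xb; apply: hM; first by rewrite ltr_pwDr// ler_norm.
by exists x => //=; rewrite in_itv.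
Qed.

Lemma lipschitz_from_derivative (f df : R -> R) (M x : R) : 0 <= x ->
  (forall y, is_derive y (1 : R) f (df y)) -> (forall y, 0 <= y <= x -> `|df y| <= M) ->
  `|f x - f 0| <= M * x.
Proof.
rewrite le_eqVlt => /predU1P[<-|x0] dfy hM; first by rewrite subrr normr0 mulr0.
have cf : continuous f by move=> y; exact: is_derive_continuous (dfy y).
have [c] := MVT x0 (fun y _ => dfy y) (continuous_subspaceT cf).
rewrite in_itv/= subr0 => /andP[c0 cx] ->; rewrite normrM (gtr0_norm x0) ler_pM2r//.
by apply: hM; rewrite !ltW.
Qed.

End ExponentialFamily.

(** * Solutions of the radial equation *)

Section RadialSolutions.
Variable R : realType.
Local Notation mR := (measurableTypeR R).
Variables (gR gR1 gR2 gL gL1 gL2 : R -> R).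
Hypotheses (dR : forall x, is_derive x (1 : R) gR (gR1 x)) (dR1 : forall x, is_derive x (1 : R) gR1 (gR2 x))
  (dL : forall x, is_derive x (1 : R) gL (gL1 x)) (dL1 : forall x, is_derive x (1 : R) gL1 (gL2 x))
  (cR2 : continuous gR2) (cL2 : continuous gL2) (match0 : gR1 0 = gL1 0).

(** For z = cosh r > 1 this is sinh r and [rap z] is r; for z = cos theta, with theta between 0 and
    pi, [snS z] is sin theta. *)
Definition shS (z : R) : R := Num.sqrt (z ^+ 2 - 1).
Definition snS (z : R) : R := Num.sqrt (1 - z ^+ 2).
Definition rap (z : R) : R := ln (z + shS z).

Lemma shS_gt0 z : 1 < z -> 0 < shS z.
Proof. by move=> h; rewrite sqrtr_gt0; nra. Qed.
Lemma shS2 z : 1 < z -> shS z ^+ 2 = z ^+ 2 - 1.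
Proof. by move=> h; rewrite sqr_sqrtr//; nra. Qed.
Lemma snS_gt0 z : -1 < z < 1 -> 0 < snS z.
Proof. by move=> h; rewrite sqrtr_gt0; nra. Qed.
Lemma snS2 z : -1 < z < 1 -> snS z ^+ 2 = 1 - z ^+ 2.
Proof. by move=> h; rewrite sqr_sqrtr//; nra. Qed.

Lemma is_derive_shS (z : R) : 1 < z -> is_derive z (1 : R) shS (z / shS z).
Proof.
move=> h; have s0 := shS_gt0 h; have p : 0 < z ^+ 2 - 1 by nra.
by rewrite /shS; dereq; rewrite /= -/(shS z); field; rewrite gt_eqF.
Qed.

Lemma is_derive_snS (z : R) : -1 < z < 1 -> is_derive z (1 : R) snS (- z / snS z).
Proof.
move=> h; have s0 := snS_gt0 h; have p : 0 < 1 - z ^+ 2 by nra.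
by rewrite /snS; dereq; rewrite /= -/(snS z); field; rewrite gt_eqF.
Qed.

Lemma is_derive_rap (z : R) : 1 < z -> is_derive z (1 : R) rap (shS z)^-1.
Proof.
move=> h; have s0 := shS_gt0 h; have ds := is_derive_shS h.
have p : 0 < z + shS z by lra.
have dl := is_derive1_ln p.
have da : is_derive z (1 : R) (fun z => z + shS z) (1 + z / shS z) by dereq.
have H := der_comp (h := @ln R) (f := fun z => z + shS z) dl da.
by notypeclasses refine (der_eq H _); field; rewrite !gt_eqF.
Qed.

(** For V = g(r) / sinh r with z = cosh r, the expression (z^2 - 1) V'' + 3 z V' is (g'' - g) / sinh
    r; for V = g(theta) / sin theta with z = cos theta it is - (g'' + g) / sin theta. These are the
    branches of [radW]. *)
Definition radV := br (fun z => gR (rap z) / shS z) (fun z => gL (acos z) / snS z).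
Definition radV1 := br (fun z => gR1 (rap z) / shS z ^+ 2 - z * gR (rap z) / shS z ^+ 3)
  (fun z => - gL1 (acos z) / snS z ^+ 2 + z * gL (acos z) / snS z ^+ 3).
Definition radV2 := br (fun z => gR2 (rap z) / shS z ^+ 3 - 3 * z * gR1 (rap z) / shS z ^+ 4 -
    gR (rap z) / shS z ^+ 3 + 3 * z ^+ 2 * gR (rap z) / shS z ^+ 5)
  (fun z => gL2 (acos z) / snS z ^+ 3 - 3 * z * gL1 (acos z) / snS z ^+ 4 + gL (acos z) / snS z ^+ 3
    + 3 * z ^+ 2 * gL (acos z) / snS z ^+ 5).
Definition radW := br (fun z => (gR2 (rap z) - gR (rap z)) / shS z)
  (fun z => - (gL2 (acos z) + gL (acos z)) / snS z).

Lemma der_rap (g dg : R -> R) (z : R) : (forall x, is_derive x (1 : R) g (dg x)) -> 1 < z ->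
  is_derive z (1 : R) (fun z => g (rap z)) (dg (rap z) / shS z).
Proof. by move=> h z1; exact: (der_comp (h := g) (f := rap) (h _) (is_derive_rap z1)). Qed.

Lemma der_acos (g dg : R -> R) (z : R) : (forall x, is_derive x (1 : R) g (dg x)) -> -1 < z < 1 ->
  is_derive z (1 : R) (fun z => g (acos z)) (- dg (acos z) / snS z).
Proof.
move=> h z1; have H := der_comp (h := g) (f := @acos R) (h _) (is_derive1_acos z1).
by notypeclasses refine (der_eq H _); rewrite -/(snS z); ring.
Qed.

Lemma is_derive_radV (z : R) : z != 1 -> z != -1 -> is_derive z (1 : R) radV (radV1 z).
Proof.
apply: is_derive_br => h.
  have s0 : shS z != 0 by rewrite gt_eqF// shS_gt0.
  have a := der_rap dR h; have b := is_derive_shS h.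
  pose G z := gR (rap z); have {}a : is_derive z (1 : R) G _ := a.
  rewrite (_ : (fun z => gR (rap z) / shS z) = fun z => G z / shS z)//.
  by dereq; rewrite /G /=; field.
have s0 : snS z != 0 by rewrite gt_eqF// snS_gt0.
have a := der_acos dL h; have b := is_derive_snS h.
pose G z := gL (acos z); have {}a : is_derive z (1 : R) G _ := a.
rewrite (_ : (fun z => gL (acos z) / snS z) = fun z => G z / snS z)//.
by dereq; rewrite /G /=; field.
Qed.

Lemma is_derive_radV1 (z : R) : z != 1 -> z != -1 -> is_derive z (1 : R) radV1 (radV2 z).
Proof.
apply: is_derive_br => h.
  have s0 : shS z != 0 by rewrite gt_eqF// shS_gt0.
  have a := der_rap dR h; have b := is_derive_shS h; have a1 := der_rap dR1 h.
  pose G z := gR (rap z); have {}a : is_derive z (1 : R) G _ := a.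
  pose G1 z := gR1 (rap z); have {}a1 : is_derive z (1 : R) G1 _ := a1.
  have s2 : shS z ^+ 2 != 0 by rewrite expf_neq0.
  have s3 : shS z ^+ 3 != 0 by rewrite expf_neq0.
  rewrite (_ : (fun z => _) = fun z => G1 z / shS z ^+ 2 - z * G z / shS z ^+ 3)//.
  by dereq; rewrite /G /G1 /=; field.
have s0 : snS z != 0 by rewrite gt_eqF// snS_gt0.
have a := der_acos dL h; have b := is_derive_snS h; have a1 := der_acos dL1 h.
pose G z := gL (acos z); have {}a : is_derive z (1 : R) G _ := a.
pose G1 z := gL1 (acos z); have {}a1 : is_derive z (1 : R) G1 _ := a1.
have s2 : snS z ^+ 2 != 0 by rewrite expf_neq0.
have s3 : snS z ^+ 3 != 0 by rewrite expf_neq0.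
rewrite (_ : (fun z => _) = fun z => - G1 z / snS z ^+ 2 + z * G z / snS z ^+ 3)//.
by dereq; rewrite /G /G1 /=; field.
Qed.

Lemma cR (z : R) : 1 < z -> forall g : R -> R, continuous g -> {for z, continuous (fun z => g (rap z))}.
Proof.
move=> h g cg; apply: (@continuous_comp _ _ _ rap g); last exact: cg.
exact: is_derive_continuous (is_derive_rap h).
Qed.

Lemma cL (z : R) : -1 < z < 1 -> forall g : R -> R, continuous g -> {for z, continuous (fun z => g (acos z))}.
Proof.
move=> h g cg; apply: (@continuous_comp _ _ _ (@acos R) g); last exact: cg.
exact: continuous_acos.
Qed.

Let cont (f df : R -> R) : (forall x, is_derive x (1 : R) f (df x)) -> continuous f.
Proof. by move=> h x; exact: is_derive_continuous (h x). Qed.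

Lemma radV2_continuous (z : R) : z != 1 -> z != -1 -> {for z, continuous radV2}.
Proof.
have cX (f : R -> R) n : {for z, continuous f} -> {for z, continuous (fun x => f x ^+ n)}.
  by move=> cf; apply: (@continuous_comp _ _ _ f (fun y => y ^+ n)) => //; exact: exprn_continuous.
have cc (c : R) : {for z, continuous (fun=> c)} by exact: cvg_cst.
have cid : {for z, continuous (fun z : R => z)} by exact: cvg_id.
apply: br_continuous => h.
  have s0 n : shS z ^+ n != 0 by rewrite expf_neq0// gt_eqF// shS_gt0.
  have cs : {for z, continuous shS} by exact: is_derive_continuous (is_derive_shS h).
  have ci n : {for z, continuous (fun z => (shS z ^+ n)^-1)} by apply: cvgV => //; exact: cX.
  have k0 := cR h (cont dR); have k1 := cR h (cont dR1); have k2 := cR h cR2.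
  apply: cvgD; [apply: cvgB; [apply: cvgB|]|].
  - exact: (cvgM k2 (ci _)).
  - exact: (cvgM (cvgM (cvgM (cc 3) cid) k1) (ci _)).
  - exact: (cvgM k0 (ci _)).
  - exact: (cvgM (cvgM (cvgM (cc 3) (cX _ 2 cid)) k0) (ci _)).
have s0 n : snS z ^+ n != 0 by rewrite expf_neq0// gt_eqF// snS_gt0.
have cs : {for z, continuous snS} by exact: is_derive_continuous (is_derive_snS h).
have ci n : {for z, continuous (fun z => (snS z ^+ n)^-1)} by apply: cvgV => //; exact: cX.
have k0 := cL h (cont dL); have k1 := cL h (cont dL1); have k2 := cL h cL2.
apply: cvgD; [apply: cvgD; [apply: cvgB|]|].
- exact: (cvgM k2 (ci _)).
- exact: (cvgM (cvgM (cvgM (cc 3) cid) k1) (ci _)).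
- exact: (cvgM k0 (ci _)).
- exact: (cvgM (cvgM (cvgM (cc 3) (cX _ 2 cid)) k0) (ci _)).
Qed.

Lemma radW_continuous (z : R) : z != 1 -> z != -1 -> {for z, continuous radW}.
Proof.
apply: br_continuous => h.
  have cs : {for z, continuous shS} by exact: is_derive_continuous (is_derive_shS h).
  have s0 : shS z != 0 by rewrite gt_eqF// shS_gt0.
  have k0 := cR h (cont dR); have k2 := cR h cR2.
  exact: (cvgM (cvgB k2 k0) (cvgV s0 cs)).
have cs : {for z, continuous snS} by exact: is_derive_continuous (is_derive_snS h).
have s0 : snS z != 0 by rewrite gt_eqF// snS_gt0.
have k0 := cL h (cont dL); have k2 := cL h cL2.
exact: (cvgM (cvgN (cvgD k2 k0)) (cvgV s0 cs)).
Qed.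

Lemma rad_ode z : -1 < z -> z != 1 -> (z ^+ 2 - 1) * radV2 z + 3 * z * radV1 z = radW z.
Proof.
move=> z0 z1; have [h|h|h] := ltgtP z 1; last by rewrite h eqxx in z1.
  have hh : -1 < z < 1 by rewrite z0 h.
  rewrite /radV2 /radV1 /radW !br_mid//; have s0 := snS_gt0 hh.
  rewrite (_ : z ^+ 2 - 1 = - snS z ^+ 2); last by rewrite snS2//; ring.
  by field; rewrite gt_eqF.
rewrite /radV2 /radV1 /radW !br_right//; have s0 := shS_gt0 h.
by rewrite -shS2//; field; rewrite gt_eqF.
Qed.

Lemma rap_bounds (z : R) : 1 < z -> 0 <= rap z <= z - 1 + shS z.
Proof.
move=> h; have s0 := shS_gt0 h; rewrite /rap ln_ge0; last lra.
have := @le_ln1Dx R (z + shS z - 1).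
rewrite (_ : 1 + (z + shS z - 1) = z + shS z) => [/(_ ltac:(lra))|]; [rewrite /=; lra|ring].
Qed.

Lemma shS_ge (z : R) : 1 < z -> Num.sqrt `|z - 1| <= shS z.
Proof. by move=> h; rewrite ler_sqrt; [rewrite gtr0_norm; [nra|lra]|nra]. Qed.

Lemma snS_ge (z : R) : 0 <= z < 1 -> Num.sqrt `|z - 1| <= snS z.
Proof. by move=> h; rewrite ler_sqrt; [rewrite ltr0_norm; [nra|lra]|nra]. Qed.

(** The cosine 1 - d is at least 1/2, so the angle is at most twice its sine, and the sine sqrt(2 d
    - d^2) is at most 2 sqrt d. *)
Lemma acos_near1 (d : R) : 0 < d <= 1/4 -> 0 <= acos (1 - d) <= 4 * Num.sqrt d /\ acos (1 - d) <= pi.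
Proof.
move=> hd; have z1 : -1 <= 1 - d <= 1 by lra.
have t0 := acos_ge0 z1; have tp := acos_lepi z1; split => //.
have := @angle_le_sin R (acos (1 - d)); rewrite ger0_norm// acosK ?in_itv//= => /(_ tp ltac:(lra)) h.
rewrite t0 (le_trans h)// sin_acos// ger0_norm ?sqrtr_ge0//.
have : Num.sqrt (1 - (1 - d) ^+ 2) <= 2 * Num.sqrt d; last lra.
rewrite -ler_sqr ?nnegrE ?sqrtr_ge0 ?mulr_ge0 ?sqrtr_ge0// exprMn !sqr_sqrtr; nra.
Qed.

Section Singular.
Variable delta : R.
Hypothesis dl : 0 < delta <= 1/2.

(** Cut-off at the other singular level: 0 for z <= -1 + delta / 2 and 1 for z >= -1 + delta, so
    that 1 is the only singularity left. *)
Definition lcut (z : R) : R := spl (6 / delta * (z + 1) - 3).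
Definition lcut1 (z : R) : R := spl1 (6 / delta * (z + 1) - 3) * (6 / delta).
Definition lcut2 (z : R) : R := spl2 (6 / delta * (z + 1) - 3) * (6 / delta) * (6 / delta).

Lemma lcut_right z : -1 + delta <= z -> [/\ lcut z = 1, lcut1 z = 0 & lcut2 z = 0].
Proof.
move=> h; have d0 : 0 < delta by case/andP : dl.
have : 3 <= 6 / delta * (z + 1) - 3.
  have : 6 <= 6 / delta * (z + 1) by rewrite mulrAC ler_pdivlMr//; lra.
  lra.
by move=> /spl_ge3[a b c]; rewrite /lcut /lcut1 /lcut2 a b c !mul0r.
Qed.

Lemma lcut_left z : z <= -1 + delta / 2 -> [/\ lcut z = 0, lcut1 z = 0 & lcut2 z = 0].
Proof.
move=> h; have d0 : 0 < delta by case/andP : dl.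
have : 6 / delta * (z + 1) - 3 <= 0.
  have : 6 / delta * (z + 1) <= 3 by rewrite mulrAC ler_pdivrMr//; lra.
  lra.
by move=> /spl_le0[a b c]; rewrite /lcut /lcut1 /lcut2 a b c !mul0r.
Qed.

Let darg (z : R) : is_derive z (1 : R) (fun z => 6 / delta * (z + 1) - 3) (6 / delta).
Proof. by dereq; rewrite /=; ring. Qed.

Lemma is_derive_lcut (z : R) : is_derive z (1 : R) lcut (lcut1 z).
Proof.
have H := der_comp (h := @spl R) (f := fun z : R => 6 / delta * (z + 1) - 3) (is_derive_spl _) (darg z).
exact: H.
Qed.

Lemma is_derive_lcut1 (z : R) : is_derive z (1 : R) lcut1 (lcut2 z).
Proof.
have H := der_comp (h := @spl1 R) (f := fun z : R => 6 / delta * (z + 1) - 3) (is_derive_spl1 _) (darg z).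
pose s z := spl1 (6 / delta * (z + 1) - 3); have {}H : is_derive z (1 : R) s _ := H.
rewrite (_ : lcut1 = fun z => s z * (6 / delta))//.
by dereq; rewrite /lcut2 /=; ring.
Qed.

Lemma lcut2_continuous : continuous lcut2.
Proof.
have c : continuous (fun z : R => 6 / delta * (z + 1) - 3) by move=> z; exact: is_derive_continuous (darg z).
have c2 := cnt_comp (@spl2_continuous R) c.
by apply: cntM; [apply: cntM => //|]; exact: cntC.
Qed.

Definition cutV z := lcut z * radV z.
Definition cutV1 z := lcut1 z * radV z + lcut z * radV1 z.
Definition cutV2 z := lcut2 z * radV z + 2 * lcut1 z * radV1 z + lcut z * radV2 z.
Definition cutW z := lcut z * radW z.

Lemma near_lcut0 (z : R) : z <= -1 ->
  \forall y \near z, [/\ lcut y = 0, lcut1 y = 0 & lcut2 y = 0].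
Proof.
move=> h; have d0 : 0 < delta by case/andP : dl.
have hz : z < -1 + delta / 2 by lra.
by apply: filterS (lt_nbhsl hz) => y hy; apply: lcut_left; exact: ltW.
Qed.

Lemma is_derive_cutV (z : R) : z != 1 -> is_derive z (1 : R) cutV (cutV1 z).
Proof.
move=> z1; have [h|h] := leP z (-1).
  have n := near_lcut0 h; have [a b _] := nbhs_singleton n.
  rewrite /cutV1 a b !mul0r addr0; have e0 := derC (0 : R) z (1 : R); apply: near_eq_is_derive e0.
  by apply: filterS n => y [y0 _ _]; rewrite /cutV y0 mul0r.
have zN1 : z != -1 by rewrite gt_eqF.
have := derM (is_derive_lcut z) (is_derive_radV z1 zN1) => H.
by notypeclasses refine (der_eq H _); rewrite /cutV1; ring.
Qed.

Lemma is_derive_cutV1 (z : R) : z != 1 -> is_derive z (1 : R) cutV1 (cutV2 z).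
Proof.
move=> z1; have [h|h] := leP z (-1).
  have n := near_lcut0 h; have [a b c] := nbhs_singleton n.
  rewrite /cutV2 a b c !mul0r mulr0 mul0r !addr0; have e0 := derC (0 : R) z (1 : R); apply: near_eq_is_derive e0.
  by apply: filterS n => y [y0 y1 _]; rewrite /cutV1 y0 y1 !mul0r addr0.
have zN1 : z != -1 by rewrite gt_eqF.
have := derD (derM (is_derive_lcut1 z) (is_derive_radV z1 zN1))
  (derM (is_derive_lcut z) (is_derive_radV1 z1 zN1)) => H.
by notypeclasses refine (der_eq H _); rewrite /cutV2; ring.
Qed.

Let cutcont (c U : R -> R) (z : R) : continuous c -> (z <= -1 -> \forall y \near z, c y = 0) ->
  (z != 1 -> z != -1 -> {for z, continuous U}) -> z != 1 -> {for z, continuous (fun y => c y * U y)}.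
Proof.
move=> cc c0 cU z1; have [h|h] := leP z (-1).
  have E : \forall y \near z, 0 = c y * U y.
    by apply: filterS (c0 h) => y ->; rewrite mul0r.
  have k : (fun y => c y * U y) @ z --> (0 : R).
    by apply: cvg_trans (near_eq_cvg E) _; exact: cvg_cst.
  by have e := nbhs_singleton E; rewrite e in k.
apply: cvgM; first exact: cc.
by apply: cU => //; rewrite gt_eqF.
Qed.

Lemma cutV2_continuous (z : R) : z != 1 -> {for z, continuous cutV2}.
Proof.
move=> z1.
have c0 : continuous lcut by move=> y; exact: is_derive_continuous (is_derive_lcut y).
have c1 : continuous lcut1 by move=> y; exact: is_derive_continuous (is_derive_lcut1 y).
have k0 : {for z, continuous (fun y => lcut2 y * radV y)}.
  apply: cutcont => //; first exact: lcut2_continuous.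
    by move=> /near_lcut0; apply: filterS => y [].
  by move=> a b; exact: is_derive_continuous (is_derive_radV a b).
have k1 : {for z, continuous (fun y => 2 * lcut1 y * radV1 y)}.
  apply: (@cutcont (fun y => 2 * lcut1 y)) => //.
  - by apply: cntM => //; exact: cntC.
  - by move=> /near_lcut0; apply: filterS => y [_ -> _]; rewrite mulr0.
  - by move=> a b; exact: is_derive_continuous (is_derive_radV1 a b).
have k2 : {for z, continuous (fun y => lcut y * radV2 y)}.
  apply: cutcont => //; last exact: radV2_continuous.
  by move=> /near_lcut0; apply: filterS => y [].
exact: (cvgD (cvgD k0 k1) k2).
Qed.

Lemma cutW_continuous (z : R) : z != 1 -> {for z, continuous cutW}.
Proof.
move=> z1; apply: cutcont => //; last exact: radW_continuous.
  by move=> y; exact: is_derive_continuous (is_derive_lcut y).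
by move=> /near_lcut0; apply: filterS => y [].
Qed.

Lemma cutV_measurable : measurable_fun setT (cutV : mR -> mR) /\ measurable_fun setT (cutW : mR -> mR).
Proof.
split; apply: measurable_off_pm1 => z z1 _; last exact: cutW_continuous.
exact: is_derive_continuous (is_derive_cutV z1).
Qed.

Lemma cutV_eq z : -1 + delta <= z -> [/\ cutV z = radV z, cutV1 z = radV1 z, cutV2 z = radV2 z & cutW z = radW z].
Proof.
move=> h; have [a b c] := lcut_right h.
by rewrite /cutV /cutV1 /cutV2 /cutW a b c !(mul1r, mul0r, mulr0, add0r).
Qed.

Local Ltac keep := clear -dR dR1 cR2 dL dL1 cL2 match0 dl cont darg cutcont.

(** The flux z V + (z^2 - 1) V' is gR'(r) on the right of 1 and gL'(theta) on the left, so [match0]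
    says that it has no jump. Below 1, (sin theta)^3 V' = cos theta gL(theta) - sin theta
    gL'(theta), which tends to gL(0). At distance d from 1 both r and theta are at most 4 sqrt d,
    and Lipschitz bounds give the rate sqrt d. *)
Lemma radial_singular : exists C, singular cutV cutV1 cutV2 cutW C (1/4) (gL 0) delta.
Proof.
have [a0 a0p ha0] := bounded_segment 1 (cont dR); have [a1 a1p ha1] := bounded_segment 1 (cont dR1).
have [a2 a2p ha2] := bounded_segment 1 cR2.
have [b0 b0p hb0] := bounded_segment pi (cont dL); have [b1 b1p hb1] := bounded_segment pi (cont dL1).
have [b2 b2p hb2] := bounded_segment pi cL2.
pose M := a0 + a1 + a2 + b0 + b1 + b2.
have M0 : 0 <= M by rewrite /M; lra.
have [dl0 dl1] := andP dl.
(* For z <= 5/4 one has sinh r <= 3/4 and r <= 1/4 + 3/4; this is why the right-hand functions are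
   bounded on [0, 1]. *)
have rb (z : R) : 1 < z -> z - 1 <= 1/4 -> 0 <= rap z <= 1 /\ shS z <= 1.
  keep; move=> h h4; have s0 := shS_gt0 h; have s2 := shS2 h.
  have s34 : shS z <= 3/4 by nra.
  by have := rap_bounds h; split; lra.
have hR (z : R) : 1 < z -> z - 1 <= 1/4 -> [/\ `|gR (rap z)| <= M, `|gR1 (rap z)| <= M & `|gR2 (rap z)| <= M].
  move=> h h4; have [r1 _] := rb z h h4; rewrite /M.
  have k0 := ha0 _ r1; have k1 := ha1 _ r1; have k2 := ha2 _ r1.
  by move: k0 k1 k2 a0p a1p a2p b0p b1p b2p; keep => *; split; lra.
have hL (z : R) : -1 < z < 1 -> [/\ `|gL (acos z)| <= M, `|gL1 (acos z)| <= M & `|gL2 (acos z)| <= M].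
  move=> h; have z1 : -1 <= z <= 1 by lra.
  have r1 : 0 <= acos z <= pi by rewrite acos_ge0// acos_lepi.
  have k0 := hb0 _ r1; have k1 := hb1 _ r1; have k2 := hb2 _ r1; rewrite /M.
  by move: k0 k1 k2 a0p a1p a2p b0p b1p b2p; keep => *; split; lra.
have M1 (y : R) : 0 <= y <= 1 -> `|gR1 y| <= M /\ `|gR2 y| <= M.
  move=> hy; have k1 := ha1 _ hy; have k2 := ha2 _ hy; rewrite /M.
  by move: k1 k2 a0p a1p a2p b0p b1p b2p; keep => *; split; lra.
have ML (y : R) : 0 <= y <= pi -> `|gL1 y| <= M /\ `|gL2 y| <= M.
  move=> hy; have k1 := hb1 _ hy; have k2 := hb2 _ hy; rewrite /M.
  by move: k1 k2 a0p a1p a2p b0p b1p b2p; keep => *; split; lra.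
have quot (x s u : R) (n : nat) : 0 <= u -> u <= s -> 0 < s -> `|x| <= M -> `|x / s ^+ n| * u ^+ n <= M.
  move=> u0 us s0 xM; rewrite normrM normfV (ger0_norm (exprn_ge0 _ (ltW s0))) mulrAC.
  rewrite ler_pdivrMr ?exprn_gt0//; apply: ler_pM => //; first exact: exprn_ge0.
  by rewrite lerXn2r// nnegrE// ltW.
have quot1 (x s u : R) : 0 <= u -> u <= s -> 0 < s -> `|x| <= M -> `|x / s| * u <= M.
  by move=> *; have := @quot x s u 1; rewrite !expr1; apply.
have zcase (z : R) : `|z - 1| <= 1/4 -> -1 + delta <= z /\ [\/ z = 1, 1 < z /\ z - 1 <= 1/4 | 0 <= z < 1].
  rewrite ler_norml => h; split; first by move: h dl1; keep => *; lra.
  move: h; keep => h; by have [h1|h1|h1] := ltgtP z 1; [apply: Or33|apply: Or32|apply: Or31] => //; lra.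
have u1 (z : R) : `|z - 1| <= 1/4 -> 0 <= Num.sqrt `|z - 1| <= 1.
  move=> h; rewrite sqrtr_ge0/= -[leRHS]sqrtr1 ler_sqrt//; lra.
(* The flux condition sets the constant: M times 4 sqrt d from either side of 1. *)
exists (8 * M); split.
- by move=> z; exact: is_derive_cutV.
- by move=> z; exact: is_derive_cutV1.
- by move=> z; exact: cutV2_continuous.
- by move=> z; exact: cutW_continuous.
- move=> z h z1; have [_ -> -> ->] := cutV_eq h; apply: rad_ode => //; lra.
- move=> z h; have [/cutV_eq[-> _ _ _]] := zcase z h; have /andP[u0 _] := u1 z h.
  case=> [->|[h1 h2]|h1].
  + by rewrite /radV br_1 normr0 mul0r; move: M0; keep => *; lra.
  + rewrite /radV br_right//; have [k0 _ _] := hR z h1 h2.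
    by have q := quot1 _ _ _ u0 (shS_ge h1) (shS_gt0 h1) k0; move: q M0; keep => *; lra.
  + have h2 : -1 < z < 1 by move: h1; keep => *; lra.
    rewrite /radV br_mid//; have [k0 _ _] := hL z h2.
    by have q := quot1 _ _ _ u0 (snS_ge h1) (snS_gt0 h2) k0; move: q M0; keep => *; lra.
- move=> z h; have [/cutV_eq[_ -> _ _]] := zcase z h; have /andP[u0 ul] := u1 z h.
  have u32 : Num.sqrt `|z - 1| ^+ 3 <= Num.sqrt `|z - 1| ^+ 2.
    by rewrite [leLHS]exprS ler_piMl ?exprn_ge0.
  case=> [->|[h1 h2]|h1].
  + by rewrite /radV1 br_1 normr0 mul0r; move: M0; keep => *; lra.
  + rewrite /radV1 br_right//; have [k0 k1 _] := hR z h1 h2.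
    have q1 := quot _ _ _ 2 u0 (shS_ge h1) (shS_gt0 h1) k1.
    have q2 := quot _ _ _ 3 u0 (shS_ge h1) (shS_gt0 h1) k0.
    have q3 : `|gR1 (rap z) / shS z ^+ 2| * Num.sqrt `|z - 1| ^+ 3 <= M.
      by apply: le_trans q1; rewrite ler_wpM2l.
    have z2 : `|z| <= 2 by move: h1 h2; keep => *; rewrite ger0_norm; lra.
    apply: (le_trans (ler_wpM2r (exprn_ge0 3 u0) (ler_normB _ _))); rewrite mulrDl -[z * _ / _]mulrA [`|z * _|]normrM.
    have q4 : `|z| * `|gR (rap z) / shS z ^+ 3| * Num.sqrt `|z - 1| ^+ 3 <= 2 * M.
      by rewrite -mulrA; apply: ler_pM => //; rewrite mulr_ge0 ?exprn_ge0.
    by move: q3 q4 M0; keep => *; lra.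
  + have h2 : -1 < z < 1 by move: h1; keep => *; lra.
    rewrite /radV1 br_mid//; have [k0 k1 _] := hL z h2; rewrite -normrN in k1.
    have q1 := quot _ _ _ 2 u0 (snS_ge h1) (snS_gt0 h2) k1.
    have q2 := quot _ _ _ 3 u0 (snS_ge h1) (snS_gt0 h2) k0.
    have q3 : `|- gL1 (acos z) / snS z ^+ 2| * Num.sqrt `|z - 1| ^+ 3 <= M.
      by apply: le_trans q1; rewrite ler_wpM2l.
    have z2 : `|z| <= 2 by move: h1 h2; keep => *; rewrite ger0_norm; lra.
    apply: (le_trans (ler_wpM2r (exprn_ge0 3 u0) (ler_normD _ _))); rewrite mulrDl -[z * _ / _]mulrA [`|z * _|]normrM.
    have q4 : `|z| * `|gL (acos z) / snS z ^+ 3| * Num.sqrt `|z - 1| ^+ 3 <= 2 * M.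
      by rewrite -mulrA; apply: ler_pM => //; rewrite mulr_ge0 ?exprn_ge0.
    by move: q3 q4 M0; keep => *; lra.
- move=> z h; have [/cutV_eq[_ _ _ ->]] := zcase z h; have /andP[u0 _] := u1 z h.
  case=> [->|[h1 h2]|h1].
  + by rewrite /radW br_1 normr0 mul0r; move: M0; keep => *; lra.
  + rewrite /radW br_right//; have [k0 _ k2] := hR z h1 h2; rewrite mulrBl.
    have q1 := quot1 _ _ _ u0 (shS_ge h1) (shS_gt0 h1) k0; have q2 := quot1 _ _ _ u0 (shS_ge h1) (shS_gt0 h1) k2.
    by apply: (le_trans (ler_wpM2r u0 (ler_normB _ _))); rewrite mulrDl; move: q1 q2 M0; keep => *; lra.
  + have h2 : -1 < z < 1 by move: h1; keep => *; lra.
    rewrite /radW br_mid//; have [k0 _ k2] := hL z h2; rewrite mulNr normrN mulrDl.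
    have q1 := quot1 _ _ _ u0 (snS_ge h1) (snS_gt0 h2) k0; have q2 := quot1 _ _ _ u0 (snS_ge h1) (snS_gt0 h2) k2.
    by apply: (le_trans (ler_wpM2r u0 (ler_normD _ _))); rewrite mulrDl; move: q1 q2 M0; keep => *; lra.
- move=> d hd; have [d0 d4] := andP hd.
  have h1 : 1 < 1 + d by move: d0; keep => *; lra.
  have h2 : -1 < 1 - d < 1 by move: d0 d4; keep => *; lra.
  have [-> -> _ _] : [/\ cutV (1 + d) = radV (1 + d), cutV1 (1 + d) = radV1 (1 + d), cutV2 (1 + d) = radV2 (1 + d) & cutW (1 + d) = radW (1 + d)].
    by apply: cutV_eq; move: d0 d4 dl1; keep => *; lra.
  have [-> -> _ _] : [/\ cutV (1 - d) = radV (1 - d), cutV1 (1 - d) = radV1 (1 - d), cutV2 (1 - d) = radV2 (1 - d) & cutW (1 - d) = radW (1 - d)].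
    by apply: cutV_eq; move: d0 d4 dl1; keep => *; lra.
  rewrite /radV /radV1 !(br_right _ _ h1) !(br_mid _ _ h2).
  have s0 := shS_gt0 h1; have n0 := snS_gt0 h2.
  rewrite -(shS2 h1) (_ : (1 - d) ^+ 2 - 1 = - snS (1 - d) ^+ 2); last by rewrite snS2//; ring.
  set A := _ + _ in s0 *; set z := 1 - d in n0 h2 *.
  rewrite (_ : A * _ + _ = gR1 (rap A)); last by field; rewrite gt_eqF.
  rewrite (_ : z * _ + _ = gL1 (acos z)); last by field; rewrite gt_eqF.
  have [r1 _] := rb A h1 ltac:(rewrite /A; move: d4; keep => *; lra); have [r0 r1'] := andP r1.
  have [t1 tp] := acos_near1 hd; have [t0 t1'] := andP t1.
  have e1 : `|gR1 (rap A) - gR1 0| <= M * rap A.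
    apply: (@lipschitz_from_derivative R gR1 gR2) => // y /andP[y0 y1].
    by have [] := M1 y => //; rewrite y0 (le_trans y1).
  have e2 : `|gL1 (acos z) - gL1 0| <= M * acos z.
    apply: (@lipschitz_from_derivative R gL1 gL2) => // y /andP[y0 y1].
    by have [] := ML y => //; rewrite y0 (le_trans y1).
  have ra : rap A <= 4 * Num.sqrt d.
    have sd2 : Num.sqrt d ^+ 2 = d by rewrite sqr_sqrtr// ltW.
    have sd0 := sqrtr_ge0 d; have rA := rap_bounds h1; have sA := shS2 h1; rewrite -/A in rA sA.
    have k1 : shS A <= 2 * Num.sqrt d.
      by rewrite -ler_sqr ?nnegrE ?(ltW s0) ?mulr_ge0// sA exprMn sd2 /A; move: d0 d4; keep => *; nra.
    have k2 : d <= Num.sqrt d by move: sd2 sd0 d0 d4; keep => *; nra.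
    by move: rA k1 k2; keep => rA k1 k2; rewrite /A in rA *; lra.
  rewrite (_ : gR1 (rap A) - gL1 (acos z) = (gR1 (rap A) - gR1 0) - (gL1 (acos z) - gL1 0)); last by rewrite match0; ring.
  apply: (le_trans (ler_normB _ _)).
  have k1 := ler_wpM2l M0 ra; have k2 := ler_wpM2l M0 t1'; rewrite -/z in k2.
  by move: k1 k2 e1 e2 M0 d0; keep => *; lra.
- move=> d hd; have [d0 d4] := andP hd.
  have h2 : -1 < 1 - d < 1 by lra.
  have [_ -> _ _] : [/\ cutV (1 - d) = radV (1 - d), cutV1 (1 - d) = radV1 (1 - d), cutV2 (1 - d) = radV2 (1 - d) & cutW (1 - d) = radW (1 - d)].
    by apply: cutV_eq; move: d0 d4 dl1; keep => *; lra.
  rewrite /radV1 br_mid// -/(snS (1 - d)).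
  have n0 := snS_gt0 h2; have n2 := snS2 h2; have [k0 k1 _] := hL _ h2.
  have [t1 tp] := acos_near1 hd; have [t0 t1'] := andP t1.
  have e2 : `|gL (acos (1 - d)) - gL 0| <= M * acos (1 - d).
    apply: (@lipschitz_from_derivative R gL gL1) => // y /andP[y0 y1].
    by have [] := ML y => //; rewrite y0 (le_trans y1).
  have sd2 : Num.sqrt d ^+ 2 = d by rewrite sqr_sqrtr// ltW.
  have sd0 := sqrtr_ge0 d.
  have ns : snS (1 - d) <= 2 * Num.sqrt d.
    by rewrite -ler_sqr ?nnegrE ?(ltW n0) ?mulr_ge0// n2 exprMn sd2; move: d0 d4; keep => *; nra.
  have dd : d <= Num.sqrt d by move: sd2 sd0 d0 d4; keep => *; nra.
  rewrite (_ : _ - gL 0 = (gL (acos (1 - d)) - gL 0) - d * gL (acos (1 - d)) - snS (1 - d) * gL1 (acos (1 - d))); last by field; rewrite gt_eqF.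
  apply: (le_trans (ler_normB _ _)); apply: (le_trans (lerD (ler_normB _ _) (lexx _))).
  rewrite !normrM (gtr0_norm d0) (gtr0_norm n0).
  have k2 : d * `|gL (acos (1 - d))| <= Num.sqrt d * M by apply: ler_pM => //; exact: ltW.
  have k3 : snS (1 - d) * `|gL1 (acos (1 - d))| <= (2 * Num.sqrt d) * M by apply: ler_pM => //; exact: ltW.
  have k4 := ler_wpM2l M0 t1'; have k5 := mulr_ge0 M0 sd0.
  by move: e2 k2 k3 k4 k5; keep => *; lra.
- by lra.
- by lra.
- exact: dl.
Qed.

End Singular.
End RadialSolutions.

Local Open Scope complex_scope.

(** * The Laplacian on test functions *)

Section ComplexParts.
Variable R : realType.
Implicit Types x y : R[i].

Lemma ReD x y : complex.Re (x + y) = complex.Re x + complex.Re y. Proof. by case: x y => ? ? []. Qed.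
Lemma ImD x y : complex.Im (x + y) = complex.Im x + complex.Im y. Proof. by case: x y => ? ? []. Qed.
Lemma ReN x : complex.Re (- x) = - complex.Re x. Proof. by case: x. Qed.
Lemma ImN x : complex.Im (- x) = - complex.Im x. Proof. by case: x. Qed.
Lemma ReM x y : complex.Re (x * y) = complex.Re x * complex.Re y - complex.Im x * complex.Im y.
Proof. by case: x y => ? ? []. Qed.
Lemma ImM x y : complex.Im (x * y) = complex.Re x * complex.Im y + complex.Im x * complex.Re y.
Proof. by case: x y => ? ? []. Qed.
Lemma ReZ (c : R) x : complex.Re (c%:C * x) = c * complex.Re x.
Proof. by rewrite ReM /= mul0r subr0. Qed.
Lemma ImZ (c : R) x : complex.Im (c%:C * x) = c * complex.Im x.
Proof. by rewrite ImM /= mul0r addr0. Qed.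
Lemma eq_ReIm x y : complex.Re x = complex.Re y -> complex.Im x = complex.Im y -> x = y.
Proof. by case: x y => ? ? [? ?] /= -> ->. Qed.
End ComplexParts.

(** * Metric, volume density and Laplacian in the chart *)

Section Metric.
Variable R : realType.
Local Notation R3 := (R * R * R)%type.
Local Notation I0 := (inord 0 : 'I_3).
Local Notation I1 := (inord 1 : 'I_3).
Local Notation I2 := (inord 2 : 'I_3).

Lemma sum3 (V : nmodType) (F : 'I_3 -> V) : \sum_(i < 3) F i = F I0 + F I1 + F I2.
Proof.
rewrite !big_ord_recl big_ord0 addr0 addrA; congr (F _ + F _ + F _);
  by apply/val_inj; rewrite /= inordK.
Qed.

Lemma ord3 (i : 'I_3) : [\/ i = I0, i = I1 | i = I2].
Proof.
by case: i => [[|[|[|//]]] ip]; [apply: Or31|apply: Or32|apply: Or33]; apply/val_inj; rewrite /= inordK.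
Qed.

Let rr (p : R3) : R := Num.sqrt (rsq p).
Let rr0 p : rr p != 0. Proof. by rewrite gt_eqF// sqrtr_gt0 rsq_gt0. Qed.
Let rr2 p : rr p ^+ 2 = rsq p. Proof. by rewrite sqr_sqrtr// ltW// rsq_gt0. Qed.

Definition dPhi (p : R3) (i j : nat) : R :=
  let t := p.1.1 in let a := p.1.2 in let b := p.2 in
  nth 0 (nth [::] [:: [:: - (rr p * sin t); rr p * cos t; 0; 0];
                      [:: a / rr p * cos t; a / rr p * sin t; 1; 0];
                      [:: b / rr p * cos t; b / rr p * sin t; 0; 1]] i) j.

Lemma is_derive_Phi (p : R3) (i : 'I_3) (j : 'I_4) :
  is_derive p (pbasis R i) (fun p => Phi p 0 j) (dPhi p i j).
Proof.
have r0 := rr0 p; have rp := rsq_gt0 p.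
have dr (k : 'I_3) : is_derive p (pbasis R k) rr
    ((p.1.2 * (k == 1%N :> nat)%:R + p.2 * (k == 2%N :> nat)%:R) / rr p).
  rewrite /rr /rsq; rewrite /rsq in rp; dereq; rewrite /= -/(rsq p) -/(rr p); field; exact: r0.
have -> : (fun p => Phi p 0 j) = (fun p : R3 => nth 0 [:: rr p * cos p.1.1; rr p * sin p.1.1; p.1.2; p.2] j).
  by apply/funext => x; rewrite /Phi mxE.
have D := dr i.
move: i D => [[|[|[|//]]] ip] D; case: j => [[|[|[|[|//]]]] jp] /=;
  rewrite /dPhi /=; (notypeclasses refine (der_eq _ _); [der|]); rewrite /=; try ring; field; exact: r0.
Qed.

Lemma derive_Phi (p : R3) (i : 'I_3) : 'D_(pbasis R i) (@Phi R) p = \row_j dPhi p i j.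
Proof.
have dj (k : 'I_1) (j : 'I_4) : is_derive p (pbasis R i) (fun p => Phi p k j) (dPhi p i j).
  by rewrite (ord1 k); exact: is_derive_Phi.
rewrite derive_mx; last by apply/derivable_mxP => k j; have [] := dj k j.
by apply/matrixP => k j; rewrite !mxE; have [_ ->] := dj k j.
Qed.

Lemma metricE (p : R3) (i j : 'I_3) : metric p i j =
  let a := p.1.2 in let b := p.2 in
  nth 0 (nth [::] [:: [:: - rsq p; 0; 0]; [:: 0; 1 - a ^+ 2 / rsq p; - (a * b) / rsq p];
                      [:: 0; - (a * b) / rsq p; 1 - b ^+ 2 / rsq p]] i) j.
Proof.
rewrite /metric mxE !derive_Phi /q !mxE !inordK//.
have r0 := rr0 p; have cs := cos2Dsin2 p.1.1; rewrite /dPhi -rr2.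
have cs1 : cos p.1.1 ^+ 2 = 1 - sin p.1.1 ^+ 2 by rewrite -cs addrK.
case: i => [[|[|[|//]]] ip]; case: j => [[|[|[|//]]] jp] /=.
- by transitivity (- (rr p ^+ 2 * (cos p.1.1 ^+ 2 + sin p.1.1 ^+ 2))); [ring|rewrite cs mulr1].
- by field.
- by field.
- by field.
- by transitivity (1 - p.1.2 ^+ 2 / rr p ^+ 2 * (cos p.1.1 ^+ 2 + sin p.1.1 ^+ 2)); [field|rewrite cs mulr1].
- by transitivity (- (p.1.2 * p.2) / rr p ^+ 2 * (cos p.1.1 ^+ 2 + sin p.1.1 ^+ 2)); [field|rewrite cs mulr1].
- by field.
- by transitivity (- (p.1.2 * p.2) / rr p ^+ 2 * (cos p.1.1 ^+ 2 + sin p.1.1 ^+ 2)); [field|rewrite cs mulr1].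
- by transitivity (1 - p.2 ^+ 2 / rr p ^+ 2 * (cos p.1.1 ^+ 2 + sin p.1.1 ^+ 2)); [field|rewrite cs mulr1].
Qed.

(** In the directions (a, b) the metric is the identity minus a rank one matrix, and rank one
    inversion turns it into the identity plus the outer product of (a, b) with itself. *)
Definition cometric (p : R3) : 'M[R]_3 := \matrix_(i, j)
  let a := p.1.2 in let b := p.2 in
  nth 0 (nth [::] [:: [:: - (rsq p)^-1; 0; 0]; [:: 0; 1 + a ^+ 2; a * b];
                      [:: 0; a * b; 1 + b ^+ 2]] i) j.

Lemma cometricE p : (cometric p I0 I0 = - (rsq p)^-1) * (cometric p I0 I1 = 0) * (cometric p I0 I2 = 0) *
  (cometric p I1 I0 = 0) * (cometric p I1 I1 = 1 + p.1.2 ^+ 2) * (cometric p I1 I2 = p.1.2 * p.2) *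
  (cometric p I2 I0 = 0) * (cometric p I2 I1 = p.1.2 * p.2) * (cometric p I2 I2 = 1 + p.2 ^+ 2).
Proof. by do ! split; rewrite mxE !inordK. Qed.

Lemma metric_cometric p : metric p *m cometric p = 1%:M.
Proof.
have r0 := rsq_neq0 p; have e : rsq p = 1 + p.1.2 ^+ 2 + p.2 ^+ 2 by [].
have key (x : R) : x * rsq p = 0 -> x = 0 by move=> /eqP; rewrite mulf_eq0 (negbTE r0) orbF => /eqP.
have h (x y : R) : (x - y) * rsq p = 0 -> x = y by move=> /key/eqP; rewrite subr_eq0 => /eqP.
apply/matrixP => i j; rewrite mxE sum3 !metricE !mxE !inordK//.
case: i => [[|[|[|//]]] ip]; case: j => [[|[|[|//]]] jp] /=; rewrite ?mulr1n ?mulr0n;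
  apply: h; rewrite e; field; try by move: r0; rewrite e.
Qed.

Lemma invmx_metric p : invmx (metric p) = cometric p.
Proof.
have /mulmx1_unit[um _] := metric_cometric p.
by rewrite -[LHS]mulmx1 -(metric_cometric p) mulmxA mulVmx// mul1mx.
Qed.

Lemma det2 (A : 'M[R]_2) : \det A = A 0 0 * A 1 1 - A 0 1 * A 1 0.
Proof.
rewrite (expand_det_row _ 0) !big_ord_recl big_ord0 addr0 /cofactor !det_mx11 !mxE /=.
rewrite expr0 expr1 mul1r mulN1r mulrN; congr (A _ _ * A _ _ - A _ _ * A _ _); exact/val_inj.
Qed.

(** The determinant is - (rsq - a^2 - b^2) = -1. *)
Lemma vol_density1 (p : R3) : vol_density p = 1.
Proof.
have r0 := rsq_neq0 p; have e : rsq p = 1 + p.1.2 ^+ 2 + p.2 ^+ 2 by [].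
rewrite /vol_density; move: (metric p) (metricE p) => M ME.
rewrite (expand_det_row _ 0) !big_ord_recl big_ord0 !ME /= !mul0r !addr0.
rewrite /cofactor det2 !mxE !ME /= expr0 mul1r.
suff E (x : R) : x = -1 -> Num.sqrt `|x| = 1.
  apply: E; transitivity (- (rsq p - p.1.2 ^+ 2 - p.2 ^+ 2)); first by field.
  by rewrite e; ring.
by move=> ->; rewrite normrN1 sqrtr1.
Qed.

Lemma div_grad_derivatives (f0 f1 f2 f00 f11 f12 f21 f22 : R3 -> R) (p : R3) :
  is_derive p (pbasis R I0) f0 (f00 p) -> is_derive p (pbasis R I1) f1 (f11 p) ->
  is_derive p (pbasis R I1) f2 (f12 p) -> is_derive p (pbasis R I2) f1 (f21 p) ->
  is_derive p (pbasis R I2) f2 (f22 p) ->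
  [/\ is_derive p (pbasis R I0) (fun p => - (rsq p)^-1 * f0 p) (- (rsq p)^-1 * f00 p),
      is_derive p (pbasis R I1) (fun p => (1 + p.1.2 ^+ 2) * f1 p + p.1.2 * p.2 * f2 p)
        ((1 + p.1.2 ^+ 2) * f11 p + 2 * p.1.2 * f1 p + (p.1.2 * p.2 * f12 p + p.2 * f2 p)) &
      is_derive p (pbasis R I2) (fun p => p.1.2 * p.2 * f1 p + (1 + p.2 ^+ 2) * f2 p)
        (p.1.2 * p.2 * f21 p + p.1.2 * f1 p + ((1 + p.2 ^+ 2) * f22 p + 2 * p.2 * f2 p))].
Proof.
move=> h0 h1 h2 h3 h4; have r0 := rsq_neq0 p; split.
- have ir : is_derive p (pbasis R I0) (fun p => (rsq p)^-1) 0.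
    rewrite /rsq; rewrite /rsq in r0; dereq.
    by rewrite !inordK//= !(mulr0, addr0).
  pose s (p : R3) := (rsq p)^-1; have {}ir : is_derive p (pbasis R I0) s 0 := ir.
  rewrite (_ : (fun p : R3 => - (rsq p)^-1 * f0 p) = fun p => - s p * f0 p)//.
  dereq; rewrite /s; ring.
- by dereq; rewrite !inordK//=; ring.
- by dereq; rewrite !inordK//=; ring.
Qed.

Section SmoothParam.
Variables (u : R3 -> R[i]) (su : smooth_param u).

Definition dRe (s : seq 'I_3) (p : R3) : R := complex.Re (pdiffs s u p).
Definition dIm (s : seq 'I_3) (p : R3) : R := complex.Im (pdiffs s u p).

Lemma is_derive_dRe s i p : is_derive p (pbasis R i) (dRe s) (dRe (i :: s) p).
Proof. by have [_ _ /(_ i p)[h _]] := su s; apply: DeriveDef. Qed.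

Lemma is_derive_dIm s i p : is_derive p (pbasis R i) (dIm s) (dIm (i :: s) p).
Proof. by have [_ _ /(_ i p)[_ h]] := su s; apply: DeriveDef. Qed.

Lemma dRe_continuous s : continuous (dRe s). Proof. by have [] := su s. Qed.
Lemma dIm_continuous s : continuous (dIm s). Proof. by have [] := su s. Qed.

Lemma C2data_parts (B : R) : bsupp (dRe [::]) B -> bsupp (dIm [::]) B ->
  (forall t a b, u (t + 2 * pi, a, b) = u (t, a, b)) ->
  C2data (dRe [::]) (dRe [:: I0]) (dRe [:: I1]) (dRe [:: I2]) (dRe [:: I0; I0]) (dRe [:: I1; I1])
    (dRe [:: I1; I2]) (dRe [:: I2; I1]) (dRe [:: I2; I2]) B /\
  C2data (dIm [::]) (dIm [:: I0]) (dIm [:: I1]) (dIm [:: I2]) (dIm [:: I0; I0]) (dIm [:: I1; I1])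
    (dIm [:: I1; I2]) (dIm [:: I2; I1]) (dIm [:: I2; I2]) B.
Proof.
move=> bR bI per; have cR := dRe_continuous; have cI := dIm_continuous.
have dR := is_derive_dRe; have dI := is_derive_dIm.
split; split => //; by move=> t a b; rewrite /dRe /dIm /= per.
Qed.

Let v := fun (w : seq 'I_3 -> R3 -> R) (i : nat) (p : R3) => nth 0
  [:: - (rsq p)^-1 * w [:: I0] p; (1 + p.1.2 ^+ 2) * w [:: I1] p + p.1.2 * p.2 * w [:: I2] p;
      p.1.2 * p.2 * w [:: I1] p + (1 + p.2 ^+ 2) * w [:: I2] p] i.

Lemma grad_parts (i : 'I_3) (p : R3) :
  complex.Re (grad_coord u i p) = v dRe i p /\ complex.Im (grad_coord u i p) = v dIm i p.
Proof.
rewrite /grad_coord sum3 invmx_metric; have Z0 (x : R[i]) : 0%:C * x = 0 := mul0r x.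
have [->|->|->] := ord3 i; rewrite !cometricE /v inordK// [nth _ _ _]/= [nth _ _ _]/=.
- by rewrite !Z0 !addr0 ReZ ImZ.
- by rewrite Z0 add0r; split; [rewrite ReD; congr (_ + _); exact: ReZ|rewrite ImD; congr (_ + _); exact: ImZ].
- by rewrite Z0 add0r; split; [rewrite ReD; congr (_ + _); exact: ReZ|rewrite ImD; congr (_ + _); exact: ImZ].
Qed.

Let box_alg (r a b g1 g2 g00 g11 g12 g21 g22 : R) :
  - (- r * g00 + ((1 + a ^+ 2) * g11 + 2 * a * g1 + (a * b * g12 + b * g2)) +
    (a * b * g21 + a * g1 + ((1 + b ^+ 2) * g22 + 2 * b * g2))) =
  r * g00 - ((1 + a ^+ 2) * g11 + a * b * g12 + a * b * g21
     + (1 + b ^+ 2) * g22 + 3 * a * g1 + 3 * b * g2).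
Proof. by ring. Qed.

Lemma div_grad_parts (p : R3) :
  complex.Re (- div_coord (grad_coord u) p) =
    box_op (dRe [:: I1]) (dRe [:: I2]) (dRe [:: I0; I0]) (dRe [:: I1; I1])
    (dRe [:: I1; I2]) (dRe [:: I2; I1]) (dRe [:: I2; I2]) p /\
  complex.Im (- div_coord (grad_coord u) p) =
    box_op (dIm [:: I1]) (dIm [:: I2]) (dIm [:: I0; I0]) (dIm [:: I1; I1])
    (dIm [:: I1; I2]) (dIm [:: I2; I1]) (dIm [:: I2; I2]) p.
Proof.
have vE : (fun (i : 'I_3) p' => (vol_density p')%:C * grad_coord u i p') = grad_coord u.
  by apply/funext => i; apply/funext => p'; rewrite vol_density1 mul1r.
have gR i : (fun p' => complex.Re (grad_coord u i p')) = v dRe i.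
  by apply/funext => p'; have [] := grad_parts i p'.
have gI i : (fun p' => complex.Im (grad_coord u i p')) = v dIm i.
  by apply/funext => p'; have [] := grad_parts i p'.
have pE (i : 'I_3) : pdiff i (fun p' => (vol_density p')%:C * grad_coord u i p') p =
    ('D_(pbasis R i) (v dRe i) p) +i* ('D_(pbasis R i) (v dIm i) p).
  by rewrite (congr1 (fun w => w i) vE) /pdiff gR gI.
rewrite ReN ImN /div_coord vol_density1 invr1 mul1r sum3 !pE !ReD !ImD /= /v !inordK//=.
have [a0 [_ a0'] [_ a0'']] := div_grad_derivatives (is_derive_dRe [:: I0] I0 p) (is_derive_dRe [:: I1] I1 p)
  (is_derive_dRe [:: I2] I1 p) (is_derive_dRe [:: I1] I2 p) (is_derive_dRe [:: I2] I2 p).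
have [b0 [_ b0'] [_ b0'']] := div_grad_derivatives (is_derive_dIm [:: I0] I0 p) (is_derive_dIm [:: I1] I1 p)
  (is_derive_dIm [:: I2] I1 p) (is_derive_dIm [:: I1] I2 p) (is_derive_dIm [:: I2] I2 p).
have [_ a1] := a0; have [_ b1] := b0.
by rewrite a1 a0' a0'' b1 b0' b0'' /box_op; split; exact: box_alg.
Qed.

End SmoothParam.

Lemma Phi_periodic (t a b : R) : Phi (t + 2 * pi, a, b) = Phi (t, a, b).
Proof. by rewrite /Phi/= (mulr_natl (@pi R) 2) cosD2pi sinD2pi. Qed.

Lemma Phi_fiber (p p' x : R3) : Phi p = Phi p' -> Phi (x + p) = Phi (x + p').
Proof.
move=> e; have ej j : Phi p 0 j = Phi p' 0 j by rewrite e.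
have a : p.1.2 = p'.1.2 by have := ej (inord 2); rewrite !mxE !inordK.
have b : p.2 = p'.2 by have := ej (inord 3); rewrite !mxE !inordK.
have rE : Num.sqrt (1 + p'.1.2 ^+ 2 + p'.2 ^+ 2) != 0 by exact: rr0.
have c : cos p.1.1 = cos p'.1.1.
  by have := ej (inord 0); rewrite !mxE !inordK//= a b => /(mulfI rE).
have s : sin p.1.1 = sin p'.1.1.
  by have := ej (inord 1); rewrite !mxE !inordK//= a b => /(mulfI rE).
by apply/matrixP => i j; rewrite !mxE /= a b cosD sinD c s -cosD -sinD.
Qed.

(** [Box] is evaluated at a preimage chosen by [chart]. Two preimages of a point have the same
    translates in the image, so the difference quotients of all orders agree there. *)
Lemma pdiffs_fiber (f : 'rV[R]_4 -> R[i]) (s : seq 'I_3) (p p' : R3) : Phi p = Phi p' ->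
  forall x, pdiffs s (f \o @Phi R) (x + p) = pdiffs s (f \o @Phi R) (x + p').
Proof.
move=> e; elim: s => [|i s IH] x /=; first by rewrite (Phi_fiber _ e).
rewrite /pdiff; set w := pdiffs s _ in IH *.
have D (g : R[i] -> R) : 'D_(pbasis R i) (g \o w) (x + p) = 'D_(pbasis R i) (g \o w) (x + p').
  rewrite /derive.
  have -> // : (fun h : R => h^-1 *: ((g \o w \o shift (x + p)) (h *: pbasis R i) - (g \o w) (x + p))) =
    (fun h => h^-1 *: ((g \o w \o shift (x + p')) (h *: pbasis R i) - (g \o w) (x + p'))).
  by apply/funext => h /=; rewrite !addrA !IH.
by congr (_ +i* _); exact: D.
Qed.

Lemma Phi_AdS (p : R3) : AdS3 (Phi p).
Proof.
rewrite /AdS3/= /q !mxE !inordK//=; have := cos2Dsin2 p.1.1; have := rr2 p; rewrite /rr /rsq.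
set r := Num.sqrt _ => h1 h2.
transitivity (- (r ^+ 2 * (cos p.1.1 ^+ 2 + sin p.1.1 ^+ 2)) + p.1.2 ^+ 2 + p.2 ^+ 2); first by ring.
by rewrite h1 h2; ring.
Qed.

Lemma q_Phi (p p' : R3) : - q (Phi p) (Phi p') = zeta4 (ads4 p') (ads4 p).
Proof.
rewrite /q !mxE !inordK//= /zeta4 /ads4 /nsq /= !addrA; ring.
Qed.

Lemma compact_coord_bounded (K : set 'rV[R]_4) : compact K ->
  exists2 B : R, 0 <= B & forall p, K (@Phi R p) -> ibox B p.
Proof.
move=> cK.
have co (j : 'I_4) : exists2 M : R, 0 <= M & forall x : 'rV[R]_4, K x -> `|x 0 j| <= M.
  have : compact ((fun x : 'rV[R]_4 => x 0 j) @` K).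
    by apply: continuous_compact => //; apply: continuous_subspaceT; exact: coord_continuous.
  move=> /compact_bounded[M [_ hM]]; exists (`|M| + 1); first by rewrite addr_ge0.
  by move=> x sx; apply: hM; [rewrite ltr_pwDr// ler_norm|exists x].
have [M1 p1 h1] := co (inord 2); have [M2 p2 h2] := co (inord 3).
exists (M1 + M2) => [|p Kp]; first by rewrite addr_ge0.
by have := h1 _ Kp; have := h2 _ Kp; rewrite !mxE !inordK//= => *; split; lra.
Qed.

Section TestFunctions.
Variables (f : 'rV[R]_4 -> R[i]) (tf : test_function f).
Let u := f \o @Phi R.

Lemma test_bsupp : exists2 B : R, 0 <= B & forall s p, pdiffs s u p != 0 -> `|p.1.2| <= B /\ `|p.2| <= B.
Proof.
have [su cs] := tf.
have [B B0 hB] := compact_coord_bounded cs; exists B => //.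
have b0 p : u p != 0 -> `|p.1.2| <= B /\ `|p.2| <= B.
  move=> up; apply: hB; apply: subset_closure; split; [exact: Phi_AdS|exact/eqP].
have bs s : bsupp (dRe u s) B /\ bsupp (dIm u s) B.
  elim: s => [|i s [IR II]].
    by split => p h; apply: b0; apply: contraNneq h => e; rewrite /dRe /dIm /= e.
  by split; [apply: bsupp_derive IR => p; exact: is_derive_dRe|apply: bsupp_derive II => p; exact: is_derive_dIm].
move=> s p h; have [bR bI] := bs s.
have [r0|r0] := eqVneq (dRe u s p) 0; last exact: bR.
apply: bI; apply: contraNneq h => i0; apply/eqP; exact: eq_ReIm.
Qed.

Lemma test_C2 : exists2 B : R, 0 <= B &
  C2data (dRe u [::]) (dRe u [:: I0]) (dRe u [:: I1]) (dRe u [:: I2]) (dRe u [:: I0; I0]) (dRe u [:: I1; I1])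
    (dRe u [:: I1; I2]) (dRe u [:: I2; I1]) (dRe u [:: I2; I2]) B /\
  C2data (dIm u [::]) (dIm u [:: I0]) (dIm u [:: I1]) (dIm u [:: I2]) (dIm u [:: I0; I0]) (dIm u [:: I1; I1])
    (dIm u [:: I1; I2]) (dIm u [:: I2; I1]) (dIm u [:: I2; I2]) B.
Proof.
have [B B0 h] := test_bsupp; exists B => //; have [su _] := tf.
apply: C2data_parts => //.
- by move=> p hp; apply: (h [::]); apply: contraNneq hp => e; rewrite /dRe e.
- by move=> p hp; apply: (h [::]); apply: contraNneq hp => e; rewrite /dIm e.
- by move=> t a b; rewrite /u /= Phi_periodic.
Qed.

Lemma Box_Phi (p : R3) :
  complex.Re (Box f (Phi p)) =
    box_op (dRe u [:: I1]) (dRe u [:: I2]) (dRe u [:: I0; I0]) (dRe u [:: I1; I1])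
    (dRe u [:: I1; I2]) (dRe u [:: I2; I1]) (dRe u [:: I2; I2]) p /\
  complex.Im (Box f (Phi p)) =
    box_op (dIm u [:: I1]) (dIm u [:: I2]) (dIm u [:: I0; I0]) (dIm u [:: I1; I1])
    (dIm u [:: I1; I2]) (dIm u [:: I2; I1]) (dIm u [:: I2; I2]) p.
Proof.
have [su _] := tf; rewrite /Box; set p' := chart _.
have e : Phi p' = Phi p by rewrite /p' /chart; case: xgetP => [x _ //|/(_ p)]; case.
have := div_grad_parts su p'; rewrite -/u => -[-> ->].
have E s : pdiffs s u p' = pdiffs s u p by have := pdiffs_fiber f s e 0; rewrite !add0r.
have [ea eb] : p'.1.2 = p.1.2 /\ p'.2 = p.2.
  have ej j : Phi p' 0 j = Phi p 0 j by rewrite e.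
  by split; [have := ej (inord 2)|have := ej (inord 3)]; rewrite !mxE !inordK.
by rewrite /box_op /rsq ea eb /dRe /dIm !E.
Qed.

End TestFunctions.

End Metric.

(** * Estimates for the kernel *)

Section RealEstimates.
Variable R : realType.

Lemma expR_sub1 (a : R) : `|expR a - 1| <= `|a| * expR `|a|.
Proof.
have key (b : R) : 0 <= b -> `|expR b - 1| <= b * expR b.
  move=> b0; have := @lipschitz_from_derivative R expR expR (expR b) b b0 (fun y => is_derive_expR y).
  rewrite expR0 mulrC; apply => y /andP[_ yb]; by rewrite ger0_norm ?expR_ge0// ler_expR.
have [a0|a0] := leP 0 a; first by rewrite (ger0_norm a0); exact: key.
have := key (- a); rewrite oppr_ge0 ltW// => /(_ isT) h.
have -> : expR a - 1 = - (expR a * (expR (- a) - 1)) by rewrite mulrBr mulr1 expRN divff ?gt_eqF ?expR_gt0//; ring.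
rewrite normrN normrM (ger0_norm (expR_ge0 a)) (ltr0_norm a0).
by apply: le_trans h; rewrite ler_piMl// -expR0 ler_expR ltW.
Qed.

Lemma expR_sub2 (a : R) : `|expR a - 1 - a| <= a ^+ 2 * expR `|a|.
Proof.
pose f (x : R) := expR x - 1 - x.
have df x : is_derive x (1 : R) f (expR x - 1).
  rewrite /f; have e := is_derive_expR x; pose E (x : R) := expR x; have {}e : is_derive x (1 : R) E _ := e.
  rewrite (_ : (fun x => expR x - 1 - x) = fun x => E x - 1 - x)//.
  by dereq; rewrite /E /=; ring.
have f0 : f 0 = 0 by rewrite /f expR0; ring.
have cf : continuous f by move=> x; exact: is_derive_continuous (df x).
have bd (c : R) : `|c| <= `|a| -> `|expR c - 1| <= `|a| * expR `|a|.
  by move=> h; apply: (le_trans (expR_sub1 c)); apply: ler_pM => //; rewrite ?expR_ge0// ler_expR.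
rewrite -/(f a) -(subr0 (f a)) -f0 -[a ^+ 2]real_normK ?num_real//.
have [->|an] := eqVneq a 0; first by rewrite subrr normr0 expr0n mul0r.
have [a0|a0|a0] := ltgtP 0 a; last by rewrite -a0 eqxx in an.
- have [c] := MVT a0 (fun y _ => df y) (continuous_subspaceT cf).
  rewrite in_itv/= subr0 => /andP[c0 ca] ->; rewrite normrM expr2 mulrAC ler_wpM2r//.
  by apply: bd; rewrite !ger0_norm ltW.
- have [c] := MVT a0 (fun y _ => df y) (continuous_subspaceT cf).
  rewrite in_itv/= sub0r => /andP[c0 ca]; rewrite distrC => ->; rewrite normrM normrN expr2 mulrAC ler_wpM2r//.
  by apply: bd; rewrite !ltr0_norm// lerN2 ltW.
Qed.

Lemma cos_sub1 (b : R) : `|cos b - 1| <= `|b| /\ `|cos b - 1| <= b ^+ 2.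
Proof.
rewrite -cos_norm -[b ^+ 2]real_normK ?num_real//.
have b0 := normr_ge0 b; set c := `|b| in b0 *.
have sb (y : R) : `|- sin y| <= 1 by rewrite normrN ler_norml sin_geN1 sin_le1.
have h1 := @lipschitz_from_derivative R cos (fun y => - sin y) 1 c b0 (fun y => is_derive_cos y) (fun y _ => sb y).
have sx (y : R) : 0 <= y <= c -> `|- sin y| <= c.
  move=> /andP[y0 yc]; have := @lipschitz_from_derivative R sin cos 1 y y0 (fun y => is_derive_sin y).
  rewrite sin0 subr0 normrN => h; apply: (le_trans (h _)); last by rewrite mul1r.
  by move=> z _; rewrite ler_norml cos_geN1 cos_le1.
have h2 := @lipschitz_from_derivative R cos (fun y => - sin y) c c b0 (fun y => is_derive_cos y) sx.
by move: h1 h2; rewrite cos0 mul1r -expr2.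
Qed.

Lemma sin_sub (b : R) : `|sin b - b| <= b ^+ 2 /\ `|sin b| <= `|b|.
Proof.
wlog b0 : b / 0 <= b.
  move=> w; have [b0|b0] := leP 0 b; first exact: w.
  have := w (- b); rewrite oppr_ge0 ltW// sinN sqrrN !normrN => /(_ isT)[h1 h2]; split => //.
  by rewrite (_ : sin b - b = - (- sin b - - b)) ?normrN//; ring.
have sb := @lipschitz_from_derivative R sin cos 1 b b0 (fun y => is_derive_sin y).
have h : `|sin b| <= `|b|.
  rewrite (ger0_norm b0) -[sin b]subr0 -sin0 -[leRHS]mul1r; apply: sb => y _.
  by rewrite ler_norml cos_geN1 cos_le1.
split => //; pose f (x : R) := sin x - x.
have df x : is_derive x (1 : R) f (cos x - 1) by rewrite /f; dereq; rewrite /=; ring.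
have := @lipschitz_from_derivative R f _ b b b0 df; rewrite /f sin0 subrr subr0 -expr2; apply.
move=> y /andP[y0 yb]; have [h1 _] := cos_sub1 y; apply: (le_trans h1); by rewrite ger0_norm.
Qed.

End RealEstimates.

(** * A real-valued norm on the complex numbers *)

Section TaxicabNorm.
Variable R : realType.
Implicit Types x y : R[i].

(* The modulus of [R[i]] takes its values in [R[i]]; this equivalent norm is real-valued. *)
Definition cabs x : R := `|complex.Re x| + `|complex.Im x|.

Lemma cabs_ge0 x : 0 <= cabs x. Proof. by rewrite addr_ge0. Qed.
Lemma cabsM x y : cabs (x * y) <= cabs x * cabs y.
Proof.
rewrite /cabs ReM ImM; apply: (le_trans (lerD (ler_normB _ _) (ler_normD _ _))).
rewrite !normrM; lra.
Qed.
Lemma cabsN x : cabs (- x) = cabs x. Proof. by rewrite /cabs ReN ImN !normrN. Qed.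
Lemma Re_cabs x : `|complex.Re x| <= cabs x. Proof. by rewrite lerDl. Qed.
Lemma Im_cabs x : `|complex.Im x| <= cabs x. Proof. by rewrite lerDr. Qed.

Lemma normc_cabs x : `|x| <= (cabs x)%:C.
Proof.
rewrite normc_def lecR -(ger0_norm (cabs_ge0 x)) -sqrtr_sqr ler_sqrt ?sqr_ge0//.
rewrite /cabs sqrrD !real_normK ?num_real// -addrA lerD2l lerDr mulrn_wge0// mulr_ge0.
Qed.

Lemma cabs_normc x (M : R) : `|x| <= M%:C -> 0 <= M /\ cabs x <= 2 * M.
Proof.
rewrite normc_def lecR => h.
have r0 : complex.Re x ^+ 2 <= complex.Re x ^+ 2 + complex.Im x ^+ 2 by rewrite lerDl sqr_ge0.
have i0 : complex.Im x ^+ 2 <= complex.Re x ^+ 2 + complex.Im x ^+ 2 by rewrite lerDr sqr_ge0.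
have hr : `|complex.Re x| <= M by apply: le_trans h; rewrite -sqrtr_sqr ler_sqrt// addr_ge0 ?sqr_ge0.
have hi : `|complex.Im x| <= M by apply: le_trans h; rewrite -sqrtr_sqr ler_sqrt// addr_ge0 ?sqr_ge0.
by rewrite /cabs (le_trans (sqrtr_ge0 _) h); split => //; lra.
Qed.

Lemma cexpD x y : cexp (x + y) = cexp x * cexp y.
Proof.
by apply: eq_ReIm; rewrite /cexp ?(ReM, ImM) /= ?(ReM, ImM) /= ReD ImD expRD cosD sinD; ring.
Qed.

Lemma cexp_sub2 x : cabs (cexp x - 1 - x) <= 6 * cabs x ^+ 2 * expR (cabs x).
Proof.
case: x => a b; rewrite /cexp /cabs /= !(mul0r, subr0, addr0, mulr0).
set C := `|a| + `|b|; have [a0 b0] := (normr_ge0 a, normr_ge0 b).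
have aC : `|a| <= C by rewrite /C; lra.
have bC : `|b| <= C by rewrite /C; lra.
have eC : expR `|a| <= expR C by rewrite ler_expR.
have eC1 : 1 <= expR C by rewrite -expR0 ler_expR (le_trans a0).
have ea : expR a <= expR C by rewrite ler_expR (le_trans (ler_norm a)).
have e0 := expR_ge0 a.
have C0 : 0 <= C by exact: le_trans aC.
have [q1 q2] := sin_sub b; have [_ q3] := cos_sub1 b; have q4 := expR_sub1 a; have q5 := expR_sub2 a.
have b2 : b ^+ 2 <= C ^+ 2 by rewrite -real_normK ?num_real// ler_sqr ?nnegrE.
have a2 : a ^+ 2 <= C ^+ 2 by rewrite -real_normK ?num_real// ler_sqr ?nnegrE.
have C2 := sqr_ge0 C.
have k1 : `|expR a * cos b - 1 - a| <= 2 * (C ^+ 2 * expR C).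
  rewrite (_ : _ - a = (expR a - 1 - a) + expR a * (cos b - 1)); last by ring.
  apply: (le_trans (ler_normD _ _)); rewrite normrM (ger0_norm e0).
  have : a ^+ 2 * expR `|a| <= C ^+ 2 * expR C by apply: ler_pM => //; rewrite ?sqr_ge0 ?expR_ge0.
  have : expR a * `|cos b - 1| <= expR C * C ^+ 2 by apply: ler_pM => //; exact: le_trans b2.
  lra.
have k2 : `|expR a * sin b - b| <= 2 * (C ^+ 2 * expR C).
  rewrite (_ : _ - b = (expR a - 1) * sin b + (sin b - b)); last by ring.
  apply: (le_trans (ler_normD _ _)); rewrite normrM.
  have : `|expR a - 1| * `|sin b| <= (C * expR C) * C.
    apply: ler_pM => //; last exact: le_trans bC.
    by apply: (le_trans q4); apply: ler_pM => //; rewrite expR_ge0.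
  have : C ^+ 2 * 1 <= C ^+ 2 * expR C by rewrite ler_wpM2l.
  rewrite (_ : C * expR C * C = C ^+ 2 * expR C); last by ring.
  lra.
have := mulr_ge0 C2 (expR_ge0 C); lra.
Qed.

End TaxicabNorm.

(** * The kernel as a pair of radial functions, and its bounds *)

Section Kernel.
Variable R : realType.
Local Notation mR := (measurableTypeR R).
Implicit Types lambda : R[i].

Let k : R := (4 * pi)^-1.
Let al lambda : R := complex.Re lambda + 1.
Let be lambda : R := complex.Im lambda.

(** With lambda + 1 = al + i be and k = 1 / (4 pi), the numerators are i k exp(- (al + i be) r) for
    z = cosh r and k exp(- i theta (al + i be)) for z = cos theta, split into real and imaginary
    parts. Divided by sinh r and sin theta, the former is the continuation of the latter to theta =
    - i r. *)
Definition FhRe lambda : R -> R :=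
  radV (expo (- al lambda) (be lambda) 0 k) (expo (be lambda) (al lambda) k 0).
Definition FhIm lambda : R -> R :=
  radV (expo (- al lambda) (be lambda) k 0) (expo (be lambda) (al lambda) 0 (- k)).

Lemma inv_real_complex (x : R) : (x%:C)^-1 = (x^-1)%:C.
Proof. by rewrite fmorphV. Qed.

Lemma Fh_parts lambda z : Fh lambda z = FhRe lambda z +i* FhIm lambda z.
Proof.
have pi0 : (pi : R) != 0 by rewrite gt_eqF// pi_gt0.
rewrite /Fh /FhRe /FhIm /radV /br -/(shS z) -/(snS z) -/(rap z).
case: ifPn => [z1|_].
  have s0 : shS z != 0 by rewrite gt_eqF// shS_gt0.
  rewrite inv_real_complex /expo /al /be /k; case: lambda => a b.
  apply: eq_ReIm; rewrite /cexp ?(ReM, ImM) /= ?(ReM, ImM) /=.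
    rewrite !(mul0r, mulr0, subr0, addr0, add0r, oppr0, mul1r, sub0r, opprK, mulNr, mulrN) ?cosN ?sinN.
    by rewrite invfM; ring.
  rewrite !(mul0r, mulr0, subr0, addr0, add0r, oppr0, mul1r, sub0r, opprK, mulNr, mulrN) ?cosN.
  by rewrite invfM; ring.
case: ifPn => [z1|_]; last by [].
have s0 : snS z != 0 by rewrite gt_eqF// snS_gt0.
rewrite /expo /al /be /k; case: lambda => a b.
apply: eq_ReIm; rewrite /cexp ?(ReM, ImM) /= ?(ReM, ImM) /=.
  rewrite !(mul0r, mulr0, subr0, addr0, add0r, oppr0, mul1r, mulN1r, sub0r, opprK, mulNr, mulrN) ?cosN ?sinN.
  by rewrite (mulrC b) (mulrC (a + 1)); rewrite invfM; ring.
rewrite !(mul0r, mulr0, subr0, addr0, add0r, oppr0, mul1r, mulN1r, sub0r, opprK, mulNr, mulrN) ?cosN ?sinN.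
by rewrite (mulrC b) (mulrC (a + 1)); rewrite invfM; ring.
Qed.

(** Integrable majorant with a singularity at each of 1 and -1; the radius Z + 1 covers |z| <= Z
    from either point. *)
Definition kz (Z z : R) : R := invsqrt 1 (Z + 1) z + invsqrt (-1) (Z + 1) z.

Lemma kz_ge0 Z z : 0 <= kz Z z. Proof. by rewrite addr_ge0 ?invsqrt_ge0. Qed.

(** The inverses of sinh r and sin theta are at most the inverse square root of the distance of z to
    1 for z >= 0, and to -1 for z < 0. *)
Lemma radV_bound (gR gL : R -> R) (Z : R) : continuous gR -> continuous gL -> 0 <= Z ->
  exists2 M, 0 <= M & forall z, `|z| <= Z -> `|radV gR gL z| <= M * kz Z z.
Proof.
move=> cR cL Z0; have [a a0 ha] := bounded_segment (2 * Z) cR.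
have [b b0 hb] := bounded_segment pi cL.
exists (a + b) => [|z zZ]; first by rewrite addr_ge0.
have i0 := invsqrt_ge0 (1 : R) (Z + 1) z; have i1 := invsqrt_ge0 (-1 : R) (Z + 1) z.
have q (x s u M : R) : 0 < u -> u <= s -> `|x| <= M -> `|x / s| <= M * u^-1.
  move=> u0 us xM; have s0 : 0 < s by exact: lt_le_trans us.
  rewrite normrM (gtr0_norm (x := s^-1)) ?invr_gt0//; apply: ler_pM => //; first by rewrite invr_ge0 ltW.
  by rewrite lef_pV2.
have n1 : `|z - 1| <= Z + 1 by rewrite (le_trans (ler_normB _ _))// normr1 lerD2r.
have n2 : `|z - -1| <= Z + 1 by rewrite opprK (le_trans (ler_normD _ _))// normr1 lerD2r.
rewrite /radV; have [h|h] := ltP 1 z.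
  rewrite br_right//; have r := rap_bounds h.
  have sz : shS z <= z by rewrite -[leRHS]ger0_norm -?sqrtr_sqr ?ler_sqrt ?sqr_ge0//; lra.
  have zz : z <= Z by exact: le_trans (ler_norm z) zZ.
  have u0 : 0 < Num.sqrt `|z - 1| by rewrite sqrtr_gt0 normr_gt0 subr_eq0 gt_eqF.
  apply: (le_trans (q _ _ _ _ u0 (shS_ge h) (ha (rap z) _))); first by lra.
  rewrite (_ : (Num.sqrt _)^-1 = invsqrt 1 (Z + 1) z); last by rewrite /invsqrt n1 mulr1.
  rewrite /kz mulrDl !mulrDr; have := mulr_ge0 a0 i1; have := mulr_ge0 b0 i0; have := mulr_ge0 b0 i1; lra.
have [h'|h'] := leP z (-1); first by rewrite br_left// normr0 mulr_ge0 ?kz_ge0// addr_ge0.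
have [z1|z1] := eqVneq z 1; first by rewrite z1 br_1 normr0 mulr_ge0 ?kz_ge0// addr_ge0.
have zz : -1 < z < 1 by rewrite h' lt_neqAle z1.
have z2 : -1 <= z <= 1 by lra.
rewrite br_mid//; have gb : `|gL (acos z)| <= b by apply: hb; rewrite acos_ge0// acos_lepi.
have [zp|zn] := leP 0 z.
  have u0 : 0 < Num.sqrt `|z - 1| by rewrite sqrtr_gt0 normr_gt0 subr_eq0.
  have zz' : 0 <= z < 1 by lra.
  apply: (le_trans (q _ _ _ _ u0 (snS_ge zz') gb)).
  rewrite (_ : (Num.sqrt _)^-1 = invsqrt 1 (Z + 1) z); last by rewrite /invsqrt n1 mulr1.
  rewrite /kz mulrDl !mulrDr; have := mulr_ge0 a0 i1; have := mulr_ge0 a0 i0; have := mulr_ge0 b0 i1; lra.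
have u0 : 0 < Num.sqrt `|z - -1| by rewrite sqrtr_gt0 normr_gt0 subr_eq0 gt_eqF.
have us : Num.sqrt `|z - -1| <= snS z by rewrite ler_sqrt; [rewrite opprK gtr0_norm; [nra|lra]|nra].
apply: (le_trans (q _ _ _ _ u0 us gb)).
rewrite (_ : (Num.sqrt _)^-1 = invsqrt (-1) (Z + 1) z); last by rewrite /invsqrt n2 mulr1.
rewrite /kz mulrDl !mulrDr; have := mulr_ge0 a0 i1; have := mulr_ge0 a0 i0; have := mulr_ge0 b0 i0; lra.
Qed.

Lemma Fh_bound lambda Z : 0 <= Z ->
  exists2 M, 0 <= M & forall z, `|z| <= Z -> cabs (Fh lambda z) <= M * kz Z z.
Proof.
move=> Z0; have ce p q u v := @expo_continuous R p q u v.
have [a a0 ha] := @radV_bound (expo (- al lambda) (be lambda) 0 k) (expo (be lambda) (al lambda) k 0) Z (ce _ _ _ _) (ce _ _ _ _) Z0.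
have [b b0 hb] := @radV_bound (expo (- al lambda) (be lambda) k 0) (expo (be lambda) (al lambda) 0 (- k)) Z (ce _ _ _ _) (ce _ _ _ _) Z0.
exists (a + b) => [|z zZ]; first by rewrite addr_ge0.
by rewrite Fh_parts /cabs /= mulrDl; apply: lerD; [exact: ha|exact: hb].
Qed.

Lemma Fh_measurable lambda :
  measurable_fun setT (FhRe lambda : mR -> mR) /\ measurable_fun setT (FhIm lambda : mR -> mR).
Proof.
have de := @is_derive_expo R.
by split; apply: measurable_off_pm1 => z z1 z2;
  exact: is_derive_continuous (is_derive_radV (fun x => de _ _ _ _ x) (fun x => de _ _ _ _ x) z1 z2).
Qed.

(* [-w] is the logarithmic derivative of [Fh] in [lambda]. *)
Definition wexp (z : R) : R[i] := br (@rap R) (fun=> 0) z +i* br (fun=> 0) (@acos R) z.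

Lemma Fh_shift lambda t z : Fh (lambda + t) z = Fh lambda z * cexp (- t * wexp z).
Proof.
rewrite /Fh /wexp /br -/(rap z); case: ifPn => z1.
  rewrite -[RHS]mulrA -cexpD; congr (_ * cexp _).
  have -> : (rap z +i* 0) = (rap z)%:C by [].
  ring.
case: ifPn => z2; last by rewrite mul0r.
rewrite -[RHS]mulrA -cexpD; congr (_ * cexp _).
have -> : (0 +i* acos z) = 'i * (acos z)%:C by apply: eq_ReIm; rewrite ?ReM ?ImM /=; ring.
ring.
Qed.

Lemma wexp_bound (Z : R) z : `|z| <= Z -> cabs (wexp z) <= 2 * Z + pi.
Proof.
move=> zZ; have Z0 : 0 <= Z by exact: le_trans zZ.
have pi0 := @pi_ge0 R; rewrite /cabs /wexp /=; have [h|h] := ltP 1 z.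
  rewrite !br_right//; have r := rap_bounds h.
  have sz : shS z <= z by rewrite -[leRHS]ger0_norm -?sqrtr_sqr ?ler_sqrt ?sqr_ge0//; lra.
  have zz : z <= Z by exact: le_trans (ler_norm z) zZ.
  by rewrite normr0 ger0_norm; lra.
have [h'|h'] := leP z (-1); first by rewrite !br_left// normr0; lra.
have [->|z1] := eqVneq z 1; first by rewrite !br_1 normr0; lra.
have zz : -1 < z < 1 by rewrite h' lt_neqAle z1.
have z2 : -1 <= z <= 1 by lra.
rewrite !br_mid// normr0 ger0_norm ?acos_ge0//; have := acos_lepi z2; lra.
Qed.

Lemma wexp_measurable : measurable_fun setT ((fun z => complex.Re (wexp z)) : mR -> mR) /\
  measurable_fun setT ((fun z => complex.Im (wexp z)) : mR -> mR).
Proof.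
split; apply: measurable_off_pm1 => z z1 z2; apply: br_continuous => // h.
- exact: is_derive_continuous (is_derive_rap h).
- exact: cvg_cst.
- exact: cvg_cst.
- exact: continuous_acos.
Qed.

(** The first hypothesis is the matching gR'(0) = gL'(0) in terms of coefficients, and the strength
    uL is gL(0). *)
Lemma expo_singular (pR qR uR vR pL qL uL vL delta : R) :
  pR * uR + qR * vR = pL * uL + qL * vL -> 0 < delta <= 1/2 ->
  exists V V1 V2 W C, [/\ singular V V1 V2 W C (1/4) uL delta, V 1 = 0 /\ W 1 = 0,
     measurable_fun setT (V : mR -> mR), measurable_fun setT (W : mR -> mR) &
     forall z, -1 + delta <= z -> V z = radV (expo pR qR uR vR) (expo pL qL uL vL) z /\
       W z = radW (expo pR qR uR vR)
         (expo pR qR (pR * (pR * uR + qR * vR) + qR * (pR * vR - qR * uR))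
            (pR * (pR * vR - qR * uR) - qR * (pR * uR + qR * vR))) (expo pL qL uL vL)
         (expo pL qL (pL * (pL * uL + qL * vL) + qL * (pL * vL - qL * uL))
            (pL * (pL * vL - qL * uL) - qL * (pL * uL + qL * vL))) z].
Proof.
move=> m dl.
pose gR := expo pR qR uR vR; pose gL := expo pL qL uL vL.
pose gR1 := expo pR qR (pR * uR + qR * vR) (pR * vR - qR * uR).
pose gL1 := expo pL qL (pL * uL + qL * vL) (pL * vL - qL * uL).
set gR2 := expo pR qR (_ + _) (_ - _); set gL2 := expo pL qL (_ + _) (_ - _).
have dR x : is_derive x (1 : R) gR (gR1 x) := is_derive_expo pR qR uR vR x.
have dR1 x : is_derive x (1 : R) gR1 (gR2 x) := is_derive_expo pR qR _ _ x.
have dL x : is_derive x (1 : R) gL (gL1 x) := is_derive_expo pL qL uL vL x.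
have dL1 x : is_derive x (1 : R) gL1 (gL2 x) := is_derive_expo pL qL _ _ x.
have cR2 : continuous gR2 by exact: expo_continuous.
have cL2 : continuous gL2 by exact: expo_continuous.
have m0 : gR1 0 = gL1 0 by rewrite /gR1 /gL1 !expo0.
have [C hC] := @radial_singular R gR gR1 gR2 gL gL1 gL2 dR dR1 dL dL1 cR2 cL2 m0 delta dl.
have [mV mW] := @cutV_measurable R gR gR1 gR2 gL gL1 gL2 dR dL cR2 cL2 delta dl.
exists (cutV gR gL delta), (cutV1 gR gR1 gL gL1 delta), (cutV2 gR gR1 gR2 gL gL1 gL2 delta),
  (cutW gR gR2 gL gL2 delta), C; split; [|  |exact: mV|exact: mW|].
- have gl0 : gL 0 = uL by exact: expo0.
  by rewrite gl0 in hC.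
- by rewrite /cutV /cutW /radV /radW !br_1 !mulr0.
- by move=> z hz; have [-> _ _ ->] := @cutV_eq R gR gR1 gR2 gL gL1 gL2 delta dl z hz.
Qed.

(** Rests on lambda (lambda + 2) = (lambda + 1)^2 - 1. *)
Lemma c_parts lambda : complex.Re (lambda * (lambda + 2)) = al lambda ^+ 2 - 1 - be lambda ^+ 2 /\
  complex.Im (lambda * (lambda + 2)) = 2 * al lambda * be lambda.
Proof.
have r2 : complex.Re (2 : R[i]) = 2 by rewrite mulr2n ReD.
have i2 : complex.Im (2 : R[i]) = 0 by rewrite mulr2n ImD /= addr0.
by rewrite ReM ImM ReD ImD r2 i2 /al /be; split; ring.
Qed.

(** The derivatives of the numerators at r = 0 and theta = 0 agree: they are be k for the real part
    and - al k for the imaginary part. The left numerator at 0 is k, respectively 0, which is the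
    strength. As lambda is complex, each W involves both parts of the kernel. *)
Lemma rad_Fh lambda delta : 0 < delta <= 1/2 ->
  (exists V V1 V2 W C, [/\ singular V V1 V2 W C (1/4) k delta, V 1 = 0 /\ W 1 = 0,
     measurable_fun setT (V : mR -> mR), measurable_fun setT (W : mR -> mR) &
     forall z, -1 + delta <= z -> V z = complex.Re (Fh lambda z) /\
       W z = complex.Re (lambda * (lambda + 2) * Fh lambda z)]) /\
  (exists V V1 V2 W C, [/\ singular V V1 V2 W C (1/4) 0 delta, V 1 = 0 /\ W 1 = 0,
     measurable_fun setT (V : mR -> mR), measurable_fun setT (W : mR -> mR) &
     forall z, -1 + delta <= z -> V z = complex.Im (Fh lambda z) /\
       W z = complex.Im (lambda * (lambda + 2) * Fh lambda z)]).
Proof.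
move=> dl; split.
  have m : - al lambda * 0 + be lambda * k = be lambda * k + al lambda * 0 by ring.
  have [V [V1 [V2 [W [C [h1 h2 h3 h4 h5]]]]]] := expo_singular m dl.
  exists V, V1, V2, W, C; split => // z hz; have [-> ->] := h5 z hz.
  rewrite ReM Fh_parts /=; split => //; have [-> ->] := c_parts lambda.
  rewrite /radW /FhRe /FhIm /radV /br /expo.
  by case: ifP => _; [|case: ifP => _]; ring.
have m : - al lambda * k + be lambda * 0 = be lambda * 0 + al lambda * - k by ring.
have [V [V1 [V2 [W [C [h1 h2 h3 h4 h5]]]]]] := expo_singular m dl.
exists V, V1, V2, W, C; split => // z hz; have [-> ->] := h5 z hz.
rewrite ImM Fh_parts /=; split => //; have [-> ->] := c_parts lambda.
rewrite /radW /FhRe /FhIm /radV /br /expo.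
by case: ifP => _; [|case: ifP => _]; ring.
Qed.

End Kernel.

(** * The distribution and its equation *)

Section ComplexIntegral.
Context d (T : measurableType d) (R : realType) (m : {measure set T -> \bar R}).
Variables (D : set T) (mD : measurable D).
Implicit Types h : T -> R[i].

Lemma cintegral_linear (a : R[i]) h1 h2 : cintegrable m D h1 -> cintegrable m D h2 ->
  cintegrable m D (fun x => a * h1 x + h2 x) /\
  cintegral m D (fun x => a * h1 x + h2 x) = a * cintegral m D h1 + cintegral m D h2.
Proof.
move=> [r1 i1] [r2 i2]; case: a => a b.
have re : (fun x => complex.Re ((a +i* b) * h1 x + h2 x)) =
    (fun x => (a * complex.Re (h1 x) - b * complex.Im (h1 x)) + complex.Re (h2 x)).
  by apply/funext => x; rewrite ReD ReM.
have im : (fun x => complex.Im ((a +i* b) * h1 x + h2 x)) =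
    (fun x => (a * complex.Im (h1 x) + b * complex.Re (h1 x)) + complex.Im (h2 x)).
  by apply/funext => x; rewrite ImD ImM.
have ir1 := integrable_realZ mD a r1; have ii1 := integrable_realZ mD a i1.
have jr1 := integrable_realZ mD b r1; have ji1 := integrable_realZ mD b i1.
have k1 := integrable_realB mD ir1 ji1; have k2 := integrable_realD mD ii1 jr1.
rewrite /cintegrable /cintegral re im; split.
  by split; apply: integrable_realD.
apply: eq_ReIm; rewrite ?ReD ?ImD ?ReM ?ImM /=.
  by rewrite RintegralD// RintegralB// !RintegralZl.
by rewrite RintegralD// RintegralD// !RintegralZl.
Qed.

Lemma eq_cintegral h1 h2 : (forall x, D x -> h1 x = h2 x) -> cintegral m D h1 = cintegral m D h2.
Proof.
by move=> e; rewrite /cintegral; congr (_ +i* _); apply: eq_Rintegral => x; rewrite inE => /e ->.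
Qed.

End ComplexIntegral.

(** * Absolute convergence of the double integral *)

Section DoubleIntegral.
Variable R : realType.
Local Notation mR := (measurableTypeR R).
Local Notation mu := (@lebesgue_measure R).
Local Notation l3 := (@leb3 R).
Local Notation l33 := (@leb33 R).
Local Notation fund := (@fundamental R).
Local Notation R3 := (mR * mR * mR)%type.

Definition zeta2 (pp : R3 * R3) : mR := zeta4 (ads4 pp.2) (ads4 pp.1).

Lemma zeta2_measurable : measurable_fun setT zeta2.
Proof. by rewrite /zeta2 /zeta4 /ads4 /nsq /=; mfun. Qed.

(** Bounds |zeta| for two points in the box: four products of coordinates, each coordinate being at
    most 1 + 2 B. *)
Definition Zbd (B : R) : R := 4 * ((1 + 2 * B) * (1 + 2 * B)).

Lemma zeta2_bound (B : R) (pp : R3 * R3) : 0 <= B -> ibox B pp.1 -> ibox B pp.2 -> `|zeta2 pp| <= Zbd B.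
Proof.
move=> B0 [x1 x2] [y1 y2].
have [x3 x4] := @comp_bound R (ads4 pp.1) B (on_ads_ads4 _) x1 x2.
have [y3 y4] := @comp_bound R (ads4 pp.2) B (on_ads_ads4 _) y1 y2.
have x1' : `|(ads4 pp.1).2.1| <= 1 + 2 * B by move: x1; rewrite /ads4/=; lra.
have x2' : `|(ads4 pp.1).2.2| <= 1 + 2 * B by move: x2; rewrite /ads4/=; lra.
have y1' : `|(ads4 pp.2).2.1| <= 1 + 2 * B by move: y1; rewrite /ads4/=; lra.
have y2' : `|(ads4 pp.2).2.2| <= 1 + 2 * B by move: y2; rewrite /ads4/=; lra.
have t (a b : R) : `|a| <= 1 + 2 * B -> `|b| <= 1 + 2 * B -> `|a * b| <= (1 + 2 * B) * (1 + 2 * B).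
  by move=> ha hb; rewrite normrM; apply: ler_pM.
rewrite /zeta2 /zeta4 (_ : Zbd B = (1 + 2 * B) * (1 + 2 * B) + (1 + 2 * B) * (1 + 2 * B) +
  (1 + 2 * B) * (1 + 2 * B) + (1 + 2 * B) * (1 + 2 * B)); last by rewrite /Zbd; ring.
apply: (le_trans (ler_normB _ _)); apply: lerD; last exact: t.
apply: (le_trans (ler_normB _ _)); apply: lerD; last exact: t.
by apply: (le_trans (ler_normD _ _)); apply: lerD; exact: t.
Qed.

(** The volume of the box for one point, times the uniform bound of [integral_zeta_le] for the
    majorant integrated over the other. *)
Definition Kbd (B : R) : R := (2 * pi * (B - - B) * (2 * B)) *
  ((2 * pi * (2 * (2 + 4 * B))) * (4 * Num.sqrt (Zbd B + 1) + 4 * Num.sqrt (Zbd B + 1))).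

Definition dker (B : R) (pp : R3 * R3) : R :=
  \1_(ibox B) pp.1 * \1_(ibox B) pp.2 * kz (Zbd B) (zeta2 pp).

Lemma dker_ge0 B pp : 0 <= dker B pp.
Proof. by rewrite /dker !mulr_ge0 ?kz_ge0. Qed.

Lemma kz_measurable Z : measurable_fun setT (kz Z : mR -> mR).
Proof. by apply: measurable_funD; exact: invsqrt_measurable. Qed.

Lemma dker_measurable B : measurable_fun setT (dker B : R3 * R3 -> mR).
Proof.
have mi : measurable_fun setT (\1_(ibox B) : R3 -> mR) by apply: measurable_indic; exact: ibox_measurable.
apply: measurable_funM; first apply: measurable_funM.
- exact: (measurableT_comp mi measurable_fst).
- exact: (measurableT_comp mi measurable_snd).
- exact: (measurableT_comp (kz_measurable _) zeta2_measurable).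
Qed.

Lemma fund2_measurable : measurable (fund `*` fund : set (R3 * R3)).
Proof. by apply: measurableX; exact: fundamental_measurable. Qed.

Local Open Scope ereal_scope.

Lemma ge0_integral_fund2 (G : R3 * R3 -> \bar R) : measurable_fun setT G -> (forall pp, 0 <= G pp) ->
  \int[l33]_(pp in fund `*` fund) G pp = \int[l3]_(p' in fund) \int[l3]_(p in fund) G (p, p').
Proof.
move=> mG G0; have mf := @fundamental_measurable R; have m2 := fund2_measurable.
rewrite integral_mkcond.
have mg : measurable_fun setT (G \_ (fund `*` fund)) by apply/(measurable_restrictT _ m2); exact: measurable_funTS.
have g0 pp : 0 <= (G \_ (fund `*` fund)) pp by rewrite patchE; case: ifP.
transitivity (\int[l3]_y \int[l3]_x (G \_ (fund `*` fund)) (x, y)).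
  exact: (fubini_tonelli2 (m1 := l3) (m2 := l3) (G \_ (fund `*` fund))).
rewrite [RHS]integral_mkcond; apply: eq_integral => y _; rewrite patchE.
case: ifPn => hy.
  rewrite [RHS]integral_mkcond; apply: eq_integral => x _; rewrite !patchE in_setX /= hy andbT.
  by [].
by rewrite integral0_eq// => x _; rewrite patchE in_setX /= (negbTE hy) andbF.
Qed.

Lemma integral_dker (B : R) : (0 <= B)%R ->
  \int[l33]_(pp in fund `*` fund) (dker B pp)%:E <= (Kbd B)%:E.
Proof.
move=> B0; have mf := @fundamental_measurable R.
have mk : measurable_fun setT (fun z : mR => (kz (Zbd B) z)%:E).
  by apply/measurable_EFinP; exact: kz_measurable.
have Z1 : (0 <= Zbd B + 1)%R by rewrite /Zbd; nra.
have ik : \int[mu]_z (kz (Zbd B) z)%:E = (4 * Num.sqrt (Zbd B + 1) + 4 * Num.sqrt (Zbd B + 1))%:E.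
  rewrite /kz; under eq_integral do rewrite EFinD.
  rewrite ge0_integralD//; last 4 first.
  - by move=> z _; rewrite lee_fin invsqrt_ge0.
  - by apply/measurable_EFinP; exact: invsqrt_measurable.
  - by move=> z _; rewrite lee_fin invsqrt_ge0.
  - by apply/measurable_EFinP; exact: invsqrt_measurable.
  by rewrite !integral_invsqrt.
rewrite ge0_integral_fund2; last 2 first.
- by apply/measurable_EFinP; exact: dker_measurable.
- by move=> pp; rewrite lee_fin dker_ge0.
pose c := ((2 * pi * (2 * (2 + 4 * B))) * (4 * Num.sqrt (Zbd B + 1) + 4 * Num.sqrt (Zbd B + 1)))%R.
have c0 : (0 <= c)%R.
  have s0 := sqrtr_ge0 (Zbd B + 1); have p0 := @pi_ge0 R.
  by apply: mulr_ge0; [apply: mulr_ge0; [apply: mulr_ge0|]|]; lra.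
have mi : measurable_fun setT (\1_(ibox B) : R3 -> mR) by apply: measurable_indic; exact: ibox_measurable.
apply: (@le_trans _ _ (\int[l3]_(p' in fund) (c%:E * (\1_(ibox B) p')%:E))).
  apply: ge0_le_integral => //.
  - by move=> p' _; apply: integral_ge0 => p _; rewrite lee_fin dker_ge0.
  - apply: measurable_funTS.
    have mX : measurable (fund `*` setT : set (R3 * R3)) by apply: measurableX.
    have md : measurable_fun setT ((fun pp : R3 * R3 => (dker B pp)%:E) \_ (fund `*` setT)).
      by apply/(measurable_restrictT _ mX); apply: measurable_funTS; apply/measurable_EFinP; exact: dker_measurable.
    have dp (pp : R3 * R3) : 0 <= ((fun pp : R3 * R3 => (dker B pp)%:E) \_ (fund `*` setT)) pp.
      by rewrite patchE; case: ifP => // _; rewrite lee_fin dker_ge0.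
    have mG := @measurable_fun_fubini_tonelli_G _ _ _ _ R l3 _ md dp.
    apply: (eq_measurable_fun _ _ mG) => p' _.
    rewrite /fubini_G [RHS]integral_mkcond; apply: eq_integral => p _.
    by rewrite !patchE in_setX in_setT andbT.
  - apply: emeasurable_funM; first exact: measurable_cst.
    by apply/measurable_EFinP; exact: measurable_funTS.
  move=> p' _.
  have h : \int[l3]_(p in fund) ((\1_(ibox B) p)%:E * (kz (Zbd B) (zeta4 (ads4 p') (ads4 p)))%:E) <= c%:E.
    apply: (le_trans (integral_zeta_le (on_ads_ads4 p') B0 mk _)); first by move=> z; rewrite lee_fin kz_ge0.
    by rewrite ik -EFinM.
  rewrite /dker [\1_(ibox B) p']indicE; case: (p' \in ibox B) => /=.
    rewrite mule1; apply: le_trans h; rewrite le_eqVlt; apply/orP; left; apply/eqP.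
    by apply: eq_integral => p _; rewrite mulr1 EFinM.
  by rewrite mule0 integral0_eq// => p _; rewrite ?mulr0 ?mul0r.
rewrite ge0_integralZl//; last by apply/measurable_EFinP; exact: measurable_funTS.
have sE : ibox B = slab (- B)%R B B.
  by apply/seteqP; split => p; rewrite /ibox/slab/= -ler_norml.
have v : \int[l3]_(p' in fund) (\1_(ibox B) p')%:E = (2 * pi * (B - - B) * (2 * B))%:E.
  rewrite integral_indic//; last exact: ibox_measurable.
  transitivity (l3 (slab (- B)%R B B `&` fund)); first by rewrite sE.
  by apply: slab_volume => //; lra.
by rewrite v -EFinM lee_fin /Kbd -/c mulrC.
Qed.

Local Close Scope ereal_scope.

Lemma dominated_fund2 (F : R3 * R3 -> R) (B c : R) : 0 <= B -> 0 <= c ->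
  measurable_fun setT (F : R3 * R3 -> mR) ->
  (forall pp, fund pp.1 -> fund pp.2 -> `|F pp| <= c * dker B pp) ->
  l33.-integrable (fund `*` fund) (EFin \o F) /\
  `|\int[l33]_(pp in fund `*` fund) F pp| <= c * Kbd B.
Proof.
move=> B0 c0 mF hF; have m2 := fund2_measurable.
have le : (\int[l33]_(pp in fund `*` fund) `|(F pp)%:E| <= (c * Kbd B)%:E)%E.
  apply: (@le_trans _ _ (\int[l33]_(pp in fund `*` fund) (c%:E * (dker B pp)%:E))%E).
    apply: ge0_le_integral => //.
    - have h := measurableT_comp (@normr_measurable R setT) mF.
      by apply: measurable_funTS; apply/measurable_EFinP; exact: h.
    - apply: emeasurable_funM; first exact: measurable_cst.
      by apply/measurable_EFinP; apply: measurable_funTS; exact: dker_measurable.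
    - by move=> pp [f1 f2]; rewrite -EFinM lee_fin; exact: hF.
  rewrite ge0_integralZl//; last 2 first.
  - by apply/measurable_EFinP; apply: measurable_funTS; exact: dker_measurable.
  - by move=> pp _; rewrite lee_fin dker_ge0.
  rewrite [X in (_ <= X)%E]EFinM; apply: lee_wpmul2l; first by rewrite lee_fin.
  exact: integral_dker.
have iF : l33.-integrable (fund `*` fund) (EFin \o F).
  apply/integrableP; split; first by apply/measurable_EFinP; exact: measurable_funTS.
  by apply: le_lt_trans le _; rewrite ltry.
split => //; rewrite -lee_fin EFin_normr_Rintegral//; apply: le_trans le.
by apply: le_abse_integral => //; apply/measurable_EFinP; exact: measurable_funTS.
Qed.

Record nice (B M : R) (u : R3 -> R[i]) : Prop := {
  nice_Re : measurable_fun setT ((fun p => complex.Re (u p)) : R3 -> mR);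
  nice_Im : measurable_fun setT ((fun p => complex.Im (u p)) : R3 -> mR);
  nice_bd : forall p, fund p -> cabs (u p) <= M * \1_(ibox B) p }.

Definition khyp (B M : R) (H : R -> R[i]) : Prop :=
  [/\ measurable_fun setT ((fun z => complex.Re (H z)) : mR -> mR),
      measurable_fun setT ((fun z => complex.Im (H z)) : mR -> mR) &
      forall z, `|z| <= Zbd B -> cabs (H z) <= M * kz (Zbd B) z].

(** The integrand is dominated by the majorant [dker]; the factor 2 comes from estimating real and
    imaginary part separately. *)
Lemma kernel_integral (B M Mf Mg : R) (H : R -> R[i]) (f g : R3 -> R[i]) :
  0 <= B -> 0 <= M -> 0 <= Mf -> 0 <= Mg -> khyp B M H -> nice B Mf f -> nice B Mg g ->
  let h pp := H (zeta2 pp) * f pp.2 * g pp.1 in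
  cintegrable l33 (fund `*` fund) h /\ cabs (cintegral l33 (fund `*` fund) h) <= 2 * (M * Mf * Mg * Kbd B).
Proof.
move=> B0 M0 Mf0 Mg0 [mHr mHi hH] nf ng h.
have hr := measurableT_comp mHr zeta2_measurable; have hi := measurableT_comp mHi zeta2_measurable.
have fr : measurable_fun setT (fun pp : R3 * R3 => complex.Re (f pp.2) : mR).
  exact: (measurableT_comp (nice_Re nf) measurable_snd).
have fi : measurable_fun setT (fun pp : R3 * R3 => complex.Im (f pp.2) : mR).
  exact: (measurableT_comp (nice_Im nf) measurable_snd).
have gr : measurable_fun setT (fun pp : R3 * R3 => complex.Re (g pp.1) : mR).
  exact: (measurableT_comp (nice_Re ng) measurable_fst).
have gi : measurable_fun setT (fun pp : R3 * R3 => complex.Im (g pp.1) : mR).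
  exact: (measurableT_comp (nice_Im ng) measurable_fst).
have ar : measurable_fun setT (fun pp : R3 * R3 => complex.Re (H (zeta2 pp) * f pp.2) : mR).
  under eq_fun do rewrite ReM; by apply: measurable_funB; exact: measurable_funM.
have ai : measurable_fun setT (fun pp : R3 * R3 => complex.Im (H (zeta2 pp) * f pp.2) : mR).
  under eq_fun do rewrite ImM; by apply: measurable_funD; exact: measurable_funM.
have mr : measurable_fun setT (fun pp : R3 * R3 => complex.Re (h pp) : mR).
  rewrite /h; under eq_fun do rewrite ReM; by apply: measurable_funB; exact: measurable_funM.
have mi : measurable_fun setT (fun pp : R3 * R3 => complex.Im (h pp) : mR).
  rewrite /h; under eq_fun do rewrite ImM; by apply: measurable_funD; exact: measurable_funM.
have bd pp : fund pp.1 -> fund pp.2 -> cabs (h pp) <= (M * Mf * Mg) * dker B pp.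
  move=> f1 f2; apply: (le_trans (cabsM _ _)).
  apply: (le_trans (ler_wpM2r (cabs_ge0 _) (cabsM _ _))).
  have bf := nice_bd nf f2; have bg := nice_bd ng f1.
  have [i1|i1] := pselect (ibox B pp.1); last first.
    rewrite [X in _ <= _ * X]indicE memNset// mulr0 in bg.
    rewrite (_ : cabs (g pp.1) = 0); last by apply: le_anti; rewrite bg cabs_ge0.
    by rewrite mulr0 mulr_ge0 ?dker_ge0// !mulr_ge0.
  have [i2|i2] := pselect (ibox B pp.2); last first.
    rewrite [X in _ <= _ * X]indicE memNset// mulr0 in bf.
    rewrite (_ : cabs (f pp.2) = 0); last by apply: le_anti; rewrite bf cabs_ge0.
    by rewrite mulr0 mul0r mulr_ge0 ?dker_ge0// !mulr_ge0.
  have bH := hH _ (zeta2_bound B0 i1 i2).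
  rewrite (_ : M * Mf * Mg * dker B pp = M * kz (Zbd B) (zeta2 pp) * (Mf * \1_(ibox B) pp.2) *
    (Mg * \1_(ibox B) pp.1)); last by rewrite /dker; ring.
  by apply: ler_pM => //; rewrite ?mulr_ge0 ?cabs_ge0//; apply: ler_pM => //; exact: cabs_ge0.
have c0 : 0 <= M * Mf * Mg by rewrite !mulr_ge0.
have [i1 b1] := dominated_fund2 B0 c0 mr (fun pp h1 h2 => le_trans (Re_cabs _) (bd pp h1 h2)).
have [i2 b2] := dominated_fund2 B0 c0 mi (fun pp h1 h2 => le_trans (Im_cabs _) (bd pp h1 h2)).
split; first by split.
rewrite /cabs /cintegral /=; move: b1 b2; lra.
Qed.

End DoubleIntegral.

Section Fubini.
Variable R : realType.
Local Notation mR := (measurableTypeR R).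
Local Notation R3 := (mR * mR * mR)%type.
Local Notation l3 := (@leb3 R).
Local Notation l33 := (@leb33 R).
Local Notation fund := (@fundamental R).

(** Fubini for an integrand whose slices have known integrals; this is how identities valid for each
    fixed y are assembled. *)
Lemma Rintegral_fund2 (G : R3 * R3 -> R) (g : R3 -> R) :
  l33.-integrable (fund `*` fund) (EFin \o G) ->
  (forall p', fund p' -> l3.-integrable fund (fun p => (G (p, p'))%:E) /\
     \int[l3]_(p in fund) G (p, p') = g p') ->
  \int[l33]_(pp in fund `*` fund) G pp = \int[l3]_(p' in fund) g p'.
Proof.
move=> iG hg; have m2 := @fund2_measurable R; have mf := @fundamental_measurable R.
rewrite /Rintegral; congr fine.
have iG' : (leb3 (R := R) \x leb3 (R := R))%E.-integrable setT ((EFin \o G) \_ (fund `*` fund)).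
  exact: (proj1 (integrable_mkcond _ m2) iG).
transitivity (\int[l3]_y \int[l3]_x ((EFin \o G) \_ (fund `*` fund)) (x, y))%E.
  by rewrite integral_mkcond; exact/esym/(integral21_prod_meas1 iG').
rewrite [RHS]integral_mkcond; apply: eq_integral => y _; rewrite patchE.
case: ifPn => hy.
  have [i <-] := hg y (set_mem hy).
  rewrite /Rintegral fineK; last exact: integrable_fin_num.
  rewrite [RHS]integral_mkcond; apply: eq_integral => x _; rewrite !patchE in_setX /= hy andbT.
  by [].
by rewrite integral0_eq// => x _; rewrite patchE in_setX /= (negbTE hy) andbF.
Qed.

End Fubini.

(** * Continuity, linearity and holomorphy of the distribution *)

Section Kernel.
Variable R : realType.
Local Notation C := R[i].
Local Notation V4 := 'rV[R]_4.
Local Notation mR := (measurableTypeR R).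
Local Notation R3 := (mR * mR * mR)%type.
Local Notation l3 := (@leb3 R).
Local Notation l33 := (@leb33 R).
Local Notation fund := (@fundamental R).
Local Notation I0 := (inord 0 : 'I_3).
Local Notation I1 := (inord 1 : 'I_3).
Local Notation I2 := (inord 2 : 'I_3).

Definition dint (H : R -> C) (f g : R3 -> C) : C :=
  cintegral l33 (fund `*` fund) (fun pp => H (zeta2 pp) * f pp.2 * g pp.1).

Lemma ads_integrand2_Rh lambda (f phi : V4 -> C) :
  ads_integrand2 (Rh_integrand lambda f phi) =
  (fun pp : R3 * R3 => Fh lambda (zeta2 pp) * f (Phi pp.2) * phi (Phi pp.1)).
Proof.
apply/funext => pp.
rewrite /ads_integrand2 !vol_density1 mulr1 (_ : 1%:C = 1)// mul1r /Rh_integrand /Rh_kernel.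
by rewrite q_Phi.
Qed.

Lemma Rh_dint lambda (f phi : V4 -> C) :
  Rh lambda f phi = dint (Fh lambda) (f \o @Phi R) (phi \o @Phi R).
Proof. by rewrite /Rh /ads_int2 ads_integrand2_Rh. Qed.

Lemma nice_of (u : R3 -> C) (B : R) :
  continuous ((fun p => complex.Re (u p)) : R * R * R -> R) ->
  continuous ((fun p => complex.Im (u p)) : R * R * R -> R) ->
  bsupp (fun p => complex.Re (u p)) B -> bsupp (fun p => complex.Im (u p)) B ->
  exists2 M, 0 <= M & nice B M u.
Proof.
move=> cr ci sr si.
have [M1 M10 h1] := continuous_box_bounded B cr; have [M2 M20 h2] := continuous_box_bounded B ci.
exists (M1 + M2); first exact: addr_ge0.
split; [exact: continuous_measurable3|exact: continuous_measurable3|move=> p fp].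
by rewrite /cabs mulrDl; apply: lerD; [apply: (bsupp_ibox sr h1)|apply: (bsupp_ibox si h2)].
Qed.

(** Exchanges the bounds that come with a function for prescribed ones: in the continuity estimate
    they have to come from the compact set K and from M, and not from phi. *)
Lemma nice_bounded (u : R3 -> C) (B B' M M' : R) : nice B' M' u -> 0 <= M ->
  (forall p, cabs (u p) <= M) -> (forall p, u p != 0 -> ibox B p) -> nice B M u.
Proof.
move=> [mr mi _] M0 hM su; split => // p _.
have [->|u0] := eqVneq (u p) 0; first by rewrite /cabs !normr0 addr0 mulr_ge0.
by rewrite indicE mem_set ?mulr1//; exact: su.
Qed.

Lemma bsupp_le (f : R * R * R -> R) (B B' : R) : B <= B' -> bsupp f B -> bsupp f B'.
Proof. by move=> BB sf p /sf[h1 h2]; split; apply: le_trans BB. Qed.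

Lemma test_nice (f : V4 -> C) : test_function f ->
  exists2 B0 : R, 0 <= B0 & forall B, B0 <= B ->
    (exists2 M, 0 <= M & nice B M (f \o @Phi R)) /\
    (exists2 M, 0 <= M & nice B M (Box f \o @Phi R)).
Proof.
move=> tf; have [B0 B00 [Dr Di]] := test_C2 tf; exists B0 => // B BB.
split; apply: nice_of.
- exact: (c2_c Dr).
- exact: (c2_c Di).
- exact: (bsupp_le BB (c2_s Dr)).
- exact: (bsupp_le BB (c2_s Di)).
- have E p : complex.Re ((Box f \o @Phi R) p) = _ := proj1 (Box_Phi tf p).
  rewrite (funext E).
  apply: box_op_continuous; [exact: (c2_c1 Dr)|exact: (c2_c2 Dr)|exact: (c2_c00 Dr)|
    exact: (c2_c11 Dr)|exact: (c2_c12 Dr)|exact: (c2_c21 Dr)|exact: (c2_c22 Dr)].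
- have E p : complex.Im ((Box f \o @Phi R) p) = _ := proj2 (Box_Phi tf p).
  rewrite (funext E).
  apply: box_op_continuous; [exact: (c2_c1 Di)|exact: (c2_c2 Di)|exact: (c2_c00 Di)|
    exact: (c2_c11 Di)|exact: (c2_c12 Di)|exact: (c2_c21 Di)|exact: (c2_c22 Di)].
- move=> p; rewrite (proj1 (Box_Phi tf p)); exact: (bsupp_le BB (box_op_supp Dr)).
- move=> p; rewrite (proj2 (Box_Phi tf p)); exact: (bsupp_le BB (box_op_supp Di)).
Qed.

Lemma Zbd_ge0 (B : R) : 0 <= B -> 0 <= Zbd B.
Proof. by move=> B0; rewrite /Zbd; nra. Qed.

Lemma khyp_Fh lambda (B : R) : 0 <= B -> exists2 M, 0 <= M & khyp B M (Fh lambda).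
Proof.
move=> B0; have [M M0 h] := Fh_bound lambda (Zbd_ge0 B0); exists M => //.
have [m1 m2] := @Fh_measurable R lambda.
split => //.
- by rewrite (_ : (fun z => _) = FhRe lambda)//; apply/funext => z; rewrite Fh_parts.
- by rewrite (_ : (fun z => _) = FhIm lambda)//; apply/funext => z; rewrite Fh_parts.
Qed.

Lemma dint_Fh lambda (B Mf Mg : R) (f g : R3 -> C) :
  0 <= B -> 0 <= Mf -> 0 <= Mg -> nice B Mf f -> nice B Mg g ->
  cintegrable l33 (fund `*` fund) (fun pp => Fh lambda (zeta2 pp) * f pp.2 * g pp.1).
Proof.
move=> B0 f0 g0 nf ng; have [M M0 k] := khyp_Fh lambda B0.
by have [] := kernel_integral B0 M0 f0 g0 k nf ng.
Qed.

Lemma Rh_cintegrable lambda (f phi : V4 -> C) : test_function f -> test_function phi ->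
  cintegrable l33 (fund `*` fund)
    (fun pp : R3 * R3 => Fh lambda (zeta2 pp) * f (Phi pp.2) * phi (Phi pp.1)) /\
  cintegrable l33 (fund `*` fund)
    (fun pp : R3 * R3 => Fh lambda (zeta2 pp) * f (Phi pp.2) * Box phi (Phi pp.1)).
Proof.
move=> tf tp; have [B1 B10 h1] := test_nice tf; have [B2 B20 h2] := test_nice tp.
have l1 : B1 <= B1 + B2 by rewrite lerDl.
have l2 : B2 <= B1 + B2 by rewrite lerDr.
have [[Mf f0 nf] _] := h1 _ l1; have [[Mg g0 ng] [Mb b0 nb]] := h2 _ l2.
have B0 := addr_ge0 B10 B20; split.
  exact: (dint_Fh lambda B0 f0 g0 nf ng).
exact: (dint_Fh lambda B0 f0 b0 nf nb).
Qed.

Lemma Rh_integrable lambda (f phi : V4 -> C) : test_function f -> test_function phi ->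
  ads_integrable2 (Rh_integrand lambda f phi).
Proof. by move=> tf tp; rewrite /ads_integrable2 ads_integrand2_Rh; have [] := Rh_cintegrable lambda tf tp. Qed.

Lemma Rh_linear_phi (lambda a : C) (f phi psi : V4 -> C) :
  test_function f -> test_function phi -> test_function psi ->
  Rh lambda f (fun x => a * phi x + psi x) = a * Rh lambda f phi + Rh lambda f psi.
Proof.
move=> tf tp ts; rewrite !Rh_dint /dint.
have [i1 _] := Rh_cintegrable lambda tf tp; have [i2 _] := Rh_cintegrable lambda tf ts.
rewrite -(proj2 (cintegral_linear (@fund2_measurable R) a i1 i2)).
by apply: eq_cintegral => pp _ /=; ring.
Qed.

Lemma Rh_linear_f (lambda a : C) (f1 f2 phi : V4 -> C) :
  test_function f1 -> test_function f2 -> test_function phi ->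
  Rh lambda (fun x => a * f1 x + f2 x) phi = a * Rh lambda f1 phi + Rh lambda f2 phi.
Proof.
move=> t1 t2 tp; rewrite !Rh_dint /dint.
have [i1 _] := Rh_cintegrable lambda t1 tp; have [i2 _] := Rh_cintegrable lambda t2 tp.
rewrite -(proj2 (cintegral_linear (@fund2_measurable R) a i1 i2)).
by apply: eq_cintegral => pp _ /=; ring.
Qed.

(** Local integrability of the kernel gives order 0: the estimate involves only the supremum of phi
    and a box that contains K. The number 2 in the constant comes from comparing the modulus with
    [cabs]. *)
Lemma Rh_distribution lambda (f : V4 -> C) : test_function f -> is_distribution (Rh lambda f).
Proof.
move=> tf; split=> [a phi psi tp ts|K KA cK]; first exact: Rh_linear_phi.
have [B1 B10 h1] := test_nice tf; have [B2 B20 hK] := compact_coord_bounded cK.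
have l1 : B1 <= B1 + B2 by rewrite lerDl.
have [[Mf f0 nf] _] := h1 _ l1; have B0 := addr_ge0 B10 B20.
have [MH MH0 kH] := khyp_Fh lambda B0.
exists 0%N, (2 * (MH * Mf * 2 * Kbd (B1 + B2))) => phi M tp sK hM.
have [M0 _] := cabs_normc (hM [::] (0, 0, 0) isT).
have [B3 _ h3] := test_nice tp; have [[M3 _ n3] _] := h3 _ (lexx _).
have nphi : nice (B1 + B2) (2 * M) (phi \o @Phi R).
  apply: (nice_bounded n3); first by rewrite mulr_ge0.
    by move=> p; have [] := cabs_normc (hM [::] p isT).
  move=> p hp; have [|b1 b2] := hK p; last by split; [apply: (le_trans b1)|apply: (le_trans b2)]; rewrite lerDr.
  by apply: sK; apply: subset_closure; split; [exact: Phi_AdS|exact/eqP].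
have M20 : 0 <= 2 * M by rewrite mulr_ge0.
have [_ hb] := kernel_integral B0 MH0 f0 M20 kH nf nphi.
rewrite Rh_dint; apply: (le_trans (normc_cabs _)); rewrite lecR.
apply: (le_trans hb); rewrite le_eqVlt; apply/orP; left; apply/eqP; ring.
Qed.

(** A remainder of second order leaves an error O(|t|) in the difference quotient. As [cabs t] is at
    most twice the modulus, the radius 1/2 makes the hypothesis applicable, and 4 |L| + 1 absorbs
    the square of the factor 2 while staying positive. *)
Lemma derivable_complex (h : C -> C) (z D : C) (L : R) :
  (forall t, cabs t <= 1 -> cabs (h (z + t) - h z - t * D) <= L * cabs t ^+ 2) ->
  derivable (h : C^o -> C^o) z 1.
Proof.
move=> hh; apply/cvg_ex; exists D; apply/cvgrPdist_le => e e0.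
have eE : e = (complex.Re e)%:C by rewrite RRe_real// ger0_real// ltW.
have r0 : 0 < complex.Re e by move: e0; rewrite eE ltcR.
move: eE r0; set r := complex.Re e => eE r0.
have L0 : 0 < 4 * `|L| + 1 by have := normr_ge0 L; lra.
pose d := Num.min (1/2) (r / (4 * `|L| + 1)).
have d0 : 0 < d by rewrite /d lt_min divr_gt0// divr_gt0.
have d0' : 0 < d%:C by rewrite ltcR.
have h1 := @dnbhs0_lt C C^o d%:C d0'.
have h2 := nbhs_dnbhs_neq (0 : C^o).
apply: filterS2 h1 h2 => t t1 t2.
have nE : `|t| = (complex.Re `|t|)%:C by rewrite RRe_real// ger0_real.
move: nE; set n := complex.Re _ => nE.
have n0 : 0 < n by rewrite -ltcR -nE normr_gt0.
have nd : n < d by rewrite -ltcR -nE.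
have [_ ct] : 0 <= n /\ cabs t <= 2 * n by apply: cabs_normc; rewrite nE.
move: (nd); rewrite /d lt_min => /andP[n1 n2].
rewrite ltr_pdivlMr// in n2.
have ht := hh t; have {}ht : cabs (h (z + t) - h z - t * D) <= L * cabs t ^+ 2 by apply: ht; lra.
have E : D - t^-1 *: ((h : C^o -> C^o) (t *: (1 : C^o) + z) - h z) = - (t^-1 * (h (z + t) - h z - t * D)).
  have -> : t *: (1 : C^o) + z = z + t by rewrite addrC; congr (_ + _); exact: mulr1.
  rewrite mulrBr mulrA mulVf// mul1r opprB; congr (_ - _).
rewrite E normrN normrM normfV ler_pdivrMl ?normr_gt0//.
apply: (le_trans (normc_cabs _)); rewrite nE eE -rmorphM lecR.
have c0 := cabs_ge0 t.
have c2 : cabs t ^+ 2 <= 4 * n * n by nra.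
apply: (le_trans ht); apply: (le_trans (ler_wpM2r (sqr_ge0 _) (ler_norm L))).
have l0 := normr_ge0 L; apply: (le_trans (ler_wpM2l l0 c2)).
rewrite mulrA mulrC ler_pM2l//; nra.
Qed.

Definition cmeas (u : mR -> C) : Prop :=
  measurable_fun setT ((fun z => complex.Re (u z)) : mR -> mR) /\
  measurable_fun setT ((fun z => complex.Im (u z)) : mR -> mR).

Lemma cmeas_cst (c : C) : cmeas (fun=> c).
Proof. by split; exact: measurable_cst. Qed.

Lemma cmeasB u v : cmeas u -> cmeas v -> cmeas (fun z => u z - v z).
Proof.
move=> [u1 u2] [v1 v2]; split.
  by under eq_fun do rewrite ReD ReN; exact: measurable_funB.
by under eq_fun do rewrite ImD ImN; exact: measurable_funB.
Qed.

Lemma cmeasM u v : cmeas u -> cmeas v -> cmeas (fun z => u z * v z).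
Proof.
move=> [u1 u2] [v1 v2]; split.
  by under eq_fun do rewrite ReM; apply: measurable_funB; exact: measurable_funM.
by under eq_fun do rewrite ImM; apply: measurable_funD; exact: measurable_funM.
Qed.

Lemma khyp_dFh (lambda : C) (B M : R) : 0 <= B -> khyp B M (Fh lambda) ->
  khyp B (M * (2 * Zbd B + pi)) (fun x => - wexp x * Fh lambda x).
Proof.
move=> B0 [m1 m2 hM]; have cF : cmeas (Fh lambda) by [].
have [w1 w2] := @wexp_measurable R; have cW : cmeas (@wexp R) by [].
have -> : (fun x => - wexp x * Fh lambda x) = (fun x => (0 - wexp x) * Fh lambda x).
  by apply/funext => x; rewrite sub0r.
have [q1 q2] := cmeasM (cmeasB (cmeas_cst 0) cW) cF; split => // z hz.
rewrite sub0r; apply: (le_trans (cabsM _ _)); rewrite cabsN mulrC mulrAC.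
by apply: ler_pM; rewrite ?cabs_ge0//; [exact: hM|exact: wexp_bound].
Qed.

(* Second order remainder of the exponential dependence on [lambda]. *)
Lemma khyp_remainder (lambda t : C) (B M : R) : 0 <= B -> 0 <= M -> khyp B M (Fh lambda) ->
  cabs t <= 1 ->
  let W := 2 * Zbd B + pi in
  khyp B (M * (6 * W ^+ 2 * expR W) * cabs t ^+ 2)
    (fun x => Fh (lambda + t) x - Fh lambda x - t * (- wexp x * Fh lambda x)).
Proof.
move=> B0 M0 kF t1 W; have [m1 m2 hM] := kF; have cF : cmeas (Fh lambda) by [].
have [d1 d2 _] := khyp_dFh B0 kF; have cD : cmeas (fun x => - wexp x * Fh lambda x) by [].
have [M' _ [f1 f2 _]] := khyp_Fh (lambda + t) B0; have cF' : cmeas (Fh (lambda + t)) by [].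
have [q1 q2] := cmeasB (cmeasB cF' cF) (cmeasM (cmeas_cst t) cD); split => // z hz.
rewrite Fh_shift.
rewrite (_ : _ - _ = Fh lambda z * (cexp (- t * wexp z) - 1 - (- t * wexp z))); last by ring.
apply: (le_trans (cabsM _ _)).
rewrite (_ : _ * kz _ _ = M * kz (Zbd B) z * (6 * (cabs t ^+ 2 * W ^+ 2) * expR W)); last by ring.
apply: ler_pM; rewrite ?cabs_ge0//; first exact: hM.
apply: (le_trans (cexp_sub2 _)).
have w0 := cabs_ge0 (wexp z); have wW : cabs (wexp z) <= W by exact: wexp_bound.
have t0 := cabs_ge0 t.
have a0 := cabs_ge0 (- t * wexp z).
have a1 : cabs (- t * wexp z) <= cabs t * cabs (wexp z) by apply: (le_trans (cabsM _ _)); rewrite cabsN.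
have a2 : cabs t * cabs (wexp z) <= cabs t * W by apply: ler_wpM2l.
have a3 : cabs t * W <= W by apply: ler_piMl => //; exact: le_trans wW.
have a4 : cabs (- t * wexp z) <= cabs t * W by apply: le_trans a2.
have a5 : cabs (- t * wexp z) <= W by apply: le_trans a3.
apply: ler_pM; rewrite ?mulr_ge0 ?expR_ge0 ?sqr_ge0//; last by rewrite ler_expR.
by rewrite -exprMn ler_wpM2l// lerXn2r// nnegrE ?mulr_ge0// (le_trans w0).
Qed.

(** The derivative in lambda is the double integral with kernel - w Fh. On the bounded range of zeta
    the remainder kernel is at most a multiple of |t|^2 times the integrable majorant, so it stays
    of second order after integration. *)
Lemma Rh_entire (f phi : V4 -> C) : test_function f -> test_function phi ->
  entire (fun lambda : C => Rh lambda f phi).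
Proof.
move=> tf tp z; have [B1 B10 h1] := test_nice tf; have [B2 B20 h2] := test_nice tp.
have l1 : B1 <= B1 + B2 by rewrite lerDl.
have l2 : B2 <= B1 + B2 by rewrite lerDr.
have [[Mf f0 nf] _] := h1 _ l1; have [[Mg g0 ng] _] := h2 _ l2.
have B0 := addr_ge0 B10 B20; set B := B1 + B2 in B0 nf ng *.
have [M M0 kF] := khyp_Fh z B0.
pose W := 2 * Zbd B + pi; have W0 : 0 <= W.
  by have := Zbd_ge0 B0; have := @pi_ge0 R; rewrite /W; lra.
have kD := khyp_dFh B0 kF.
apply: (@derivable_complex _ z (dint (fun x => - wexp x * Fh z x) (f \o @Phi R) (phi \o @Phi R))
  (2 * (M * (6 * W ^+ 2 * expR W) * Mf * Mg * Kbd B))) => t t1.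
rewrite !Rh_dint.
have [i1 _] := Rh_cintegrable (z + t) tf tp; have [i0 _] := Rh_cintegrable z tf tp.
have [iD _] := kernel_integral B0 (mulr_ge0 M0 W0) f0 g0 kD nf ng.
have [j1 e1] := cintegral_linear (@fund2_measurable R) (-1) i0 i1.
have [_ e2] := cintegral_linear (@fund2_measurable R) (- t) iD j1.
have kE := khyp_remainder B0 M0 kF t1; rewrite /= -/W in kE.
have ME : 0 <= M * (6 * W ^+ 2 * expR W) * cabs t ^+ 2.
  apply: mulr_ge0; last exact: sqr_ge0.
  apply: mulr_ge0 => //; apply: mulr_ge0; last exact: expR_ge0.
  by apply: mulr_ge0 => //; exact: sqr_ge0.
have [_ hb] := kernel_integral B0 ME f0 g0 kE nf ng.
rewrite (_ : _ - _ = dint (fun x => Fh (z + t) x - Fh z x - t * (- wexp x * Fh z x))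
  (f \o @Phi R) (phi \o @Phi R)).
  apply: (le_trans hb); rewrite le_eqVlt; apply/orP; left; apply/eqP; ring.
transitivity (- t * dint (fun x => - wexp x * Fh z x) (f \o @Phi R) (phi \o @Phi R) +
  (-1 * dint (Fh z) (f \o @Phi R) (phi \o @Phi R) + dint (Fh (z + t)) (f \o @Phi R) (phi \o @Phi R))).
  by ring.
rewrite /dint -e1 -e2; apply: eq_cintegral => pp _ /=; ring.
Qed.

End Kernel.

(** * The differential equation *)

Section Equation.
Variable R : realType.
Local Notation C := R[i].
Local Notation V4 := 'rV[R]_4.
Local Notation mR := (measurableTypeR R).
Local Notation R3 := (mR * mR * mR)%type.
Local Notation l3 := (@leb3 R).
Local Notation l33 := (@leb33 R).
Local Notation fund := (@fundamental R).

Lemma derive_vanish (f g : R * R * R -> R) (v : R * R * R) (O : set (R * R * R)) : open O ->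
  (forall p, is_derive p v f (g p)) -> (forall p, O p -> f p = 0) -> forall p, O p -> g p = 0.
Proof.
move=> oO df fO p Op.
have near0 : \forall q \near p, 0 = f q.
  have : nbhs p O by exact: open_nbhs_nbhs.
  by apply: filterS => q /fO ->.
have := near_eq_is_derive near0 (derC 0 p v) => -[_ <-].
by have [_ <-] := df p.
Qed.

Lemma box_op_vanish f f0 f1 f2 f00 f11 f12 f21 f22 (B : R) (O : set (R * R * R)) :
  C2data f f0 f1 f2 f00 f11 f12 f21 f22 B -> open O -> (forall p, O p -> f p = 0) ->
  forall p, O p -> box_op f1 f2 f00 f11 f12 f21 f22 p = 0.
Proof.
move=> D oO z p Op; have dv := derive_vanish oO.
have z0 := dv _ _ _ (c2_0 D) z; have z1 := dv _ _ _ (c2_1 D) z; have z2 := dv _ _ _ (c2_2 D) z.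
rewrite /box_op (z1 p Op) (z2 p Op) (dv _ _ _ (c2_00 D) z0 p Op) (dv _ _ _ (c2_11 D) z1 p Op).
by rewrite (dv _ _ _ (c2_12 D) z2 p Op) (dv _ _ _ (c2_21 D) z1 p Op) (dv _ _ _ (c2_22 D) z2 p Op) !(mulr0, addr0, subr0).
Qed.

(** The two pairs of radial functions agree for z >= -1 + delta. The set where zeta < -1 + delta is
    open and f vanishes on it, hence so do its derivatives, and both integrands are 0 there. *)
Lemma pairing_off (V V1 V2 W V' W' : R -> R) (C0 g delta : R)
    (f f0 f1 f2 f00 f11 f12 f21 f22 : R * R * R -> R) (B : R) (p0 : R3) :
  [/\ singular V V1 V2 W C0 (1/4) g delta, V 1 = 0 /\ W 1 = 0,
     measurable_fun setT (V : mR -> mR), measurable_fun setT (W : mR -> mR) &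
     forall z, -1 + delta <= z -> V z = V' z /\ W z = W' z] ->
  C2data f f0 f1 f2 f00 f11 f12 f21 f22 B -> 0 <= B -> fund p0 ->
  (forall p, f p != 0 -> -1 + delta <= zeta4 (ads4 p0) (ads4 p)) ->
  let T p := V' (zeta4 (ads4 p0) (ads4 p)) * box_op f1 f2 f00 f11 f12 f21 f22 p +
             W' (zeta4 (ads4 p0) (ads4 p)) * f p in
  l3.-integrable fund (EFin \o T) /\ \int[l3]_(p in fund) T p = 4 * pi * g * f p0.
Proof.
move=> [sg [V10 W10] mV mW E] D B0 fp0 sf T.
have := pairing sg V10 W10 mV mW D B0 fp0 sf => /=.
set T' := (fun p => _ : R); suff -> : T = T' by [].
have cz : continuous ((fun p => zeta4 (ads4 p0) (ads4 p)) : R * R * R -> R).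
  rewrite (_ : (fun p => _) = zeta (ads4 p0).1.1 (ads4 p0).1.2 (ads4 p0).2.1 (ads4 p0).2.2).
    exact: zeta_continuous.
  by apply/funext => p; rewrite zetaE.
apply/funext => p; rewrite /T /T'; have [h|h] := leP (-1 + delta) (zeta4 (ads4 p0) (ads4 p)).
  by have [-> ->] := E _ h.
pose O : set (R * R * R) := [set p | zeta4 (ads4 p0) (ads4 p) < -1 + delta].
have oO : open O by rewrite openE => q Oq; exact: (cz q _ (lt_nbhsl Oq)).
have z0 q : O q -> f q = 0.
  by move=> Oq; apply/eqP; apply: contraT => /sf; rewrite leNgt Oq.
by rewrite (z0 p h) (box_op_vanish D oO z0 h) !mulr0.
Qed.

(** Four real pairings, one for each choice of real or imaginary part of the kernel and of phi.
    Those with the real part of the kernel have strength 1 / (4 pi), the others 0. *)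
Lemma pairing_complex (lambda : C) (phi : V4 -> C) (delta : R) (p0 : R3) :
  test_function phi -> 0 < delta <= 1/2 -> fund p0 ->
  (forall p, phi (Phi p) != 0 -> -1 + delta <= zeta4 (ads4 p0) (ads4 p)) ->
  let T p := Fh lambda (zeta4 (ads4 p0) (ads4 p)) * Box phi (Phi p) +
             lambda * (lambda + 2) * Fh lambda (zeta4 (ads4 p0) (ads4 p)) * phi (Phi p) in
  cintegrable l3 fund T /\ cintegral l3 fund T = phi (Phi p0).
Proof.
move=> tp dl fp0 sp T; have [B B0 [Dr Di]] := test_C2 tp.
have [[Vr [? [? [Wr [? hr]]]]] [Vi [? [? [Wi [? hi]]]]]] := rad_Fh lambda dl.
have sr p : dRe (phi \o @Phi R) [::] p != 0 -> -1 + delta <= zeta4 (ads4 p0) (ads4 p).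
  by move=> h; apply: sp; apply: contraNneq h => e; rewrite /dRe /= e.
have si p : dIm (phi \o @Phi R) [::] p != 0 -> -1 + delta <= zeta4 (ads4 p0) (ads4 p).
  by move=> h; apply: sp; apply: contraNneq h => e; rewrite /dIm /= e.
have ebr := funext (fun p => proj1 (Box_Phi tp p)); have ebi := funext (fun p => proj2 (Box_Phi tp p)).
have [irr err] := pairing_off hr Dr B0 fp0 sr; rewrite -ebr in irr err.
have [iri eri] := pairing_off hr Di B0 fp0 si; rewrite -ebi in iri eri.
have [iir eir] := pairing_off hi Dr B0 fp0 sr; rewrite -ebr in iir eir.
have [iii eii] := pairing_off hi Di B0 fp0 si; rewrite -ebi in iii eii.
have mf := @fundamental_measurable R.
have pi0 : (pi : R) != 0 by rewrite gt_eqF// pi_gt0.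
have k1 : 4 * pi * (4 * pi)^-1 = 1 :> R by rewrite mulfV// mulf_neq0.
have reT : (fun p => complex.Re (T p)) = (fun p =>
   (complex.Re (Fh lambda (zeta4 (ads4 p0) (ads4 p))) * complex.Re (Box phi (Phi p)) +
    complex.Re (lambda * (lambda + 2) * Fh lambda (zeta4 (ads4 p0) (ads4 p))) * dRe (phi \o @Phi R) [::] p) -
   (complex.Im (Fh lambda (zeta4 (ads4 p0) (ads4 p))) * complex.Im (Box phi (Phi p)) +
    complex.Im (lambda * (lambda + 2) * Fh lambda (zeta4 (ads4 p0) (ads4 p))) * dIm (phi \o @Phi R) [::] p)).
  apply/funext => p; rewrite /T ReD [complex.Re (_ * Box _ _)]ReM [complex.Re (_ * phi _)]ReM /dRe /dIm /=; ring.
have imT : (fun p => complex.Im (T p)) = (fun p =>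
   (complex.Re (Fh lambda (zeta4 (ads4 p0) (ads4 p))) * complex.Im (Box phi (Phi p)) +
    complex.Re (lambda * (lambda + 2) * Fh lambda (zeta4 (ads4 p0) (ads4 p))) * dIm (phi \o @Phi R) [::] p) +
   (complex.Im (Fh lambda (zeta4 (ads4 p0) (ads4 p))) * complex.Re (Box phi (Phi p)) +
    complex.Im (lambda * (lambda + 2) * Fh lambda (zeta4 (ads4 p0) (ads4 p))) * dRe (phi \o @Phi R) [::] p)).
  apply/funext => p; rewrite /T ImD [complex.Im (_ * Box _ _)]ImM [complex.Im (_ * phi _)]ImM /dRe /dIm /=; ring.
rewrite /cintegrable /cintegral reT imT.
split; first by split; [exact: integrable_realB|exact: integrable_realD].
have a1 := RintegralB mf irr iii; have a2 := RintegralD mf iri iir.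
apply: eq_ReIm => /=.
  by rewrite a1 err eii k1 mul1r mulr0 mul0r subr0.
by rewrite a2 eri eir k1 mul1r mulr0 mul0r addr0.
Qed.

(** On the compact support the continuous function - q(x, y) attains its minimum, so a strict
    inequality improves to a gap. *)
Lemma support_gap (phi : V4 -> C) (y : V4) : test_function phi ->
  (forall x, supp phi x -> -1 < - q x y) ->
  exists2 delta : R, 0 < delta <= 1/2 & forall p : R3, phi (Phi p) != 0 -> -1 + delta <= - q (Phi p) y.
Proof.
move=> [_ cs] h.
have sP (p : R3) : phi (Phi p) != 0 -> supp phi (Phi p).
  by move=> hp; apply: subset_closure; split; [exact: Phi_AdS|exact/eqP].
have [ne|e] := pselect (supp phi !=set0); last first.
  exists (1/2); first by lra.
  by move=> p /sP sp; case: e; exists (Phi p).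
have cq : continuous (fun x : V4 => - q x y).
  have cc j : continuous (fun x : V4 => x 0 j * y 0 j).
    by apply: cntM; [exact: coord_continuous|exact: cntC].
  exact: (cntN (cntD (cntD (cntD (cntN (cc _)) (cntN (cc _))) (cc _)) (cc _))).
have [c cS hc] := compact_EVT_min ne cs (continuous_subspaceT cq).
have := h c (set_mem cS) => mc.
(* The number 1 - q c y is the distance from -1 to the minimum, attained at c; the cap 1/2 is what
   the cut-off near -1 requires. *)
exists (Num.min (1/2) (1 - q c y)).
  by rewrite lt_min ge_min lexx /=; apply/andP; split => //; apply/andP; split; lra.
move=> p /sP sp; have := hc (Phi p) (mem_set sp).
have : Num.min (1/2) (1 - q c y) <= 1 - q c y by rewrite ge_min lexx orbT.
lra.
Qed.

(** For fixed y the integral over x is f(y) times the pairing of the kernel based at y, that is f(y)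
    phi(y). The gap delta may vary with y, because only the exact values of the slices are
    integrated; slices with f(y) = 0 vanish identically. *)
Lemma Rh_equation (lambda : C) (f : V4 -> C) : test_function f ->
  eq_distr_on (Omega f)
    (fun phi => Box_distr (Rh lambda f) phi + lambda * (lambda + 2) * Rh lambda f phi)
    (distr_of_fun f).
Proof.
move=> tf phi tp sO; rewrite /Box_distr !Rh_dint /distr_of_fun /ads_int /dint.
have [i1 i2] := Rh_cintegrable lambda tf tp.
have [iA eA] := cintegral_linear (@fund2_measurable R) (lambda * (lambda + 2)) i1 i2.
rewrite addrC -eA.
have vE : (fun p : R * R * R => (vol_density p)%:C * (f (Phi p) * phi (Phi p))) = (fun p => f (Phi p) * phi (Phi p)).
  by apply/funext => p; rewrite vol_density1 [1%:C]rmorph1 mul1r.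
rewrite vE.
have mf := @fundamental_measurable R.
have key (p' : R3) : fund p' -> f (Phi p') != 0 ->
  let T p := Fh lambda (zeta4 (ads4 p') (ads4 p)) * Box phi (Phi p) +
             lambda * (lambda + 2) * Fh lambda (zeta4 (ads4 p') (ads4 p)) * phi (Phi p) in
  cintegrable l3 fund T /\ cintegral l3 fund T = phi (Phi p').
  move=> fp' nz.
  have sy : supp f (Phi p') by apply: subset_closure; split; [exact: Phi_AdS|exact/eqP].
  have [delta dl hd] := support_gap tp (fun x sx => proj2 (sO x sx) _ sy).
  by apply: (pairing_complex lambda tp dl fp') => p /hd; rewrite q_Phi.
have slice (p' : R3) : fund p' ->
  let T p := lambda * (lambda + 2) * (Fh lambda (zeta2 (p, p')) * f (Phi p') * phi (Phi p)) +
    Fh lambda (zeta2 (p, p')) * f (Phi p') * Box phi (Phi p) in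
  cintegrable l3 fund T /\ cintegral l3 fund T = f (Phi p') * phi (Phi p').
  move=> fp' T.
  have [f0|f0] := eqVneq (f (Phi p')) 0.
    have -> : T = (fun=> 0).
      by apply/funext => p; rewrite /T f0 !(mulr0, mul0r) addr0.
    rewrite /cintegrable /cintegral f0 mul0r /=; split; last by rewrite /Rintegral integral0.
    by split; exact: integrable0.
  have [i e] := key p' fp' f0.
  have z0 : \int[l3]_(p in fund) (0 : R) = 0 by rewrite /Rintegral integral0.
  have i0 : cintegrable l3 fund (fun=> 0 : C) by split; exact: integrable0.
  have [j e'] := cintegral_linear mf (f (Phi p')) i i0.
  have -> : T = fun p => f (Phi p') * (Fh lambda (zeta4 (ads4 p') (ads4 p)) * Box phi (Phi p) +
             lambda * (lambda + 2) * Fh lambda (zeta4 (ads4 p') (ads4 p)) * phi (Phi p)) + 0.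
    by apply/funext => p; rewrite /T /zeta2 /=; ring.
  by split => //; rewrite e' e /cintegral /= z0 addr0.
rewrite /cintegral; apply: eq_ReIm => /=.
  by apply: (Rintegral_fund2 iA.1) => p' fp'; have [[i _]] := slice p' fp'; rewrite /cintegral => /(congr1 (@complex.Re R)).
by apply: (Rintegral_fund2 iA.2) => p' fp'; have [[_ i]] := slice p' fp'; rewrite /cintegral => /(congr1 (@complex.Im R)).
Qed.

End Equation.

Theorem proposition3p2 (R : realType) :
  [/\ forall (lambda : R[i]) (f phi : 'rV[R]_4 -> R[i]),
        test_function f -> test_function phi ->
        ads_integrable2 (Rh_integrand lambda f phi),
      forall (lambda : R[i]) (f : 'rV[R]_4 -> R[i]),
        test_function f -> is_distribution (Rh lambda f),
      forall (lambda a : R[i]) (f1 f2 phi : 'rV[R]_4 -> R[i]),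
        test_function f1 -> test_function f2 -> test_function phi ->
        Rh lambda (fun x => a * f1 x + f2 x) phi
        = a * Rh lambda f1 phi + Rh lambda f2 phi,
      forall f phi : 'rV[R]_4 -> R[i],
        test_function f -> test_function phi ->
        entire (fun lambda : R[i] => Rh lambda f phi) &
      forall (lambda : R[i]) (f : 'rV[R]_4 -> R[i]),
        test_function f ->
        eq_distr_on (Omega f)
          (fun phi => Box_distr (Rh lambda f) phi
                      + lambda * (lambda + 2) * Rh lambda f phi)
          (distr_of_fun f)].

Proof.
split.
- exact: Rh_integrable.
- exact: Rh_distribution.
- exact: Rh_linear_f.
- exact: Rh_entire.
- exact: Rh_equation.
Qed.
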